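(* Let $X$ be a closed subscheme of the toric variety $Y_\Delta$ over $K$ with dense torus $T$ such that $X\cap T$ is equidimensional and dense in $X$. If for every $\sigma\in\Delta$ either $X\cap O(\sigma)=\emptyset$ or $\dim(X\cap O(\sigma))=\dim(X)-\dim(\sigma)$, then the tropical skeleton $S_{\mathrm{Trop}}(X)$ is closed in $X^{\mathrm{an}}$.
   Context: $K$ is a field complete with respect to a (possibly trivial) non-Archimedean valuation. $M\cong\mathbb Z^n$, $N=\mathrm{Hom}(M,\mathbb Z)$, $N_{\mathbb R}=N\otimes\mathbb R$, $T=\mathrm{Spec}(K[M])$ with characters $\chi^u$, $u\in M$. $\Delta$ is a pointed rational fan in $N_{\mathbb R}$ and $Y_\Delta$ is the associated toric variety over $K$ with dense torus $T$; as a set $Y_\Delta=\bigsqcup_{\sigma\in\Delta}O(\sigma)$ with torus orbits $O(\sigma)=\mathrm{Spec}(K[\sigma^\perp\cap M])$. Put $N_{\mathbb R}(\sigma)=N_{\mathbb R}/\langle\sigma\rangle$, where $\langle\sigma\rangle$ is the linear span. $\overline N{}^\Delta_{\mathbb R}=\bigsqcup_{\sigma\in\Delta}N_{\mathbb R}(\sigma)$ is the Kajiwara--Payne partial compactification of $N_{\mathbb R}$, glued from the open pieces $\mathrm{Hom}(\sigma^\vee\cap M,\mathbb R\cup\{\infty\})$ (monoid homomorphisms, topology of pointwise convergence), where for a face $\tau\prec\sigma$ a point $\omega\in N_{\mathbb R}(\tau)$ is the homomorphism $u\mapsto\langle u,\omega\rangle$ if $u\in\tau^\perp$ and $u\mapsto\infty$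 otherwise. $Y^{\mathrm{an}}$ denotes Berkovich analytification. The map $\mathrm{trop}\colon Y_\Delta^{\mathrm{an}}\to\overline N{}^\Delta_{\mathbb R}$ is given by $\langle u,\mathrm{trop}(\xi)\rangle=-\log|\chi^u(\xi)|$. For $\omega\in\mathrm{trop}(X^{\mathrm{an}})\cap N_{\mathbb R}(\sigma)$, $X_\omega=\mathrm{trop}^{-1}(\omega)\cap X^{\mathrm{an}}$ is an affinoid domain in $(X\cap O(\sigma))^{\mathrm{an}}$. The Shilov boundary of an affinoid space $\mathscr M(\mathcal A)$ is the (finite) smallest subset on which every $|f|$, $f\in\mathcal A$, attains its maximum. The tropical skeleton is $S_{\mathrm{Trop}}(X)=\{\xi\in X^{\mathrm{an}}\mid\xi\text{ is a Shilov boundary point of }X_{\mathrm{trop}(\xi)}\}$. *)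

(* Defs.v *)
From HB Require Import structures.
From Stdlib Require Import Relation_Operators Operators_Properties.
From mathcomp Require Import all_boot all_order all_algebra finmap.
From mathcomp Require Import all_classical all_reals all_analysis.
From mathcomp Require Import lra.
From mathcomp.analysis.showcase Require Import summability.
(* The notations of monalg clash with those of MathComp-Analysis. *)
From mathcomp.multinomials Require Import -(notations) monalg.

Set Implicit Arguments.
Unset Strict Implicit.
Unset Printing Implicit Defensive.

Import Order.TTheory GRing.Theory Num.Theory.
Import numFieldNormedType.Exports.

Local Open Scope classical_set_scope.
Local Open Scope quotient_scope.
Local Open Scope ring_scope.

(* The ring structure of monalg is only declared on monoids without nontrivial
   units, which excludes lattices. Here the exponents S form an arbitrary
   commutative monoid, written additively; monalg is used as a K-module. *)
Section MonoidAlgebra.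
Variables (K : fieldType) (S : nmodType).

Definition monoid_algebra : Type := malg S K.

HB.instance Definition _ := GRing.Lmodule.copy monoid_algebra (malg S K).

Implicit Types f g h : monoid_algebra.

Definition chi (u : S) : monoid_algebra := mkmalgU u 1.

Definition ma_mul f g : monoid_algebra :=
  \sum_(u <- msupp f) \sum_(v <- msupp g)
    (mkmalgU (u + v) (mcoeff u f * mcoeff v g) : monoid_algebra).

Lemma ma_mulw (d1 d2 : {fset S}) f g :
  (msupp f `<=` d1)%fset -> (msupp g `<=` d2)%fset ->
  ma_mul f g = \sum_(u <- d1) \sum_(v <- d2)
    (mkmalgU (u + v) (mcoeff u f * mcoeff v g) : monoid_algebra).
Proof.
move=> le1 le2; rewrite /ma_mul (big_fset_incl _ le1) /=.
  apply/eq_bigr=> u _; apply/big_fset_incl => // v _ /mcoeff_outdom ->.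
  by rewrite mulr0 monalgU0.
move=> u _ /mcoeff_outdom fu.
by rewrite big1 // => v _; rewrite fu mul0r monalgU0.
Qed.

Lemma ma_mulC : commutative ma_mul.
Proof.
move=> f g; rewrite /ma_mul exchange_big.
by apply: eq_bigr => u _; apply: eq_bigr => v _; rewrite addrC mulrC.
Qed.

Lemma ma_mulDl : left_distributive ma_mul +%R.
Proof.
move=> f g h.
rewrite [in RHS](ma_mulw (fsubsetUl _ (msupp g)) (fsubset_refl _)).
rewrite [in RHS](ma_mulw (fsubsetUr (msupp f) _) (fsubset_refl _)).
rewrite (ma_mulw (msuppD_le _ _) (fsubset_refl _)).
rewrite -big_split /=; apply/eq_bigr=> u _.
rewrite -big_split /=; apply/eq_bigr=> v _.
by rewrite mcoeffD mulrDl monalgUD.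
Qed.

Lemma ma_mulDr : right_distributive ma_mul +%R.
Proof. by move=> f g h; rewrite !(ma_mulC f) ma_mulDl. Qed.

Lemma ma_mul0 : right_zero 0 ma_mul.
Proof. by move=> f; rewrite ma_mulC /ma_mul msupp0 big_seq_fset0. Qed.

Lemma ma_0mul : left_zero 0 ma_mul.
Proof. by move=> f; rewrite ma_mulC ma_mul0. Qed.

Lemma ma_mulUU (a b : K) (u v : S) :
  ma_mul (mkmalgU u a) (mkmalgU v b) = mkmalgU (u + v) (a * b).
Proof. by rewrite (ma_mulw msuppU_le msuppU_le) !big_seq_fset1 !mcoeffUU. Qed.

Section Bilinear.
Variable op : monoid_algebra -> monoid_algebra -> monoid_algebra.
Hypotheses (op0l : left_zero 0 op) (op0r : right_zero 0 op).
Hypotheses (opDl : left_distributive op +%R) (opDr : right_distributive op +%R).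

Lemma op_suml (I : Type) (r : seq I) (F : I -> monoid_algebra) g :
  op (\sum_(i <- r) F i) g = \sum_(i <- r) op (F i) g.
Proof. exact: (big_morph (op^~ g) (fun a b => opDl a b g) (op0l g)). Qed.

Lemma op_sumr (I : Type) (r : seq I) (F : I -> monoid_algebra) g :
  op g (\sum_(i <- r) F i) = \sum_(i <- r) op g (F i).
Proof. exact: (big_morph (op g) (fun a b => opDr g a b) (op0r g)). Qed.

Lemma op_assoc :
  (forall a b c u v w,
     op (mkmalgU u a) (op (mkmalgU v b) (mkmalgU w c)) =
     op (op (mkmalgU u a) (mkmalgU v b)) (mkmalgU w c)) -> associative op.
Proof.
move=> opU f g h; rewrite (monalgE f) !op_suml; apply: eq_bigr => u _.
rewrite (monalgE g) op_suml !op_sumr op_suml; apply: eq_bigr => v _.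
by rewrite (monalgE h) !op_sumr; apply: eq_bigr => w _.
Qed.

Lemma op_left_id e :
  (forall a u, op e (mkmalgU u a) = mkmalgU u a) -> left_id e op.
Proof.
move=> opU f; rewrite [in LHS](monalgE f) [RHS]monalgE op_sumr.
by apply: eq_bigr.
Qed.

Lemma op_scale :
  (forall (c a b : K) u v, c *: op (mkmalgU u a) (mkmalgU v b) =
     op (c *: (mkmalgU u a : monoid_algebra)) (mkmalgU v b)) ->
  forall c f g, c *: op f g = op (c *: f) g.
Proof.
move=> opU c f g; rewrite (monalgE f) scaler_sumr !op_suml scaler_sumr.
apply: eq_bigr => u _; rewrite (monalgE g) !op_sumr scaler_sumr.
by apply: eq_bigr.
Qed.

End Bilinear.

Lemma ma_mulA : associative ma_mul.
Proof.
apply: (op_assoc ma_0mul ma_mul0 ma_mulDl ma_mulDr) => a b c u v w.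
by rewrite !ma_mulUU mulrA addrA.
Qed.

Lemma ma_mul1 : left_id (chi 0) ma_mul.
Proof.
by apply: (op_left_id ma_mul0 ma_mulDr) => a u; rewrite ma_mulUU add0r mul1r.
Qed.

Lemma chi0_neq0 : chi 0 != 0.
Proof. by rewrite /chi monalgU_eq0 oner_eq0. Qed.

HB.instance Definition _ := GRing.Zmodule_isComNzRing.Build monoid_algebra
  ma_mulA ma_mulC ma_mul1 ma_mulDl chi0_neq0.

Lemma ma_scaleU (c a : K) (u : S) :
  c *: (mkmalgU u a : monoid_algebra) = mkmalgU u (c * a).
Proof. by apply/malgP => v; rewrite mcoeffZ !mcoeffU mulrnAr. Qed.

Lemma ma_scaleAl (c : K) f g : c *: (f * g) = (c *: f) * g.
Proof.
apply: (op_scale ma_0mul ma_mul0 ma_mulDl ma_mulDr) => d a b u v.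
by rewrite !ma_mulUU !ma_scaleU ma_mulUU mulrA.
Qed.

HB.instance Definition _ :=
  GRing.Lmodule_isLalgebra.Build K monoid_algebra ma_scaleAl.
HB.instance Definition _ := GRing.Lalgebra_isComAlgebra.Build K monoid_algebra.

Lemma chi0 : chi 0 = 1. Proof. by []. Qed.

Lemma chiD u v : chi (u + v) = chi u * chi v.
Proof. by rewrite -[RHS]/(ma_mul _ _) ma_mulUU mulr1. Qed.

End MonoidAlgebra.

Section Lift.
Variables (K : fieldType) (S : nmodType) (A : comAlgType K) (g : S -> A).

Definition ma_lift (f : monoid_algebra K S) : A :=
  \sum_(u <- msupp f) mcoeff u f *: g u.

Lemma ma_liftw (d : {fset S}) f : (msupp f `<=` d)%fset ->
  ma_lift f = \sum_(u <- d) mcoeff u f *: g u.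
Proof.
move=> le; rewrite /ma_lift; apply: big_fset_incl => // u _ /mcoeff_outdom ->.
by rewrite scale0r.
Qed.

Lemma ma_liftU u a : ma_lift (mkmalgU u a) = a *: g u.
Proof. by rewrite (ma_liftw msuppU_le) big_seq_fset1 mcoeffUU. Qed.

Lemma ma_lift_chi u : ma_lift (chi K u) = g u.
Proof. by rewrite ma_liftU scale1r. Qed.

Lemma ma_liftD : {morph ma_lift : f h / f + h}.
Proof.
move=> f h; rewrite (ma_liftw (msuppD_le f h)).
rewrite (ma_liftw (fsubsetUl (msupp f) (msupp h))).
rewrite (ma_liftw (fsubsetUr (msupp f) (msupp h))) -big_split /=.
by apply: eq_bigr => u _; rewrite mcoeffD scalerDl.
Qed.

Lemma ma_lift0 : ma_lift 0 = 0.
Proof. by rewrite /ma_lift msupp0 big_seq_fset0. Qed.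

Lemma ma_lift_sum (I : Type) (r : seq I) (F : I -> monoid_algebra K S) :
  ma_lift (\sum_(i <- r) F i) = \sum_(i <- r) ma_lift (F i).
Proof. exact: (big_morph ma_lift ma_liftD ma_lift0). Qed.

Hypothesis g0 : g 0 = 1.
Hypothesis gD : forall u v, g (u + v) = g u * g v.

Lemma ma_liftM : {morph ma_lift : f h / f * h}.
Proof.
move=> f h; rewrite -[f * h]/(ma_mul f h) ma_lift_sum mulr_suml.
apply: eq_bigr => u _; rewrite ma_lift_sum mulr_sumr; apply: eq_bigr => v _.
by rewrite ma_liftU gD -scalerAl -scalerAr scalerA.
Qed.

Lemma ma_lift1 : ma_lift 1 = 1.
Proof. by rewrite -g0 -ma_lift_chi. Qed.

Lemma ma_liftA c : ma_lift (c%:A) = c%:A.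
Proof. by rewrite -[1 in LHS]/(chi K 0) ma_scaleU ma_liftU mulr1 g0. Qed.

End Lift.

Section Ideals.
Variable A : comNzRingType.

Definition ideal (I : set A) : Prop :=
  [/\ I 0, forall a b, I a -> I b -> I (a + b) & forall a b, I b -> I (a * b)].

Definition prime_ideal (P : set A) : Prop :=
  [/\ ideal P, ~ P 1 & forall a b, P (a * b) -> P a \/ P b].

Definition ideal_span (F : set A) : set A :=
  \bigcap_(I in [set I | ideal I /\ F `<=` I]) I.

Definition minimal_prime (I P : set A) : Prop :=
  [/\ prime_ideal P, I `<=` P &
      forall Q, prime_ideal Q -> I `<=` Q -> Q `<=` P -> Q = P].

(* The Krull dimension of A / I, -oo for the zero ring. *)
Definition krull_dim (R : realType) (I : set A) : \bar R :=
  ereal_sup [set d%:R%:E | d in [set d : nat |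
    exists P : 'I_d.+1 -> set A,
      (forall i, prime_ideal (P i) /\ I `<=` P i) /\
      (forall i j : 'I_d.+1, (i < j)%N -> P i `<` P j)]].

End Ideals.
Arguments krull_dim {A} R I.

Section Glue.
Variables (I : choiceType) (X : I -> topologicalType).
Variable r : {i & X i} -> {i & X i} -> Prop.

Let e (x y : {i & X i}) : bool := `[< clos_refl_sym_trans _ r x y >].

Lemma glue_refl : reflexive e.
Proof. by move=> x; apply/asboolP; exact: rst_refl. Qed.

Lemma glue_sym : symmetric e.
Proof. by move=> x y; apply/asboolP/asboolP; exact: rst_sym. Qed.

Lemma glue_trans : transitive e.
Proof.
move=> y x z /asboolP xy /asboolP yz; apply/asboolP.
exact: (rst_trans _ _ _ _ _ xy yz).
Qed.

Definition glue_rel : equiv_rel {i & X i} :=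
  EquivRel e glue_refl glue_sym glue_trans.

(* Quotient of the disjoint union of the X i by the equivalence relation
   generated by r, with the quotient topology. *)
Definition glued : topologicalType := quotient_topology {eq_quot glue_rel}.

Definition glue_pi (i : I) (x : X i) : glued :=
  \pi_{eq_quot glue_rel} (existT X i x).

Lemma glue_piP (x y : {i & X i}) :
  glue_pi (projT2 x) = glue_pi (projT2 y) <-> clos_refl_sym_trans _ r x y.
Proof.
by case: x y => [i x] [j y]; split=> [/eqmodP/asboolP|h]; last exact/eqmodP/asboolP.
Qed.

Lemma glue_pi_step i j (x : X i) (y : X j) :
  r (existT X i x) (existT X j y) -> glue_pi x = glue_pi y.
Proof. by move=> rxy; apply/eqmodP/asboolP; exact: rst_step. Qed.

Lemma glue_repr (x : {i & X i}) :
  clos_refl_sym_trans _ r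
    (repr (glue_pi (projT2 x) : {eq_quot glue_rel})) x.
Proof.
case: x => i x.
by have /eqmodP/asboolP := reprK (\pi_{eq_quot glue_rel} (existT X i x)).
Qed.

End Glue.

Section Valuation.
Variables (R : realType) (K : fieldType).

(* abs is exp (- val); the trivial absolute value is allowed. *)
Record complete_nonarch_abs (abs : K -> R) : Prop := {
  abs_ge0 : forall x, 0 <= abs x;
  abs_eq0 : forall x, abs x = 0 <-> x = 0;
  absM : forall x y, abs (x * y) = abs x * abs y;
  abs_ultra : forall x y, abs (x + y) <= Num.max (abs x) (abs y);
  abs_complete : forall u : nat -> K,
    (forall e, 0 < e ->
       exists N, forall i j, (N <= i)%N -> (N <= j)%N -> abs (u i - u j) < e) ->
    exists l, forall e, 0 < e ->
       exists N, forall i, (N <= i)%N -> abs (u i - l) < e }.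

End Valuation.

Section Berkovich.
Variables (R : realType) (K : fieldType) (abs : K -> R) (A : comAlgType K).

Definition mult_seminorm : set {ptws A -> R} :=
  [set x | [/\ x 1 = 1, forall a, 0 <= x a,
               forall a b, x (a * b) = x a * x b,
               forall a b, x (a + b) <= x a + x b &
               forall c : K, x c%:A = abs c]].

(* The analytification of Spec A, for A of finite type over K, with the
   topology of pointwise convergence. *)
Definition berkovich : topologicalType := mult_seminorm.

Definition seminorm (x : berkovich) : A -> R := sval x.

Lemma seminormP (x : berkovich) : mult_seminorm (seminorm x).
Proof. exact: set_mem (svalP x). Qed.

End Berkovich.

Definition berkovich_lift (R : realType) (K : fieldType) (abs : K -> R)
    (S : nmodType) (A : comAlgType K) (g : S -> A)
    (g0 : g 0 = 1) (gD : forall u v, g (u + v) = g u * g v)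
    (x : berkovich abs A) : berkovich abs (monoid_algebra K S).
Proof.
exists (fun f : monoid_algebra K S => seminorm x (ma_lift g f)).
apply/mem_set; case: (seminormP x) => x1 x0 xM xD xK; split => //.
- by rewrite ma_lift1.
- by move=> a b; rewrite ma_liftM.
- by move=> a b; rewrite ma_liftD.
- by move=> c; rewrite ma_liftA.
Defined.

(* M = Z^n, N_R = R^n, with the standard pairing. *)
Section Cones.
Variables (R : realType) (n : nat).

Definition pairing (u : 'rV[int]_n) (v : 'rV[R]_n) : R :=
  \sum_(i < n) (u 0 i)%:~R * v 0 i.

Lemma pairing0 v : pairing 0 v = 0.
Proof. by rewrite /pairing big1 // => i _; rewrite mxE mul0r. Qed.

Lemma pairingD u1 u2 v : pairing (u1 + u2) v = pairing u1 v + pairing u2 v.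
Proof.
by rewrite /pairing -big_split; apply: eq_bigr => i _; rewrite mxE intrD mulrDl.
Qed.

(* s^\vee \cap M and s^\perp \cap M. *)
Definition dual_cone (s : set 'rV[R]_n) : {pred 'rV[int]_n} :=
  [pred u | `[< forall v, s v -> 0 <= pairing u v >]].

Definition orth_cone (s : set 'rV[R]_n) : {pred 'rV[int]_n} :=
  [pred u | `[< forall v, s v -> pairing u v = 0 >]].

Lemma dual_cone_closed s : addr_closed (dual_cone s).
Proof.
split=> [|u1 u2 /asboolP h1 /asboolP h2]; apply/asboolP => v sv.
  by rewrite pairing0.
by rewrite pairingD addr_ge0 ?h1 ?h2.
Qed.

Lemma orth_cone_closed s : addr_closed (orth_cone s).
Proof.
split=> [|u1 u2 /asboolP h1 /asboolP h2]; apply/asboolP => v sv.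
  by rewrite pairing0.
by rewrite pairingD h1 // h2 // addr0.
Qed.

HB.instance Definition _ s :=
  GRing.isAddClosed.Build _ (dual_cone s) (dual_cone_closed s).
HB.instance Definition _ s :=
  GRing.isAddClosed.Build _ (orth_cone s) (orth_cone_closed s).

Record submonoid (P : addrClosed 'rV[int]_n) :=
  Submonoid { submonoid_val :> 'rV[int]_n; _ : (P : {pred _}) submonoid_val }.

HB.instance Definition _ P := [isSub for @submonoid_val P].
HB.instance Definition _ P := [Choice of submonoid P by <:].
HB.instance Definition _ P :=
  GRing.SubChoice_isSubNmodule.Build _ _ (submonoid P) (rpred0D P).

Definition dual_monoid (s : set 'rV[R]_n) : nmodType := submonoid (dual_cone s).
Definition orth_monoid (s : set 'rV[R]_n) : nmodType := submonoid (orth_cone s).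

Definition rational_cone (s : set 'rV[R]_n) : Prop :=
  exists (k : nat) (G : 'M[int]_(k, n)),
    s = [set v | exists2 c : 'rV[R]_k,
           forall i, 0 <= c 0 i & v = c *m map_mx intr G].

Definition pointed (s : set 'rV[R]_n) : Prop :=
  forall v, s v -> s (- v) -> v = 0.

(* The faces of a rational cone are cut out by integral functionals. *)
Definition face (t s : set 'rV[R]_n) : Prop :=
  exists2 u, u \in dual_cone s & t = s `&` [set v | pairing u v = 0].

Record pointed_rational_fan (D : set (set 'rV[R]_n)) : Prop := {
  fan_finite : finite_set D;
  fan_zero : D [set 0];
  fan_rational : forall s, D s -> rational_cone s;
  fan_pointed : forall s, D s -> pointed s;
  fan_face : forall s t, D s -> face t s -> D t;
  fan_meet : forall s t, D s -> D t -> face (s `&` t) s /\ face (s `&` t) t }.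

Definition is_lin_span (s : set 'rV[R]_n) (V : {vspace 'rV[R]_n}) : Prop :=
  (forall v, s v -> v \in V) /\
  (forall W : {vspace 'rV[R]_n}, (forall v, s v -> v \in W) -> (V <= W)%VS).

Definition lin_span (s : set 'rV[R]_n) : {vspace 'rV[R]_n} :=
  xget 0%VS [set V | is_lin_span s V].

Definition cone_dim (s : set 'rV[R]_n) : nat := \dim (lin_span s).

Lemma lin_spanP s : is_lin_span s (lin_span s).
Proof.
rewrite /lin_span; apply: (@xgetPex _ 0%VS [set V | is_lin_span s V]).
pose P d := `[< exists V : {vspace 'rV[R]_n},
                  (forall v, s v -> v \in V) /\ \dim V = d >].
have exP : exists d, P d.
  by exists (\dim {:'rV[R]_n}%VS); apply/asboolP; exists fullv; split => // v _;
    rewrite memvf.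
case: (ex_minnP exP) => d /asboolP[V [sV dV]] dmin; exists V; split => // W sW.
have sVW v : s v -> v \in (V :&: W)%VS by move=> sv; rewrite memv_cap sV ?sW.
apply: subv_trans (capvSr V W).
rewrite -(geq_leqif (dimv_leqif_sup (capvSl V W))) dV.
by apply: dmin; apply/asboolP; exists (V :&: W)%VS.
Qed.

End Cones.

Section ExtHom.
Variables (R : realType) (S : nmodType).

Definition ext_hom_set : set {ptws S -> \bar R} :=
  [set h | [/\ h 0 = 0%E, forall u v, h (u + v) = (h u + h v)%E &
               forall u, h u <> -oo%E]].

(* Hom(S, R \cup {oo}) with the topology of pointwise convergence. *)
Definition ext_hom : topologicalType := ext_hom_set.

Definition ext_val (h : ext_hom) : S -> \bar R := sval h.

End ExtHom.

Lemma neg_lne_neqNy (R : realType) (c : R) : (- lne c%:E)%E <> -oo%E.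
Proof. by rewrite /=; case: ifP. Qed.

Lemma neg_lneM (R : realType) (a b : R) : 0 <= a -> 0 <= b ->
  (- lne (a * b)%:E)%E = (- lne a%:E + - lne b%:E)%E.
Proof.
move=> a0 b0; have lne0 : (- lne (0 : R)%:E)%E = +oo%E by rewrite /= lexx.
have [->|an0] := eqVneq a 0.
  by rewrite mul0r lne0 addye //; apply/eqP/neg_lne_neqNy.
have [->|bn0] := eqVneq b 0.
  by rewrite mulr0 lne0 addey //; apply/eqP/neg_lne_neqNy.
have ap : 0 < a by rewrite lt_neqAle eq_sym an0.
have bp : 0 < b by rewrite lt_neqAle eq_sym bn0.
by rewrite !lne_EFin ?mulr_gt0 // lnM ?posrE // -!EFinN -EFinD opprD.
Qed.

Section Toric.
Variables (R : realType) (K : fieldType) (abs : K -> R) (n : nat).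
Implicit Types s t : set 'rV[R]_n.

(* The coordinate rings K[s^\vee \cap M] of Y_s and K[s^\perp \cap M] of O(s). *)
Definition toric_ring s : comAlgType K := monoid_algebra K (dual_monoid s).
Definition orbit_ring s : comAlgType K := monoid_algebra K (orth_monoid s).

Definition dual_val s (u : dual_monoid s) : 'rV[int]_n := submonoid_val u.
Definition orth_val s (u : orth_monoid s) : 'rV[int]_n := submonoid_val u.

(* Meaningful for u \in dual_cone s, resp. orth_cone s; otherwise 0. *)
Definition to_dual s (u : 'rV[int]_n) : dual_monoid s :=
  insubd (0 : submonoid (dual_cone s)) u.
Definition to_orth s (u : 'rV[int]_n) : orth_monoid s :=
  insubd (0 : submonoid (orth_cone s)) u.

Lemma to_orthK s u : u \in orth_cone s -> orth_val (to_orth s u) = u.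
Proof. by move=> h; rewrite /orth_val /to_orth insubdK. Qed.

Lemma to_dualK s u : u \in dual_cone s -> dual_val (to_dual s u) = u.
Proof. by move=> h; rewrite /dual_val /to_dual insubdK. Qed.

Lemma dual_valP s (u : dual_monoid s) : dual_val u \in dual_cone s.
Proof. exact: valP. Qed.

Lemma orth_val_inj s : injective (@orth_val s).
Proof. exact: val_inj. Qed.

Lemma dual_val0 s : dual_val (0 : dual_monoid s) = 0.
Proof. by []. Qed.

Lemma dual_valD s (u v : dual_monoid s) :
  dual_val (u + v) = dual_val u + dual_val v.
Proof. by []. Qed.

Lemma orth_valD s (u v : orth_monoid s) :
  orth_val (u + v) = orth_val u + orth_val v.
Proof. by []. Qed.

(* The inclusion K[s^\vee] -> K[t^\vee], for t `<=` s. *)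
Definition incl s t : toric_ring s -> toric_ring t :=
  ma_lift (fun u : dual_monoid s =>
    chi K (to_dual t (dual_val u)) : toric_ring t).

Definition orbit_chi s (u : dual_monoid s) : orbit_ring s :=
  if dual_val u \in orth_cone s then chi K (to_orth s (dual_val u)) else 0.

(* The surjection K[s^\vee] -> K[s^\perp] of the closed embedding of O(s). *)
Definition orbit_proj s : toric_ring s -> orbit_ring s := ma_lift (@orbit_chi s).

Lemma orth_coneD s (u v : dual_monoid s) :
  (dual_val (u + v) \in orth_cone s) =
  (dual_val u \in orth_cone s) && (dual_val v \in orth_cone s).
Proof.
have /asboolP du := dual_valP u; have /asboolP dv := dual_valP v.
apply/idP/andP => [/asboolP h|[hu hv]]; last by rewrite dual_valD rpredD.
have E w : s w -> pairing (dual_val u) w + pairing (dual_val v) w = 0.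
  by move=> sw; rewrite -pairingD -dual_valD h.
by split; apply/asboolP => w sw; have := E w sw; have := du w sw;
  have := dv w sw; lra.
Qed.

Lemma orbit_chi0 s : @orbit_chi s 0 = 1.
Proof.
rewrite /orbit_chi dual_val0 rpred0.
rewrite (_ : to_orth s 0 = 0); first exact: chi0.
by apply: orth_val_inj; rewrite to_orthK ?rpred0.
Qed.

Lemma orbit_chiD s (u v : dual_monoid s) :
  orbit_chi (u + v) = orbit_chi u * orbit_chi v.
Proof.
rewrite /orbit_chi orth_coneD.
have [hu|] := boolP (dual_val u \in orth_cone s); last by rewrite mul0r.
have [hv|] := boolP (dual_val v \in orth_cone s); last by rewrite mulr0.
rewrite /= (_ : to_orth s (dual_val (u + v)) =
  to_orth s (dual_val u) + to_orth s (dual_val v)); first exact: chiD.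
apply: orth_val_inj; rewrite to_orthK ?orth_coneD ?hu ?hv //.
by rewrite orth_valD !to_orthK // dual_valD.
Qed.

Definition orbit_pullback s : berkovich abs (orbit_ring s) ->
    berkovich abs (toric_ring s) :=
  berkovich_lift (orbit_chi0 s) (@orbit_chiD s).

Lemma orbit_pullbackE s (z : berkovich abs (orbit_ring s)) f :
  seminorm (orbit_pullback z) f = seminorm z (orbit_proj f).
Proof. by []. Qed.

Lemma trop_chart_subproof s (x : berkovich abs (toric_ring s)) :
  ext_hom_set (fun u : dual_monoid s => - lne (seminorm x (chi K u))%:E)%E.
Proof.
case: (seminormP x) => x1 x0 xM _ _; split.
- by rewrite (chi0 K (dual_monoid s)) x1 lne1 oppe0.
- by move=> u v; rewrite (chiD K u v) xM neg_lneM.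
- by move=> u; exact: neg_lne_neqNy.
Qed.

Definition trop_chart s (x : berkovich abs (toric_ring s)) :
  ext_hom R (dual_monoid s) := SigSub (mem_set (trop_chart_subproof x)).

(* The point of Hom(s^\vee, R \cup {oo}) given by the class of w in N_R(s). *)
Definition stratum_fun s (w : 'rV[R]_n) (u : dual_monoid s) : \bar R :=
  if dual_val u \in orth_cone s then (pairing (dual_val u) w)%:E else +oo%E.

Lemma stratum_subproof s w : ext_hom_set (stratum_fun (s := s) w).
Proof.
split.
- by rewrite /stratum_fun dual_val0 rpred0 pairing0.
- move=> u v; rewrite /stratum_fun orth_coneD dual_valD pairingD EFinD.
  by case: (dual_val u \in _); case: (dual_val v \in _).
- by move=> u; rewrite /stratum_fun; case: ifP.
Qed.

Definition stratum s w : ext_hom R (dual_monoid s) :=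
  SigSub (mem_set (stratum_subproof s w)).

Variable D : set (set 'rV[R]_n).

(* The charts Y_s^an and Y_t^an are glued along Y_t^an when t is a face of s. *)
Definition Yglue (x y : {s : D & berkovich abs (toric_ring (sval s))}) : Prop :=
  face (sval (projT1 x)) (sval (projT1 y)) /\
  forall f, seminorm (projT2 y) f = seminorm (projT2 x) (incl _ f).

Definition Yan : topologicalType := glued Yglue.

Definition Ychart (s : D) (x : berkovich abs (toric_ring (sval s))) : Yan :=
  glue_pi Yglue x.

Definition orbit_emb (s : D) (z : berkovich abs (orbit_ring (sval s))) : Yan :=
  Ychart (orbit_pullback z).

Definition Nglue (x y : {s : D & ext_hom R (dual_monoid (sval s))}) : Prop :=
  face (sval (projT1 x)) (sval (projT1 y)) /\
  forall u, ext_val (projT2 y) u =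
            ext_val (projT2 x) (to_dual (sval (projT1 x)) (dual_val u)).

(* The Kajiwara-Payne partial compactification. *)
Definition NR : topologicalType := glued Nglue.

Definition Nchart (s : D) (h : ext_hom R (dual_monoid (sval s))) : NR :=
  glue_pi Nglue h.

Definition Nstratum (s : D) (w : 'rV[R]_n) : NR := Nchart (stratum (sval s) w).

Definition trop (p : Yan) : NR :=
  let x := repr (p : {eq_quot glue_rel Yglue}) in Nchart (trop_chart (projT2 x)).

Lemma trop_glue (x y : {s : D & berkovich abs (toric_ring (sval s))}) :
  clos_refl_sym_trans _ Yglue x y ->
  Nchart (trop_chart (projT2 x)) = Nchart (trop_chart (projT2 y)).
Proof.
move=> h; induction h as [x y h| |x y _ IH|x y z _ IH1 _ IH2]; last 3 first.
- by [].
- exact: esym.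
- exact: etrans IH1 IH2.
case: h => fxy xy; apply: glue_pi_step; split; first exact: fxy.
move=> u; have E := xy (chi K u).
rewrite /incl ma_lift_chi in E.
exact: (congr1 (fun c : R => - lne c%:E)%E E).
Qed.

Lemma trop_Ychart (s : D) (x : berkovich abs (toric_ring (sval s))) :
  trop (Ychart x) = Nchart (trop_chart x).
Proof. exact: trop_glue (glue_repr Yglue (existT _ s x)). Qed.

(* A closed subscheme of Y_D is a quasi-coherent ideal sheaf: one ideal for each
   affine chart, where passing to the chart of a face is localization. Values
   outside D are irrelevant. *)
Record closed_subscheme := {
  ideal_of : forall s, set (toric_ring s);
  ideal_ofP : forall s, D s -> ideal (@ideal_of s);
  ideal_of_face : forall s t, D s -> D t -> face t s ->
    @ideal_of t = ideal_span (@incl s t @` @ideal_of s) }.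
Arguments ideal_of : clear implicits.

Variable X : closed_subscheme.

(* X \cap T is the chart of the zero cone. *)
Definition torus_equidimensional : Prop :=
  forall P Q, minimal_prime (ideal_of X [set 0]) P ->
    minimal_prime (ideal_of X [set 0]) Q ->
    krull_dim R P = krull_dim R Q.

(* Every nonempty basic open subset of a chart of X meets X \cap T. *)
Definition torus_dense : Prop :=
  forall s, D s -> forall (P : set (toric_ring s)) f,
    prime_ideal P -> ideal_of X s `<=` P -> ~ P f ->
    exists Q : set (toric_ring [set 0]),
      [/\ prime_ideal Q, ideal_of X [set 0] `<=` Q & ~ Q (incl [set 0] f)].

(* The dimension of X, computed on the affine open cover by the charts. *)
Definition scheme_dim : \bar R :=
  ereal_sup [set krull_dim R (ideal_of X s) | s in D].

(* The ideal of X \cap O(s) in K[s^\perp]. *)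
Definition orbit_ideal s : set (orbit_ring s) :=
  ideal_span (@orbit_proj s @` ideal_of X s).

Definition Xan : set Yan :=
  [set p | exists (s : D) (x : berkovich abs (toric_ring (sval s))),
     p = Ychart x /\ forall f, ideal_of X (sval s) f -> seminorm x f = 0].

Definition trop_fiber (om : NR) : set Yan := Xan `&` trop @^-1` [set om].

(* X_om inside O(s)^an, for om the class of w in N_R(s). *)
Definition affinoid (s : D) (w : 'rV[R]_n) :
    set (berkovich abs (orbit_ring (sval s))) :=
  @orbit_emb s @^-1` trop_fiber (Nstratum s w).
Arguments affinoid : clear implicits.

(* The Laurent series a = \sum_u a_u chi^u converging on U_om = trop^-1(om).
   They form the affinoid algebra of U_om, which surjects onto that of X_om. *)
Definition laurent (s : D) (w : 'rV[R]_n) : set (orth_monoid (sval s) -> K) :=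
  [set a | forall e, 0 < e ->
     finite_set [set u | e <= abs (a u) * expR (- pairing (orth_val u) w)]].
Arguments laurent : clear implicits.

(* |a|(z), the limit of |.|_z along the finite partial sums of a. *)
Definition laurent_abs (s : D) (a : orth_monoid (sval s) -> K)
    (z : berkovich abs (orbit_ring (sval s))) : R :=
  lim ((fun J : {fset orth_monoid (sval s)} =>
          seminorm z (\sum_(u <- J) a u *: (chi K u : orbit_ring (sval s))))
         @ totally).

(* As in Berkovich, a boundary is closed: among arbitrary subsets there need not
   be a smallest one on which every |f| attains its maximum. *)
Definition boundary (s : D) (w : 'rV[R]_n) (B : set (affinoid s w)) : Prop :=
  closed B /\
  forall a, laurent s w a ->
    exists2 x : affinoid s w, B x &
      forall y : affinoid s w, laurent_abs a (sval y) <= laurent_abs a (sval x).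

Definition shilov_boundary (s : D) (w : 'rV[R]_n) (B : set (affinoid s w)) :
    Prop :=
  boundary B /\ forall C, boundary C -> B `<=` C.

Definition tropical_skeleton : set Xan :=
  [set p | exists (s : D) (w : 'rV[R]_n) (x : affinoid s w)
             (B : set (affinoid s w)),
     [/\ sval p = orbit_emb (sval x), shilov_boundary B & B x]].

End Toric.

Arguments orbit_ideal {R K n D} X s.
Arguments tropical_skeleton {R K} abs {n D} X.

(* Main.v *)
(* There is a list La of integral forms with the following property. Write M'
   for the sublattice of M on which they vanish. For every orbit that meets X,
   the ring K[s^\perp \cap M] modulo the ideal of X is finite over the subring
   of elements supported in M', and on the torus every minimal prime of the
   ideal of X meets K[M'] in 0. The forms are found one at a time: while the
   dimension hypothesis leaves room, the ideals contain nonzero elements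
   supported in the current sublattice, and a generic form that separates the
   exponents of these finitely many elements, one per orbit, makes K[M]
   finite over the smaller ring. Equidimensionality gives the second property.

   A point of the affinoid X_w lies in the Shilov boundary if and only if it is
   a Gauss norm on K[M'], that is |f| >= |f_u| |chi^u| for f supported in M'.
   These points form a boundary because every point z of X_w is dominated at
   any given g by such a point x, |g|_z <= |g|_x, with the same values on
   characters. On the torus x is obtained by extending the Gauss norm along
   the finite extension above; on another orbit z is first approximated by
   points of the torus. They lie in every boundary: at such a
   point x, products of peak functions, built from integral equations over
   K[M'], can only attain their maximum at points arbitrarily close to x.

   Multiplying by characters, the condition |f_u| |chi^u| <= |f| for f supported
   in one coset of M' makes sense on all charts of Y_Delta, is closed, and is
   compatible with the gluing; it cuts out the tropical skeleton in X^an. *)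
From HB Require Import structures.
From Stdlib Require Import Relation_Operators Operators_Properties.
From mathcomp Require Import all_boot all_order all_algebra finmap.
From mathcomp Require Import all_classical all_reals all_analysis.
From mathcomp Require Import zify ring lra.
From mathcomp.analysis.showcase Require Import summability.
From mathcomp.multinomials Require Import -(notations) monalg.
Require Import Defs.

Set Implicit Arguments.
Unset Strict Implicit.
Unset Printing Implicit Defensive.

Import Order.TTheory GRing.Theory Num.Theory.
Import numFieldNormedType.Exports.

Local Open Scope classical_set_scope.
Local Open Scope ring_scope.

(** * Ideals and multiplicative seminorms *)

(** The obstacle is that Shilov boundaries are defined fibre by fibre through Laurent series,
    whereas closedness compares fibres over different orbits. Hence one list of forms has to serve
    all orbits, and the criterion has to consist of inequalities between values of a single
    seminorm, in which [w] does not occur. On a chart the dual cone may contain too few exponents of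
    M' to carry the criterion; this is why cosets of M' come in.

    Gauss norms are extended from a polynomial ring rather than from K[M']: the two tools, complete
    integral closedness of B[X] and Taylor expansions in B, are obtained by induction on the
    variables of B. The ring B is generated by the x + 1/x for x in a basis of M', and K[M'] is
    finite over it.

    The rest takes place in spaces of seminorms. Seminorms with prescribed values come from minimal
    power-multiplicative ones, maxima from ultrafilter limits of pointwise bounded families, and
    Laurent series from partial sums that converge uniformly on a fibre. *)

Section Ideals.
Variable A : comNzRingType.
Implicit Types (I P S : set A) (a b : A).

Lemma idealN I a : ideal I -> I a -> I (- a).
Proof. by case=> _ _ IM Ia; rewrite -mulN1r; apply: IM. Qed.

Lemma idealB I a b : ideal I -> I a -> I b -> I (a - b).
Proof. by move=> iI Ia Ib; have [_ ID _] := iI; apply: ID => //; exact: idealN. Qed.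

Lemma idealMr I a b : ideal I -> I a -> I (a * b).
Proof. by case=> _ _ IM Ia; rewrite mulrC; exact: IM. Qed.

Lemma ideal_sum I (J : Type) (r : seq J) (Q : pred J) (F : J -> A) :
  ideal I -> (forall i, Q i -> I (F i)) -> I (\sum_(i <- r | Q i) F i).
Proof. by case=> I0 ID _ IF; elim/big_ind: _. Qed.

Lemma ideal_equivM I a a' b b' : ideal I -> I (a - a') -> I (b - b') ->
  I (a * b - a' * b').
Proof.
move=> iI h h'.
have -> : a * b - a' * b' = (a - a') * b + a' * (b - b') by ring.
by case: (iI) => _ ID IM; apply: ID; [exact: idealMr|exact: IM].
Qed.

Lemma ideal_span_ideal I : ideal (ideal_span I).
Proof.
split=> [J [[J0 _ _] _]|a b ha hb J hJ|a b hb J hJ] //.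
  by have [[_ JD _] _] := hJ; apply: JD; [exact: ha|exact: hb].
by have [[_ _ JM] _] := hJ; apply: JM; exact: hb.
Qed.

Lemma sub_ideal_span I : I `<=` ideal_span I.
Proof. by move=> a Ia J [_ sJ]; exact: sJ. Qed.

Lemma ideal_span_sub I J : ideal J -> I `<=` J -> ideal_span I `<=` J.
Proof. by move=> iJ sIJ a; apply. Qed.

Lemma prime_idealX P a k : prime_ideal P -> P (a ^+ k) -> P a.
Proof.
move=> [iP P1 PM]; elim: k => [|k IH]; first by rewrite expr0 => /P1.
by rewrite exprS => /PM[].
Qed.

Lemma prime_avoiding I S : ideal I -> S 1 ->
  (forall a b, S a -> S b -> S (a * b)) -> (forall a, I a -> ~ S a) ->
  exists P, [/\ prime_ideal P, I `<=` P & forall a, P a -> ~ S a].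
Proof.
move=> iI S1 SM IS.
pose good := [set J | [/\ ideal J, I `<=` J & forall a, J a -> ~ S a]].
pose good0 := [set J | J = set0 \/ good J].
have [F FP Ftot|P [gP Pmax]] := @Zorn_bigcup A good0.
  have [[J0 FJ0 J0n]|F0] := pselect (exists2 J, F J & J !=set0); last first.
    left; apply/seteqP; split=> // a [J FJ Ja]; apply: F0; exists J => //.
    by exists a.
  have gF J : F J -> J !=set0 -> good J by move=> /FP[->|//] [? []].
  right; have [iJ0 IJ0 _] := gF _ FJ0 J0n; split.
  - split=> [|a b [J FJ Ja] [J' FJ' J'b]|a b [J FJ Jb]].
    + by exists J0 => //; case: iJ0.
    + have [JJ'|J'J] := Ftot _ _ FJ FJ'.
        exists J' => //; have [|[_ D _] _ _] := gF _ FJ'; first by exists b.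
        by apply: D => //; exact: JJ'.
      exists J => //; have [|[_ D _] _ _] := gF _ FJ; first by exists a.
      by apply: D => //; exact: J'J.
    + exists J => //; have [|[_ _ M] _ _] := gF _ FJ; first by exists b.
      exact: M.
  - by move=> a Ia; exists J0 => //; exact: IJ0.
  - move=> a [J FJ Ja]; have [|_ _] := gF _ FJ; first by exists a.
    exact.
have gI : good I by split.
have {}gP : good P.
  case: gP => // P0; exfalso; apply: (Pmax I); last by right.
  by rewrite P0; split=> // /(_ 0); apply; case: iI.
have [iP IP PS] := gP.
have add_elt c : ~ P c -> exists2 d, P d & exists a, S (d + a * c).
  move=> Pc; apply: contrapT => hc.
  pose J := [set x | exists2 d, P d & exists a, x = d + a * c].
  apply: (Pmax J); last first.
    right; split.
    - case: (iP) => P0 PD PM; split.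
      + by exists 0 => //; exists 0; rewrite mul0r addr0.
      + move=> _ _ [d Pd [a ->]] [d' Pd' [a' ->]]; exists (d + d'); first exact: PD.
        by exists (a + a'); ring.
      + move=> x _ [d Pd [a ->]]; exists (x * d); first exact: PM.
        by exists (x * a); ring.
    - by move=> x /IP Px; exists x => //; exists 0; rewrite mul0r addr0.
    - by move=> x [d Pd [a ->]] Sx; apply: hc; exists d => //; exists a.
  split; first by move=> x Px; exists x => //; exists 0; rewrite mul0r addr0.
  move=> JP; apply: Pc; apply: JP; exists 0; first by case: iP.
  by exists 1; rewrite mul1r add0r.
exists P; split=> //; split=> // [P1|a b Pab]; first exact: (PS 1).
apply: contrapT => /not_orP[/add_elt[d Pd [x Sx]] /add_elt[e Pe [y Sy]]].
apply: (PS _ _ (SM _ _ Sx Sy)).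
have -> : (d + x * a) * (e + y * b) =
  (e + y * b) * d + (x * a) * e + x * y * (a * b) by ring.
by case: iP => _ PD' PM'; apply: (PD'); [apply: (PD')|]; apply: (PM').
Qed.

(** Zorn's lemma for reverse inclusion: the intersection of a chain of primes is prime. *)
Lemma minimal_prime_below I P : prime_ideal P -> I `<=` P ->
  exists2 Q, minimal_prime I Q & Q `<=` P.
Proof.
move=> pP IP.
pose T := {Q : set A | [/\ prime_ideal Q, I `<=` Q & Q `<=` P]}.
pose le (s t : T) := `[< sval t `<=` sval s >].
have [s|s t u /asboolP h1 /asboolP h2|[s hs] [t ht]|F Ftot|] := @Zorn T le.
- exact/asboolP.
- by apply/asboolP => a /h2 /h1.
- by move=> /asboolP h1 /asboolP h2; apply/eq_exist/seteqP.
- have [[t0 Ft0]|F0] := pselect (F !=set0); last first.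
    exists (exist _ P (And3 pP IP (@subset_refl _ _))) => s Fs.
    by exfalso; apply: F0; exists s.
  pose Q := \bigcap_(t in F) sval t.
  have hQ : [/\ prime_ideal Q, I `<=` Q & Q `<=` P].
    have [[it0 _ _] _ t0P] := svalP t0.
    split.
    - split.
      + split=> [t _|a b ha hb t Ft|a b hb t Ft];
          have [[[z D M] _ _] _ _] := svalP t => //.
          by apply: D; [exact: ha|exact: hb].
        by apply: M; exact: hb.
      + by move=> /(_ _ Ft0); have [[_]] := svalP t0.
      + move=> a b hab; apply: contrapT => /not_orP[].
        move=> /existsNP[s /not_implyP[Fs sa]] /existsNP[t /not_implyP[Ft tb]].
        have [/asboolP st|/asboolP ts] := Ftot _ _ Fs Ft.
          have [[_ _ M] _ _] := svalP t.
          by have [/st/sa|/tb] := M _ _ (hab _ Ft).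
        have [[_ _ M] _ _] := svalP s.
        by have [/sa|/ts/tb] := M _ _ (hab _ Fs).
    - by move=> a Ia t Ft; have [_ It _] := svalP t; exact: It.
    - by move=> a /(_ _ Ft0)/t0P.
  exists (exist _ Q hQ) => s Fs; apply/asboolP => a /=; exact.
move=> [Q [pQ IQ QP]] Qmin; exists Q => //; split=> // Q' pQ' IQ' Q'Q.
have hQ' : [/\ prime_ideal Q', I `<=` Q' & Q' `<=` P].
  by split=> //; exact: (subset_trans Q'Q QP).
have /(_ _)/(congr1 sval)/= := Qmin (exist _ Q' hQ'); apply.
exact/asboolP.
Qed.

End Ideals.

Section Mnorm.
Variable R : realType.

(* The condition x 0 = 0 only excludes the constant 1. *)
Record mnorm (A : comNzRingType) (x : A -> R) : Prop := {
  mnorm0 : x 0 = 0;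
  mnorm1 : x 1 = 1;
  mnorm_ge0 : forall a, 0 <= x a;
  mnormM : forall a b, x (a * b) = x a * x b;
  mnormD : forall a b, x (a + b) <= Num.max (x a) (x b) }.

Section Theory.
Variables (A : comNzRingType) (x : A -> R).
Hypothesis hx : mnorm x.

Lemma mnormN a : x (- a) = x a.
Proof.
have : x (-1) ^+ 2 = 1 by rewrite expr2 -(mnormM hx) mulrNN mulr1 (mnorm1 hx).
move=> /eqP; rewrite sqrf_eq1 => /orP[/eqP h|/eqP h].
  by rewrite -mulN1r (mnormM hx) h mul1r.
by have := mnorm_ge0 hx (-1); rewrite h; lra.
Qed.

Lemma mnormB a b : x (a - b) <= Num.max (x a) (x b).
Proof. by rewrite -(mnormN b); exact: mnormD. Qed.

Lemma mnormX a k : x (a ^+ k) = x a ^+ k.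
Proof.
elim: k => [|k IH]; first by rewrite !expr0 (mnorm1 hx).
by rewrite !exprS (mnormM hx) IH.
Qed.

Lemma mnorm_prod (J : Type) (r : seq J) (Q : pred J) (F : J -> A) :
  x (\prod_(i <- r | Q i) F i) = \prod_(i <- r | Q i) x (F i).
Proof. exact: (big_morph x (mnormM hx) (mnorm1 hx)). Qed.

Lemma mnorm_sum_le (J : Type) (r : seq J) (Q : pred J) (F : J -> A) c :
  0 <= c -> (forall i, Q i -> x (F i) <= c) -> x (\sum_(i <- r | Q i) F i) <= c.
Proof.
move=> c0 h; elim/big_ind: _ => [|a b ha hb|//]; first by rewrite (mnorm0 hx).
by rewrite (le_trans (mnormD hx a b)) // ge_max ha.
Qed.

Lemma mnorm_sum_lt (J : eqType) (r : seq J) (Q : pred J) (F : J -> A) c :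
  0 < c -> (forall i, i \in r -> Q i -> x (F i) < c) ->
  x (\sum_(i <- r | Q i) F i) < c.
Proof.
move=> c0 h; rewrite big_seq_cond.
elim/big_ind: _ => [|a b ha hb|i /andP[]]; [by rewrite (mnorm0 hx)| |exact: h].
by rewrite (le_lt_trans (mnormD hx a b)) // gt_max ha.
Qed.

Lemma mnorm_addl a b : x b < x a -> x (a + b) = x a.
Proof.
move=> h; apply/le_anti/andP; split.
  by rewrite (le_trans (mnormD hx a b)) // ge_max lexx ltW.
have : x a <= Num.max (x (a + b)) (x b).
  by rewrite -[X in x X <= _](addrK b) mnormB.
by rewrite le_max (leNgt (x a) (x b)) h orbF.
Qed.

Lemma mnorm_sub0 a b : x (a - b) = 0 -> x a = x b.
Proof.
move=> h; have le c d : x (c - d) = 0 -> x c <= x d.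
  move=> hcd; rewrite -[X in x X <= _](subrK d).
  by rewrite (le_trans (mnormD hx _ _)) // hcd ge_max lexx mnorm_ge0.
by apply/le_anti/andP; split; apply: le => //; rewrite -mnormN opprB.
Qed.

Lemma mnorm_ker_prime : prime_ideal [set a | x a = 0].
Proof.
split=> [|/=|a b /= /eqP]; first split=> /= [|a b ha hb|a b hb].
- exact: mnorm0.
- by apply/le_anti; rewrite mnorm_ge0 // (le_trans (mnormD hx a b)) // ha hb maxxx lexx.
- by rewrite (mnormM hx) hb mulr0.
- by rewrite (mnorm1 hx); apply/eqP; rewrite oner_eq0.
- by rewrite (mnormM hx) mulf_eq0 => /orP[]/eqP; [left|right].
Qed.

Lemma mnorm_comp (B : comNzRingType) (f : {rmorphism B -> A}) :
  mnorm (x \o f).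
Proof.
split=> /= [||a|a b|a b].
- by rewrite rmorph0 (mnorm0 hx).
- by rewrite rmorph1 (mnorm1 hx).
- exact: mnorm_ge0.
- by rewrite rmorphM (mnormM hx).
- by rewrite rmorphD mnormD.
Qed.

End Theory.

(** Views primes as seminorms with values 0 and 1, so that comparison results for seminorms
    specialize to primes, as in [prime_incomparable]. *)
Lemma prime_mnorm (A : comNzRingType) (P : set A) : prime_ideal P ->
  mnorm (fun a => if `[< P a >] then 0 else 1).
Proof.
case=> iP P1 PM; have [P0 PD _] := iP; split.
- by rewrite asboolT.
- by rewrite asboolF.
- by move=> a; case: ifP => _; rewrite ?ler01.
- move=> a b; case: asboolP => [/PM[]|] Pab.
    by rewrite asboolT ?mul0r.
  - by rewrite (asboolT Pab) mulr0.
  rewrite !asboolF ?mulr1 // => h; apply: Pab; last exact: idealMr.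
    by case: iP => _ _; apply.
- move=> a b; rewrite le_max; case: (asboolP (P a)) => Pa.
    case: (asboolP (P b)) => Pb; last by case: ifP; rewrite ?ler01 ?lexx ?orbT.
    by rewrite asboolT ?lexx //; exact: PD.
  by case: ifP; rewrite ?ler01 ?lexx.
Qed.

End Mnorm.

(** * Finite extensions *)

Section Subrings.
Variable A : comNzRingType.
Implicit Types (B C I J : set A) (a b : A).

Definition subring (B : set A) : Prop :=
  [/\ B 1, forall a b, B a -> B b -> B (a - b) &
      forall a b, B a -> B b -> B (a * b)].

(* C is contained in a finitely generated B-submodule of A / I. *)
Definition finite_over (C B I : set A) : Prop :=
  exists (m : nat) (s : 'I_m -> A), forall a, C a ->
    exists2 b : 'I_m -> A, forall i, B (b i) & I (a - \sum_i b i * s i).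

Section Subring.
Variable B : set A.
Hypothesis sB : subring B.

Lemma subring0 : B 0.
Proof. by case: sB => B1 BB _; rewrite -(subrr 1); exact: BB. Qed.

Lemma subringN a : B a -> B (- a).
Proof. by move=> Ba; rewrite -sub0r; case: sB => _ BB _; apply: BB => //; exact: subring0. Qed.

Lemma subringD a b : B a -> B b -> B (a + b).
Proof.
by move=> Ba Bb; rewrite -[b]opprK; case: sB => _ BB _; apply: BB => //; exact: subringN.
Qed.

Lemma subringM a b : B a -> B b -> B (a * b).
Proof. by case: sB => _ _; apply. Qed.

Lemma subring_sum (T : Type) (r : seq T) (Q : pred T) (F : T -> A) :
  (forall i, Q i -> B (F i)) -> B (\sum_(i <- r | Q i) F i).
Proof. by move=> h; elim/big_ind: _ => //; [exact: subring0|exact: subringD]. Qed.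

Lemma subring_prod (T : Type) (r : seq T) (Q : pred T) (F : T -> A) :
  (forall i, Q i -> B (F i)) -> B (\prod_(i <- r | Q i) F i).
Proof. by move=> h; elim/big_ind: _ => //; [case: sB|exact: subringM]. Qed.

Lemma subring_det m (N : 'M[A]_m) : (forall i j, B (N i j)) -> B (\det N).
Proof.
move=> h; apply: subring_sum => s _; apply: subringM; last exact: subring_prod.
case: (perm.odd_perm s) => /=; rewrite ?expr0 ?expr1; last by case: sB.
by apply: subringN; case: sB.
Qed.

Section DetCongr.
Variable q : set A.
Hypotheses (q0 : q 0) (qD : forall a b, q a -> q b -> q (a + b)).
Hypothesis qM : forall a b, B a -> q b -> q (a * b).

Lemma prod_congr (T : Type) (r : seq T) (F G : T -> A) :
  (forall i, B (F i)) -> (forall i, B (G i)) -> (forall i, q (F i - G i)) ->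
  q (\prod_(i <- r) F i - \prod_(i <- r) G i).
Proof.
move=> BF BG qFG; elim: r => [|i r IH]; first by rewrite !big_nil subrr.
rewrite !big_cons.
have -> : F i * \prod_(j <- r) F j - G i * \prod_(j <- r) G j =
  F i * (\prod_(j <- r) F j - \prod_(j <- r) G j) +
  (\prod_(j <- r) G j) * (F i - G i) by ring.
by apply: qD; apply: qM => //; exact: subring_prod.
Qed.

Lemma det_congr m (N N' : 'M[A]_m) :
  (forall i j, B (N i j)) -> (forall i j, B (N' i j)) ->
  (forall i j, q (N i j - N' i j)) -> q (\det N - \det N').
Proof.
move=> BN BN' qN; rewrite /determinant -sumrB.
elim/big_ind: _ => // s _; rewrite -mulrBr; apply: qM; last exact: prod_congr.
case: (perm.odd_perm s) => /=; rewrite ?expr0 ?expr1; last by case: sB.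
by apply: subringN; case: sB.
Qed.

End DetCongr.

End Subring.

Lemma subring_setT : subring setT. Proof. by []. Qed.

End Subrings.

Section FiniteModules.
Variable A : comNzRingType.
Implicit Types (B C I J : set A) (a b : A).

Lemma finite_over_refl B I : subring B -> ideal I -> finite_over B B I.
Proof.
move=> sB iI; exists 1%N, (fun _ => 1) => a Ba; exists (fun _ => a) => //.
by rewrite big_ord1 mulr1 subrr; case: iI.
Qed.

Lemma finite_over_sub C C' B I J : C' `<=` C -> I `<=` J ->
  finite_over C B I -> finite_over C' B J.
Proof.
move=> CC IJ [m [s h]]; exists m, s => a /CC/h[b Bb Ib].
by exists b => //; exact: IJ.
Qed.

Lemma finite_over_trans D C B I : subring B -> ideal I ->
  finite_over D C I -> finite_over C B I -> finite_over D B I.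
Proof.
move=> sB iI [m [s hs]] [p [t ht]]; have [I0 ID IM] := iI.
exists #|{: 'I_m * 'I_p}|, (fun k => s (enum_val k).1 * t (enum_val k).2).
move=> a /hs[c Cc Ic].
pose b i := sval (cid2 (ht _ (Cc i))).
have Bb i j : B (b i j) by rewrite /b; case: cid2.
have Ib i : I (c i - \sum_j b i j * t j) by rewrite /b; case: cid2.
exists (fun k => b (enum_val k).1 (enum_val k).2) => [k|]; first exact: Bb.
rewrite -(@big_enum_val _ _ _ _ predT (fun k => b k.1 k.2 * (s k.1 * t k.2))).
rewrite /= -(pair_bigA _ (fun i j => b i j * (s i * t j))) /=.
rewrite -[a](subrK (\sum_i c i * s i)) -addrA; apply: ID => //.
rewrite -sumrB; apply: ideal_sum => // i _.
have -> : c i * s i - \sum_j b i j * (s i * t j) = s i * (c i - \sum_j b i j * t j).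
  by rewrite mulrBr mulr_sumr mulrC; congr (_ - _); apply: eq_bigr => j _; ring.
exact: IM.
Qed.

(** Cramer's rule: multiplying the relations by the adjugate of [N] isolates the determinant times
    each generator. *)
Lemma ideal_det_mul I m (s : 'I_m -> A) (N : 'M[A]_m) k : ideal I ->
  (forall i, I (\sum_j N i j * s j)) -> I (\det N * s k).
Proof.
move=> iI IN; have [_ _ IM] := iI.
have -> : \det N * s k = \sum_i (\adj N) k i * \sum_j N i j * s j.
  rewrite (eq_bigr (fun i => \sum_j (\adj N k i * N i j) * s j)); last first.
    by move=> i _; rewrite mulr_sumr; apply: eq_bigr => j _; rewrite mulrA.
  rewrite exchange_big /= (bigD1 k) //= [X in _ + X]big1 => [|j jk].
    by rewrite addr0 -mulr_suml; congr (_ * _); have /matrixP/(_ k k) := mul_adj_mx N;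
      rewrite !mxE eqxx mulr1n.
  rewrite -mulr_suml; have /matrixP/(_ k j) := mul_adj_mx N; rewrite !mxE.
  by rewrite eq_sym (negPf jk) mulr0n => ->; rewrite mul0r.
by apply: ideal_sum => // i _; exact: IM.
Qed.

Lemma ideal_det I m (s c : 'I_m -> A) (N : 'M[A]_m) : ideal I ->
  I (1 - \sum_i c i * s i) -> (forall i, I (\sum_j N i j * s j)) -> I (\det N).
Proof.
move=> iI I1 IN; have [_ ID IM] := iI.
rewrite -[\det N]mulr1 -(subrK (\sum_i c i * s i) 1) mulrDr; apply: ID.
  exact: IM.
rewrite mulr_sumr; apply: ideal_sum => // i _.
by rewrite mulrCA; apply: (IM); exact: (ideal_det_mul i iI IN).
Qed.

Section Integral.
Variables (B I : set A).
Hypotheses (sB : subring B) (iI : ideal I) (fBI : finite_over setT B I).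

(** Cayley-Hamilton for a matrix over [B] of multiplication by [a] on the generators of A / I. *)
Lemma finite_over_monic a :
  exists p : {poly A}, [/\ p \is monic, forall i, B p`_i & I p.[a]].
Proof.
have [m [s hs]] := fBI; have [c _ Ic] := hs 1 Logic.I.
pose M : 'M[A]_m := \matrix_(i, j) sval (cid2 (hs (a * s i) Logic.I)) j.
have BM i j : B (M i j) by rewrite mxE; case: cid2.
have IM i : I (a * s i - \sum_j M i j * s j).
  by under eq_bigr do rewrite mxE; case: cid2.
exists (char_poly M); split; first exact: char_poly_monic.
- pose PB := [set p : {poly A} | forall i, B p`_i].
  have sPB : subring PB.
    split=> [i|p r hp hr i|p r hp hr i].
    + by rewrite coef1; case: (i == _); [case: sB|exact: subring0].
    + by rewrite coefB; case: sB => _ BB _; exact: BB.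
    + by rewrite coefM; apply: subring_sum => // j _; exact: subringM.
  suff : PB (char_poly M) by [].
  apply: (subring_det sPB) => i j k; 
  have -> : char_poly_mx M i j = 'X *+ (i == j) - (M i j)%:P by rewrite !mxE.
  rewrite coefB coefMn coefX coefC.
  case: (sB) => B1 BB _; apply: BB; last first.
    by case: (k == 0)%N => //; exact: subring0.
  by case: (k == 1)%N; case: (i == j); rewrite ?mulr1n ?mulr0n //; exact: subring0.
- have -> : (char_poly M).[a] = \det (a%:M - M).
    rewrite -/(horner_eval a (char_poly M)) -det_map_mx; congr (\det _).
    apply/matrixP => i j; rewrite mxE.
    have -> : char_poly_mx M i j = 'X *+ (i == j) - (M i j)%:P by rewrite !mxE.
    by rewrite /= /horner_eval hornerD hornerMn hornerN hornerX hornerC !mxE.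
  apply: (ideal_det iI Ic) => i.
  have -> // : \sum_j (a%:M - M) i j * s j = a * s i - \sum_j M i j * s j.
  rewrite (eq_bigr (fun j => (a *+ (i == j)) * s j - M i j * s j)).
    rewrite sumrB; congr (_ - _); rewrite (bigD1 i) //= eqxx mulr1n big1 ?addr0 // => j ji.
    by rewrite eq_sym (negPf ji) mulr0n mul0r.
  by move=> j _; rewrite !mxE mulrBl.
Qed.

(** The extension [J] of [q] consists of the combinations of the generators with coefficients in
    [q], modulo [I]. If b in [B] lies in [J], multiplication by b has a matrix M over [q]; then det
    (b - M) lies in [I] and in [B], hence in [q], and it is congruent to a power of b, so b is in
    [q]. It remains to take a prime that contains [J] and avoids the elements of [B] outside [q]. *)
Lemma lying_over (q : set A) : q `<=` B -> q 0 ->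
  (forall a b, q a -> q b -> q (a + b)) -> (forall a b, B a -> q b -> q (a * b)) ->
  ~ q 1 -> (forall a b, B a -> B b -> q (a * b) -> q a \/ q b) ->
  I `&` B `<=` q ->
  exists Q, [/\ prime_ideal Q, I `<=` Q & forall b, B b -> (Q b <-> q b)].
Proof.
move=> qB q0 qD qM q1 qP IBq; have [m [s hs]] := fBI; have [c Bc Ic] := hs 1 Logic.I.
have [I0 ID IM] := iI; have [B1 BB BM] := sB.
have qN a : q a -> q (- a).
  by move=> qa; rewrite -mulN1r; apply: qM => //; exact: subringN.
pose J := [set x | exists2 b : 'I_m -> A, forall i, q (b i) & I (x - \sum_i b i * s i)].
have iJ : ideal J.
  split.
  - by exists (fun _ => 0) => //; rewrite big1 ?subrr // => i _; rewrite mul0r.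
  - move=> x y [b qb Ib] [b' qb' Ib']; exists (fun i => b i + b' i) => [i|]; first exact: qD.
    have -> // : x + y - \sum_i (b i + b' i) * s i =
      (x - \sum_i b i * s i) + (y - \sum_i b' i * s i).
      by under eq_bigr do rewrite mulrDl; rewrite big_split /=; ring.
    exact: ID.
  - move=> a x [b qb Ib].
    pose M i j := sval (cid2 (hs (a * s i) Logic.I)) j.
    have BMij i j : B (M i j) by rewrite /M; case: cid2.
    have IMi i : I (a * s i - \sum_j M i j * s j) by rewrite /M; case: cid2.
    exists (fun j => \sum_i M i j * b i) => [j|].
      by elim/big_ind: _ => // i _; exact: qM.
    have -> : a * x - \sum_j (\sum_i M i j * b i) * s j =
        a * (x - \sum_i b i * s i) + \sum_i b i * (a * s i - \sum_j M i j * s j).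
      under [X in _ = _ + X]eq_bigr do rewrite mulrBr.
      rewrite sumrB mulrBr addrA; congr (_ - _).
        have -> : \sum_i b i * (a * s i) = a * \sum_i b i * s i.
          by rewrite mulr_sumr; apply: eq_bigr => i _; rewrite mulrCA.
        by rewrite subrK.
      under eq_bigr do rewrite mulr_suml.
      rewrite exchange_big; apply: eq_bigr => i _; rewrite mulr_sumr.
      by apply: eq_bigr => j _; ring.
    by apply: ID; [exact: IM|apply: ideal_sum => // i _; exact: IM].
pose S := [set b | B b /\ ~ q b].
have [||b Jb [Bb qb]|Q [pQ JQ QS]] := prime_avoiding (S := S) iJ.
- by split.
- move=> a b [Ba qa] [Bb qb]; split; first exact: BM.
  by move/(qP _ _ Ba Bb) => [].
- have Js i : J (b * s i) by apply: idealMr.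
  pose M : 'M[A]_m := \matrix_(i, j) sval (cid2 (Js i)) j.
  have qMij i j : q (M i j) by rewrite mxE; case: cid2.
  have IMi i : I (b * s i - \sum_j M i j * s j).
    by under eq_bigr do rewrite mxE; case: cid2.
  have Bbm i j : B ((b%:M : 'M[A]_m) i j).
    by rewrite mxE; case: (i == j); rewrite ?mulr1n ?mulr0n //; exact: subring0.
  have BN i j : B ((b%:M - M) i j).
    by rewrite !mxE; apply: BB; [have := Bbm i j; rewrite mxE|apply: qB; have := qMij i j; rewrite mxE].
  have IN : I (\det (b%:M - M)).
    apply: (ideal_det iI Ic) => i.
    have -> // : \sum_j (b%:M - M) i j * s j = b * s i - \sum_j M i j * s j.
    rewrite (eq_bigr (fun j => (b *+ (i == j)) * s j - M i j * s j)).
      rewrite sumrB; congr (_ - _); rewrite (bigD1 i) //= eqxx mulr1n big1 ?addr0 // => j ji.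
      by rewrite eq_sym (negPf ji) mulr0n mul0r.
    by move=> j _; rewrite !mxE mulrBl.
  have qdet : q (\det (b%:M - M)) by apply: IBq; split=> //; exact: subring_det.
  have := @det_congr _ _ sB q q0 qD qM m (b%:M - M) b%:M BN Bbm.
  have /[swap]/[apply] : forall i j, q ((b%:M - M) i j - (b%:M : 'M[A]_m) i j).
    move=> i j; have -> : (b%:M - M) i j - (b%:M : 'M[A]_m) i j = - M i j.
      by rewrite !mxE; ring.
    exact: qN.
  rewrite det_scalar => h; have {h} : q (b ^+ m).
    have -> : b ^+ m = \det (b%:M - M) + - (\det (b%:M - M) - b ^+ m) by ring.
    by apply: qD => //; exact: qN.
  elim: m {s hs c Bc Ic J iJ Jb Js M qMij IMi Bbm BN IN qdet} => [|m IH]; first by rewrite expr0.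
  rewrite exprS => /qP[||//|//] //; elim: (m) => [|k Bk]; first by rewrite expr0.
  by rewrite exprS; exact: BM.
exists Q; split=> // [a Ia|b Bb].
  apply: JQ; exists (fun _ => 0) => //.
  by rewrite big1 ?subr0 // => i _; rewrite mul0r.
split=> [Qb|qb]; first by apply: contrapT => ?; exact: (QS b).
apply: JQ; exists (fun i => c i * b) => [i|]; first exact: qM.
have -> : b - \sum_i (c i * b) * s i = b * (1 - \sum_i c i * s i).
  by rewrite mulrBr mulr1 mulr_sumr; congr (_ - _); apply: eq_bigr => i _; ring.
exact: IM.
Qed.

End Integral.

Section Incomparable.
Variable R : realType.
Implicit Types x y : A -> R.

(** Dividing p(a) by the largest possible power of [a] leaves c + r a of value 0 for [y], hence for
    [x], where c is the first coefficient of nonzero value. Both seminorms then give |c| = |r| |a|;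
    as x <= y on r and on [a], neither factor can drop. *)
Lemma mnorm_incomparable (T : set A) x y a (p : {poly A}) : subring T -> T a ->
  (forall i, T p`_i) -> mnorm x -> mnorm y -> (forall b, T b -> x b <= y b) -> p \is monic -> (forall i, x p`_i = y p`_i) ->
  y p.[a] = 0 -> x a = y a.
Proof.
move=> sT Ta Tp hx hy xy pm xyp ypa.
have Tdrop j : T (drop_poly j p).[a].
  rewrite horner_coef; apply: (subring_sum sT) => i _; apply: (subringM sT).
    by rewrite coef_drop_poly.
  by elim: (i : nat) => [|k IH]; rewrite ?expr0 ?exprS; [case: sT|exact: (subringM sT)].
apply/eqP; rewrite eq_le xy //= leNgt; apply/negP => xay.
have ya0 : y a != 0 by rewrite gt_eqF // (le_lt_trans _ xay) // mnorm_ge0.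
have exj : exists j, y p`_j != 0.
  by exists (size p).-1; have /monicP := pm; rewrite /lead_coef => ->; rewrite mnorm1 ?oner_eq0.
have [j yj jmin] := ex_minnP exj.
pose u := (drop_poly j p).[a].
have yu : y u = 0.
  have E : p.[a] = (take_poly j p).[a] + u * a ^+ j.
    by rewrite -[in LHS](poly_take_drop j p) hornerD hornerM hornerXn.
  have yt : y (take_poly j p).[a] = 0.
    apply/eqP; rewrite eq_le mnorm_ge0 // andbT horner_coef.
    apply: mnorm_sum_le => // i _; rewrite mnormM // coef_take_poly.
    case: ifP => [ij|_]; last by rewrite mnorm0 // mul0r.
    suff /eqP-> : y p`_i == 0 by rewrite mul0r.
    by apply: contraTT ij => /jmin; rewrite -leqNgt.
  have : y (u * a ^+ j) = 0.
    have -> : u * a ^+ j = p.[a] - (take_poly j p).[a] by rewrite E addrC addKr.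
    apply/eqP; rewrite eq_le mnorm_ge0 // andbT.
    by rewrite (le_trans (mnormB hy _ _)) // ypa yt maxxx.
  rewrite mnormM // mnormX // => /eqP; rewrite mulf_eq0 => /orP[/eqP //|].
  by rewrite expf_eq0 (negPf ya0) andbF.
pose r := (drop_poly j.+1 p).[a].
have Eu : u = p`_j - - (r * a).
  have Ep : drop_poly j p = drop_poly j.+1 p * 'X + (p`_j)%:P.
    apply/polyP => -[|i]; rewrite coefD coefMX coefC !coef_drop_poly ?add0r //=.
    by rewrite addr0 addSnnS.
  by rewrite opprK /u Ep hornerMXaddC addrC.
have xu : x u = 0 by apply/eqP; rewrite eq_le mnorm_ge0 // andbT -yu; apply/xy/Tdrop.
rewrite Eu in yu xu.
have := mnorm_sub0 hy yu; have := mnorm_sub0 hx xu.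
rewrite !mnormN // !mnormM // xyp => ->; apply/eqP; rewrite lt_eqF //.
have yr0 : 0 < y r.
  rewrite lt_def mnorm_ge0 // andbT; apply/eqP => yr; move: yj.
  have := mnorm_sub0 hy yu; rewrite mnormN // mnormM // yr mul0r => ->.
  by rewrite eqxx.
by rewrite (le_lt_trans _ (_ : y r * x a < _)) // ?ltr_pM2l //; apply: ler_wpM2r; [exact: mnorm_ge0|exact/xy/Tdrop].
Qed.

End Incomparable.

End FiniteModules.

(** * Power-multiplicative seminorms and the multiplicative ones below them *)

Section PowerSeminorms.
Variable R : realType.

Record power_seminorm (A : comNzRingType) (p : A -> R) : Prop := {
  psn0 : p 0 = 0;
  psn1 : p 1 = 1;
  psn_ge0 : forall a, 0 <= p a;
  psnM : forall a b, p (a * b) <= p a * p b;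
  psnX : forall a k, p (a ^+ k) = p a ^+ k;
  psnD : forall a b, p (a + b) <= Num.max (p a) (p b) }.

Lemma le_gtP (x y : R) : (forall c, x < c -> y <= c) -> y <= x.
Proof. by move=> h; apply/ler_addgt0Pr => e e0; apply: h; rewrite ltrDl. Qed.

Lemma le_expn (x y : R) k : 0 <= x -> x <= y -> x ^+ k <= y ^+ k.
Proof.
move=> x0 xy; elim: k => [|k IH]; first by rewrite !expr0.
by rewrite !exprS ler_pM // exprn_ge0.
Qed.

Lemma le_mul_gtP (x y z : R) : 0 <= x -> 0 <= y ->
  (forall c d, x < c -> y < d -> z <= c * d) -> z <= x * y.
Proof.
move=> x0 y0 h; apply/ler_addgt0Pr => e e0.
pose t := Num.min 1 (e / (x + y + 1)).
have s0 : 0 < x + y + 1 by lra.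
have t0 : 0 < t by rewrite lt_min ltr01 divr_gt0.
have t1 : t <= 1 by rewrite ge_min lexx.
have te : t * (x + y + 1) <= e by rewrite -ler_pdivlMr // ge_min lexx orbT.
have := h (x + t) (y + t); rewrite !ltrDl t0 => /(_ isT isT) /le_trans; apply.
have : t * t <= t by rewrite ler_piMr // ltW.
by nra.
Qed.

Section Localize.
Variables (A : comNzRingType) (p : A -> R) (b : A).
Hypotheses (hp : power_seminorm p) (pb : 0 < p b).

(** The quotients decrease with n. The result is the largest function below [p] for which
    multiplication by [b] multiplies all values by [p b]; it is induced by A[1/b], with 1/b given
    the value 1 / p b. *)
Definition localize_seminorm (a : A) : R :=
  inf [set p (a * b ^+ n) / p b ^+ n | n in [set: nat]].

Local Notation q := localize_seminorm.

Let pbX n : 0 < p b ^+ n. Proof. exact: exprn_gt0. Qed.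

Let hlb a : has_lbound [set p (a * b ^+ n) / p b ^+ n | n in [set: nat]].
Proof. by exists 0 => _ [n _ <-]; apply: divr_ge0; [exact: psn_ge0|exact: ltW]. Qed.

Lemma localize_le a n : q a <= p (a * b ^+ n) / p b ^+ n.
Proof. by apply: ge_inf; [exact: hlb|exists n]. Qed.

Lemma localize_lt a c : q a < c ->
  exists N, forall n, (N <= n)%N -> p (a * b ^+ n) <= c * p b ^+ n.
Proof.
move=> /inf_lt[]; first by exists (p (a * b ^+ 0) / p b ^+ 0), 0%N.
move=> _ [N _ <-]; rewrite ltr_pdivrMr // => h; exists N => n Nn.
rewrite -(subnKC Nn) !exprD !mulrA (le_trans (psnM hp _ _)) //.
by rewrite (psnX hp) ler_wpM2r ?exprn_ge0 ?psn_ge0 // ltW.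
Qed.

Lemma le_localize a c : (forall n, c * p b ^+ n <= p (a * b ^+ n)) -> c <= q a.
Proof.
move=> h; apply: lb_le_inf; first by exists (p (a * b ^+ 0) / p b ^+ 0), 0%N.
by move=> _ [n _ <-]; rewrite ler_pdivlMr.
Qed.

Lemma localize_le_seminorm a : q a <= p a.
Proof. by have := localize_le a 0; rewrite !expr0 mulr1 divr1. Qed.

Lemma localize_ge0 a : 0 <= q a.
Proof. by apply: le_localize => n; rewrite mul0r psn_ge0. Qed.

Lemma localizeM_le a a' : q (a * a') <= q a * q a'.
Proof.
apply: le_mul_gtP; rewrite ?localize_ge0 // => c c' ac a'c'.
have [N hN] := localize_lt ac; have [N' hN'] := localize_lt a'c'.
pose n := maxn N N'.
rewrite (le_trans (localize_le _ (n + n))) // ler_pdivrMr //.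
have -> : a * a' * b ^+ (n + n) = (a * b ^+ n) * (a' * b ^+ n) by rewrite exprD; ring.
rewrite (le_trans (psnM hp _ _)) // exprD.
have -> : c * c' * (p b ^+ n * p b ^+ n) = (c * p b ^+ n) * (c' * p b ^+ n) by ring.
by apply: ler_pM; rewrite ?psn_ge0 // ?hN ?hN' // ?leq_maxl ?leq_maxr.
Qed.

Lemma localize1 : q 1 = 1.
Proof.
apply/le_anti/andP; split; first by rewrite -(psn1 hp) localize_le_seminorm.
by apply: le_localize => n; rewrite !mul1r (psnX hp).
Qed.

Lemma localize_power_seminorm : power_seminorm q.
Proof.
split.
- apply/le_anti; rewrite localize_ge0 andbT.
  by rewrite (le_trans (localize_le_seminorm 0)) // (psn0 hp).
- exact: localize1.
- exact: localize_ge0.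
- exact: localizeM_le.
- move=> a [|k]; first by rewrite !expr0 localize1.
  apply/le_anti/andP; split.
    elim: k => [|k IH]; first by rewrite !expr1.
    rewrite exprS [leRHS]exprS (le_trans (localizeM_le _ _)) //.
    by rewrite ler_wpM2l // localize_ge0.
  apply: le_gtP => c /localize_lt[N /(_ (N * k.+1)%N)].
  rewrite leq_pmulr // exprM -exprMn (psnX hp) exprM -ler_pdivrMr; last by rewrite exprn_gt0.
  rewrite -expr_div_n => /(_ isT); apply: le_trans.
  by rewrite le_expn ?localize_ge0 ?localize_le.
- move=> a a'; apply: le_gtP => c; rewrite gt_max => /andP[ac a'c].
  have [N hN] := localize_lt ac; have [N' hN'] := localize_lt a'c.
  rewrite (le_trans (localize_le _ (maxn N N'))) // ler_pdivrMr //.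
  rewrite mulrDl (le_trans (psnD hp _ _)) // ge_max.
  by rewrite hN ?hN' // ?leq_maxl ?leq_maxr.
Qed.

Lemma localizeZ w : (forall a, p (w * a) = p w * p a) ->
  forall a, q (w * a) = p w * q a.
Proof.
move=> hw a; apply/le_anti/andP; split; last first.
  apply: le_localize => n; rewrite -(mulrA w) hw -mulrA ler_wpM2l ?psn_ge0 //.
  by rewrite -ler_pdivlMr // localize_le.
have [pw0|pw0] := eqVneq (p w) 0.
  rewrite pw0 mul0r (le_trans (localize_le_seminorm _)) //.
  by rewrite hw pw0 mul0r.
have pw : 0 < p w by rewrite lt_def pw0 psn_ge0.
rewrite -ler_pdivrMl //; apply: le_gtP => c /localize_lt[N /(_ N (leqnn N)) h].
rewrite ler_pdivrMl // (le_trans (localize_le _ N)) // ler_pdivrMr //.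
by rewrite -(mulrA w) hw -mulrA ler_wpM2l // ltW.
Qed.

Lemma localize_mul a : q (b * a) = p b * q a.
Proof.
apply/le_anti/andP; split; last first.
  apply: le_localize => n; have := localize_le a n.+1.
  rewrite ler_pdivlMr // exprS mulrA [p b * q a]mulrC => /le_trans; apply.
  by rewrite exprS mulrA [a * b]mulrC.
rewrite -ler_pdivrMl //; apply: le_gtP => c /localize_lt[N /(_ N (leqnn N)) h].
rewrite ler_pdivrMl // (le_trans (localize_le _ N)) // ler_pdivrMr //.
by rewrite -(mulrA b) (le_trans (psnM hp _ _)) // -mulrA ler_wpM2l // ltW.
Qed.

End Localize.

Section ZornSeminorm.
Variables (A : comNzRingType) (p : A -> R) (W : set A).
Hypotheses (hp : power_seminorm p) (hW : forall w a, W w -> p (w * a) = p w * p a).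

Let good (q : A -> R) := [/\ power_seminorm q, forall a, q a <= p a &
  forall w a, W w -> q (w * a) = p w * q a].

(* A minimal power-multiplicative seminorm is multiplicative, as localizing it
   at b can only decrease it. *)
Lemma exists_minimal_mnorm :
  exists x, [/\ mnorm x, forall a, x a <= p a & forall w, W w -> x w = p w].
Proof.
pose T := {q | good q}.
pose le (s t : T) := `[< forall a, sval t a <= sval s a >].
have gp : good p by split.
have [s|s t u /asboolP h1 /asboolP h2|[s hs] [t ht]|F Ftot|] := @Zorn T le.
- exact/asboolP.
- by apply/asboolP => a; rewrite (le_trans (h2 a)).
- move=> /asboolP h1 /asboolP h2; apply/eq_exist/funext => a.
  by apply/le_anti; rewrite h1 h2.
- have [[t0 Ft0]|F0] := pselect (F !=set0); last first.
    exists (exist _ p gp) => s Fs.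
    by exfalso; apply: F0; exists s.
  pose E a := [set sval t a | t in F].
  have hlb a : has_lbound (E a).
    by exists 0 => _ [t _ <-]; have [ht _ _] := svalP t; exact: psn_ge0.
  pose q a := inf (E a).
  have qle t a : F t -> q a <= sval t a by move=> Ft; apply: ge_inf => //; exists t.
  have En0 a : E a !=set0 by exists (sval t0 a), t0.
  have leq c a : (forall t, F t -> c <= sval t a) -> c <= q a.
    by move=> h; apply: lb_le_inf => // _ [t Ft <-]; exact: h.
  have qlt a c : q a < c -> exists2 t, F t & sval t a < c.
    by move=> /inf_lt[] // _ [t Ft <-] h; exists t.
  have qlt2 a a' c c' : q a < c -> q a' < c' ->
      exists t, [/\ F t, sval t a < c & sval t a' < c'].
    move=> /qlt[t Ft ta] /qlt[t' Ft' ta'].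
    have [/asboolP h|/asboolP h] := Ftot _ _ Ft Ft'.
      by exists t'; split=> //; rewrite (le_lt_trans (h a)).
    by exists t; split=> //; rewrite (le_lt_trans (h a')).
  have q0 a : 0 <= q a by apply: leq => t _; have [ht _ _] := svalP t; exact: psn_ge0.
  have gq : good q.
    split.
    - split=> //.
      + apply/le_anti; rewrite q0 andbT (le_trans (qle t0 0 Ft0)) //.
        by have [ht _ _] := svalP t0; rewrite (psn0 ht).
      + apply/le_anti/andP; split.
          by rewrite (le_trans (qle t0 1 Ft0)) //; have [ht _ _] := svalP t0; rewrite (psn1 ht).
        by apply: leq => t _; have [ht _ _] := svalP t; rewrite (psn1 ht).
      + move=> a b; apply: le_mul_gtP => // c d ac bd.
        have [t [Ft ta tb]] := qlt2 _ _ _ _ ac bd; have [ht _ _] := svalP t.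
        rewrite (le_trans (qle t _ Ft)) // (le_trans (psnM ht _ _)) //.
        by rewrite ler_pM ?psn_ge0 // ltW.
      + move=> a k; apply/le_anti/andP; split; last first.
          apply: leq => t Ft; have [ht _ _] := svalP t.
          by rewrite (psnX ht) le_expn ?qle.
        elim: k => [|k IH].
          by rewrite !expr0 (le_trans (qle t0 1 Ft0)) //; have [ht _ _] := svalP t0; rewrite (psn1 ht).
        rewrite exprS [leRHS]exprS (@le_trans _ _ (q a * q (a ^+ k))) ?ler_wpM2l //.
        apply: le_mul_gtP => // c d ac bd.
        have [t [Ft ta tb]] := qlt2 _ _ _ _ ac bd; have [ht _ _] := svalP t.
        rewrite (le_trans (qle t _ Ft)) // (le_trans (psnM ht _ _)) //.
        by rewrite ler_pM ?psn_ge0 // ltW.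
      + move=> a b; apply: le_gtP => c; rewrite gt_max => /andP[ac bc].
        have [t [Ft ta tb]] := qlt2 _ _ _ _ ac bc; have [ht _ _] := svalP t.
        rewrite (le_trans (qle t _ Ft)) // (le_trans (psnD ht _ _)) //.
        by rewrite ge_max !ltW.
    - by move=> a; rewrite (le_trans (qle t0 a Ft0)) //; have [_ h _] := svalP t0.
    - move=> w a Ww; apply/le_anti/andP; split; last first.
        apply: leq => t Ft; have [_ _ h] := svalP t.
        by rewrite h // ler_wpM2l ?psn_ge0 // qle.
      apply: le_mul_gtP => [|//|c d pc /qlt[t Ft ta]]; first exact: psn_ge0.
      have [ht _ h] := svalP t.
      by rewrite (le_trans (qle t _ Ft)) // h // ler_pM ?psn_ge0 // ltW.
  by exists (exist _ q gq) => s Fs; apply/asboolP => a /=; exact: qle.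
move=> [q [hq qp qW]] qmin; exists q; split=> //; last first.
  by move=> w Ww; rewrite -[w in LHS]mulr1 qW // (psn1 hq) mulr1.
split; [exact: psn0|exact: psn1|exact: psn_ge0| |exact: psnD].
move=> b a; have [qb0|qb0] := eqVneq (q b) 0.
  apply/le_anti; rewrite psnM //= qb0 mul0r psn_ge0 //.
have qb : 0 < q b by rewrite lt_def qb0 psn_ge0.
have qq : power_seminorm (localize_seminorm q b) by exact: localize_power_seminorm.
have gq : good (localize_seminorm q b).
  split=> // [c|w c Ww]; first by rewrite (le_trans (localize_le_seminorm hq qb c)).
  have qw : q w = p w by rewrite -[w in LHS]mulr1 qW // (psn1 hq) mulr1.
  by rewrite -qw; apply: localizeZ => // d; rewrite qW ?qw.
have /(_ _)/(congr1 sval)/= := qmin (exist _ _ gq); move=> E.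
rewrite -{1}E ?localize_mul // ?E //; apply/asboolP => c /=; exact: localize_le_seminorm.
Qed.

End ZornSeminorm.

(** Localizing at [g] before minimizing makes [g] multiplicative for the seminorm, so that [g] can
    join [W] and its value survives the minimization. *)
Lemma exists_mnorm (A : comNzRingType) (p : A -> R) (W : set A) (g : A) :
  power_seminorm p -> (forall w a, W w -> p (w * a) = p w * p a) ->
  exists x, [/\ mnorm x, forall a, x a <= p a, forall w, W w -> x w = p w & x g = p g].
Proof.
move=> hp hW; have [pg0|pg0] := eqVneq (p g) 0.
  have [x [hx xp xW]] := exists_minimal_mnorm hp hW; exists x; split=> //.
  by apply/le_anti; rewrite xp pg0 mnorm_ge0.
have pg : 0 < p g by rewrite lt_def pg0 psn_ge0.
have hq := localize_power_seminorm hp pg.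
have q1 := psn1 hq.
have qg : localize_seminorm p g g = p g.
  by have := localize_mul hp pg 1; rewrite mulr1 q1 mulr1.
have qW w : W w -> localize_seminorm p g w = p w.
  by move=> Ww; rewrite -[w in LHS]mulr1 localizeZ // ?q1 ?mulr1 // => a; rewrite hW.
have [w a|x [hx xq xW]] := @exists_minimal_mnorm _ _ (g |` W) hq.
  move=> [->|Ww]; first by rewrite localize_mul ?qg.
  by rewrite (qW _ Ww); apply: localizeZ => // d; rewrite hW.
exists x; split=> // [a|w Ww|].
- by rewrite (le_trans (xq a)) // localize_le_seminorm.
- by rewrite xW ?qW //; right.
- by rewrite xW ?qg //; left.
Qed.

End PowerSeminorms.

(** * Complete integral closedness of polynomial rings *)

Section CompletelyIntegrallyClosed.

(* Completely integrally closed: an element a / b of the field of fractions all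
   of whose powers have the common denominator h lies in B. *)
Definition cic (B : idomainType) : Prop := forall a b h : B,
  b != 0 -> h != 0 -> (forall n, exists q, h * a ^+ n = b ^+ n * q) ->
  exists q, a = b * q.

Lemma field_cic (F : fieldType) : cic F.
Proof. by move=> a b h b0 _ _; exists (b^-1 * a); rewrite mulrA divff ?mul1r. Qed.

Variable B : idomainType.
Implicit Types a b h q : {poly B}.

Import Pdiv.Idomain.

(** Divisibility is here over the field of fractions. For b' the quotient of [b] by its gcd with
    [a], all powers of b' divide [h]; hence b' is constant and [b] divides [a]. *)
Lemma dvdp_almost_integral a b h : b != 0 -> h != 0 ->
  (forall n, b ^+ n %| h * a ^+ n) -> b %| a.
Proof.
move=> b0 h0 hn; pose g := gcdp a b.
have g0 : g != 0 by rewrite gcdp_eq0 negb_and b0 orbT.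
have eqp_div p : g %| p -> p %/ g * g %= p.
  by rewrite dvdp_eq => /eqP<-; rewrite eqp_scale // expf_neq0 // lead_coef_eq0.
have ea := eqp_div a (dvdp_gcdl a b); have eb := eqp_div b (dvdp_gcdr a b).
have cop : coprimep (a %/ g) (b %/ g) by rewrite coprimep_div_gcd ?b0 ?orbT.
have b'h n : (b %/ g) ^+ n %| h.
  rewrite -(Gauss_dvdpl _ (q := (a %/ g) ^+ n)); last first.
    by rewrite coprimep_expl // coprimep_expr // coprimep_sym.
  rewrite -(dvdp_mul2r (r := g ^+ n)) ?expf_neq0 // -mulrA -!exprMn.
  rewrite (eqp_dvdl _ (eqp_exp n eb)).
  by rewrite (eqp_dvdr _ (eqp_mull h (eqp_exp n ea))).
have b'0 : b %/ g != 0.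
  by apply: contraTneq eb => ->; rewrite mul0r eqp_sym eqp0.
have b'1 : size (b %/ g) = 1%N.
  have := dvdp_leq h0 (b'h (size h)).
  have := size_exp (b %/ g) (size h).
  have b'n0 : (b %/ g) ^+ size h != 0 by rewrite expf_neq0.
  move: b'0; rewrite -size_poly_gt0; case: (size (b %/ g)) => [//|[//|k]] _ /=.
  move: b'n0; rewrite -size_poly_gt0.
  by case: (size ((b %/ g) ^+ size h)) => //= l _ ->; rewrite ltnNge mulSn leq_addr.
have eg : g %= b.
  rewrite -(eqp_rtrans eb) -{1}[g]mul1r; apply: eqp_mulr.
  by rewrite eqp_sym -size_poly_eq1 b'1.
by rewrite -(eqp_dvdl _ eg) dvdp_gcdl.
Qed.

(** Leading coefficients satisfy the same divisibilities in [B], so the leading term of [a] has the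
    form c t. By the binomial formula, subtracting it preserves the hypothesis. *)
Lemma poly_cic_scalar (c : B) a h : cic B -> c != 0 -> h != 0 ->
  (forall n, exists q, h * a ^+ n = (c ^+ n)%:P * q) -> exists q, a = c%:P * q.
Proof.
move=> cicB c0 h0; have [k] := ubnP (size a).
elim: k a => // k IH a; rewrite ltnS => ak hn.
have [->|a0] := eqVneq a 0; first by exists 0; rewrite mulr0.
have lh0 : lead_coef h != 0 by rewrite lead_coef_eq0.
have [n|u lu] := cicB (lead_coef a) c (lead_coef h) c0 lh0.
  have [q E] := hn n; exists (lead_coef q).
  by rewrite -lead_coef_exp -lead_coefM E lead_coefM lead_coefC.
pose t := u%:P * 'X^((size a).-1).
have ct : c%:P * t = (lead_coef a)%:P * 'X^((size a).-1).
  by rewrite /t mulrA -polyCM -lu.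
have st : (size (a - c%:P * t)%R < k)%N.
  have s : (size (a - c%:P * t)%R <= (size a).-1)%N.
    apply/leq_sizeP => j; rewrite leq_eqVlt => /predU1P[<-|lj].
      by rewrite ct coefB coefCM coefXn eqxx mulr1 subrr.
    rewrite ct coefB coefCM coefXn gtn_eqF // mulr0 subr0 nth_default //.
    by move: lj; case: (size a).
  by apply: leq_trans ak; rewrite (leq_ltn_trans s) // prednK // size_poly_gt0.
have [n|q E] := IH _ st.
  pose q m := sval (cid (hn m)).
  have hq m : h * a ^+ m = (c ^+ m)%:P * q m by rewrite /q; case: cid.
  exists (\sum_(i < n.+1) (q (n - i)%N * (- t) ^+ i) *+ 'C(n, i)).
  rewrite -mulrN exprDn !mulr_sumr; apply: eq_bigr => i _.
  rewrite (mulrnAr h) (mulrnAr (c ^+ n)%:P); congr (_ *+ _).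
  have E : c ^+ n = c ^+ (n - i) * c ^+ i by rewrite -exprD subnK // -ltnS.
  transitivity ((c ^+ (n - i))%:P * q (n - i)%N * ((c%:P * - t) ^+ i)).
    by rewrite -hq; ring.
  by rewrite exprMn E polyCM -[c%:P ^+ i]polyC_exp; ring.
by exists (q + t); rewrite mulrDr -E subrK.
Qed.

(** Over the field of fractions [b] divides [a]; the scalar case then removes the denominator of the
    quotient. *)
Lemma poly_cic : cic B -> cic {poly B}.
Proof.
move=> cicB a b h b0 h0 hn.
have /dvdpP[[c q0] /= c0 E] : b %| a.
  apply: (dvdp_almost_integral b0 h0) => n; have [q ->] := hn n.
  by rewrite dvdp_mulr.
have [n|q Eq] := poly_cic_scalar (a := q0) cicB c0 h0.
  have [q Eq] := hn n; exists q.
  apply: (mulfI (expf_neq0 n b0)).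
  rewrite mulrCA -exprMn [b * _]mulrC -E -mul_polyC exprMn mulrCA Eq.
  by rewrite -polyC_exp; ring.
exists q; apply: (mulfI (_ : c%:P != 0)); first by rewrite polyC_eq0.
by rewrite mul_polyC E Eq; ring.
Qed.

End CompletelyIntegrallyClosed.

(** * Gauss norms on polynomial rings *)

Section GaussNorm.
Variables (R : realType) (B : comNzRingType) (D : B -> R) (rho : R).
Hypotheses (hD : mnorm D) (rho0 : 0 < rho).
Implicit Types f g : {poly B}.

Definition gauss f : R := \big[Num.max/0]_(i < size f) (D f`_i * rho ^+ i).

Let rX i : 0 < rho ^+ i. Proof. exact: exprn_gt0. Qed.

Let term_ge0 f i : 0 <= D f`_i * rho ^+ i.
Proof. by apply: mulr_ge0; [exact: mnorm_ge0|exact: ltW]. Qed.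

Lemma gauss_le f i : D f`_i * rho ^+ i <= gauss f.
Proof.
have [si|si] := ltnP i (size f); first exact: (le_bigmax _ _ (Ordinal si)).
rewrite nth_default // (mnorm0 hD) mul0r.
by apply: (big_ind (fun x => 0 <= x)) => // x y x0 y0; rewrite le_max x0.
Qed.

Lemma gauss_ge0 f : 0 <= gauss f.
Proof.
by rewrite (le_trans _ (gauss_le f 0)) // expr0 mulr1 mnorm_ge0.
Qed.

Lemma gauss_leP f c : 0 <= c -> (forall i, D f`_i * rho ^+ i <= c) -> gauss f <= c.
Proof. by move=> c0 h; apply/bigmax_leP; split. Qed.

Lemma gauss_attained f : exists i, gauss f = D f`_i * rho ^+ i.
Proof.
have [s0|s0] := posnP (size f).
  by exists 0%N; rewrite /gauss s0 big_ord0 nth_default ?s0 // (mnorm0 hD) mul0r.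
have [//|i _|i _ E] := @eq_bigmax _ R _ 0 (Ordinal s0) predT (fun i => D f`_i * rho ^+ i).
  exact: term_ge0.
by exists i; rewrite -E.
Qed.

Lemma gaussC c : gauss c%:P = D c.
Proof.
apply/le_anti/andP; split; last by have := gauss_le c%:P 0; rewrite coefC expr0 mulr1.
apply: gauss_leP => [|i]; first exact: mnorm_ge0.
rewrite coefC; case: eqP => [->|_]; first by rewrite expr0 mulr1.
by rewrite (mnorm0 hD) mul0r mnorm_ge0.
Qed.

Lemma gaussX : gauss 'X = rho.
Proof.
apply/le_anti/andP; split; last by have := gauss_le 'X 1; rewrite coefX (mnorm1 hD) mul1r.
apply: gauss_leP => [|i]; first exact: ltW.
rewrite coefX; case: eqP => [->|_]; first by rewrite expr1 (mnorm1 hD) mul1r.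
by rewrite (mnorm0 hD) mul0r ltW.
Qed.

Lemma gaussM f g : gauss (f * g) = gauss f * gauss g.
Proof.
have nn (i j : nat) : D f`_i * rho ^+ i * (D g`_j * rho ^+ j) = D (f`_i * g`_j) * rho ^+ (i + j).
  by rewrite (mnormM hD) exprD mulrACA.
apply/le_anti/andP; split.
  apply: gauss_leP => [|k]; first by rewrite mulr_ge0 ?gauss_ge0.
  rewrite coefM -ler_pdivlMr //; apply: mnorm_sum_le => // [|i _].
    by rewrite divr_ge0 ?mulr_ge0 ?gauss_ge0 // ltW.
  have ik : (i <= k)%N by rewrite -ltnS.
  rewrite ler_pdivlMr // -[X in rho ^+ X](subnKC ik) -nn.
  by apply: ler_pM; rewrite ?gauss_le // term_ge0.
have [->|f0] := eqVneq (gauss f) 0; first by rewrite mul0r gauss_ge0.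
have [->|g0] := eqVneq (gauss g) 0; first by rewrite mulr0 gauss_ge0.
have {}f0 : 0 < gauss f by rewrite lt_def f0 gauss_ge0.
have {}g0 : 0 < gauss g by rewrite lt_def g0 gauss_ge0.
have exm (p : {poly B}) : exists i, gauss p <= D p`_i * rho ^+ i.
  by have [i ->] := gauss_attained p; exists i.
(* The smallest indices at which the two maxima are reached: in degree i0 + j0 every other product
   of terms is strictly smaller. *)
have [i0 hi0 mi0] := ex_minnP (exm f); have [j0 hj0 mj0] := ex_minnP (exm g).
rewrite (le_trans (ler_pM (ltW f0) (ltW g0) hi0 hj0)) // nn.
rewrite (le_trans _ (gauss_le _ (i0 + j0))) // ler_pM2r // coefM.
have lt_i0 : (i0 < (i0 + j0).+1)%N by rewrite ltnS leq_addr.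
rewrite (bigD1 (Ordinal lt_i0)) //= addKn (mnorm_addl hD) //.
apply: (mnorm_sum_lt hD) => [|i _ ii0]; rewrite -(ltr_pM2r (rX (i0 + j0)%N)).
  by rewrite mul0r -nn mulr_gt0 // ?(lt_le_trans _ hi0) ?(lt_le_trans _ hj0).
have ik : (i <= i0 + j0)%N by rewrite -ltnS.
rewrite -[X in _ * rho ^+ X < _](subnKC ik) -!nn.
rewrite (lt_le_trans _ (ler_pM (ltW f0) (ltW g0) hi0 hj0)) //.
have [lt|gt|e] := ltngtP (i : nat) i0; last by move: ii0; rewrite -val_eqE /= e eqxx.
- apply: (@le_lt_trans _ _ (D f`_i * rho ^+ i * gauss g)).
    by rewrite ler_wpM2l ?gauss_le ?term_ge0.
  by rewrite ltr_pM2r // ltNge; apply: contraL lt => /mi0; rewrite -leqNgt.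
- apply: (@le_lt_trans _ _ (gauss f * (D g`_(i0 + j0 - i) * rho ^+ (i0 + j0 - i)))).
    by rewrite ler_wpM2r ?gauss_le ?term_ge0.
  rewrite ltr_pM2l // ltNge; apply/negP => /mj0.
  by rewrite leqNgt ltn_subLR ?ltn_add2r ?gt // -ltnS.
Qed.

Lemma gauss_mnorm : mnorm gauss.
Proof.
split=> [||||f g].
- by rewrite -polyC0 gaussC (mnorm0 hD).
- by rewrite -polyC1 gaussC (mnorm1 hD).
- exact: gauss_ge0.
- exact: gaussM.
- apply: gauss_leP => [|i]; first by rewrite le_max gauss_ge0.
  rewrite coefD (@le_trans _ _ (Num.max (D f`_i) (D g`_i) * rho ^+ i)) //.
    by rewrite ler_pM2r ?mnormD.
  by rewrite maxr_pMl ?(ltW (rX i)) // ge_max !le_max !gauss_le orbT.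
Qed.

End GaussNorm.

(** * Spectral seminorms *)

Section SpectralSeminorm.
Variable R : realType.

Lemma geometric_le (M a b : R) : 0 <= a -> 0 <= b ->
  (forall n, a ^+ n <= M * b ^+ n) -> a <= b.
Proof.
move=> a0 b0 h; rewrite leNgt; apply/negP => ba.
have M1 : 1 <= M by have := h 0%N; rewrite !expr0 mulr1.
have ap : 0 < a by rewrite (le_lt_trans b0).
have r0 : 0 <= b / a by rewrite divr_ge0.
have r1 : b / a < 1 by rewrite ltr_pdivrMr // mul1r.
have M0 : 0 < M^-1 by rewrite invr_gt0 (lt_le_trans ltr01).
have cv : (fun n => (b / a) ^+ n) @ \oo --> (0 : R).
  by apply: cvg_expr; rewrite ger0_norm.
have /cvgrPdist_lt/(_ _ M0)[N _ /(_ N (leqnn N))] /= := cv.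
rewrite sub0r normrN ger0_norm ?exprn_ge0 // expr_div_n ltr_pdivrMr ?exprn_gt0 //.
rewrite ltr_pdivlMl ?(lt_le_trans ltr01) //.
by rewrite ltNge h.
Qed.

Lemma root_exists (c : R) k : 0 < c -> exists2 b : R, 0 < b & b ^+ k.+1 = c.
Proof.
move=> c0; exists (expR (ln c / k.+1%:R)); first exact: expR_gt0.
by rewrite -expRM_natr divfK ?pnatr_eq0 // lnK.
Qed.

Variables (A : comNzRingType) (N : A -> R) (C : R).
Hypotheses (N0 : N 0 = 0) (N1 : 0 < N 1) (N_ge0 : forall a, 0 <= N a).
Hypothesis ND : forall a b, N (a + b) <= Num.max (N a) (N b).
Hypotheses (C0 : 0 < C) (NM : forall a b, N (a * b) <= C * N a * N b).

(** Its infimum is the upper limit of the n-th roots of N(a^n), expressed without roots. *)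
Definition growth (a : A) : set R :=
  [set r | 0 < r /\ exists M, forall n, N (a ^+ n) <= M * r ^+ n].

Definition spectral (a : A) : R := inf (growth a).

Lemma growth_n0 a : growth a !=set0.
Proof.
exists (C * N a + 1); split; first by rewrite ltr_wpDl // mulr_ge0 // ltW.
exists (N 1); elim=> [|n IH]; first by rewrite !expr0 mulr1.
rewrite exprS (le_trans (NM _ _)) // exprS mulrCA ler_pM //.
  by rewrite mulr_ge0 // ltW.
by rewrite lerDl.
Qed.

Lemma growth_lb a : has_lbound (growth a).
Proof. by exists 0 => r [r0 _]; exact: ltW. Qed.

Lemma spectral_le a r : 0 < r -> (exists M, forall n, N (a ^+ n) <= M * r ^+ n) ->
  spectral a <= r.
Proof. by move=> r0 h; apply: ge_inf; [exact: growth_lb|split]. Qed.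

Lemma le_spectral a c : (forall r M, 0 < r -> (forall n, N (a ^+ n) <= M * r ^+ n) -> c <= r) ->
  c <= spectral a.
Proof.
by move=> h; apply: lb_le_inf; [exact: growth_n0|move=> r [r0 [M hM]]; exact: (h r M)].
Qed.

Lemma spectral_ge0 a : 0 <= spectral a.
Proof. by apply: le_spectral => r M r0 _; exact: ltW. Qed.

Lemma spectral_lt a c : spectral a < c ->
  exists2 M, 0 < M & forall n, N (a ^+ n) <= M * c ^+ n.
Proof.
move=> /inf_lt[]; first exact: growth_n0.
move=> r [r0 [M hM]] rc.
have M0 : 0 < M.
  by have := hM 0%N; rewrite !expr0 mulr1; exact: lt_le_trans.
exists M => // n; rewrite (le_trans (hM n)) // ler_pM2l //.
by apply: le_expn; exact: ltW.
Qed.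

Lemma natmul_N a n : N (a *+ n) <= N a.
Proof.
elim: n => [|n IH]; first by rewrite mulr0n N0.
by rewrite mulrS (le_trans (ND _ _)) // ge_max lexx.
Qed.

Lemma sum_N (J : Type) (r : seq J) (F : J -> A) c :
  0 <= c -> (forall i, N (F i) <= c) -> N (\sum_(i <- r) F i) <= c.
Proof.
move=> c0 h; elim/big_ind: _ => [|a b ha hb|//]; first by rewrite N0.
by rewrite (le_trans (ND _ _)) // ge_max ha.
Qed.

Lemma spectralM a b : spectral (a * b) <= spectral a * spectral b.
Proof.
apply: le_mul_gtP; rewrite ?spectral_ge0 // => c d ac bd.
have c0 := le_lt_trans (spectral_ge0 a) ac; have d0 := le_lt_trans (spectral_ge0 b) bd.
have [M M0 hM] := spectral_lt ac; have [M' M'0 hM'] := spectral_lt bd.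
apply: spectral_le; first exact: mulr_gt0.
exists (C * M * M') => n; rewrite exprMn (le_trans (NM _ _)) // exprMn.
have -> : C * M * M' * (c ^+ n * d ^+ n) = C * (M * c ^+ n) * (M' * d ^+ n) by ring.
by rewrite ler_pM ?ler_pM2l ?hM ?hM' // mulr_ge0 // ltW.
Qed.

Lemma spectral1 : spectral 1 = 1.
Proof.
apply/le_anti/andP; split.
  by apply: spectral_le => //; exists (N 1) => n; rewrite !expr1n mulr1.
apply: le_spectral => r M r0 h; apply: (@geometric_le (M / N 1)) => // [|n].
  exact: ltW.
by rewrite expr1n mulrAC ler_pdivlMr // mul1r; have := h n; rewrite expr1n.
Qed.

Lemma spectral_power_seminorm : power_seminorm spectral.
Proof.
split.
- apply/le_anti; rewrite spectral_ge0 andbT; apply: le_gtP => c c0.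
  apply: spectral_le => //; exists (N 1) => -[|n]; first by rewrite !expr0 mulr1.
  by rewrite expr0n /= N0 mulr_ge0 // ?exprn_ge0 // ltW.
- exact: spectral1.
- exact: spectral_ge0.
- exact: spectralM.
- move=> a [|k]; first by rewrite !expr0 spectral1.
  apply/le_anti/andP; split.
    elim: k => [|k IH]; first by rewrite !expr1.
    by rewrite exprS [leRHS]exprS (le_trans (spectralM _ _)) // ler_wpM2l // spectral_ge0.
  apply: le_gtP => c ac; have c0 := le_lt_trans (spectral_ge0 _) ac.
  have [M M0 hM] := spectral_lt ac; have [b b0 bk] := root_exists k c0.
  rewrite -bk le_expn ?spectral_ge0 //; apply: spectral_le => //.
  (* Bounds the leftover powers a^j, j <= k, in the division of the exponent n by k + 1. *)
  pose m := \big[Num.max/0]_(j < k.+1) (N (a ^+ j) / b ^+ j).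
  have m0 : 0 <= m.
    apply: (big_ind (fun x => 0 <= x)) => // [x y x0 y0|j _]; first by rewrite le_max x0.
    by rewrite divr_ge0 // exprn_ge0 // ltW.
  exists (C * M * m) => n; rewrite (divn_eq n k.+1) exprD (le_trans (NM _ _)) //.
  have -> : C * M * m * b ^+ (n %/ k.+1 * k.+1 + n %% k.+1) =
      C * (M * c ^+ (n %/ k.+1)) * (m * b ^+ (n %% k.+1)).
    by rewrite exprD mulnC exprM bk; ring.
  apply: ler_pM => //; first by rewrite mulr_ge0 // ltW.
    by rewrite ler_pM2l // mulnC exprM.
  rewrite -ler_pdivrMr ?exprn_gt0 //.
  exact: (le_bigmax _ _ (Ordinal (ltn_pmod n (ltn0Sn k)))).
- move=> a b; apply: le_gtP => c; rewrite gt_max => /andP[ac bc].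
  have c0 := le_lt_trans (spectral_ge0 a) ac.
  have [M M0 hM] := spectral_lt ac; have [M' M'0 hM'] := spectral_lt bc.
  apply: spectral_le => //; exists (C * M * M') => n; rewrite exprDn.
  apply: sum_N => [|i]; first by rewrite !mulr_ge0 // ?exprn_ge0 // ltW.
  rewrite (le_trans (natmul_N _ _)) // (le_trans (NM _ _)) //.
  have -> : C * M * M' * c ^+ n = C * (M * c ^+ (n - i)) * (M' * c ^+ i).
    have -> : c ^+ n = c ^+ (n - i) * c ^+ i by rewrite -exprD subnK // -ltnS.
    by ring.
  by rewrite ler_pM ?mulr_ge0 ?ler_pM2l ?N_ge0 ?hM ?hM' // ltW.
Qed.

Lemma spectralZ w d : 0 <= d -> (forall a, N (w * a) = d * N a) ->
  forall a, spectral (w * a) = d * spectral a.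
Proof.
move=> d0 hw a; have NwX n b : N (w ^+ n * b) = d ^+ n * N b.
  elim: n => [|n IH]; first by rewrite !expr0 !mul1r.
  by rewrite !exprS -!mulrA hw IH.
have [dz|dnz] := eqVneq d 0.
  rewrite dz mul0r; apply/le_anti; rewrite spectral_ge0 andbT; apply: le_gtP => c c0.
  apply: spectral_le => //; exists (N 1) => -[|n]; first by rewrite !expr0 mulr1.
  by rewrite exprMn NwX dz expr0n /= mul0r mulr_ge0 // ?exprn_ge0 // ltW.
have dp : 0 < d by rewrite lt_def dnz.
apply/le_anti/andP; split.
  rewrite -ler_pdivrMl //; apply: le_spectral => r M r0 h.
  rewrite ler_pdivrMl //; apply: spectral_le; first exact: mulr_gt0.
  by exists M => n; rewrite exprMn NwX exprMn mulrCA ler_wpM2l ?exprn_ge0.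
apply: le_spectral => r M r0 h; rewrite -ler_pdivlMl // mulrC.
apply: spectral_le; first exact: divr_gt0.
exists M => n; rewrite expr_div_n mulrA ler_pdivlMr ?exprn_gt0 // mulrC -NwX -exprMn.
exact: h.
Qed.

End SpectralSeminorm.

(** * Extension of seminorms along finite extensions *)

Section Domination.
Variables (R : realType) (B : idomainType) (A : comNzRingType).
Variables (iota : {rmorphism B -> A}) (P : set A).
Hypotheses (pP : prime_ideal P) (injP : forall b, P (iota b) -> b = 0).
Hypothesis finP : finite_over setT (range iota) P.

Let iP : ideal P. Proof. by case: pP. Qed.
Let P0 : P 0. Proof. by case: iP. Qed.
Let PD a b : P a -> P b -> P (a + b). Proof. by case: iP => _ h _; exact: h. Qed.
Let PM a b : P b -> P (a * b). Proof. by case: iP => _ _; apply. Qed.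
Let PN a : P a -> P (- a). Proof. exact: idealN. Qed.

Let lin (c : nat -> B) (e : seq A) := \sum_(i < size e) iota (c i) * e`_i.
Let indep (e : seq A) := forall c, P (lin c e) -> forall i, (i < size e)%N -> c i = 0.

Let lin_cons c a e : lin c (a :: e) = iota (c 0%N) * a + lin (fun i => c i.+1) e.
Proof. by rewrite /lin /= big_ord_recl. Qed.

Let linZ b c e : lin (fun i => b * c i) e = iota b * lin c e.
Proof. by rewrite /lin mulr_sumr; apply: eq_bigr => i _; rewrite rmorphM mulrA. Qed.

Let sub_basis (s : seq A) : exists (e : seq A) (h : B), [/\ h != 0, indep e &
  forall a, a \in s -> exists c, P (iota h * a - lin c e)].
Proof.
elim: s => [|a s [e [h [h0 ie hs]]]].
  by exists [::], 1; split; rewrite ?oner_eq0.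
have [[h1 [h10 [c1 hc1]]]|nh] :=
    pselect (exists h1, h1 != 0 /\ exists c, P (iota h1 * a - lin c e)).
  exists e, (h * h1); split; rewrite ?mulf_neq0 // => b; rewrite inE => /predU1P[->|bs].
    exists (fun i => h * c1 i).
    by rewrite linZ rmorphM -mulrA -mulrBr; exact: PM.
  have [c hc] := hs b bs; exists (fun i => h1 * c i).
  by rewrite linZ rmorphM [iota h * _]mulrC -mulrA -mulrBr; exact: PM.
exists (a :: e), h; split=> //.
  move=> c; rewrite lin_cons => hc.
  have c0 : c 0%N = 0.
    apply: contrapT => /eqP c0; apply: nh; exists (c 0%N); split=> //.
    exists (fun i => -1 * c i.+1); rewrite linZ rmorphN rmorph1 mulN1r opprK //.
  move: hc; rewrite c0 rmorph0 mul0r add0r => /ie hc [|i] //=.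
  by rewrite ltnS => /hc.
move=> b; rewrite inE => /predU1P[->|bs].
  exists (fun i => if i is 0%N then h else 0); rewrite lin_cons /= /lin.
  by rewrite big1 ?addr0 ?subrr // => i _; rewrite rmorph0 mul0r.
have [c hc] := hs b bs; exists (fun i => if i is i'.+1 then c i' else 0).
by rewrite lin_cons /= rmorph0 mul0r add0r.
Qed.

(** A maximal independent family over [B], modulo [P], among finitely many generators; [h] is a
    common denominator that brings the coordinates of all h a into [B]. The family is nonempty
    because [P] meets [B] in 0. *)
Lemma fraction_basis : exists (m : nat) (e : 'I_m.+1 -> A) (h : B), [/\ h != 0,
  forall c : 'I_m.+1 -> B, P (\sum_i iota (c i) * e i) -> forall i, c i = 0 &
  forall a, exists c : 'I_m.+1 -> B, P (iota h * a - \sum_i iota (c i) * e i)].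
Proof.
have [k [s hs]] := finP; have [e [h [h0 ie hse]]] := sub_basis (codom s).
have span a : exists c, P (iota h * a - lin c e).
  have [b hb Pb] := hs a Logic.I.
  pose b' i := sval (cid2 (hb i)).
  have hb' i : iota (b' i) = b i by rewrite /b'; case: cid2.
  have hc i : exists c, P (iota h * s i - lin c e) by apply: hse; exact: codom_f.
  pose c i := sval (cid (hc i)).
  have Pc i : P (iota h * s i - lin (c i) e) by rewrite /c; case: cid.
  exists (fun j => \sum_i b' i * c i j).
  have -> : lin (fun j => \sum_i b' i * c i j) e = \sum_i b i * lin (c i) e.
    rewrite /lin; under eq_bigr do rewrite rmorph_sum mulr_suml.
    rewrite exchange_big; apply: eq_bigr => i _; rewrite mulr_sumr.
    by apply: eq_bigr => j _; rewrite rmorphM hb' mulrA.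
  have -> : iota h * a - \sum_i b i * lin (c i) e =
     iota h * (a - \sum_i b i * s i) + \sum_i b i * (iota h * s i - lin (c i) e).
    rewrite mulrBr mulr_sumr -addrA; congr (_ + _).
    under [X in _ = _ + X]eq_bigr do rewrite mulrBr mulrCA.
    by rewrite sumrB addrA addNr add0r.
  by apply: PD; [exact: PM|apply: ideal_sum => // i _; exact: PM].
case: e ie span {hse} => [|e0 e] ie span.
  have [c] := span 1; rewrite /lin big_ord0 subr0 mulr1 => /injP h00.
  by rewrite h00 eqxx in h0.
exists (size e), (fun i => (e0 :: e)`_i), h; split=> // [c hc i|a].
  have hc' : P (lin (fun j => c (inord j)) (e0 :: e)).
    by congr (P _): hc; apply: eq_bigr => j _; rewrite inord_val.
  by have := ie _ hc' _ (ltn_ord i); rewrite inord_val.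
by have [c hc] := span a; exists (fun i => c i).
Qed.

Variables (m : nat) (e : 'I_m.+1 -> A) (h : B).
Hypothesis h0 : h != 0.
Hypothesis ie : forall c : 'I_m.+1 -> B, P (\sum_i iota (c i) * e i) -> forall i, c i = 0.
Hypothesis he : forall a, exists c : 'I_m.+1 -> B, P (iota h * a - \sum_i iota (c i) * e i).

Definition coord (a : A) : 'I_m.+1 -> B := sval (cid (he a)).

Lemma coordP a : P (iota h * a - \sum_i iota (coord a i) * e i).
Proof. by rewrite /coord; case: cid. Qed.

Lemma basis_uniq (c c' : 'I_m.+1 -> B) :
  P (\sum_i iota (c i) * e i - \sum_i iota (c' i) * e i) -> forall i, c i = c' i.
Proof.
rewrite -sumrB => hc i; apply/eqP; rewrite -subr_eq0; apply/eqP; move: i.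
apply: ie; congr (P _): hc; apply: eq_bigr => i _.
by rewrite rmorphB mulrBl.
Qed.

Lemma coord_uniq a c : P (iota h * a - \sum_i iota (c i) * e i) -> forall i, coord a i = c i.
Proof.
move=> hc; apply: basis_uniq; have := idealB iP hc (coordP a).
congr (P _); ring.
Qed.

Lemma coordD a b i : coord (a + b) i = coord a i + coord b i.
Proof.
move: i; apply: coord_uniq; have := PD (coordP a) (coordP b).
congr (P _); under [in RHS]eq_bigr do rewrite rmorphD mulrDl.
by rewrite big_split /=; ring.
Qed.

Lemma coordZ b a i : coord (iota b * a) i = b * coord a i.
Proof.
move: i; apply: coord_uniq; have := PM (iota b) (coordP a).
rewrite mulrBr mulrCA mulr_sumr; congr (P (_ - _)); apply: eq_bigr => i _.
by rewrite rmorphM mulrA.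
Qed.

Lemma coord_ideal a i : P a -> coord a i = 0.
Proof.
move=> Pa; move: i; apply: coord_uniq; rewrite big1 ?subr0; first exact: PM.
by move=> i _; rewrite rmorph0 mul0r.
Qed.

Lemma coord_congr a b i : P (a - b) -> coord a i = coord b i.
Proof. by move=> Pab; rewrite -[a](subrK b) coordD (coord_ideal _ Pab) add0r. Qed.

Lemma coord_sum (J : Type) (r : seq J) (F : J -> A) i :
  coord (\sum_(j <- r) F j) i = \sum_(j <- r) coord (F j) i.
Proof.
by apply: (big_morph (coord^~ i)) => [a b|]; [exact: coordD|exact: coord_ideal].
Qed.

Variable D : B -> R.
Hypotheses (hD : mnorm D) (D_eq0 : forall b, D b = 0 -> b = 0).

(** The maximum norm in the basis [e], up to the factor D h, as [coord] gives the coordinates of h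
    a. It is multiplicative for scalars in [B]. It is submultiplicative up to the constant [C]
    below, which collects the products of basis vectors and the two factors [h] spent on multiplying
    coordinates. *)
Definition coord_norm (a : A) : R := \big[Num.max/0]_i D (coord a i).
Local Notation N := coord_norm.

Let leN a i : D (coord a i) <= N a. Proof. exact: (le_bigmax _ _ i). Qed.

Let N_ge0 a : 0 <= N a. Proof. exact: le_trans (mnorm_ge0 hD _) (leN a ord0). Qed.

Let N_leP a c : 0 <= c -> (forall i, D (coord a i) <= c) -> N a <= c.
Proof. by move=> c0 hc; apply/bigmax_leP; split. Qed.

Let N_eq0 a : N a = 0 -> P a.
Proof.
move=> Na; have hc i : coord a i = 0.
  by apply: D_eq0; apply/le_anti; rewrite mnorm_ge0 // andbT -Na leN.
have := coordP a; rewrite big1 ?subr0 => [|i _]; last by rewrite hc rmorph0 mul0r.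
by case: pP => _ _ PMP /PMP[/injP h00|//]; move: h0; rewrite h00 eqxx.
Qed.

Let N_ideal a : P a -> N a = 0.
Proof.
move=> Pa; apply/le_anti; rewrite N_ge0 andbT; apply: N_leP => // i.
by rewrite coord_ideal // (mnorm0 hD).
Qed.

Let ND a b : N (a + b) <= Num.max (N a) (N b).
Proof.
apply: N_leP => [|i]; first by rewrite le_max N_ge0.
by rewrite coordD (le_trans (mnormD hD _ _)) // ge_max !le_max !leN orbT.
Qed.

Let NZ b a : N (iota b * a) = D b * N a.
Proof.
apply/le_anti/andP; split.
  apply: N_leP => [|i]; first by rewrite mulr_ge0 // mnorm_ge0.
  by rewrite coordZ (mnormM hD) ler_wpM2l ?leN // mnorm_ge0.
have [->|Db] := eqVneq (D b) 0; first by rewrite mul0r.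
have Db0 : 0 < D b by rewrite lt_def Db mnorm_ge0.
rewrite -ler_pdivlMl //; apply: N_leP => [|i]; first by rewrite mulr_ge0 // invr_ge0 ltW.
by rewrite ler_pdivlMl // -(mnormM hD) -coordZ.
Qed.

Let Dh : 0 < D h.
Proof.
rewrite lt_def mnorm_ge0 // andbT; apply/eqP => /D_eq0 h00.
by move: h0; rewrite h00 eqxx.
Qed.

Let N1 : 0 < N 1.
Proof.
by rewrite lt_def N_ge0 andbT; apply/eqP => /N_eq0; case: pP.
Qed.

Let Gam := \big[Num.max/1]_i \big[Num.max/1]_j N (e i * e j).

Let Gam1 : 1 <= Gam.
Proof. exact: bigmax_ge_id. Qed.

Let leGam i j : N (e i * e j) <= Gam.
Proof.
apply: (le_trans (le_bigmax 1 (fun j => N (e i * e j)) j)).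
exact: (le_bigmax 1 (fun i => \big[Num.max/1]_j N (e i * e j)) i).
Qed.

Let C := Gam / D h ^+ 2.

Let C0 : 0 < C. Proof. by rewrite divr_gt0 ?exprn_gt0 // (lt_le_trans ltr01 Gam1). Qed.

Let NM a b : N (a * b) <= C * N a * N b.
Proof.
suff E : D h ^+ 2 * N (a * b) <= Gam * (N a * N b).
  rewrite -(ler_pM2l (exprn_gt0 2 Dh)) (le_trans E) // le_eqVlt; apply/orP; left.
  by apply/eqP; rewrite /C; field; exact: (lt0r_neq0 Dh).
have -> : D h ^+ 2 * N (a * b) = N ((iota h * a) * (iota h * b)).
  by rewrite mulrACA -rmorphM NZ (mnormM hD).
pose a' := \sum_i iota (coord a i) * e i; pose b' := \sum_i iota (coord b i) * e i.
have Pab : P (iota h * a * (iota h * b) - a' * b').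
  by apply: ideal_equivM => //; exact: coordP.
apply: N_leP => [|k]; first by rewrite !mulr_ge0 // (le_trans ler01 Gam1).
rewrite (coord_congr _ Pab) /a' mulr_suml coord_sum; apply: mnorm_sum_le => // [|i _].
  by rewrite !mulr_ge0 // (le_trans ler01 Gam1).
rewrite /b' mulr_sumr coord_sum; apply: mnorm_sum_le => // [|j _].
  by rewrite !mulr_ge0 // (le_trans ler01 Gam1).
rewrite mulrACA -rmorphM coordZ !(mnormM hD) mulrC; apply: ler_pM.
- exact: mnorm_ge0.
- by rewrite mulr_ge0 // mnorm_ge0.
- exact: le_trans (leN _ _) (leGam i j).
- by apply: ler_pM; rewrite ?mnorm_ge0.
Qed.

Hypothesis cicX : cic {poly B}.

Section CharPoly.
Variable t : A.

Let M k : 'M[B]_m.+1 := \matrix_(i, j) coord (t ^+ k * e i) j.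

Let ME k i : P (iota h * t ^+ k * e i - \sum_j iota (M k i j) * e j).
Proof. by under eq_bigr do rewrite mxE; rewrite -mulrA; exact: coordP. Qed.

(** For T the matrix of multiplication by [t] over the field of fractions, [M k] is h T^k: all
    powers of T have the common denominator [h]. *)
Let Mpow k : h *: M 1 ^+ k = h ^+ k *: M k.
Proof.
have E k' i : P (iota (h ^+ k') * t ^+ k' * e i - \sum_j iota ((M 1 ^+ k') i j) * e j).
  elim: k' i => [|k' IH] i.
    rewrite !expr0 rmorph1 !mul1r (bigD1 i) //= mxE eqxx rmorph1 mul1r big1 ?addr0 ?subrr //.
    by move=> j ji; rewrite mxE eq_sym (negPf ji) rmorph0 mul0r.
  have -> : iota (h ^+ k'.+1) * t ^+ k'.+1 * e i - \sum_j iota ((M 1 ^+ k'.+1) i j) * e j =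
     iota (h ^+ k') * t ^+ k' * (iota h * t ^+ 1 * e i - \sum_l iota (M 1%N i l) * e l) +
     \sum_l iota (M 1%N i l) * (iota (h ^+ k') * t ^+ k' * e l - \sum_j iota ((M 1 ^+ k') l j) * e j).
    have -> : \sum_j iota ((M 1 ^+ k'.+1) i j) * e j =
        \sum_l iota (M 1%N i l) * \sum_j iota ((M 1 ^+ k') l j) * e j.
      under eq_bigr do rewrite exprS !mxE rmorph_sum mulr_suml.
      rewrite exchange_big; apply: eq_bigr => l _; rewrite mulr_sumr.
      by apply: eq_bigr => j _; rewrite rmorphM mulrA.
    under [X in _ = _ + X]eq_bigr do rewrite mulrBr.
    rewrite sumrB mulrBr mulr_sumr.
    under [X in _ = _ + (X - _)]eq_bigr do rewrite mulrCA.
    by rewrite [h ^+ k'.+1]exprS [t ^+ k'.+1]exprS rmorphM expr1; ring.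
  by apply: PD; [exact: PM|apply: ideal_sum => // l _; exact: PM].
apply/matrixP => i; suff : forall j, (h *: M 1 ^+ k) i j = (h ^+ k *: M k) i j by [].
apply: basis_uniq.
have := idealB iP (PM (iota (h ^+ k)) (ME k i)) (PM (iota h) (E k i)).
congr (P _).
under [X in _ = X - _]eq_bigr do rewrite mxE rmorphM -mulrA.
under [X in _ = _ - X]eq_bigr do rewrite mxE rmorphM -mulrA.
by rewrite -!mulr_sumr; ring.
Qed.

Let Q : 'M[{poly B}]_m.+1 := (h *: 'X)%:M - map_mx polyC (M 1).
Let F := \det Q.

Let F_comp : F = char_poly (M 1) \Po (h *: 'X).
Proof.
rewrite /F /char_poly -det_map_mx; congr (\det _); apply/matrixP => i j.
have -> : Q i j = (h *: 'X) *+ (i == j) - (M 1 i j)%:P by rewrite !mxE.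
rewrite [RHS]mxE; have -> : char_poly_mx (M 1) i j = 'X *+ (i == j) - (M 1 i j)%:P by rewrite !mxE.
by rewrite rmorphB rmorphMn /= comp_polyX comp_polyC.
Qed.

Let coefF i : F`_i = (char_poly (M 1))`_i * h ^+ i.
Proof.
rewrite F_comp coef_comp_poly.
have E (k : nat) : (h *: 'X) ^+ k = h ^+ k *: 'X^k :> {poly B} by rewrite exprZn.
under eq_bigr do rewrite E coefZ coefXn mulrA.
have [si|si] := ltnP i (size (char_poly (M 1))).
  rewrite (bigD1 (Ordinal si)) //= eqxx mulr1 big1 ?addr0 // => j ji.
  by rewrite -val_eqE /= eq_sym in ji; rewrite (negPf ji) mulr0.
rewrite big1 => [|j _]; first by rewrite nth_default ?mul0r.
by rewrite gtn_eqF ?mulr0 // (leq_trans (ltn_ord j)).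
Qed.

(** [F] is h^(m+1) times the characteristic polynomial of T = M 1 / h. By the binomial formula h (h
    (X - T))^n is h^n times a matrix over B[X]; taking determinants yields exactly the hypothesis of
    [cicX]. So the characteristic polynomial of T, called [Phi] below, has its coefficients in
    [B]. *)
Let F_divides : exists q, F = (h ^+ m.+1)%:P * q.
Proof.
have hm0 : (h ^+ m.+1)%:P != 0 :> {poly B} by rewrite polyC_eq0 expf_neq0.
apply: (cicX hm0 hm0) => n.
have EQ : h%:P *: Q ^+ n = (h ^+ n)%:P *: \sum_(i < n.+1)
    ('X^(n - i) *: map_mx polyC ((-1) ^+ i *: M i)) *+ 'C(n, i).
  have cQ : GRing.comm ((h *: 'X)%:M : 'M[{poly B}]_m.+1) (- map_mx polyC (M 1)).
    by apply: commrN; exact: comm_scalar_mx.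
  rewrite /Q (exprDn_comm _ cQ) !scaler_sumr; apply: eq_bigr => i _.
  rewrite -!scalerMnr; congr (_ *+ _).
  have -> : ((h *: 'X)%:M : 'M[{poly B}]_m.+1) ^+ (n - i) = ((h *: 'X) ^+ (n - i))%:M.
    by rewrite -rmorphXn.
  have -> : (- map_mx polyC (M 1)) ^+ i = map_mx polyC ((-1) ^+ i *: M 1 ^+ i).
    have EX : (map_mx polyC (M 1)) ^+ i = map_mx polyC (M 1 ^+ i) by rewrite -rmorphXn.
    rewrite [LHS]exprNn EX -(signr_odd _ i) -(signr_odd B i).
    case: (odd i); rewrite ?expr0 ?expr1 ?mul1r ?scale1r // mulN1r scaleN1r.
    by apply/matrixP => a b; rewrite !mxE polyCN.
  rewrite [_%:M * _]mul_scalar_mx.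
  have Eh : h ^+ n = h ^+ (n - i) * h ^+ i by rewrite -exprD subnK // -ltnS.
  apply/matrixP => a b; have := Mpow i => /matrixP/(_ a b); rewrite !mxE => Eab.
  rewrite !polyCM !exprZn -mul_polyC Eh polyCM.
  by transitivity ((h ^+ (n - i))%:P * 'X^(n - i) * ((-1) ^+ i)%:P * (h * (M 1 ^+ i) a b)%:P);
    [rewrite polyCM; ring|rewrite Eab polyCM; ring].
exists (\det (\sum_(i < n.+1) ('X^(n - i) *: map_mx polyC ((-1) ^+ i *: M i)) *+ 'C(n, i))).
have := congr1 determinant EQ; rewrite !detZ.
rewrite -!polyC_exp -!exprM mulnC => <-; congr (_ * _).
by elim: (n) => [|k IH]; rewrite ?expr0 ?det1 // !exprS det_mulmx IH.
Qed.

Let Phi := sval (cid F_divides).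
Let FPhi : F = (h ^+ m.+1)%:P * Phi. Proof. by rewrite /Phi; case: cid. Qed.

Let hm0 : h ^+ m.+1 != 0. Proof. exact: expf_neq0. Qed.

Let Phi_lead : Phi`_m.+1 = 1.
Proof.
have := coefF m.+1; rewrite FPhi coefCM.
have <- : lead_coef (char_poly (M 1)) = (char_poly (M 1))`_m.+1.
  by rewrite lead_coefE size_char_poly.
have /monicP -> := char_poly_monic (M 1).
by rewrite mul1r -[RHS]mulr1 => /(mulfI hm0).
Qed.

Let Phi_size i : (m.+1 < i)%N -> Phi`_i = 0.
Proof.
move=> mi; apply: (mulfI hm0); rewrite -coefCM -FPhi coefF mulr0.
by rewrite nth_default ?mul0r // size_char_poly.
Qed.

Let Phi_root : P (\sum_(i < m.+2) iota Phi`_i * t ^+ i).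
Proof.
have cfu : commr_rmorph iota t by move=> b; exact: mulrC.
pose psi : {rmorphism {poly B} -> A} := horner_morph cfu.
have psiE (f : {poly B}) k : (forall i, (k < i)%N -> f`_i = 0) ->
    psi f = \sum_(i < k.+1) iota f`_i * t ^+ i.
  move=> hf; rewrite /psi /= /horner_morph (@horner_coef_wide _ k.+1).
    by apply: eq_bigr => i _; rewrite coef_map.
  by apply: (leq_trans (size_poly _ _)); apply/leq_sizeP => i /hf.
rewrite -(psiE Phi m.+1) //.
have PF : P (psi F * e ord0).
  have -> : psi F = \det (map_mx psi Q) by rewrite det_map_mx.
  apply: (ideal_det_mul (I := P)) => // i; have := ME 1%N i.
  congr (P _); rewrite expr1.
  transitivity (\sum_j ((iota h * t) *+ (i == j) * e j - iota (M 1%N i j) * e j)).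
    rewrite sumrB; congr (_ - _); rewrite (bigD1 i) //= eqxx mulr1n big1 ?addr0 // => j ji.
    by rewrite eq_sym (negPf ji) mulr0n mul0r.
  apply: eq_bigr => j _; rewrite -mulrBl; congr (_ * _).
  rewrite [in RHS]mxE; have -> : Q i j = (h *: 'X) *+ (i == j) - (M 1 i j)%:P by rewrite !mxE.
  by rewrite rmorphB rmorphMn /= /psi -mul_polyC rmorphM /= !horner_morphC horner_morphX.
have e0 : ~ P (e ord0).
  move=> Pe; suff h1 : (ord0 == ord0 :> 'I_m.+1)%:R = 0 :> B.
    by move: (oner_neq0 B); rewrite -[1]/(true%:R) -(eqxx (ord0 : 'I_m.+1)) h1 eqxx.
  apply: (ie (c := fun i => (i == ord0)%:R)).
  rewrite (bigD1 ord0) //= rmorph1 mul1r big1 ?addr0 // => i i0.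
  by rewrite (negPf i0) rmorph0 mul0r.
have [_ _ PMP] := pP.
have : P (psi F) by have [|//] := PMP _ _ PF.
rewrite FPhi rmorphM /= horner_morphC => /PMP[|//] /injP hz.
by move: hm0; rewrite hz eqxx.
Qed.

Variable z : A -> R.
Hypotheses (hz : mnorm z) (zP : forall a, P a -> z a = 0) (zD : forall b, z (iota b) <= D b).

Let E := \big[Num.max/1]_i N (e i).
Let E1 : 1 <= E. Proof. exact: bigmax_ge_id. Qed.

(** The entries of h T are at most [r], the product of D h and [rho]. The Gauss norm of radius [r]
    then bounds the characteristic polynomial, and the coefficient of degree i of [Phi] is at most
    rho^(m+1-i). If z t exceeded [rho], t^(m+1) would be the only dominant term of Phi(t), which
    lies in [P]. *)
Lemma mnorm_le_coord_norm : z t <= C * E / D h * N t.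
Proof.
have [Nt|Nt] := eqVneq (N t) 0; first by rewrite Nt mulr0 zP //; exact: N_eq0.
pose rho := C * E / D h * N t.
have E0 := lt_le_trans ltr01 E1.
have Nt0 : 0 < N t by rewrite lt_def Nt N_ge0.
have rho0 : 0 < rho by rewrite mulr_gt0 // divr_gt0 // mulr_gt0.
pose r := D h * rho.
have r0 : 0 < r by rewrite mulr_gt0.
have hG := gauss_mnorm hD r0.
have Mr i j : D (M 1 i j) <= r.
  rewrite mxE expr1 (le_trans (leN _ _)) // (le_trans (NM _ _)) //.
  have -> : r = C * N t * E by rewrite /r /rho; field; exact: (lt0r_neq0 Dh).
  apply: ler_wpM2l; last exact: (le_bigmax 1 (fun i => N (e i)) i).
  by rewrite mulr_ge0 // ltW.
have Gp : gauss D r (char_poly (M 1)) <= r ^+ m.+1.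
  rewrite /char_poly /determinant; apply: (mnorm_sum_le hG) => [|s _].
    by rewrite exprn_ge0 // ltW.
  rewrite (mnormM hG) (mnormX hG) (mnormN hG) (mnorm1 hG) expr1n mul1r (mnorm_prod hG).
  rewrite -[X in _ <= _ ^+ X](card_ord m.+1) -prodr_const; apply: ler_prod => i _.
  rewrite (mnorm_ge0 hG) /=.
  set j := (X in _ i X).
  have -> : char_poly_mx (M 1) i j = 'X *+ (i == j) - (M 1 i j)%:P by rewrite !mxE.
  rewrite (le_trans (mnormB hG _ _)) // ge_max gaussC // Mr andbT.
  by case: (i == j); rewrite ?mulr1n ?mulr0n ?(gaussX hD r0) // (mnorm0 hG) ltW.
have DPhi (i : nat) : (i <= m)%N -> D Phi`_i <= rho ^+ (m.+1 - i).
  move=> im; have := gauss_le hD r0 (char_poly (M 1)) i => /le_trans/(_ Gp) Hi.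
  have hi : D h ^+ m.+1 * D Phi`_i = D (char_poly (M 1))`_i * D h ^+ i.
    by rewrite -!(mnormX hD) -!(mnormM hD) -coefCM -FPhi coefF.
  have im1 : (i <= m.+1)%N by rewrite ltnW.
  rewrite -(ler_pM2l (exprn_gt0 m.+1 Dh)) hi -(ler_pM2r (exprn_gt0 i rho0)).
  rewrite -[leRHS]mulrA -exprD subnK // -exprMn.
  by rewrite -mulrA -exprMn.
rewrite leNgt; apply/negP => rz.
have z0 : 0 < z t by rewrite (lt_trans rho0).
have := zP Phi_root; rewrite big_ord_recr /= Phi_lead rmorph1 mul1r addrC (mnorm_addl hz).
  by rewrite (mnormX hz) => /eqP; rewrite expf_eq0 /= (gt_eqF z0).
rewrite (mnormX hz); apply: (mnorm_sum_lt hz) => [|i _ _]; first exact: exprn_gt0.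
have im : (i <= m)%N by rewrite -ltnS.
rewrite (mnormM hz) (mnormX hz).
have -> : z t ^+ m.+1 = z t ^+ (m.+1 - i) * z t ^+ i by rewrite -exprD subnK // ltnW.
rewrite ltr_pM2r ?exprn_gt0 // (le_lt_trans (zD _)) // (le_lt_trans (DPhi _ im)) //.
by rewrite ltrXn2r ?subn_eq0 -?ltnNge // ltW.
Qed.

End CharPoly.

Variable z : A -> R.
Hypotheses (hz : mnorm z) (zP : forall a, P a -> z a = 0) (zD : forall b, z (iota b) <= D b).

(** Applied to the powers of [g], the bound by the coordinate norm loses its constant: z g is at
    most the spectral value of [g], and [exists_mnorm] preserves that value. *)
Lemma domination_basis g : exists x, [/\ mnorm x, forall a, P a -> x a = 0,
  forall b, x (iota b) = D b & z g <= x g].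
Proof.
have hs := spectral_power_seminorm (N_ideal P0) N1 N_ge0 ND C0 NM.
have sZ b a : spectral N (iota b * a) = D b * spectral N a.
  by apply: (spectralZ N_ge0 C0 NM); [exact: mnorm_ge0|move=> c; exact: NZ].
have s1 : spectral N 1 = 1 by rewrite (psn1 hs).
have sB b : spectral N (iota b) = D b by rewrite -[iota b]mulr1 sZ s1 mulr1.
have [w a [b _ <-]|x [hx xs xB xg]] := @exists_mnorm R A (spectral N) (range iota) g hs.
  by rewrite sZ sB.
exists x; split=> // [a Pa|b|].
- apply/le_anti; rewrite mnorm_ge0 // andbT (le_trans (xs a)) //.
  apply: le_gtP => c c0; apply: spectral_le => //; exists (N 1) => -[|n].
    by rewrite !expr0 mulr1.
  by rewrite exprS N_ideal ?mulr_ge0 ?exprn_ge0 ?(ltW c0) // mulrC; exact: PM.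
- by rewrite xB ?sB //; exists b.
- rewrite xg; apply: (le_spectral N_ge0 C0 NM) => r M r0 hM.
  apply: (@geometric_le _ (C * \big[Num.max/1]_i N (e i) / D h * M)) => [||n].
  + exact: mnorm_ge0.
  + exact: ltW.
  rewrite -(mnormX hz); apply: (le_trans (mnorm_le_coord_norm (g ^+ n) hz zP zD)).
  rewrite -[leRHS]mulrA; apply: ler_wpM2l; last exact: hM.
  by rewrite divr_ge0 ?(ltW Dh) // mulr_ge0 ?(ltW C0) // (le_trans ler01) // bigmax_ge_id.
Qed.

End Domination.

(* Going-down for seminorms: the hypothesis on {poly B} makes the characteristic
   polynomials over B of the elements of A divisible by the common denominator,
   so that z is bounded by the spectral seminorm of A over (B, D). *)
Theorem domination (R : realType) (B : idomainType) (A : comNzRingType)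
    (iota : {rmorphism B -> A}) (P : set A) (D : B -> R) (z : A -> R) (g : A) :
  prime_ideal P -> (forall b, P (iota b) -> b = 0) ->
  finite_over setT (range iota) P -> cic {poly B} ->
  mnorm D -> (forall b, D b = 0 -> b = 0) ->
  mnorm z -> (forall a, P a -> z a = 0) -> (forall b, z (iota b) <= D b) ->
  exists x, [/\ mnorm x, forall a, P a -> x a = 0,
    forall b, x (iota b) = D b & z g <= x g].
Proof.
move=> pP injP finP cicX hD D0 hz zP zD.
have [m [e [h [h0 ie he]]]] := fraction_basis pP injP finP.
exact: (domination_basis pP injP h0 ie he hD D0 cicX hz zP zD).
Qed.

(** * Approximation by norms on polynomial rings *)

Section Expansions.
Variables (K : Type) (B : comNzRingType) (kappa : K -> B).
Implicit Types (tau : {rmorphism B -> {poly B}}) (l : seq {rmorphism B -> {poly B}}).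

(** A deformation of the identity, modelled on the Taylor expansion f(T + X): for a small radius e,
    [gauss y e \o tau] lies slightly above [y], and its kernel is contained in that of [y]. *)
Record expansion tau : Prop := {
  expansion0 : forall f, (tau f)`_0 = f;
  expansionC : forall c, tau (kappa c) = (kappa c)%:P }.

Fixpoint all_expansions l : Prop :=
  if l is tau :: l' then expansion tau /\ all_expansions l' else True.

(** Contains the kernel of the perturbation of [y] when [J] is the kernel of [y]; the expansions are
    chosen so that it is 0. *)
Fixpoint residual l (J : set B) : set B :=
  if l is tau :: l' then residual l' [set f | forall j, J (tau f)`_j] else J.

Lemma residual_mono l J J' : J `<=` J' -> residual l J `<=` residual l J'.
Proof.
by elim: l J J' => //= tau l IH J J' JJ'; apply: IH => f h j; apply: JJ'.
Qed.

Variable R : realType.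
Implicit Types (y : B -> R) (e : R).

Fixpoint perturb l e y : B -> R :=
  if l is tau :: l' then perturb l' e (gauss y e \o tau) else y.

Lemma perturb_mnorm l e y : 0 < e -> mnorm y -> mnorm (perturb l e y).
Proof.
move=> e0; elim: l y => //= tau l IH y hy; apply: IH.
exact: (mnorm_comp (gauss_mnorm hy e0)).
Qed.

Lemma expansion_gauss_ge tau e y f : 0 < e -> mnorm y -> expansion tau ->
  y f <= gauss y e (tau f).
Proof.
move=> e0 hy ht; have := gauss_le hy e0 (tau f) 0.
by rewrite expr0 mulr1 (expansion0 ht).
Qed.

Lemma perturb_ge l e y f : 0 < e -> mnorm y -> all_expansions l ->
  y f <= perturb l e y f.
Proof.
move=> e0; elim: l y => //= tau l IH y hy [ht hl].
apply: (le_trans (expansion_gauss_ge f e0 hy ht)).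
exact: (IH (gauss y e \o tau) (mnorm_comp (gauss_mnorm hy e0) _) hl).
Qed.

Lemma perturbC l e y c : 0 < e -> mnorm y -> all_expansions l ->
  perturb l e y (kappa c) = y (kappa c).
Proof.
move=> e0; elim: l y => //= tau l IH y hy [ht hl].
rewrite IH //; last exact: (mnorm_comp (gauss_mnorm hy e0)).
by rewrite /= (expansionC ht) (gaussC hy e0).
Qed.

Lemma gauss_mono e e' y y' (f : {poly B}) : 0 < e -> e <= e' -> mnorm y -> mnorm y' ->
  (forall b, y b <= y' b) -> gauss y e f <= gauss y' e' f.
Proof.
move=> e0 ee' hy hy' yy'; have e'0 := lt_le_trans e0 ee'.
apply: gauss_leP => [|i]; first exact: (gauss_ge0 hy' e'0).
apply: le_trans (gauss_le hy' e'0 f i).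
by apply: ler_pM; rewrite ?(mnorm_ge0 hy) ?exprn_ge0 ?(ltW e0) // le_expn ?(ltW e0).
Qed.

Lemma perturb_mono l e e' y y' f : 0 < e -> e <= e' -> mnorm y -> mnorm y' ->
  (forall b, y b <= y' b) -> perturb l e y f <= perturb l e' y' f.
Proof.
move=> e0 ee'; have e'0 := lt_le_trans e0 ee'.
elim: l y y' f => //= tau l IH y y' f hy hy' yy'; apply: IH.
- exact: (mnorm_comp (gauss_mnorm hy e0)).
- exact: (mnorm_comp (gauss_mnorm hy' e'0)).
- by move=> b; exact: gauss_mono.
Qed.

Lemma perturb_le l e y f : 0 < e -> e <= 1 -> mnorm y -> all_expansions l ->
  perturb l e y f <= Num.max (y f) (e * perturb l 1 y f).
Proof.
move=> e0 e1; elim: l y => [|tau l IH] y hy /=; first by rewrite le_max lexx.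
move=> [ht hl].
have h1 := mnorm_comp (gauss_mnorm hy e0) tau.
have h2 := mnorm_comp (gauss_mnorm hy (@ltr01 R)) tau.
apply: (le_trans (IH _ h1 hl)); rewrite ge_max; apply/andP; split; last first.
  rewrite le_max; apply/orP; right; apply: ler_wpM2l; first exact: ltW.
  by apply: perturb_mono => // b; exact: gauss_mono.
apply: (@le_trans _ _ (Num.max (y f) (e * gauss y 1 (tau f)))).
  have h0 : 0 <= Num.max (y f) (e * gauss y 1 (tau f)).
    by rewrite le_max (mnorm_ge0 hy).
  apply: gauss_leP => // -[|i].
    by rewrite expr0 mulr1 (expansion0 ht) le_max lexx.
  rewrite le_max; apply/orP; right; rewrite exprS mulrCA; apply: ler_wpM2l; first exact: ltW.
  apply: le_trans (gauss_le hy (@ltr01 R) (tau f) i.+1).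
  rewrite expr1n; apply: ler_wpM2l; first exact: (mnorm_ge0 hy).
  by rewrite exprn_ile1 // ltW.
rewrite ge_max !le_max lexx /=; apply/orP; right; apply: ler_wpM2l; first exact: ltW.
exact: (perturb_ge f ltr01 h2 hl).
Qed.

Lemma perturb_ker l e y f : 0 < e -> mnorm y ->
  perturb l e y f = 0 -> residual l [set b | y b = 0] f.
Proof.
move=> e0; elim: l y => //= tau l IH y hy /(IH _ (mnorm_comp (gauss_mnorm hy e0) _)).
apply: residual_mono => b /= hb j; apply/eqP.
have := gauss_le hy e0 (tau b) j; rewrite hb => h.
have : y (tau b)`_j * e ^+ j == 0.
  by rewrite eq_le h mulr_ge0 ?(mnorm_ge0 hy) // exprn_ge0 // ltW.
by rewrite mulf_eq0 expf_eq0 (gt_eqF e0) andbF orbF.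
Qed.

End Expansions.

Section LiftExpansion.
Variables (K : Type) (B : comNzRingType) (kappa : K -> B).

(** Taylor expansion: f(X + Y) as a polynomial in the new variable, which is the outer one. *)
Definition translate : {rmorphism {poly B} -> {poly {poly B}}} :=
  (comp_poly ('X + 'X%:P) \o map_poly polyC)%FUN.

(** Expands the coefficients; [swapXY] makes the expansion variable the outer one. *)
Definition lift_expansion (tau : {rmorphism B -> {poly B}}) :
  {rmorphism {poly B} -> {poly {poly B}}} := (swapXY \o map_poly tau)%FUN.

Lemma translateC c : translate c%:P = c%:P%:P.
Proof. by rewrite /translate /= map_polyC /= comp_polyC. Qed.

Lemma translateX : translate 'X = 'X + 'X%:P.
Proof. by rewrite /translate /= map_polyX comp_polyX. Qed.

Lemma translate_expansion : expansion (fun c => (kappa c)%:P) translate.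
Proof.
split=> [f|c]; last exact: translateC.
by rewrite /translate /= -horner_coef0 horner_comp !hornerE -/(comp_poly 'X f) comp_polyXr.
Qed.

Lemma lift_expansionP tau : expansion kappa tau ->
  expansion (fun c => (kappa c)%:P) (lift_expansion tau).
Proof.
case=> t0 tC; split=> [f|c] /=; last by rewrite map_polyC /= tC swapXY_polyC map_polyC.
by apply/polyP => i; rewrite coef_swapXY coef_map /= t0.
Qed.

Lemma residual_lift l (J' : set {poly B}) (J : set B) :
  (forall f, J' f -> forall i, J f`_i) ->
  forall f, residual (map lift_expansion l) J' f -> forall i, residual l J f`_i.
Proof.
elim: l J' J => //= tau l IH J' J h; apply: IH => f hf i j.
by have := h _ (hf j) i; rewrite coef_swapXY coef_map.
Qed.

(** In every characteristic the highest Taylor coefficient of [f] is its leading coefficient. It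
    lies in [J], and removing the leading term allows induction on the degree. *)
Lemma residual_translate (J : set {poly B}) f : ideal J ->
  (forall j, J (translate f)`_j) -> forall i, J (f`_i)%:P.
Proof.
move=> iJ; have [J0 JD JM] := iJ.
move: {2}(size f) (leqnn (size f)) => m; elim: m f => [|m IH] f sf h i.
  by move: sf; rewrite leqn0 size_poly_eq0 => /eqP->; rewrite coef0.
have monT : 'X + ('X : {poly B})%:P \is monic.
  by rewrite -[X in 'X + X]opprK -polyCN monicXsubC.
have sizeT : size ('X + ('X : {poly B})%:P) = 2.
  by rewrite -[X in 'X + X]opprK -polyCN size_XsubC.
have sizeTX k : size (('X + ('X : {poly B})%:P) ^+ k) = k.+1.
  elim: k => [|k IHk]; first by rewrite expr0 size_poly1.
  by rewrite exprS size_monicM ?IHk ?sizeT // -size_poly_eq0 IHk.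
have coefT : (translate f)`_m = (f`_m)%:P.
  have {1}-> : f = \sum_(k < m.+1) (f`_k)%:P * 'X^k.
    rewrite -[LHS]coefK poly_def (big_ord_widen _ (fun k => f`_k *: 'X^k) sf).
    rewrite [RHS](bigID (fun k : 'I_m.+1 => (k < size f)%N)) /= [X in _ = _ + X]big1 ?addr0.
      by apply: eq_bigr => k _; rewrite mul_polyC.
    by move=> k; rewrite -leqNgt => /(nth_default 0)->; rewrite polyC0 mul0r.
  rewrite (rmorph_sum translate) coef_sum big_ord_recr big1 => [|k _].
    rewrite [LHS]add0r (rmorphM translate) translateC (rmorphXn translate) translateX coefCM.
    have -> : (('X + ('X : {poly B})%:P) ^+ m)`_m = 1.
      by have /monicP := monic_exp m monT; rewrite /lead_coef sizeTX.
    by rewrite mulr1.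
  rewrite (rmorphM translate) translateC (rmorphXn translate) translateX coefCM.
  rewrite (_ : (('X + ('X : {poly B})%:P) ^+ _)`_m = 0) ?mulr0 //.
  by apply: nth_default; rewrite sizeTX; exact: (ltn_ord k).
have Jm : J (f`_m)%:P by rewrite -coefT; exact: h.
pose g := f - (f`_m)%:P * 'X^m.
have sg : (size g <= m)%N.
  apply/leq_sizeP => k mk; rewrite coefB coefCM coefXn.
  case: ltngtP mk => // [mk _|-> _]; last by rewrite mulr1 subrr.
  by rewrite mulr0 subr0 nth_default // (leq_trans sf).
have hg j : J (translate g)`_j.
  rewrite (rmorphB translate) (rmorphM translate) translateC coefB coefCM mulrC.
  by apply: idealB; [|exact: h|exact: JM].
have := IH g sg hg i; rewrite coefB coefCM coefXn.
by case: eqP => [-> //|_]; rewrite mulr0 subr0.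
Qed.

End LiftExpansion.

Fixpoint iter_poly (K : fieldType) (d : nat) : idomainType :=
  if d is e.+1 then {poly iter_poly K e} else K.

Fixpoint iter_polyC (K : fieldType) (d : nat) : {rmorphism K -> iter_poly K d} :=
  match d return {rmorphism K -> iter_poly K d} with
  | 0 => idfun
  | e.+1 => (polyC \o iter_polyC K e)%FUN
  end.

Lemma iter_poly_cic (K : fieldType) d : cic (iter_poly K d).
Proof. by elim: d => [|d IH]; [exact: field_cic|exact: poly_cic]. Qed.

(** One Taylor expansion for each variable: the residual condition descends to coefficients one
    variable at a time and ends with the constants in [J]. *)
Lemma exists_expansions (K : fieldType) d :
  exists l : seq {rmorphism iter_poly K d -> {poly iter_poly K d}},
    all_expansions (iter_polyC K d) l /\
    forall J : set (iter_poly K d), ideal J -> (forall c, J (iter_polyC K d c) -> c = 0) ->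
      forall f, residual l J f -> f = 0.
Proof.
elim: d => [|d [l [hl Jl]]]; first by exists [::]; split=> // J _ h f /h.
exists (translate (iter_poly K d) :: map (@lift_expansion (iter_poly K d)) l); split.
  split; first exact: (translate_expansion (iter_polyC K d)).
  elim: {Jl} l hl => //= tau l IH [ht /IH]; split=> //.
  exact: (lift_expansionP ht).
move=> J iJ JC f hf; apply/polyP => i; rewrite coef0.
have [J0 JD JM] := iJ.
apply: (Jl [set r | J r%:P]) => [|c /JC//|].
  split=> /= [|a b Ja Jb|a b Jb]; first by rewrite polyC0.
    by rewrite polyCD; exact: JD.
  by rewrite polyCM; exact: JM.
have := @residual_lift (iter_poly K d) l _ [set r | J r%:P] _ f hf i; apply=> g hg k.
refine (@residual_translate (iter_poly K d) J g iJ hg k).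
Qed.

(** Perturbations of radius 1 / (k + 1). The error in the last clause is measured by the
    perturbation of radius 1, which is [D 0]. *)
Lemma norm_approximation (R : realType) (K : fieldType) d (y : iter_poly K d -> R) :
  mnorm y -> (forall c, y (iter_polyC K d c) = 0 -> c = 0) ->
  exists D : nat -> iter_poly K d -> R, forall k,
    [/\ mnorm (D k), forall f, D k f = 0 -> f = 0, forall f, y f <= D k f,
        forall c, D k (iter_polyC K d c) = y (iter_polyC K d c) &
        forall f, D k f <= Num.max (y f) (k.+1%:R^-1 * D 0%N f)].
Proof.
move=> hy y0; have [l [hl hres]] := exists_expansions K d.
exists (fun k => perturb l k.+1%:R^-1 y) => k; have k0 : 0 < k.+1%:R^-1 :> R by [].
split=> [|f|f|c|f].
- exact: perturb_mnorm.
- by move=> /(perturb_ker k0 hy)/hres; apply=> //; have [] := mnorm_ker_prime hy.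
- exact: (perturb_ge f k0 hy hl).
- exact: perturbC.
- by have := perturb_le f k0 _ hy hl; rewrite invr1; apply; rewrite invf_le1 // ler1n.
Qed.

(** * Limits of seminorms and peak functions *)

Section Limits.
Variables (R : realType) (A : comNzRingType).
Implicit Types (U F : set_system (A -> R)) (c x z : A -> R) (DD : set (A -> R)).

Definition limit U c : Prop := forall a, (fun x : A -> R => x a) @ U --> c a.

Lemma limit_le U c a m : ProperFilter U -> limit U c -> U [set x | x a <= m] -> c a <= m.
Proof. by move=> FU /(_ a) ca h; exact: (cvgr_to_le ca h). Qed.

Lemma limit_ge U c a m : ProperFilter U -> limit U c -> U [set x | m <= x a] -> m <= c a.
Proof. by move=> FU /(_ a) ca h; exact: (cvgr_to_ge ca h). Qed.

Lemma limit_near U c a e : Filter U -> limit U c -> 0 < e ->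
  U [set x | `|x a - c a| < e].
Proof. by move=> FU /(_ a)/cvgr_distC_lt h /h. Qed.

Lemma limit_mnorm U c : ProperFilter U -> U [set x | mnorm x] -> limit U c -> mnorm c.
Proof.
move=> FU Um hc.
have const a m : (forall x, mnorm x -> x a = m) -> c a = m.
  move=> h; apply/le_anti/andP; split.
    by apply: (limit_le _ hc); apply: filterS Um => x /h /= ->.
  by apply: (limit_ge _ hc); apply: filterS Um => x /h /= ->.
split=> [||a|a b|a b].
- by apply: const => x /mnorm0.
- by apply: const => x /mnorm1.
- by apply: (limit_ge _ hc); apply: filterS Um => x /= hx; exact: mnorm_ge0.
- have h : (fun x : A -> R => x (a * b)) @ U --> c a * c b.
    apply: cvg_trans (cvgM (hc a) (hc b)); apply: near_eq_cvg.
    by apply: filterS Um => x /= hx; rewrite mnormM.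
  exact: (cvg_unique (@Rhausdorff R) (hc _) h).
- apply: le_gtP => m; rewrite gt_max => /andP[am bm]; apply: (limit_le _ hc).
  have near d : c d < m -> U [set x | x d <= m].
    move=> dm; have := @limit_near U c d (m - c d) (@filter_filter _ _ FU) hc; rewrite subr_gt0 => /(_ dm).
    apply: filterS => x /= h; rewrite -(subrK (c d) (x d)) -lerBrDr ltW //.
    exact: le_lt_trans (ler_norm _) h.
  apply: filterS3 Um (near a am) (near b bm) => x /= hx xa xb.
  by rewrite (le_trans (mnormD hx a b)) // ge_max xa.
Qed.

(** Tychonoff's theorem by ultrafilters: a bound at each element makes the values there converge in
    a compact interval. *)
Lemma exists_limit F : ProperFilter F -> F [set x | mnorm x] ->
  (forall a, exists M, F [set x | x a <= M]) ->
  exists U c, [/\ UltraFilter U, F `<=` U, mnorm c & limit U c].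
Proof.
move=> FF Fm bF; have [U [uU FU]] := ultraFilterLemma FF.
suff h a : exists p : R, (fun x : A -> R => x a) @ U --> p.
  have [c hc] := choice h; exists U, c; split=> //.
  by apply: (limit_mnorm (U := U)) => //; exact: FU.
have [M FM] := bF a.
have [|p [_ hp]] := @segment_compact R 0 M ((fun x : A -> R => x a) @ U).
  by apply: FU; apply: filterS2 Fm FM => x hx xM; rewrite /= in_itv /= xM mnorm_ge0.
exists p => V Vp; have [//|UV] := in_ultra_setVsetC ((fun x : A -> R => x a) @^-1` V) uU.
by have [r [/= nVr Vr]] := hp (~` V) V UV Vp.
Qed.

Definition limit_closed DD : Prop :=
  forall U c, UltraFilter U -> U DD -> mnorm c -> limit U c -> DD c.

Lemma limit_closed_eq (W : set A) (w : A -> R) :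
  limit_closed [set x | forall a, W a -> x a = w a].
Proof.
move=> U c uU UW hc lc a Wa; apply/le_anti/andP; split.
  by apply: (limit_le _ lc); apply: filterS UW => x /(_ a Wa) /= ->.
by apply: (limit_ge _ lc); apply: filterS UW => x /(_ a Wa) /= ->.
Qed.

Lemma limit_closed_mnorm : limit_closed [set x | mnorm x].
Proof. by []. Qed.

Lemma limit_closedI DD DD' : limit_closed DD -> limit_closed DD' ->
  limit_closed (DD `&` DD').
Proof.
by move=> h h' U c uU UD hc lc; split; [apply: (h U)|apply: (h' U)] => //;
  apply: filterS UD => x [].
Qed.

Section Refine.
Variables (DD : set (A -> R)) (z : A -> R) (E : set A).
Hypotheses (DDm : forall x, DD x -> mnorm x) (hz : mnorm z).
Hypothesis DDb : forall a, exists M, forall x, DD x -> x a <= M.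
Hypothesis DDcl : limit_closed DD.
Hypothesis dom : forall g, exists2 x, DD x & z g <= x g.
Hypothesis Ez : forall e, E e -> 0 < z e.
Hypothesis Ele : forall e x, E e -> DD x -> x e <= z e.

(* Dominating z on (\prod_e e)^N g forces the values on the e to be close to
   those of z for N large. *)
Lemma refine g : exists x, [/\ DD x, forall e, E e -> x e = z e & z g <= x g].
Proof.
wlog zg : g / 0 < z g.
  move=> h; have [zg0|zg] := eqVneq (z g) 0; last by apply: h; rewrite lt_def zg mnorm_ge0.
  have [|x [DDx xE x1]] := h 1; first by rewrite (mnorm1 hz).
  by exists x; split=> //; rewrite zg0 mnorm_ge0 //; exact: DDm.
have [M hM] := DDb g.
have M0 : 0 < M by have [x DDx h] := dom g; rewrite (lt_le_trans zg) // (le_trans h) // hM.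
pose f (i : (A * nat)%type) := [set x | [/\ DD x, z g <= x g &
  z i.1 * (1 - i.2.+1%:R^-1) <= x i.1]].
pose D := [set i : (A * nat)%type | E i.1].
have fin : finI D f.
  move=> D' sD'; pose P := \prod_(i <- D') i.1; pose k := \max_(i <- D') i.2.
  pose q : R := 1 - k.+1%:R^-1.
  have k0 : 0 < k.+1%:R^-1 :> R by rewrite invr_gt0 ltr0Sn.
  have q0 : 0 <= q by rewrite subr_ge0 invf_le1 ?ler1n ?ltr0Sn.
  (* [q] is the factor lost when some e in [D'] falls short by 1 / (k + 1), and [M] bounds x g: for
     this N such an [x] cannot dominate. *)
  have [N hN] : exists N, q ^+ N * M < z g.
    apply: contrapT => /forallNP h; have : 1 <= q.
      apply: (@geometric_le _ (M / z g)) => [//|//|n]; rewrite expr1n.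
      rewrite mulrAC ler_pdivlMr // mul1r mulrC leNgt; exact/negP.
    by rewrite /q lerBrDr gerDl leNgt k0.
  have ED i : i \in D' -> E i.1 by move=> /sD'; rewrite inE.
  have prod_le x (Q : pred _) : DD x ->
      x (\prod_(i <- D' | Q i) i.1) <= z (\prod_(i <- D' | Q i) i.1).
    move=> DDx; rewrite (mnorm_prod (DDm DDx)) (mnorm_prod hz) [leLHS]big_seq_cond [leRHS]big_seq_cond.
    apply: ler_prod => i /andP[/ED Ei _]; rewrite mnorm_ge0 ?Ele //; exact: DDm.
  have zP : 0 < z P.
    by rewrite /P (mnorm_prod hz) big_seq_cond prodr_gt0 // => i /andP[/ED/Ez].
  have [x DDx hx] := dom (P ^+ N * g); have mx := DDm DDx.
  move: hx; rewrite !(mnormM hz, mnormM mx, mnormX hz, mnormX mx) => hx.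
  have xP : x P <= z P by exact: prod_le.
  exists x => i /= iD'; split=> //.
    rewrite leNgt; apply/negP => lt; suff: z P ^+ N * z g < z P ^+ N * z g by rewrite ltxx.
    apply: (le_lt_trans hx); apply: (@le_lt_trans _ _ (z P ^+ N * x g)).
      by apply: ler_wpM2r; rewrite ?mnorm_ge0 // le_expn ?mnorm_ge0.
    by rewrite ltr_pM2l // exprn_gt0.
  rewrite leNgt; apply/negP => lt; suff : z g <= q ^+ N * M by rewrite leNgt hN.
  have xPq : x P <= q * z P.
    have E0 y : mnorm y -> y P = y i.1 * y (\prod_(j <- D' | j != i) j.1).
      move=> hy; rewrite -(mnormM hy); congr (y _).
      by rewrite /P (bigD1_seq i) ?fset_uniq.
    rewrite !E0 // mulrA; apply: ler_pM; rewrite ?mnorm_ge0 ?prod_le //.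
    apply: (le_trans (ltW lt)); rewrite mulrC; apply: ler_wpM2r; first exact: mnorm_ge0.
    rewrite lerD2l lerN2 lef_pV2 ?posrE ?ltr0Sn // ler_nat ltnS.
    by rewrite /k; apply: (@leq_bigmax_seq _ _ _ (fun j : (A * nat)%type => j.2)).
  have : z P ^+ N * z g <= z P ^+ N * (q ^+ N * M).
    apply: (le_trans hx); rewrite mulrA -exprMn; apply: ler_pM => //.
    - by rewrite exprn_ge0 ?mnorm_ge0.
    - exact: mnorm_ge0.
    - by rewrite le_expn ?mnorm_ge0 // mulrC.
    - exact: hM.
  by rewrite ler_pM2l // exprn_gt0.
have FF := finI_filter fin.
pose F := filter_from (finI_from D f) id.
have F1 i : E i.1 -> F (f i) by move=> Ei; exists (f i) => //; exact: finI_from1.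
have [[e0 Ee0]|E0] := pselect (E !=set0); last first.
  have [x DDx xg] := dom g; exists x; split=> // e Ee.
  by exfalso; apply: E0; exists e.
have FDD : F [set x | DD x /\ z g <= x g].
  by apply: filterS (F1 (e0, 0%N) Ee0) => x [].
have [|a|U [c [uU FU hc lc]]] := @exists_limit F FF.
- by apply: filterS FDD => x [/DDm].
- by have [Ma hMa] := DDb a; exists Ma; apply: filterS FDD => x [/hMa].
exists c; split.
- by apply: (DDcl uU _ hc lc); apply: FU; apply: filterS FDD => x [].
- move=> e Ee; apply/le_anti/andP; split.
    by apply: (limit_le _ lc); apply: FU; apply: filterS FDD => x [DDx _]; exact: Ele.
  rewrite leNgt; apply/negP => lt; have ze := Ez Ee.
  have [k] : exists k : nat, 0 + k.+1%:R^-1 < (z e - c e) / z e.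
    by apply: ltr_add_invr; rewrite divr_gt0 // subr_gt0.
  rewrite add0r ltr_pdivlMr // mulrC => hk.
  have : z e * (1 - k.+1%:R^-1) <= c e.
    by apply: (limit_ge _ lc); apply: FU; apply: filterS (F1 (e, k) Ee) => x [].
  rewrite mulrBr mulr1 => h; by have := lt_le_trans hk (lerB (lexx (z e)) h); rewrite subKr ltxx.
- by apply: (limit_ge _ lc); apply: FU; apply: filterS FDD => x [].
Qed.

End Refine.

End Limits.

(** * Peak functions *)

Section Peaks.
Variables (R : realType) (A : comNzRingType).
Implicit Types (c z : A -> R).

Lemma le_exprz (th : R) (l l' : int) : 0 < th -> th <= 1 -> l <= l' -> th ^ l' <= th ^ l.
Proof.
move=> th0 th1 ll'; rewrite -(subrK l l') expfzDr ?gt_eqF //.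
apply: ler_piMl; first by rewrite ltW // exprz_gt0.
have : 0 <= l' - l by rewrite subr_ge0.
by case: (l' - l) => // k _; rewrite -exprnP exprn_ile1 // ltW.
Qed.

(* H collects the terms of degree at least that of the dominant one. *)
Lemma graded_peak (J : finType) (a : J -> A) (l : J -> int) (al : J -> R) (j0 : J) :
  injective l -> (forall j, 0 <= al j) -> 0 < al j0 -> exists (j1 : J) (H : A), 0 < al j1 /\
  forall c th, mnorm c -> 0 < th -> (forall j, c (a j) = al j * th ^ l j) ->
    c (\sum_j a j) = 0 ->
    c H <= al j1 * th ^ l j1 /\ (c H = al j1 * th ^ l j1 <-> th <= 1).
Proof.
move=> l_inj al_ge0 al0.
have [m [am _] mmax] : exists2 m, al m = al m /\ true & forall j, al j <= al m.
  by case: (arg_maxP al (erefl true) : extremum_spec _ _ _ (Order.arg_max j0 xpredT al)) => m _ h; exists m => // j; exact: h.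
case: (arg_maxP l (eqxx (al m)) : extremum_spec _ _ _ (Order.arg_max m [pred j | al j == al m] l)).
move=> j1 /eqP al1 j1max.
have alj1 : 0 < al j1 by rewrite al1 (lt_le_trans al0).
exists j1, (\sum_(j | (l j1 <= l j)%R) a j); split=> // c th hc th0 ca csum.
have thl i : 0 < th ^ i by exact: exprz_gt0.
have p1 : 0 < al j1 * th ^ l j1 by rewrite mulr_gt0.
have [th1|th1] := leP th 1.
  suff -> : c (\sum_(j | (l j1 <= l j)%R) a j) = al j1 * th ^ l j1 by [].
  rewrite (bigD1 j1) //= (mnorm_addl hc) ca //.
  apply: (mnorm_sum_lt hc) => // j _ /andP[lj jj1].
  have {}lj : l j1 < l j by rewrite lt_neqAle lj andbT (inj_eq l_inj) eq_sym.
  rewrite ca; apply: (@le_lt_trans _ _ (al j * th ^ l j1)).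
    by apply: ler_wpM2l => //; apply: le_exprz => //; exact: ltW.
  rewrite ltr_pM2r // lt_neqAle al1 mmax andbT; apply/negP => alj.
  by have := le_lt_trans (j1max j alj) lj; rewrite ltxx.
(* For th > 1 the relation gives H the value of the sum of the terms of smaller degree, all strictly
   below the bound. *)
have lt : c (\sum_(j | (l j1 <= l j)%R) a j) < al j1 * th ^ l j1.
  have -> : c (\sum_(j | (l j1 <= l j)%R) a j) = c (- \sum_(j | ~~ (l j1 <= l j)%R) a j).
    by apply: (mnorm_sub0 hc); rewrite opprK -csum [in RHS](bigID (fun j => (l j1 <= l j)%R)).
  rewrite (mnormN hc); apply: (mnorm_sum_lt hc) => // j _; rewrite -ltNge => lj.
  rewrite ca; apply: (@le_lt_trans _ _ (al j1 * th ^ l j)).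
    by rewrite ler_pM2r // al1.
  by rewrite ltr_pM2l // ltr_eXz2l.
split; first exact: ltW.
by split=> [E|]; [rewrite E ltxx in lt|].
Qed.

(** Put th = c s / z s. The relation p(s) = 0, graded by i and by -i, yields two functions that
    reach their bounds only for th <= 1 and only for th >= 1. The product of the bounds contains
    th^(i1 + i2), which a power of [s'] cancels, because c(s s') does not depend on c where c s is
    nonzero; the last factor s s' discards the points with c s = 0. If z s = 0, then [g0] already
    separates the points with c s = 0 from the others. *)
Lemma peak (CC : set (A -> R)) z (p : {poly A}) s :
  (forall c, CC c -> mnorm c) -> CC z -> p \is monic ->
  (forall c i, CC c -> c p`_i = z p`_i) -> (forall c, CC c -> c p.[s] = 0) ->
  exists g, [/\ 0 < z g, forall c, CC c -> c g <= z g &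
    forall c, CC c -> c g = z g -> c s = z s].
Proof.
move=> CCm CCz pm Cp Cps; have hz := CCm z CCz.
have exj : exists j, z p`_j != 0.
  by exists (size p).-1; have /monicP := pm; rewrite /lead_coef => ->; rewrite mnorm1 ?oner_eq0.
have [j zj jmin] := ex_minnP exj; set al := z p`_j in zj *.
have al0 : 0 < al by rewrite lt_def zj mnorm_ge0.
pose g0 := (drop_poly j p).[s]; pose s' := (drop_poly j.+1 p).[s].
have g0E : g0 = p`_j + s * s'.
  have h : drop_poly j p = (p`_j)%:P + 'X * drop_poly j.+1 p.
    apply/polyP => i; rewrite coefD coefC coefXM !coef_drop_poly.
    by case: i => [|i]; rewrite ?add0n ?addr0 //= add0r addSnnS.
  by rewrite /g0 h hornerD hornerM hornerC hornerX.
have cg0 c : CC c -> c s != 0 -> c g0 = 0.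
  move=> Cc cs; have hc := CCm c Cc.
  suff : c (g0 * s ^+ j) = 0.
    by rewrite (mnormM hc) (mnormX hc) => /eqP; rewrite mulf_eq0 expf_eq0 (negPf cs) andbF orbF => /eqP.
  have -> : g0 * s ^+ j = p.[s] - (take_poly j p).[s].
    have -> : p.[s] = (take_poly j p).[s] + g0 * s ^+ j.
      by rewrite -[in LHS](poly_take_drop j p) hornerD hornerM hornerXn.
    by rewrite addrC addKr.
  apply/le_anti; rewrite mnorm_ge0 // andbT (le_trans (mnormB hc _ _)) // Cps // ge_max lexx /=.
  rewrite horner_coef; apply: (mnorm_sum_le hc) => // i _.
  rewrite (mnormM hc) coef_take_poly; case: ifP => [ij|_]; last by rewrite (mnorm0 hc) mul0r.
  suff /eqP -> : c p`_i == 0 by rewrite mul0r.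
  by rewrite Cp //; apply/negP => h; have := jmin i (introN idP h); rewrite leqNgt ij.
have [zs0|zs] := eqVneq (z s) 0.
  have eqs c : CC c -> c s = 0 -> c g0 = al.
    move=> Cc cs; have hc := CCm c Cc.
    rewrite g0E (mnorm_addl hc) ?Cp // (mnormM hc) cs mul0r //.
  exists g0; split=> [|c Cc|c Cc]; rewrite (eqs z) //.
    by have [/(eqs c Cc)->//|/(cg0 c Cc)->] := eqVneq (c s) 0; rewrite ltW.
  by have [->|/(cg0 c Cc)->] := eqVneq (c s) 0; rewrite ?zs0 // => h; move: al0; rewrite -h ltxx.
have zs_gt0 : 0 < z s by rewrite lt_def zs mnorm_ge0.
pose a (i : 'I_(size p)) := p`_i * s ^+ i; pose be (i : 'I_(size p)) := z (a i).
have lj : (j < size p)%N.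
  by rewrite ltnNge; apply/negP => /(nth_default 0) h; move: zj; rewrite /al h mnorm0 // eqxx.
have be0 : 0 < be (Ordinal lj).
  by rewrite /be /a /= (mnormM hz) (mnormX hz) mulr_gt0 // exprn_gt0.
have be_ge0 i : 0 <= be i by exact: mnorm_ge0.
have inj1 : injective (fun i : 'I_(size p) => i%:Z) by move=> i i' [] /val_inj.
have inj2 : injective (fun i : 'I_(size p) => - i%:Z) by move=> i i' /oppr_inj [] /val_inj.
have [i1 [H1 [b1 h1]]] := graded_peak a inj1 be_ge0 be0.
have [i2 [H2 [b2 h2]]] := graded_peak a inj2 be_ge0 be0.
pose N := (i1 + i2)%N.
pose g := H1 * H2 * s' ^+ N * (s * s').
have sE : p.[s] = \sum_i a i by rewrite horner_coef.
have val c : CC c -> c s != 0 ->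
    let th := c s / z s in 0 < th /\ [/\ c H1 <= be i1 * th ^+ i1,
      c H2 <= be i2 * th ^+ i2, c H1 = be i1 * th ^+ i1 -> th <= 1,
      c H2 = be i2 * th ^+ i2 -> 1 <= th & c g = c H1 * c H2 * (al / c s) ^+ N * al].
  move=> Cc cs th; have hc := CCm c Cc.
  have cs0 : 0 < c s by rewrite lt_def cs mnorm_ge0.
  have th0 : 0 < th by rewrite divr_gt0.
  have ca i : c (a i) = be i * th ^+ i.
    rewrite /a /be !(mnormM hc, mnormM hz, mnormX hc, mnormX hz) Cp // -mulrA -exprMn.
    by rewrite /th mulrCA divff // mulr1.
  have csum : c (\sum_i a i) = 0 by rewrite -sE Cps.
  split=> //; have [|h1a h1b] := h1 c th hc th0 _ csum; first by move=> i; exact: ca.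
  have thV : 0 < th^-1 by rewrite invr_gt0.
  have thE i : th^-1 ^ (- (i%:Z)) = th ^+ i.
    by rewrite -exprz_inv invrK.
  have [|h2a h2b] := h2 c th^-1 hc thV _ csum; first by move=> i; rewrite thE; exact: ca.
  have css : c (s * s') = al.
    have := cg0 c Cc cs; rewrite g0E -[X in _ + X]opprK => /(mnorm_sub0 hc); rewrite (mnormN hc) => <-.
    by rewrite Cp.
  have cs' : c s' = al / c s.
    by rewrite -css (mnormM hc) mulrAC divff // mul1r.
  split=> //.
  - by rewrite -thE.
  - by move=> E; apply/h1b.
  - by rewrite -thE => E; have /h2b := E; rewrite invf_le1.
  - by rewrite /g !(mnormM hc) (mnormX hc) -(mnormM hc s) css cs'.
have [_ [_ _ _ _ zg]] := val z CCz zs.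
have [zH1 zH2] : z H1 = be i1 /\ z H2 = be i2.
  have zsum : z (\sum_i a i) = 0 by rewrite -sE Cps.
  have [|_ [_ e1]] := h1 z 1 hz ltr01 _ zsum; first by move=> i; rewrite exp1rz mulr1.
  have [|_ [_ e2]] := h2 z 1 hz ltr01 _ zsum; first by move=> i; rewrite exp1rz mulr1.
  by rewrite e1 // e2 // !exp1rz !mulr1.
have zg0 : 0 < z g.
  by rewrite zg zH1 zH2; do ?[apply: mulr_gt0 => //]; rewrite exprn_gt0 // divr_gt0.
have eqg c : CC c -> c s != 0 -> z g = (be i1 * (c s / z s) ^+ i1) *
    (be i2 * (c s / z s) ^+ i2) * (al / c s) ^+ N * al.
  move=> Cc cs; rewrite zg zH1 zH2; congr (_ * _).
  rewrite mulrACA -exprD -/N -!mulrA; congr (_ * (_ * _)).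
  by rewrite -exprMn; congr (_ ^+ _); field; rewrite cs zs.
exists g; split=> // c Cc; have hc := CCm c Cc; have [cs0|cs] := eqVneq (c s) 0.
- by rewrite /g (mnormM hc) (mnormM hc s) cs0 mul0r mulr0 ltW.
- have [th0 [e1 e2 _ _ ->]] := val c Cc cs; rewrite (eqg c Cc cs).
  do 2![apply: ler_wpM2r; first by rewrite ?exprn_ge0 ?divr_ge0 ?mnorm_ge0 // ltW].
  by apply: ler_pM; rewrite ?mnorm_ge0.
- by rewrite /g (mnormM hc) (mnormM hc s) cs0 mul0r mulr0 => E; move: zg0; rewrite -E ltxx.
have [th0 [e1 e2 f1 f2 ->]] := val c Cc cs; rewrite (eqg c Cc cs).
have cs_gt0 : 0 < c s by rewrite lt_def cs mnorm_ge0.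
move=> /(mulIf zj) /mulIf -/(_ _) E.
have {}E : c H1 * c H2 = be i1 * (c s / z s) ^+ i1 * (be i2 * (c s / z s) ^+ i2).
  by apply: E; rewrite expf_neq0 // mulf_neq0 // invr_eq0.
have t1 : 0 < be i1 * (c s / z s) ^+ i1 by rewrite mulr_gt0 // exprn_gt0.
have t2 : 0 < be i2 * (c s / z s) ^+ i2 by rewrite mulr_gt0 // exprn_gt0.
have E1 : c H1 = be i1 * (c s / z s) ^+ i1.
  apply/le_anti; rewrite e1 /= -(ler_pM2r t2) -E; apply: ler_wpM2l => //.
  exact: mnorm_ge0.
have E2 : c H2 = be i2 * (c s / z s) ^+ i2.
  by move: E; rewrite E1 => /mulfI; apply; rewrite gt_eqF.
have /le_anti : 1 <= c s / z s <= 1 by rewrite f2 ?f1.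
by move/(congr1 ( *%R^~ (z s))); rewrite mul1r divfK.
Qed.

End Peaks.

(** * Monoid algebras of lattices *)

Section Separation.
Variable n : nat.
Implicit Types u w : 'rV[int]_n.

Definition dot u w : int := \sum_i u 0 i * w 0 i.

Lemma dotDl u u' w : dot (u + u') w = dot u w + dot u' w.
Proof. by rewrite /dot -big_split; apply: eq_bigr => i _; rewrite mxE mulrDl. Qed.

Lemma dotNl u w : dot (- u) w = - dot u w.
Proof. by rewrite /dot -sumrN; apply: eq_bigr => i _; rewrite mxE mulNr. Qed.

Lemma dotBl u u' w : dot (u - u') w = dot u w - dot u' w.
Proof. by rewrite dotDl dotNl. Qed.

Lemma dot0l w : dot 0 w = 0.
Proof. by rewrite /dot big1 // => i _; rewrite mxE mul0r. Qed.

(* A vector (N^i)_i for which N is not a root of the polynomials \sum_i w_i X^i. *)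
Lemma exists_nonorthogonal (W : seq 'rV[int]_n) : (forall w, w \in W -> w != 0) ->
  exists t, forall w, w \in W -> dot w t != 0.
Proof.
move=> W0; pose p := \prod_(w <- W) rVpoly w.
have p0 : p != 0.
  rewrite prodf_seq_neq0; apply/allP => w wW /=; apply: contraNneq (W0 w wW) => h.
  by rewrite -[w]rVpolyK h linear0.
have [N hN] : exists N : nat, ~~ root p N%:Z.
  apply: contrapT => /forallNP h.
  have := @max_poly_roots _ p [seq Posz k | k <- iota 0 (size p)] p0.
  rewrite size_map size_iota ltnn map_inj_uniq ?iota_uniq; last by move=> ? ? [].
  by move=> H; apply/notF/H => //; apply/allP => _ /mapP[k _ ->]; apply/negPn/negP => /h.
exists (\row_i (N%:Z ^+ i)) => w wW.
have : ~~ root (rVpoly w) N%:Z.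
  apply: contra hN => h; rewrite /p (big_rem w) //= rootM h //.
rewrite /root /rVpoly horner_poly; apply: contra => /eqP dw; apply/eqP; rewrite -[RHS]dw.
apply: eq_bigr => i _; rewrite mxE; case: insubP => [j _ ji|]; rewrite ?ltn_ord //.
by congr (_ * _); congr (w _ _); exact: val_inj.
Qed.

End Separation.

Lemma exists_lex_max d (R : orderType d) (T : eqType) (r : seq T) (al : T -> R) (l : T -> int) :
  r != [::] -> exists2 u, u \in r &
    forall w, w \in r -> (al w < al u)%O \/ al w = al u /\ l w <= l u.
Proof.
elim: r => // u [|u' r] IH _.
  by exists u; rewrite ?mem_head // => w; rewrite inE => /eqP ->; right.
have [//|m mr mmax] := IH.
have [um|mu] : ((al u < al m)%O \/ al u = al m /\ l u <= l m) \/
    ((al m < al u)%O \/ al m = al u /\ l m <= l u).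
- have [h|h|h] := ltgtP (al u) (al m); [by left; left|by right; left|].
  by have [h'|/ltW h'] := lerP (l u) (l m); [left|right]; right; rewrite h.
- exists m; first by rewrite inE mr orbT.
  by move=> w; rewrite inE => /predU1P[->|/mmax].
exists u; rewrite ?mem_head // => w; rewrite inE => /predU1P[->|/mmax]; first by right.
case: mu => [mu|[mu mu']] [wm|[wm wm']].
- by left; exact: lt_trans mu.
- by left; rewrite wm.
- by left; rewrite -mu.
- by right; rewrite wm mu; split=> //; exact: le_trans mu'.
Qed.

Section MonoidAlgebraTheory.
Variables (K : fieldType) (S : nmodType).
Local Notation A := (monoid_algebra K S).
Implicit Types (f g : A) (u w : S) (L : set S).

Lemma ma_sum f : f = \sum_(u <- msupp f) mcoeff u f *: chi K u.
Proof. by rewrite {1}[f]monalgE; apply: eq_bigr => u _; rewrite ma_scaleU mulr1. Qed.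

Lemma mcoeff_sumE (I : Type) (r : seq I) (F : I -> A) x :
  mcoeff x (\sum_(i <- r) F i) = \sum_(i <- r) mcoeff x (F i).
Proof. exact: (big_morph (mcoeff x) (mcoeffD x) (mcoeff0 x)). Qed.

Lemma mcoeffM f g x : mcoeff x (f * g) =
  \sum_(u <- msupp f) \sum_(w <- msupp g) (mcoeff u f * mcoeff w g) *+ (u + w == x).
Proof.
rewrite -[f * g]/(ma_mul f g) /ma_mul mcoeff_sumE; apply: eq_bigr => u _.
by rewrite mcoeff_sumE; apply: eq_bigr => w _; rewrite mcoeffU.
Qed.

Lemma mcoeffM_neq0 f g x : mcoeff x (f * g) != 0 ->
  exists u w, [/\ mcoeff u f != 0, mcoeff w g != 0 & x = u + w].
Proof.
move=> h; apply: contrapT => H; move/negP: h; apply; rewrite mcoeffM big_seq big1 // => u uf.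
rewrite big_seq big1 // => w wg; case: eqP => // E; exfalso; apply: H.
by exists u, w; split; rewrite ?mcoeff_neq0.
Qed.

Lemma mcoeff_chi u x : mcoeff x (chi K u) = (u == x)%:R.
Proof. exact: mcoeffU. Qed.

Definition supported L : set A := [set f | forall u, mcoeff u f != 0 -> L u].

Lemma supported_subring L : L 0 -> (forall u w, L u -> L w -> L (u + w)) ->
  subring (supported L).
Proof.
move=> L0 LD; split.
- move=> u; rewrite -[1]/(chi K 0) mcoeff_chi; have [<- //|_] := eqVneq 0 u.
  by rewrite eqxx.
- move=> f g hf hg u; rewrite mcoeffB => h.
  have [f0|] := eqVneq (mcoeff u f) 0; last exact: hf.
  by apply: hg; move: h; rewrite f0 sub0r oppr_eq0.
- by move=> f g hf hg x /mcoeffM_neq0[u [w [/hf uf /hg wg ->]]]; exact: LD.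
Qed.

Lemma supported_chi L u : L u -> supported L (chi K u).
Proof. by move=> Lu w; rewrite mcoeff_chi; have [<- //|_] := eqVneq u w; rewrite eqxx. Qed.

Lemma supported_scale L c f : supported L f -> supported L (c *: f).
Proof.
by move=> hf u; rewrite mcoeffZ => h; apply: hf; apply: contraNneq h => ->; rewrite mulr0.
Qed.

Section Gauss.
Variables (R : realType) (abs : K -> R) (wt : S -> R).

Definition gaussw f : R := \big[Num.max/0]_(u <- msupp f) (abs (mcoeff u f) * wt u).

Hypotheses (habs : mnorm abs) (abs0 : forall c, abs c = 0 -> c = 0).
Hypotheses (wt_gt0 : forall u, 0 < wt u).

Let term_ge0 f u : 0 <= abs (mcoeff u f) * wt u.
Proof. by rewrite mulr_ge0 ?(mnorm_ge0 habs) // ltW. Qed.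

Lemma gaussw_ge0 f : 0 <= gaussw f.
Proof. by apply: (big_ind (fun x => 0 <= x)) => // x y x0 y0; rewrite le_max x0. Qed.

Lemma gaussw_le f u : abs (mcoeff u f) * wt u <= gaussw f.
Proof.
have [uf|/mcoeff_outdom ->] := boolP (u \in msupp f); first by apply: (@le_bigmax_seq _ _ _ _ _ u xpredT).
by rewrite (mnorm0 habs) mul0r gaussw_ge0.
Qed.

Lemma gaussw_leP f c : 0 <= c -> (forall u, mcoeff u f != 0 -> abs (mcoeff u f) * wt u <= c) ->
  gaussw f <= c.
Proof.
by move=> c0 h; rewrite /gaussw big_seq; apply: bigmax_le => // u uf; apply: h; rewrite mcoeff_neq0.
Qed.

Lemma gaussw0 : gaussw 0 = 0.
Proof.
apply/le_anti; rewrite gaussw_ge0 andbT; apply: gaussw_leP => // u.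
by rewrite mcoeff0 eqxx.
Qed.

Lemma gaussw_eq0 f : gaussw f = 0 -> f = 0.
Proof.
move=> h; apply/malgP => u; rewrite mcoeff0; apply: abs0.
have := gaussw_le f u; rewrite h => h'.
have /eqP : abs (mcoeff u f) * wt u == 0 by rewrite eq_le h' term_ge0.
by move/eqP; rewrite mulf_eq0 (gt_eqF (wt_gt0 u)) orbF => /eqP.
Qed.

Lemma gaussw_scale_chi c u : gaussw (c *: chi K u) = abs c * wt u.
Proof.
have E : mcoeff u (c *: chi K u) = c by rewrite mcoeffZ mcoeff_chi eqxx mulr1.
apply/le_anti; rewrite -[X in _ && (X <= _)]/(abs c * wt u) -{3}E gaussw_le andbT.
apply: gaussw_leP => [|w]; first by rewrite mulr_ge0 ?(mnorm_ge0 habs) // ltW.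
by rewrite mcoeffZ mcoeff_chi; have [<-|_] := eqVneq u w; rewrite ?mulr1 // mulr0 eqxx.
Qed.

End Gauss.

End MonoidAlgebraTheory.

(* S is identified by v with the kernel of E in Z^n. *)
Record lattice_emb (n e : nat) (S : nmodType) (v : S -> 'rV[int]_n) (E : 'M[int]_(n, e)) :
    Prop := {
  emb_inj : injective v;
  embD : forall u w, v (u + w) = v u + v w;
  embP : forall u, v u *m E = 0;
  emb_surj : forall x, x *m E = 0 -> exists u, v u = x }.

Section Lattice.
Variables (n e : nat) (S : nmodType) (v : S -> 'rV[int]_n) (E : 'M[int]_(n, e)).
Hypothesis hv : lattice_emb v E.
Variable K : fieldType.
Local Notation A := (monoid_algebra K S).
Implicit Types (f g : A) (u w x : S) (La : seq 'rV[int]_n).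

Lemma emb0 : v 0 = 0.
Proof. by have := embD hv 0 0; rewrite addr0 => /eqP; rewrite -subr_eq subrr => /eqP. Qed.

(** Subtraction in [S], which carries only a monoid structure; by [emb_surj] the default value is
    never taken. *)
Definition emb_sub u w : S := xget 0 [set x | v x = v u - v w].

Lemma emb_subE u w : v (emb_sub u w) = v u - v w.
Proof.
rewrite /emb_sub; apply: (@xgetPex _ 0 [set x | v x = v u - v w]).
by apply: (emb_surj hv); rewrite mulmxBl !(embP hv) subr0.
Qed.

Lemma emb_subK u w : emb_sub u w + w = u.
Proof. by apply: (emb_inj hv); rewrite (embD hv) emb_subE subrK. Qed.

Lemma emb_addI u w w' : u + w = u + w' -> w = w'.
Proof. by move=> /(congr1 v); rewrite !(embD hv) => /addrI /(emb_inj hv). Qed.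

Lemma chi_mul_opp u : chi K u * chi K (emb_sub 0 u) = 1.
Proof. by rewrite -chiD addrC emb_subK chi0. Qed.

Lemma exists_separating (F : seq S) : exists t, forall u w, u \in F -> w \in F ->
  dot (v u) t = dot (v w) t -> u = w.
Proof.
pose W := [seq v u.1 - v u.2 | u : S * S <- [seq (u, w) | u <- F, w <- F] & u.1 != u.2].
have [|t ht] := @exists_nonorthogonal n W.
  move=> ? /mapP[[u w]]; rewrite mem_filter => /andP[/= uw _] ->.
  by rewrite subr_eq0 (inj_eq (emb_inj hv)).
exists t => u w uF wF h; apply/eqP/negPn/negP => uw.
have /ht : v u - v w \in W.
  by apply/mapP; exists (u, w) => //; rewrite mem_filter /= uw; apply/allpairsP; exists (u, w).
by rewrite dotBl h subrr eqxx.
Qed.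

Definition lat La : set S := [set u | forall t, t \in La -> dot (v u) t = 0].

Lemma lat0 La : lat La 0.
Proof. by move=> t _; rewrite emb0 dot0l. Qed.

Lemma latD La u w : lat La u -> lat La w -> lat La (u + w).
Proof. by move=> hu hw t tL; rewrite (embD hv) dotDl hu ?hw. Qed.

Lemma lat_sub La u w : lat La u -> lat La w -> lat La (emb_sub u w).
Proof. by move=> hu hw t tL; rewrite emb_subE dotBl hu ?hw. Qed.

Lemma lat_cons t La u : lat (t :: La) u <-> dot (v u) t = 0 /\ lat La u.
Proof.
split=> [h|[h h'] t']; last by rewrite inE => /predU1P[->|/h'].
by split=> [|t' t'L]; apply: h; rewrite inE ?eqxx ?t'L ?orbT.
Qed.

Definition KL La : set A := supported (lat La).

Lemma KL_subring La : subring (KL La).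
Proof. by apply: supported_subring; [exact: lat0|exact: latD]. Qed.

Lemma KL_nil f : KL [::] f.
Proof. by move=> u _ t. Qed.

Section GaussNorm.
Variables (R : realType) (abs : K -> R) (wt : S -> R).
Hypotheses (habs : mnorm abs) (abs0 : forall c, abs c = 0 -> c = 0).
Hypotheses (wt_gt0 : forall u, 0 < wt u) (wt0 : wt 0 = 1).
Hypothesis wtD : forall u w, wt (u + w) = wt u * wt w.
Local Notation G := (gaussw abs wt).

(* Among the dominant terms of f and g, those of largest degree for a
   separating linear form multiply to a coefficient of f g without competitor. *)
Let gaussw_mul_ge f g : G f * G g <= G (f * g).
Proof.
have [->|f0] := eqVneq f 0.
  by rewrite (gaussw0 habs wt_gt0) mul0r; exact: gaussw_ge0.
have [->|g0] := eqVneq g 0.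
  by rewrite (gaussw0 habs wt_gt0) mulr0; exact: gaussw_ge0.
have [t ht] := exists_separating (msupp f ++ msupp g).
pose l u := dot (v u) t.
have top h : h != 0 -> exists u, [/\ u \in msupp h, G h = abs (mcoeff u h) * wt u &
    forall w, w \in msupp h -> abs (mcoeff w h) * wt w < abs (mcoeff u h) * wt u \/
      abs (mcoeff w h) * wt w = abs (mcoeff u h) * wt u /\ l w <= l u].
  move=> h0; have [|u uh umax] := @exists_lex_max _ R S (msupp h) (fun u => abs (mcoeff u h) * wt u) l.
    by apply: contraNneq h0 => h1; apply/eqP/malgP => z; rewrite mcoeff0; apply: mcoeff_outdom; rewrite -[z \in _]/(z \in enum_fset _) h1.
  exists u; split=> //; apply/le_anti; rewrite (gaussw_le habs wt_gt0) andbT.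
  apply: gaussw_leP => [|w]; first by rewrite mulr_ge0 ?(mnorm_ge0 habs) // ltW.
  by rewrite mcoeff_neq0 => /umax[/ltW|[->]].
have [u0 [u0f -> umax]] := top f f0; have [w0 [w0g -> wmax]] := top g g0.
pose a := abs (mcoeff u0 f) * abs (mcoeff w0 g).
have a0 : 0 < a.
  by rewrite mulr_gt0 // lt_def (mnorm_ge0 habs) andbT; apply/eqP => /abs0/eqP; apply/negP;
    rewrite mcoeff_neq0.
have lt u w : u \in msupp f -> w \in msupp g -> u != u0 -> u + w = u0 + w0 ->
    abs (mcoeff u f * mcoeff w g) < a.
  move=> uf wg uu0 E0; rewrite (mnormM habs).
  have wE : wt u * wt w = wt u0 * wt w0 by rewrite -!wtD E0.
  have lE : l u + l w = l u0 + l w0 by rewrite -!dotDl -!(embD hv) E0.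
  rewrite -(ltr_pM2r (mulr_gt0 (wt_gt0 u) (wt_gt0 w))) {2}wE mulrACA [ltRHS]mulrACA.
  have [h1|[h1 h1']] := umax _ uf; have [h2|[h2 h2']] := wmax _ wg.
  - by apply: ltr_pM; rewrite ?mulr_ge0 ?(mnorm_ge0 habs) // ltW.
  - rewrite h2 ltr_pM2r // mulr_gt0 // lt_def (mnorm_ge0 habs) andbT.
    by apply/eqP => /abs0/eqP; apply/negP; rewrite mcoeff_neq0.
  - rewrite h1 ltr_pM2l // mulr_gt0 // lt_def (mnorm_ge0 habs) andbT.
    by apply/eqP => /abs0/eqP; apply/negP; rewrite mcoeff_neq0.
  - have lu : l u = l u0 by move: lE h1' h2'; lia.
    by move/eqP: uu0; case; apply: ht lu; rewrite mem_cat ?uf ?u0f.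
have E0 : abs (mcoeff (u0 + w0) (f * g)) = a.
  rewrite mcoeffM (bigD1_seq u0) ?fset_uniq //= (mnorm_addl habs).
    rewrite (bigD1_seq w0) ?fset_uniq //= eqxx mulr1n big1 ?addr0 ?(mnormM habs) //.
    move=> w /eqP ww0; case: eqP => // /emb_addI E1; by case: ww0.
  have -> : abs (\sum_(w <- msupp g) mcoeff u0 f * mcoeff w g *+ (u0 + w == u0 + w0)) = a.
    rewrite (bigD1_seq w0) ?fset_uniq //= eqxx mulr1n big1 ?addr0 ?(mnormM habs) //.
    by move=> w /eqP ww0; case: eqP => // /emb_addI E1; case: ww0.
  apply: (mnorm_sum_lt habs) => // u uf uu0; apply: (mnorm_sum_lt habs) => // w wg _.
  by case: eqP => [/lt|_]; rewrite ?mulr1n ?mulr0n ?(mnorm0 habs) //; apply.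
have := gaussw_le habs wt_gt0 (f * g) (u0 + w0).
by rewrite E0 wtD /a mulrACA.
Qed.

Lemma gaussw_mnorm : mnorm G.
Proof.
split=> [||f|f g|f g].
- exact: gaussw0.
- have -> : (1 : A) = 1 *: chi K 0 by rewrite scale1r chi0.
  by rewrite (gaussw_scale_chi habs wt_gt0) wt0 (mnorm1 habs) mulr1.
- exact: gaussw_ge0.
- apply/le_anti; rewrite gaussw_mul_ge andbT.
  have G0 h : 0 <= G h by exact: gaussw_ge0.
  apply: gaussw_leP => [|x _]; first by rewrite mulr_ge0.
  rewrite -ler_pdivlMr // mcoeffM; apply: (mnorm_sum_le habs) => [|u _].
    by rewrite divr_ge0 ?mulr_ge0 // ltW.
  apply: (mnorm_sum_le habs) => [|w _]; first by rewrite divr_ge0 ?mulr_ge0 // ltW.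
  case: eqP => [<-|_]; rewrite ?mulr1n ?mulr0n; last first.
    by rewrite (mnorm0 habs) divr_ge0 ?mulr_ge0 // ltW.
  rewrite ler_pdivlMr // wtD (mnormM habs) mulrACA.
  by apply: ler_pM; rewrite ?(gaussw_le habs wt_gt0) // mulr_ge0 ?(mnorm_ge0 habs) // ltW.
- have G0 h : 0 <= G h by exact: gaussw_ge0.
  apply: gaussw_leP => [|x _]; first by rewrite le_max G0.
  rewrite mcoeffD; apply: (@le_trans _ _ (Num.max (abs (mcoeff x f)) (abs (mcoeff x g)) * wt x)).
    by rewrite ler_pM2r // mnormD.
  rewrite maxr_pMl; last exact: ltW.
  by rewrite ge_max !le_max !(gaussw_le habs wt_gt0) orbT.
Qed.

Lemma mnorm_le_gaussw (z : A -> R) f : mnorm z -> (forall c : K, z c%:A = abs c) ->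
  (forall u, z (chi K u) <= wt u) -> z f <= G f.
Proof.
move=> hz zK zwt; rewrite [in leLHS](ma_sum f); apply: (mnorm_sum_le hz) => [|u _].
  exact: gaussw_ge0.
rewrite -mulr_algl (mnormM hz) zK; apply: le_trans (gaussw_le habs wt_gt0 f u).
by apply: ler_wpM2l => //; exact: mnorm_ge0.
Qed.

End GaussNorm.

End Lattice.

(** * Elimination and dimension *)

Section Tower.
Variables (n e : nat) (S : nmodType) (v : S -> 'rV[int]_n) (E : 'M[int]_(n, e)).
Hypothesis hv : lattice_emb v E.
Variables (R : realType) (K : fieldType).
Local Notation A := (monoid_algebra K S).
Local Notation KL := (@KL n S v K).
Implicit Types (f g : A) (u w x : S) (La : seq 'rV[int]_n) (I J P : set A) (t : 'rV[int]_n).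

Definition separates t f : Prop := forall u w, mcoeff u f != 0 -> mcoeff w f != 0 ->
  dot (v u) t = dot (v w) t -> u = w.

(* The leading and trailing terms of f rewrite any monomial, modulo f, into
   monomials whose t-degree lies in a window of the width of f. *)
Lemma elimination I La t f : ideal I -> I f -> f != 0 -> KL La f -> separates t f ->
  finite_over (KL La) (KL (t :: La)) I.
Proof.
move=> iI If f0 Lf sep; have [I0 ID IM] := iI; have sK := KL_subring hv K (t :: La).
pose l u := dot (v u) t.
have fn0 : msupp f != [::] :> seq S.
  apply: contraNneq f0 => h1; apply/eqP/malgP => z; rewrite mcoeff0.
  by apply: mcoeff_outdom; rewrite -[z \in _]/(z \in enum_fset _) h1.
have [u1 u1f u1max] : exists2 u1, mcoeff u1 f != 0 & forall w, mcoeff w f != 0 -> l w <= l u1.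
  have [u uf um] := exists_lex_max l (fun=> 0 : int) fn0.
  by exists u => [|w]; rewrite mcoeff_neq0 // => /um[/ltW|[->]].
have [u0 u0f u0min] : exists2 u0, mcoeff u0 f != 0 & forall w, mcoeff w f != 0 -> l u0 <= l w.
  have [u uf um] := exists_lex_max (fun u => - l u) (fun=> 0 : int) fn0.
  by exists u => [|w]; rewrite mcoeff_neq0 // => /um[/ltW|[]]; lia.
pose W := `|l u1 - l u0|%N.
have WE : W%:Z = l u1 - l u0 by have := u1max _ u0f; rewrite /W; lia.
(* One monomial for each degree in the window; the default 0 occurs when no exponent of the lattice
   has degree [k]. *)
pose s (k : 'I_W) : A := xget 0 [set a | exists u, [/\ lat v La u, l u = k%:Z & a = chi K u]].
pose M (a : A) := exists2 b : 'I_W -> A, forall k, KL (t :: La) (b k) & I (a - \sum_k b k * s k).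
have MI a a' : I (a - a') -> M a' -> M a.
  move=> h [b Lb h']; exists b => //.
  by rewrite -(subrK a' a) -addrA; apply: ID.
have M0 : M 0.
  exists (fun=> 0) => [k|]; first exact: (subring0 sK).
  by rewrite big1 ?subr0 // => k _; rewrite mul0r.
have MD a a' : M a -> M a' -> M (a + a').
  move=> [b Lb h] [b' Lb' h']; exists (fun k => b k + b' k) => [k|]; first exact: (subringD sK).
  have -> : a + a' - \sum_k (b k + b' k) * s k =
      (a - \sum_k b k * s k) + (a' - \sum_k b' k * s k).
    by rewrite (eq_bigr (fun k => b k * s k + b' k * s k)) ?big_split /=; [ring|move=> k _; rewrite mulrDl].
  exact: ID.
have MM c a : KL (t :: La) c -> M a -> M (c * a).
  move=> Lc [b Lb h]; exists (fun k => c * b k) => [k|]; first exact: (subringM sK).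
  have -> : c * a - \sum_k c * b k * s k = c * (a - \sum_k b k * s k).
    by rewrite mulrBr mulr_sumr; congr (_ - _); apply: eq_bigr => k _; rewrite mulrA.
  exact: IM.
have MZ c a : M a -> M (c *: a).
  move=> Ma; rewrite -mulr_algl; apply: MM => //; apply: supported_scale.
  by case: sK.
have window u : lat v La u -> 0 <= l u -> l u < W%:Z -> M (chi K u).
  move=> Lu u_ge0 uW; pose k := `|l u|%N.
  have kE : k%:Z = l u by rewrite /k; lia.
  have kW : (k < W)%N by rewrite -ltz_nat kE.
  have [u' [Lu' lu' sE]] : exists u', [/\ lat v La u', l u' = k%:Z & s (Ordinal kW) = chi K u'].
    exact: (@xgetPex _ 0 [set a | exists u, [/\ lat v La u, l u = k%:Z & a = chi K u]]
      (ex_intro _ _ (ex_intro _ u (And3 Lu (esym kE) erefl)))).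
  have Ld : lat v (t :: La) (emb_sub v u u').
    by apply/lat_cons; split; [rewrite (emb_subE hv) dotBl -/(l u) -/(l u') lu' kE subrr|exact: (lat_sub hv)].
  exists (fun k' => if k' == Ordinal kW then chi K (emb_sub v u u') else 0) => [k'|].
    by case: eqP => _; [exact: supported_chi|exact: (subring0 sK)].
  rewrite (bigD1 (Ordinal kW)) //= eqxx big1 ?addr0 => [|k' /negPf ->]; last by rewrite mul0r.
  by rewrite sE -chiD (emb_subK hv) subrr.
(* Solves the relation f = 0 for its term of exponent [p], shifted to the exponent [u]. *)
have red p u : mcoeff p f != 0 -> lat v La u ->
    (forall w, mcoeff w f != 0 -> w != p -> M (chi K (emb_sub v u p + w))) -> M (chi K u).
  move=> pf Lu h; set c := mcoeff p f in pf.
  apply: (MI _ (\sum_(w <- msupp f | w != p) (- (c^-1 * mcoeff w f)) *: chi K (emb_sub v u p + w))).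
    have -> : chi K u - \sum_(w <- msupp f | w != p) (- (c^-1 * mcoeff w f)) *: chi K (emb_sub v u p + w)
        = c^-1%:A * chi K (emb_sub v u p) * f.
      rewrite {3}(ma_sum f) (bigD1_seq p) ?fset_uniq -?mcoeff_neq0 //= -/c.
      rewrite mulrDr mulr_algl -scalerAl -[_ * (c *: _)]scalerAr -chiD (emb_subK hv).
      rewrite scalerA mulVf // scale1r; congr (_ + _).
      rewrite mulr_sumr -sumrN; apply: eq_bigr => w _.
      by rewrite scaleNr opprK -scalerAl -scalerAr -chiD scalerA.
    exact: IM.
  rewrite big_seq_cond; apply: (big_ind M) => // w /andP[wf wp].
  by apply: MZ; apply: h; rewrite ?mcoeff_neq0.
have Lstep p u w : mcoeff p f != 0 -> mcoeff w f != 0 -> lat v La u ->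
    lat v La (emb_sub v u p + w) /\ l (emb_sub v u p + w) = l u - l p + l w.
  move=> pf wf Lu; split; last by rewrite /l (embD hv) (emb_subE hv) dotDl dotBl.
  by apply: (latD hv); [apply: (lat_sub hv)|]; rewrite //; exact: Lf.
have lneq p w : mcoeff p f != 0 -> mcoeff w f != 0 -> w != p -> l w <> l p.
  by move=> pf wf /eqP wp h; apply: wp; exact: sep.
have pos : forall m u, lat v La u -> 0 <= l u -> l u < m%:Z -> M (chi K u).
  elim=> [|m IH] u Lu u_ge0 um; first by lia.
  have [uW|Wu] := ltrP (l u) W%:Z; first exact: window.
  apply: (red u1) => // w wf wu1; have [L1 L2] := Lstep _ _ _ u1f wf Lu.
  have := lneq _ _ u1f wf wu1; have := u1max _ wf; have := u0min _ wf.
  by move=> h1 h2 h3; apply: IH => //; rewrite L2; move: WE Wu um h1 h2 h3; lia.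
have neg : forall m u, lat v La u -> - m%:Z <= l u -> M (chi K u).
  elim=> [|m IH] u Lu um; first by apply: (pos (`|l u|.+1)%N) => //; lia.
  have [u_ge0|u_lt0] := lerP 0 (l u); first by apply: (pos (`|l u|.+1)%N) => //; lia.
  apply: (red u0) => // w wf wu0; have [L1 L2] := Lstep _ _ _ u0f wf Lu.
  have := lneq _ _ u0f wf wu0; have := u0min _ wf.
  by move=> h1 h2; apply: IH => //; rewrite L2; move: um h1 h2; lia.
exists W, s => a La_a; suff : M a by [].
rewrite (ma_sum a) big_seq; apply: (big_ind M) => // u ua; apply: MZ.
apply: (neg `|l u|%N); first by apply: La_a; rewrite mcoeff_neq0.
by lia.
Qed.

(** Records one relation for each application of [elimination]. Being monotone in the ideal, it
    passes to the primes that contain [I]. *)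
Inductive tower I : seq 'rV[int]_n -> Prop :=
  | tower_nil : tower I [::]
  | tower_cons t La f : tower I La -> I f -> f != 0 -> KL La f -> separates t f ->
      tower I (t :: La).

Lemma tower_sub I J La : I `<=` J -> tower I La -> tower J La.
Proof.
move=> IJ; elim=> [|t La' f _ IH If]; first exact: tower_nil.
by apply: tower_cons => //; exact: IJ.
Qed.

Lemma tower_finite I La : ideal I -> tower I La -> finite_over setT (KL La) I.
Proof.
move=> iI; elim=> [|t La' f _ IH If f0 Lf sep].
  have := finite_over_refl (KL_subring hv K [::]) iI.
  by apply: finite_over_sub => // a _; exact: KL_nil.
apply: finite_over_trans IH _ => //; first exact: (KL_subring hv).
exact: (@elimination _ _ _ f).
Qed.

(** Monomials are units, so a proper ideal contains none of them. *)
Lemma ideal_two_terms I f : ideal I -> ~ I 1 -> I f -> f != 0 ->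
  exists u w, [/\ u != w, mcoeff u f != 0 & mcoeff w f != 0].
Proof.
move=> iI I1 If f0; have [I0 ID IM] := iI; apply: contrapT => h.
have [u uf] : exists u, mcoeff u f != 0.
  apply: contrapT => /forallNP h'; move/eqP: f0; apply; apply/malgP => u; rewrite mcoeff0.
  by apply/eqP/negPn/negP => /h'.
apply: I1; have -> : (1 : A) = (mcoeff u f)^-1%:A * chi K (emb_sub v 0 u) * f; last exact: IM.
rewrite {2}(ma_sum f) (bigD1_seq u) ?fset_uniq -?mcoeff_neq0 //= big_seq_cond big1 ?addr0.
  rewrite mulr_algl -scalerAl -[_ * (_ *: _)]scalerAr mulrC -chiD addrC (emb_subK hv).
  by rewrite scalerA mulVf // scale1r chi0.
move=> w /andP[wf wu]; exfalso; apply: h; exists w, u; split=> //.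
by rewrite mcoeff_neq0.
Qed.

(** The forms are linearly independent over the rationals: [t] takes different values at two
    exponents of [f], whereas the previous forms vanish at both. *)
Lemma tower_size I La : ideal I -> ~ I 1 -> tower I La -> (size La <= n)%N.
Proof.
move=> iI I1 h; pose q (t : 'rV[int]_n) : 'rV[rat]_n := map_mx intr t.
suff : free (map q La).
  rewrite /free size_map => /eqP <-; apply: leq_trans (dimvS (subvf _)) _.
  by rewrite dimvf /dim /= mul1n.
elim: h => [|t La' f _ IH If f0 Lf sep] /=; first by rewrite nil_free.
rewrite free_cons IH andbT; apply/negP => tX.
have [u [w [uw uf wf]]] := ideal_two_terms iI I1 If f0.
move/eqP: uw; apply; apply: sep => //; apply/eqP; rewrite -subr_eq0 -dotBl.
have phiE (y : 'rV[int]_n) : \sum_i ((v u - v w) 0 i)%:~R * q y 0 i = (dot (v u - v w) y)%:~R :> rat.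
  rewrite /dot (big_morph _ (@intrD rat) (erefl _)); apply: eq_bigr => i _.
  by rewrite /q [map_mx _ _ _ _]mxE intrM.
rewrite -(intr_eq0 rat) -phiE (coord_span (X := in_tuple (map q La')) tX).
rewrite (eq_bigr (fun i => \sum_(j < size (map q La'))
    vector.coord (in_tuple (map q La')) j (q t) * (((v u - v w) 0 i)%:~R * (map q La')`_j 0 i))).
  rewrite exchange_big big1 //= => j _; rewrite -mulr_sumr.
  have jL : (j < size La')%N by rewrite -(size_map q).
  rewrite (nth_map 0) // phiE dotBl.
  by rewrite (Lf u uf) ?(Lf w wf) ?mem_nth // subrr mulr0.
by move=> i _; rewrite summxE mulr_sumr; apply: eq_bigr => j _; rewrite !mxE mulrCA.
Qed.

Lemma prime_incomparable (A' : comNzRingType) (B P Q : set A') : subring B ->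
  prime_ideal P -> prime_ideal Q -> P `<=` Q -> finite_over setT B P ->
  (forall b, B b -> Q b -> P b) -> Q `<=` P.
Proof.
move=> sB pP pQ PQ fB QP a Qa; apply: contrapT => Pa.
have [iP _ _] := pP; have [p [pm Bp Pp]] := finite_over_monic sB iP fB a.
have := mnorm_incomparable (a := a) (p := p) (subring_setT A') Logic.I (fun=> Logic.I)
  (prime_mnorm R pQ) (prime_mnorm R pP) _ pm.
rewrite (asboolT Qa) (asboolF Pa) (asboolT Pp) => H.
suff /eqP : 0 = 1 :> R by rewrite eq_sym oner_eq0.
apply: H => //.
- by move=> b _; case: asboolP => Qb; case: asboolP => Pb //; [case: Qb; exact: PQ].
- move=> i; case: asboolP => Qb; case: asboolP => Pb //; first by case: Pb; exact: QP.
  by case: Qb; exact: PQ.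
Qed.

(* By incomparability, each strict inclusion of primes produces an element of
   the next prime in K[lat La], hence one more elimination. *)
Lemma tower_chain k La (P : nat -> set A) : (forall i, (i <= k)%N -> prime_ideal (P i)) ->
  (forall i, (i < k)%N -> P i `<` P i.+1) -> tower (P 0%N) La -> (k + size La <= n)%N.
Proof.
elim: k La P => [|k IH] La P pP PS h.
  by have [iP P1 _] := pP _ (leqnn 0); exact: tower_size h.
have [[iP0 _ _] p1] : prime_ideal (P 0%N) /\ prime_ideal (P 1%N) by split; apply: pP.
have [f P1f [f0 Lf]] : exists2 f, P 1%N f & f != 0 /\ KL La f.
  apply: contrapT => hn; have [P01] := PS 0%N isT; apply.
  apply: (prime_incomparable (KL_subring hv K La) (pP 0%N isT) p1 P01 (tower_finite iP0 h)).
  move=> b Lb Pb; have [->|b0] := eqVneq b 0; first by case: iP0.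
  by exfalso; apply: hn; exists b.
have [t ht] := exists_separating hv (msupp f).
have := IH (t :: La) (fun i => P i.+1); rewrite /= addnS addSn; apply.
- by move=> i ik; exact: pP.
- by move=> i ik; exact: PS.
- apply: (@tower_cons _ t La f) => //; first by apply: tower_sub h; case: (PS 0%N isT).
  by move=> u w; rewrite !mcoeff_neq0; exact: ht.
Qed.

Lemma tower_chain_lt k La (P : nat -> set A) f : (forall i, (i <= k)%N -> prime_ideal (P i)) ->
  (forall i, (i < k)%N -> P i `<` P i.+1) -> tower (P 0%N) La ->
  P 0%N f -> KL La f -> f != 0 -> (k + size La < n)%N.
Proof.
move=> pP PS h Pf Lf f0; have [t ht] := exists_separating hv (msupp f).
rewrite -addnS; apply: (@tower_chain k (t :: La) P) => //; apply: (@tower_cons _ t La f) => //.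
by move=> u w; rewrite !mcoeff_neq0; exact: ht.
Qed.

End Tower.

(** Smith normal form: the left kernel of [M] is a direct summand with basis the rows of [U], and
    [V] gives the coordinates of a projection onto it. *)
Lemma kernel_basis m c (M : 'M[int]_(m, c)) : exists r (U : 'M[int]_(r, m)) (V : 'M[int]_(m, r)),
  [/\ U *m M = 0, U *m V = 1%:M, forall x : 'rV[int]_m, x *m M = 0 -> x = x *m V *m U &
      (m <= r + \rank (map_mx intr M : 'M[rat]_(m, c)))%N].
Proof.
have [L Lu [Q Qu [d _ ME]]] := int_Smith_normal_form M.
set D := (X in _ *m X *m _) in ME.
pose z := [pred i : 'I_m | (i < c)%N && (d`_i != 0)].
pose f (i : 'I_#|predC z|) : 'I_m := enum_val i.
pose g (i : 'I_#|z|) : 'I_m := enum_val i.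
have LM : invmx L *m M = D *m Q by rewrite ME -!mulmxA mulKmx.
exists #|predC z|, (rowsub f (invmx L)), (colsub f L); split.
- rewrite mul_rowsub_mx LM; apply/matrixP => i j; rewrite !mxE big1 // => k _.
  rewrite mxE; case: eqP => [ik|_]; last by rewrite mul0r.
  have := enum_valP i; rewrite inE /= negb_and -leqNgt negbK -/(f i) ik leqNgt ltn_ord /=.
  by rewrite -ik => /eqP ->; rewrite mul0r.
- rewrite mul_rowsub_mx mulmx_colsub mulVmx //; apply/matrixP => i j.
  by rewrite !mxE (inj_eq (@enum_val_inj _ _)).
- move=> x xM; have yD : x *m L *m D = 0.
    by apply: (can_inj (mulmxK Qu)); rewrite mul0mx -!mulmxA mulmxA -[RHS]xM ME !mulmxA.
  rewrite -[LHS](mulmxK Lu); apply/matrixP => a j; rewrite !mxE.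
  rewrite (bigID z) /= big1 ?add0r => [|i /andP[ic di]].
    rewrite (eq_bigl (fun i => i \in predC z)); last by move=> i; rewrite inE.
    rewrite (big_enum_val (A := predC z)); apply: eq_bigr => k _.
    by rewrite !mxE; congr (_ * _); apply: eq_bigr => l _; rewrite mxE.
  suff -> : (x *m L) a i = 0 by rewrite mul0r.
  move/matrixP: yD => /(_ a (Ordinal ic)); rewrite [LHS]mxE (bigD1 i) //= big1 ?addr0.
    by rewrite [D _ _]mxE eqxx mulr1n [RHS]mxE => /eqP; rewrite mulf_eq0 (negPf di) orbF => /eqP.
  move=> k ki; rewrite [D _ _]mxE; case: eqP => [E|]; last by rewrite mulr0.
  by move/eqP: ki; case; apply: val_inj.
- rewrite -[X in (X <= _)%N]card_ord -(cardC z) addnC leq_add2l.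
  pose W : 'M[int]_(c, #|z|) := \matrix_(j, k) ((j : nat) == g k)%:R.
  pose Y := rowsub g (invmx L) *m M *m (invmx Q *m W).
  have YE : Y = diag_mx (\row_k d`_(g k)).
    rewrite /Y mul_rowsub_mx LM -mul_rowsub_mx -mulmxA mulKVmx //.
    apply/matrixP => i k; have /andP[gc _] := enum_valP k; rewrite mxE (bigD1 (Ordinal gc)) //= big1 ?addr0.
      rewrite !mxE /= eqxx mulr1 -[(g i : nat) == _]/(g i == g k) (inj_eq (@enum_val_inj _ _)).
      by case: eqP => [->|].
    by move=> j jk; rewrite [W _ _]mxE -val_eqE in jk *; rewrite (negPf jk) mulr0.
  have : \rank (map_mx intr Y : 'M[rat]_#|z|) = #|z|.
    apply: mxrank_unit; rewrite YE map_diag_mx unitmxE det_diag unitfE.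
    apply/prodf_neq0 => k _; rewrite !mxE intr_eq0.
    by have /andP[] := enum_valP k.
  move=> <-; rewrite /Y !map_mxM /=.
  by apply: leq_trans (mxrankM_maxl _ _) _; exact: mxrankM_maxr.
Qed.

Lemma id_lattice_emb r : lattice_emb (fun u : 'rV[int]_r => u) (0 : 'M[int]_(r, 0)).
Proof. by split=> // [u|x _]; [rewrite mulmx0|exists x]. Qed.

Lemma mnorm_mul0 (R : realType) (A : comNzRingType) (x : A -> R) (a b : A) : mnorm x ->
  (forall c, x c = 0 -> c = 0) -> a * b = 0 -> a = 0 \/ b = 0.
Proof.
move=> hx x0 ab; have := mnormM hx a b; rewrite ab (mnorm0 hx) => /esym/eqP.
by rewrite mulf_eq0 => /orP[]/eqP/x0; [left|right].
Qed.

Lemma ma_lift_chi_comp (K : fieldType) (S S' : nmodType) (A : comAlgType K) (p : S -> S')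
    (h : S' -> A) (f : monoid_algebra K S) :
  ma_lift h (ma_lift (fun u => chi K (p u) : monoid_algebra K S') f) = ma_lift (h \o p) f.
Proof.
rewrite {2}/ma_lift ma_lift_sum; apply: eq_bigr => u _.
by rewrite ma_scaleU ma_liftU mulr1.
Qed.

(** * Prime chains of the expected length *)

Section Chains.
Variables (n e : nat) (S : nmodType) (v : S -> 'rV[int]_n) (E : 'M[int]_(n, e)).
Hypothesis hv : lattice_emb v E.
Variables (R : realType) (K : fieldType).
Local Notation A := (monoid_algebra K S).
Local Notation KL := (@KL n S v K).

Lemma field_prime0 : prime_ideal [set c : K | c = 0].
Proof.
split=> [|/eqP|a b /= /eqP]; last by rewrite mulf_eq0 => /orP[]/eqP; [left|right].
  by split=> [//|a b /= -> ->|a b /= ->]; rewrite ?addr0 ?mulr0.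
by rewrite oner_eq0.
Qed.

Definition trivial_abs (c : K) : R := if `[< c = 0 >] then 0 else 1.

Lemma trivial_abs_mnorm : mnorm trivial_abs.
Proof. exact: (prime_mnorm R field_prime0). Qed.

Lemma trivial_abs0 c : trivial_abs c = 0 -> c = 0.
Proof. by rewrite /trivial_abs; case: asboolP => // _ /eqP; rewrite oner_eq0. Qed.

Section Projections.
Variables (r : nat) (V : 'M[int]_(n, r)).

(** [copid_mx k] erases the first [k] coordinates, which amounts to setting the first [k] variables
    to 1. *)
Definition proj_chi k (u : S) : monoid_algebra K 'rV[int]_r :=
  chi K (v u *m V *m copid_mx k).

Lemma proj_chi0 k : proj_chi k 0 = 1.
Proof. by rewrite /proj_chi (emb0 hv) !mul0mx chi0. Qed.

Lemma proj_chiD k u w : proj_chi k (u + w) = proj_chi k u * proj_chi k w.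
Proof. by rewrite /proj_chi (embD hv) !mulmxDl chiD. Qed.

Definition proj_ker La k : set A := [set f | KL La f /\ ma_lift (proj_chi k) f = 0].

(** The target K[Z^r] is a domain, because the Gauss norm over the trivial absolute value is
    multiplicative and vanishes only at 0. *)
Lemma proj_ker_prime La k a b : KL La a -> KL La b -> proj_ker La k (a * b) ->
  proj_ker La k a \/ proj_ker La k b.
Proof.
move=> La_a La_b [_]; rewrite (ma_liftM (proj_chiD k)) => h.
have hN := gaussw_mnorm (id_lattice_emb r) trivial_abs_mnorm trivial_abs0
  (fun=> @ltr01 R) erefl (fun _ _ => esym (mulr1 1)).
have N0 := @gaussw_eq0 K 'rV[int]_r R _ _ trivial_abs_mnorm trivial_abs0 (fun=> @ltr01 R).
by have [h0|h0] := mnorm_mul0 hN N0 h; [left|right].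
Qed.

End Projections.

(* Lifts the chain of the kernels of the projections of K[lat La] onto
   coordinate subtori of decreasing dimension. *)
Lemma exists_prime_chain I La r (U : 'M[int]_(r, n)) (V : 'M[int]_(n, r)) :
  ideal I -> (forall f, I f -> KL La f -> f = 0) -> finite_over setT (KL La) I ->
  U *m E = 0 -> (forall i t, t \in La -> dot (row i U) t = 0) -> U *m V = 1%:M ->
  exists P : nat -> set A, (forall i, (i <= r)%N -> prime_ideal (P i) /\ I `<=` P i) /\
    forall i, (i < r)%N -> P i `<` P i.+1.
Proof.
move=> iI I0 finI UE ULa UV; pose q := proj_ker V La.
have sK := KL_subring hv K La.
have lift0 k : ma_lift (proj_chi V k) 0 = 0 by exact: ma_lift0.
have liftM k := ma_liftM (proj_chiD V k).
have lying J k : ideal J -> I `<=` J -> (forall b, KL La b -> J b -> q k b) ->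
    exists Q, [/\ prime_ideal Q, J `<=` Q & forall b, KL La b -> (Q b <-> q k b)].
  move=> iJ IJ Jq; apply: (lying_over sK iJ).
  - exact: finite_over_sub finI.
  - by move=> f [].
  - by split; [exact: subring0|exact: lift0].
  - by move=> a b [ha ha'] [hb hb']; split; [exact: (subringD sK)|rewrite ma_liftD ha' hb' addr0].
  - by move=> a b ha [hb hb']; split; [exact: (subringM sK)|rewrite liftM hb' mulr0].
  - by move=> [_]; rewrite (ma_lift1 (proj_chi0 V k)) => /eqP; rewrite oner_eq0.
  - by move=> a b; exact: proj_ker_prime.
  - by move=> b [Jb Lb]; exact: Jq.
have q_mono k : q k `<=` q k.+1.
  move=> f [Lf h]; split; first exact: Lf.
  transitivity (ma_lift (fun w => chi K (w *m copid_mx k.+1) : monoid_algebra K 'rV[int]_r)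
    (ma_lift (proj_chi V k) f)); last by rewrite h; exact: ma_lift0.
  have -> : proj_chi V k.+1 =
      (fun w : 'rV[int]_r => chi K (w *m copid_mx k.+1) : monoid_algebra K 'rV[int]_r) \o
      (fun u => v u *m V *m copid_mx k).
    apply/funext => u; rewrite /proj_chi /= -[in RHS]mulmxA; congr (chi K (_ *m _)).
    rewrite /copid_mx mulmxBl mul1mx mulmxBr mulmx1 mul_pid_mx pid_mx_minh.
    by rewrite (minn_idPl (leqnSn k)) subrr subr0.
  exact/esym/ma_lift_chi_comp.
have q0 k : q k 0 by split; [exact: (subring0 sK)|exact: lift0].
have qP k b : q k b <-> KL La b /\ ma_lift (proj_chi V k) b = 0 by split.
clearbody q; clear lift0 liftM.
have chain k : exists P : nat -> set A,
    (forall i, (i <= k)%N -> [/\ prime_ideal (P i), I `<=` P i & forall b, KL La b -> (P i b <-> q i b)]) /\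
    forall i, (i < k)%N -> P i `<=` P i.+1.
  elim: k => [|k [P [hP PS]]].
    have [|Q hQ] := @lying I 0%N iI (@subset_refl _ _); last first.
      by exists (fun=> Q); split=> [i|i]; rewrite ?leqn0 ?ltn0 // => /eqP ->.
    by move=> b Lb Ib; rewrite (I0 b).
  have [pP IP Pq] := hP k (leqnn k); have [iP _ _] := pP.
  have [b Lb /(Pq b Lb)/q_mono //|Q [pQ PQ Qq]] := @lying (P k) k.+1 iP IP.
  exists (fun i => if (i <= k)%N then P i else Q); split=> i.
    rewrite leq_eqVlt => /predU1P[->|]; last by rewrite ltnS => ik; rewrite ik; exact: hP.
    by rewrite ltnn; split=> //; exact: subset_trans PQ.
  rewrite ltnS => ik; rewrite ik; have [ltk|kle] := ltnP i k; first exact: PS.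
  by have -> : i = k by apply/eqP; rewrite eqn_leq ik.
have [P [hP PS]] := chain r; exists P; split=> i ir; first by have [] := hP i ir.
split; first exact: PS.
have ir' := ltnW ir.
have [u uE] : exists u, v u = row (Ordinal ir) U.
  by apply: (emb_surj hv); rewrite -row_mul UE row0.
(* This element vanishes under the projection of index i + 1 but not under that of index i, so the
   inclusion is strict. *)
have Lu : KL La (chi K u - 1).
  have [L1 LB _] := sK; apply: LB => //; apply: supported_chi => t tL.
  by rewrite uE ULa.
have liftu k : ma_lift (proj_chi V k) (chi K u - 1) = chi K (row (Ordinal ir) (copid_mx k)) - 1.
  rewrite -scaleN1r ma_liftD ma_lift_chi -(chi0 K S) ma_scaleU mulr1 ma_liftU proj_chi0 scaleN1r.
  by rewrite /proj_chi uE -mulmxA -row_mul mulmxA UV mul1mx.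
move=> PP; have [_ _ /(_ _ Lu)[_ q1]] := hP i.+1 ir.
have [_ _ /(_ _ Lu)[q2 _]] := hP i ir'.
have qi : q i.+1 (chi K u - 1).
  apply/qP; split; first exact: Lu.
  rewrite liftu; have -> : row (Ordinal ir) (copid_mx i.+1) = 0 :> 'rV[int]_r.
    by apply/rowP => j; rewrite !mxE /= ltnSn andbT subrr.
  by rewrite chi0 subrr.
have /qP[_] := q2 (PP _ (q1 qi)).
rewrite liftu => /eqP; rewrite subr_eq0 => /eqP /(congr1 (mcoeff 0)).
rewrite -(chi0 K) !mcoeff_chi eqxx; case: eqP => [|_ /eqP]; last by rewrite eq_sym oner_eq0.
move=> /rowP /(_ (Ordinal ir)) /eqP; rewrite !mxE /= eqxx ltnn andbF subr0 => /eqP /eqP.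
by [].
Qed.

End Chains.

Lemma range_subring (B A : comNzRingType) (f : {rmorphism B -> A}) : subring (range f).
Proof.
split=> [|_ _ [a _ <-] [b _ <-]|_ _ [a _ <-] [b _ <-]].
- by exists 1; rewrite ?rmorph1.
- by exists (a - b); rewrite ?rmorphB.
- by exists (a * b); rewrite ?rmorphM.
Qed.

(** * Polynomial subrings of lattice algebras *)

Section IterEval.
Variables (K : fieldType) (A : comAlgType K) (p : nat -> A).

Fixpoint iter_eval (d : nat) : {rmorphism iter_poly K d -> A} :=
  match d return {rmorphism iter_poly K d -> A} with
  | 0 => in_alg A
  | e.+1 => horner_morph (fun c => mulrC (p e) (iter_eval e c))
  end.

Lemma iter_evalS e (f : {poly iter_poly K e}) :
  iter_eval e.+1 f = \sum_(i < size f) iter_eval e f`_i * p e ^+ i.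
Proof.
rewrite /= /horner_morph (horner_coef_wide _ (size_poly _ _)).
by apply: eq_bigr => i _; rewrite coef_map.
Qed.

Lemma iter_evalC d c : iter_eval d (iter_polyC K d c) = c%:A.
Proof.
elim: d => [|d IH] //=.
by rewrite /horner_morph map_polyC hornerC.
Qed.

Fixpoint iter_var (d i : nat) : iter_poly K d :=
  match d return iter_poly K d with
  | 0 => 0
  | e.+1 => if i == e then ('X : {poly iter_poly K e}) else (iter_var e i)%:P
  end.

Lemma iter_eval_var d i : (i < d)%N -> iter_eval d (iter_var d i) = p i.
Proof.
elim: d => // d IH; rewrite ltnS leq_eqVlt /=; case: eqP => [-> _|_ /= /IH id].
  by rewrite /horner_morph map_polyX hornerX.
by rewrite /horner_morph map_polyC hornerC.
Qed.

Lemma iter_eval_range d i : (i < d)%N -> range (iter_eval d) (p i).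
Proof. by move=> id; exists (iter_var d i) => //; exact: iter_eval_var. Qed.

Lemma iter_eval_sub d (T : set A) : subring T -> (forall c : K, T c%:A) ->
  (forall i, (i < d)%N -> T (p i)) -> forall b, T (iter_eval d b).
Proof.
move=> sT TK; elim: d => [|d IH] Tp b; first exact: TK.
rewrite iter_evalS; apply: (subring_sum sT) => i _; apply: (subringM sT).
  by apply: IH => j jd; apply: Tp; rewrite ltnS ltnW.
elim: (i : nat) => [|k IHk]; first by rewrite expr0; case: sT.
by rewrite exprS; apply: (subringM sT) => //; exact: Tp.
Qed.

End IterEval.

Section Normalization.
Variables (n e : nat) (S : nmodType) (v : S -> 'rV[int]_n) (E : 'M[int]_(n, e)).
Hypothesis hv : lattice_emb v E.
Variables (R : realType) (K : fieldType).
Local Notation A := (monoid_algebra K S).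
Local Notation KL := (@KL n S v K).
Implicit Types (La : seq 'rV[int]_n) (u w : S).

(* With weights 2^{deg}, the powers of p d have distinct norms while the
   polynomials in the preceding p i have norm 1. *)
Lemma iter_eval_inj (p : nat -> A) (r : nat) (deg : nat -> S -> int) :
  (forall d u w, deg d (u + w) = deg d u + deg d w) ->
  (forall d i, (d < r)%N -> (i < d)%N -> supported [set u | deg d u = 0] (p i)) ->
  (forall d, (d < r)%N -> gaussw (@trivial_abs R K) (fun u => 2 ^ deg d u) (p d) = 2) ->
  forall d, (d <= r)%N -> forall a, iter_eval p d a = 0 -> a = 0.
Proof.
move=> degD psupp pnorm; elim=> [|d IH] dr a.
  by move=> /eqP; rewrite /= scaler_eq0 oner_eq0 orbF => /eqP.
have {}IH := IH (ltnW dr).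
pose wt u : R := 2 ^ deg d u.
have wt_gt0 u : 0 < wt u by rewrite exprz_gt0.
have wtD u w : wt (u + w) = wt u * wt w by rewrite /wt degD expfzDr.
have deg0 : deg d 0 = 0.
  by have := degD d 0 0; rewrite addr0 => /eqP; rewrite -subr_eq subrr => /eqP.
have wt0 : wt 0 = 1 by rewrite /wt deg0 expr0z.
have tabs := trivial_abs_mnorm R K.
pose N := gaussw (@trivial_abs R K) wt : A -> R.
have hN : mnorm N by exact: (gaussw_mnorm hv tabs (@trivial_abs0 R K)).
pose L0 := [set u | deg d u = 0].
have sL0 : subring (supported L0 : set A).
  by apply: supported_subring => // u w; rewrite /L0 /= degD => -> ->.
have N1 f : iter_eval p d f != 0 -> N (iter_eval p d f) = 1.
  set g := iter_eval _ _ _ => g0.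
  have Lg : supported L0 g.
    apply: (iter_eval_sub sL0) => [c|i id]; last exact: psupp.
    by apply: supported_scale; rewrite -(chi0 K S); exact: supported_chi.
  apply/le_anti/andP; split.
    apply: gaussw_leP => // u /Lg; rewrite /L0 /wt /= => ->; rewrite expr0z mulr1.
    by rewrite /trivial_abs; case: asboolP.
  have [u ug] : exists u, mcoeff u g != 0.
    apply: contrapT => /forallNP h; move/eqP: g0; apply; apply/malgP => u; rewrite mcoeff0.
    by apply/eqP/negPn/negP => /h.
  have := gaussw_le tabs wt_gt0 g u; rewrite /wt (Lg u ug) expr0z mulr1 -/wt -/N.
  by rewrite /trivial_abs asboolF //; exact/eqP.
have Np : N (p d) = 2 by exact: pnorm.
rewrite iter_evalS => h; apply/eqP; apply: contrapT => /negP a0.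
have sa : (0 < size (a : {poly iter_poly K d}))%N by rewrite size_poly_gt0.
move: h; rewrite -(prednK sa) big_ord_recr /= addrC => h.
have lead : iter_eval p d (lead_coef (a : {poly iter_poly K d})) != 0.
  by apply/eqP => /IH/eqP; rewrite lead_coef_eq0 (negPf a0).
have := congr1 N h; rewrite (mnorm0 hN) (mnorm_addl hN).
  rewrite (mnormM hN) (mnormX hN) Np N1 // mul1r => /eqP.
  by rewrite expf_eq0 pnatr_eq0 andbF.
have Nl : N (iter_eval p d (a : {poly iter_poly K d})`_(size (a : {poly iter_poly K d})).-1 *
    p d ^+ (size (a : {poly iter_poly K d})).-1) = 2 ^+ (size (a : {poly iter_poly K d})).-1.
  by rewrite (mnormM hN) (mnormX hN) Np N1 // mul1r.
rewrite Nl; apply: (mnorm_sum_lt hN) => [|i _ _]; first by rewrite exprn_gt0 ?ltr0n.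
rewrite (mnormM hN) (mnormX hN) Np.
have [->|/N1 ->] := eqVneq (iter_eval p d (a : {poly iter_poly K d})`_i) 0.
  by rewrite (mnorm0 hN) mul0r exprn_gt0 ?ltr0n.
by rewrite mul1r ltr_eXn2l ?ltr1n.
Qed.

Definition forms_mx La : 'M[int]_(n, size La) := \matrix_(i, j) (La`_j) 0 i.

Lemma forms_mx_dot La (x : 'rV[int]_n) (j : 'I_(size La)) :
  (x *m forms_mx La) 0 j = dot x La`_j.
Proof. by rewrite mxE /dot; apply: eq_bigr => i _; rewrite mxE. Qed.

Definition lat_mx La : 'M[int]_(n, e + size La) := row_mx E (forms_mx La).

Lemma lat_mxP La u : lat v La u <-> v u *m lat_mx La = 0.
Proof.
rewrite mul_mx_row (embP hv); split=> [h|].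
  rewrite (_ : v u *m forms_mx La = 0) ?row_mx0 //; apply/rowP => j.
  by rewrite forms_mx_dot h ?mem_nth // mxE.
rewrite -row_mx0 => /eq_row_mx[_ h] t tL.
have tl : (index t La < size La)%N by rewrite index_mem.
have := congr1 (fun x : 'rV_(size La) => x 0 (Ordinal tl)) h.
by rewrite forms_mx_dot /= nth_index // mxE.
Qed.

(** Applies [kernel_basis] to the equations [E] of the lattice together with the forms in [La]; the
    columns of [V] are dual to the basis. *)
Lemma lat_basis La : exists r (b : 'I_r -> S) (V : 'M[int]_(n, r)),
  [/\ forall i, lat v La (b i), forall i, v (b i) *m V = delta_mx 0 i,
      forall u, lat v La u -> v u = \sum_i v (b i) *~ (v u *m V) 0 i &
      (n <= r + \rank (map_mx intr (lat_mx La) : 'M[rat]_(n, e + size La)))%N].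
Proof.
have [r [U [V [UM UV hU hr]]]] := kernel_basis (lat_mx La).
have [b hb] : exists b : 'I_r -> S, forall i, v (b i) = row i U.
  have h (i : 'I_r) : exists u, v u = row i U.
    apply: (emb_surj hv); move: UM; rewrite mul_mx_row -row_mx0 => /eq_row_mx[UE _].
    by rewrite -row_mul UE row0.
  by have [b hb] := choice h; exists b.
exists r, b, V; split=> // [i|i|u Lu].
- by apply/lat_mxP; rewrite hb -row_mul UM row0.
- by rewrite hb -row_mul UV row1.
- rewrite [LHS]hU; last exact/lat_mxP.
  apply/rowP => j; rewrite mxE summxE; apply: eq_bigr => i _.
  by rewrite hb -scaler_int !mxE intz.
Qed.

Section Basis.
Variables (La : seq 'rV[int]_n) (r : nat) (b : 'I_r -> S) (V : 'M[int]_(n, r)).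
Hypotheses (Lb : forall i, lat v La (b i)) (bV : forall i, v (b i) *m V = delta_mx 0 i).
Hypothesis bgen : forall u, lat v La u -> v u = \sum_i v (b i) *~ (v u *m V) 0 i.

(** Induction on the sum of the absolute values of the coordinates. *)
Lemma lat_ind (Q : S -> Prop) : Q 0 ->
  (forall u i, lat v La u -> Q u -> Q (u + b i) /\ Q (emb_sub v u (b i))) ->
  forall u, lat v La u -> Q u.
Proof.
move=> Q0 Qb; pose k u i := (v u *m V) 0 i.
suff h m u : lat v La u -> (\sum_i `|k u i|%N <= m)%N -> Q u by move=> u Lu; exact: h.
elim: m u => [|m IH] u Lu hm.
  suff -> : u = 0 by [].
  apply: (emb_inj hv); rewrite (emb0 hv) bgen // big1 // => i _.
  move: hm; rewrite leqn0 sum_nat_eq0 => /forallP/(_ i)/=.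
  by rewrite absz_eq0 -/(k u i) => /eqP ->; rewrite mulr0z.
have [[i ki]|hk] := pselect (exists i, k u i != 0); last first.
  apply: IH => //; rewrite big1 // => i _; apply/eqP; rewrite absz_eq0; apply/negPn/negP => ki.
  by apply: hk; exists i.
have kD w w' j : k (w + w') j = k w j + k w' j by rewrite /k (embD hv) mulmxDl mxE.
have kB w w' j : k (emb_sub v w w') j = k w j - k w' j.
  by rewrite /k (emb_subE hv) mulmxBl !mxE.
have kb j : k (b i) j = (j == i)%:R by rewrite /k bV mxE eqxx.
have less (u' : S) : (forall j, j != i -> k u' j = k u j) -> (`|k u' i| < `|k u i|)%N ->
    (\sum_j `|k u' j| <= m)%N.
  move=> h1 h2; rewrite -ltnS; apply: leq_trans hm; rewrite (bigD1 i) //= [X in (_ < X)%N](bigD1 i) //=.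
  by rewrite (eq_bigr (fun j => `|k u j|%N)) ?ltn_add2r // => j /h1 ->.
have [kpos|kneg] := lerP 0 (k u i).
  rewrite -(emb_subK hv u (b i)); have L' := lat_sub hv Lu (Lb i).
  apply: (proj1 (Qb _ i L' _)); apply: IH => //; apply: less => [j /negPf ji|].
    by rewrite kB kb ji subr0.
  by rewrite kB kb eqxx; move: ki kpos => /eqP; lia.
have L' := latD hv Lu (Lb i).
have -> : u = emb_sub v (u + b i) (b i).
  by apply: (emb_inj hv); rewrite (emb_subE hv) (embD hv) addrK.
apply: (proj2 (Qb _ i L' _)); apply: IH => //; apply: less => [j /negPf ji|].
  by rewrite kD kb ji addr0.
by rewrite kD kb eqxx; move: kneg; lia.
Qed.

Definition gen_chi (i : nat) : A := if insub i is Some j then chi K (b j) else 1.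
Definition gen_inv (i : nat) : A := if insub i is Some j then chi K (emb_sub v 0 (b j)) else 1.
(** For x a basis character, K[x, 1/x] is finite over the polynomial ring K[x + 1/x]; the latter
    serves as base ring in [domination]. Indices from [r] on only get a default value. *)
Definition gen_sym (i : nat) : A := gen_chi i + gen_inv i.
Local Notation iota := (iter_eval gen_sym r).

Lemma gen_chiE (i : 'I_r) : gen_chi i = chi K (b i).
Proof. by rewrite /gen_chi valK. Qed.

Lemma gen_invE (i : 'I_r) : gen_inv i = chi K (emb_sub v 0 (b i)).
Proof. by rewrite /gen_inv valK. Qed.

Lemma gen_mulV (i : 'I_r) : gen_chi i * gen_inv i = 1.
Proof. by rewrite gen_chiE gen_invE (chi_mul_opp hv). Qed.

Lemma supported_gen_sym (L : set S) (i : 'I_r) : L (b i) -> L (emb_sub v 0 (b i)) -> L 0 ->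
  (forall u w, L u -> L w -> L (u + w)) -> supported L (gen_sym i).
Proof.
move=> L1 L2 L0 LD; have sL := supported_subring K L0 LD.
rewrite /gen_sym; apply: (subringD sL).
  by rewrite gen_chiE; exact: supported_chi.
by rewrite gen_invE; exact: supported_chi.
Qed.

Lemma KL_scalar (L : set S) (c : K) : L 0 -> supported L (c%:A : A).
Proof. by move=> L0; apply: supported_scale; rewrite -(chi0 K S); exact: supported_chi. Qed.

Lemma KL_iota a : KL La (iota a).
Proof.
apply: (iter_eval_sub (KL_subring hv K La)) => [c|i ir]; first by apply: KL_scalar; exact: (lat0 hv).
apply: (@supported_gen_sym _ (Ordinal ir)); rewrite //.
- by apply: (lat_sub hv) => //; exact: (lat0 hv).
- exact: (lat0 hv).
- exact: (latD hv).
Qed.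

(* K[lat La] is spanned by the squarefree monomials in the gen_chi i, as
   x^2 = (x + x^-1) x - 1. *)
Lemma finite_over_iota I : ideal I -> finite_over (KL La) (range iota) I.
Proof.
move=> iI; have sB := range_subring iota.
pose L (s : {set 'I_r}) : A := \prod_(i in s) gen_chi i.
pose M (a : A) := exists2 c : {set 'I_r} -> A, forall s, range iota (c s) & a = \sum_s c s * L s.
have ML s : M (L s).
  exists (fun s' => if s' == s then 1 else 0) => [s'|].
    by case: eqP => _; [case: sB|exact: (subring0 sB)].
  by rewrite (bigD1 s) //= eqxx mul1r big1 ?addr0 // => s' /negPf ->; rewrite mul0r.
have M0 : M 0.
  by exists (fun=> 0) => [s|]; [exact: (subring0 sB)|rewrite big1 // => s _; rewrite mul0r].
have MD a a' : M a -> M a' -> M (a + a').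
  move=> [c hc ->] [c' hc' ->]; exists (fun s => c s + c' s) => [s|]; first exact: (subringD sB).
  by rewrite -big_split; apply: eq_bigr => s _; rewrite mulrDl.
have MM x a : range iota x -> M a -> M (x * a).
  move=> hx [c hc ->]; exists (fun s => x * c s) => [s|]; first exact: (subringM sB).
  by rewrite mulr_sumr; apply: eq_bigr => s _; rewrite mulrA.
have MN a : M a -> M (- a).
  by move=> Ma; rewrite -mulN1r; apply: MM => //; apply: (subringN sB); case: sB.
have symR (i : 'I_r) : range iota (gen_sym i) by exact: iter_eval_range.
have Mgen (i : 'I_r) a : M a -> M (gen_chi i * a).
  move=> [c hc ->]; rewrite mulr_sumr; apply: (big_ind M) => // s _.
  rewrite mulrCA; apply: (MM _ _) => //; have [si|si] := boolP (i \in s); last first.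
    have -> : gen_chi i * L s = L (i |: s) by rewrite /L big_setU1.
    exact: ML.
  have -> : gen_chi i * L s = gen_sym i * L s - L (s :\ i).
    rewrite /L (big_setD1 i) //= /gen_sym mulrDl; set P := \prod_(j in _) _.
    by rewrite [gen_inv i * (_ * P)]mulrA [gen_inv i * _]mulrC gen_mulV mul1r addrK.
  by apply: MD; [apply: MM|apply: MN].
have Minv (i : 'I_r) a : M a -> M (gen_inv i * a).
  move=> Ma; have -> : gen_inv i * a = gen_sym i * a - gen_chi i * a.
    by rewrite /gen_sym mulrDl addrC addKr.
  by apply: MD; [exact: MM|apply/MN/Mgen].
have Mchi u : lat v La u -> M (chi K u).
  apply: (lat_ind (Q := fun u => M (chi K u))) => [|u' i _ Mu].
    rewrite chi0; have -> : 1 = L (finset.set0) by rewrite /L big_set0.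
    exact: ML.
  split; first by rewrite addrC chiD -gen_chiE; exact: Mgen.
  have -> : emb_sub v u' (b i) = emb_sub v 0 (b i) + u'.
    by apply: (emb_inj hv); rewrite (embD hv) !(emb_subE hv) (emb0 hv) sub0r addrC.
  by rewrite chiD -gen_invE; exact: Minv.
exists #|{set 'I_r}|, (fun k => L (enum_val k)) => a La_a.
have [c hc ->] : M a.
  rewrite (ma_sum a) big_seq; apply: (big_ind M) => // u ua.
  rewrite -mulr_algl; apply: MM; first by exists (iter_polyC K r (mcoeff u a)); rewrite ?iter_evalC.
  by apply: Mchi; apply: La_a; rewrite mcoeff_neq0.
exists (fun k => c (enum_val k)) => //.
rewrite (eq_bigl (mem {set 'I_r})) // big_enum_val subrr; by case: iI.
Qed.

(** For the weight 2^deg in the coordinate of index d, the generator x + 1/x of index d has Gauss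
    norm 2, and the earlier ones are of degree 0. *)
Lemma iota_inj : forall d, (d <= r)%N -> forall a, iter_eval gen_sym d a = 0 -> a = 0.
Proof.
pose deg (d : nat) u : int := if insub d is Some k then (v u *m V) 0 (k : 'I_r) else 0.
have degE (k : 'I_r) u : deg k u = (v u *m V) 0 k by rewrite /deg valK.
have degb (k i : 'I_r) : deg k (b i) = (i == k)%:R by rewrite degE bV mxE eqxx eq_sym.
have degbV (k i : 'I_r) : deg k (emb_sub v 0 (b i)) = - (i == k)%:R.
  by rewrite degE (emb_subE hv) (emb0 hv) sub0r mulNmx bV !mxE eqxx eq_sym.
have degD d u w : deg d (u + w) = deg d u + deg d w.
  by rewrite /deg; case: insub => [k|]; rewrite ?addr0 // (embD hv) mulmxDl mxE.
have tabs := trivial_abs_mnorm R K.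
apply: (iter_eval_inj degD) => [d i dr id|d dr].
  have ir : (i < r)%N by exact: ltn_trans dr.
  have neq : (Ordinal ir == Ordinal dr) = false.
    by apply/eqP => /(congr1 val) /= h; move: id; rewrite /= h ltnn.
  have d1 : deg d (b (Ordinal ir)) = 0 by rewrite -[d]/(val (Ordinal dr)) degb neq.
  have d2 : deg d (emb_sub v 0 (b (Ordinal ir))) = 0.
    by rewrite -[d]/(val (Ordinal dr)) degbV neq oppr0.
  have d3 : deg d 0 = 0 by rewrite -[d]/(val (Ordinal dr)) degE (emb0 hv) mul0mx mxE.
  apply: (@supported_gen_sym _ (Ordinal ir)) => //= u w.
  by rewrite degD => -> ->; rewrite addr0.
rewrite -[d]/(val (Ordinal dr)).
pose wt u : R := 2 ^ deg (Ordinal dr) u.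
have wt_gt0 u : 0 < wt u by rewrite exprz_gt0.
have hN : mnorm (gaussw (@trivial_abs R K) wt : A -> R).
  apply: (gaussw_mnorm hv tabs (@trivial_abs0 R K) wt_gt0) => [|u w].
    by rewrite /wt degE (emb0 hv) mul0mx mxE expr0z.
  by rewrite /wt degD expfzDr.
have Nchi u : gaussw (@trivial_abs R K) wt (chi K u) = wt u.
  by rewrite -[chi K u]scale1r (gaussw_scale_chi tabs) // (mnorm1 tabs) mul1r.
have d1 : wt (b (Ordinal dr)) = 2 by rewrite /wt degb eqxx expr1z.
have dV : wt (emb_sub v 0 (b (Ordinal dr))) = 2^-1.
  by rewrite /wt degbV eqxx -[- true%:R]/(- (1 : int)) -invr_expz expr1z.
rewrite /gen_sym gen_chiE gen_invE (mnorm_addl hN) !Nchi d1 ?dV //.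
by rewrite (@lt_trans _ _ 1) ?ltr1n // invf_lt1 ?ltr0n // ltr1n.
Qed.

End Basis.

End Normalization.

(** * Domination on a torus *)

Lemma mnorm_le_coefs (R : realType) (A : comNzRingType) (x : A -> R) (p : {poly A}) a M :
  mnorm x -> p \is monic -> x p.[a] = 0 -> 1 <= M -> (forall i, x p`_i <= M) -> x a <= M.
Proof.
move=> hx pm xp M1 Mp; rewrite leNgt; apply/negP => Ma.
have a1 : 1 < x a by exact: le_lt_trans Ma.
have a0 : 0 < x a by exact: lt_trans a1.
have sp : (0 < size p)%N by rewrite size_poly_gt0 monic_neq0.
move: xp; rewrite horner_coef -(prednK sp) big_ord_recr /= -/(lead_coef p) (monicP pm) mul1r addrC.
rewrite (mnorm_addl hx) (mnormX hx); first by move=> /eqP; rewrite expf_eq0 (gt_eqF a0) andbF.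
apply: (mnorm_sum_lt hx) => [|i _ _]; first exact: exprn_gt0.
rewrite (mnormM hx) (mnormX hx); apply: (@lt_le_trans _ _ (x a ^+ i.+1)).
  by rewrite exprS ltr_pM2r ?exprn_gt0 //; exact: le_lt_trans Ma.
by rewrite ler_eXn2l.
Qed.

(** The value at an integral element is bounded by 1 and the values at the coefficients of its
    equation. *)
Lemma mnorm_integral_bounded (R : realType) (A : comNzRingType) (B P : set A)
    (DD : set (A -> R)) : subring B -> ideal P -> finite_over setT B P ->
  (forall x, DD x -> mnorm x /\ forall a, P a -> x a = 0) ->
  (forall b, B b -> exists M, forall x, DD x -> x b <= M) ->
  forall a, exists M, forall x, DD x -> x a <= M.
Proof.
move=> sB iP fB DDm DDB a; have [p [pm Bp Pp]] := finite_over_monic sB iP fB a.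
have h i : exists M, forall x, DD x -> x p`_i <= M by exact: DDB.
have [M hM] := choice h.
exists (Num.max 1 (\big[Num.max/0]_(i < size p) M i)) => x DDx; have [hx xP] := DDm x DDx.
apply: (mnorm_le_coefs hx pm); rewrite ?xP ?le_max ?lexx // => i.
rewrite le_max; have [ip|ip] := ltnP i (size p); last first.
  by rewrite nth_default // (mnorm0 hx) ler01.
apply/orP; right; apply: (le_trans (hM i x DDx)).
exact: (le_bigmax _ (fun i : 'I_(size p) => M i) (Ordinal ip)).
Qed.

(** The second and third conditions express the compactness of [DD]. Such a set is repeatedly cut
    down by [dominating_refine], which prescribes further values of [z] and keeps the domination. *)
Record dominating (R : realType) (A : comNzRingType) (z : A -> R) (DD : set (A -> R)) : Prop := {
  dom_mnorm : forall x, DD x -> mnorm x;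
  dom_bounded : forall a, exists M, forall x, DD x -> x a <= M;
  dom_closed : limit_closed DD;
  dom_ge : forall g, exists2 x, DD x & z g <= x g }.

Lemma dominating_refine (R : realType) (A : comNzRingType) (z : A -> R) DD (E : set A) :
  mnorm z -> dominating z DD -> (forall e, E e -> 0 < z e) ->
  (forall e x, E e -> DD x -> x e <= z e) ->
  dominating z (DD `&` [set x | forall e, E e -> x e = z e]).
Proof.
move=> hz [Dm Db Dc Dg] Ez Ele; split=> [x []|a||g].
- by move=> /Dm.
- by have [M hM] := Db a; exists M => x [/hM].
- by apply: limit_closedI Dc _; exact: limit_closed_eq.
- have [x [DDx xE zg]] := refine Dm hz Db Dc Dg Ez Ele g; by exists x.
Qed.

Lemma mnorm_scale (R : realType) (K : fieldType) (A : comAlgType K) (x : A -> R) c a :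
  mnorm x -> x (c *: a) = x c%:A * x a.
Proof. by move=> hx; rewrite -(mnormM hx) mulr_algl. Qed.

Section Lattice.
Variables (n e : nat) (S : nmodType) (v : S -> 'rV[int]_n) (E : 'M[int]_(n, e)).
Hypothesis hv : lattice_emb v E.
Variables (R : realType) (K : fieldType) (abs : K -> R).
Hypotheses (habs : mnorm abs) (abs0 : forall c, abs c = 0 -> c = 0).
Local Notation A := (monoid_algebra K S).
Local Notation KL := (@KL n S v K).
Implicit Types (La : seq 'rV[int]_n) (u w : S) (P Q : set A) (z x c : A -> R).

Lemma tower_iota_finite La P r (b : 'I_r -> S) V : ideal P -> tower v P La ->
  (forall i, lat v La (b i)) ->
  (forall i, v (b i) *m V = delta_mx 0 i) ->
  (forall u, lat v La u -> v u = \sum_i v (b i) *~ (v u *m V) 0 i) ->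
  finite_over setT (range (iter_eval (gen_sym v K b) r)) P.
Proof.
move=> iP tP Lb bV bgen.
apply: finite_over_trans (tower_finite hv iP tP) _ => //; first exact: range_subring.
exact: (finite_over_iota hv Lb bV bgen iP).
Qed.

Lemma iota_mod_inj La P r (b : 'I_r -> S) V : (forall i, lat v La (b i)) ->
  (forall i, v (b i) *m V = delta_mx 0 i) ->
  (forall f, P f -> KL La f -> f = 0) ->
  forall a, P (iter_eval (gen_sym v K b) r a) -> a = 0.
Proof.
move=> Lb bV P0 a Pa; apply: (iota_inj hv R bV (leqnn r)).
by apply: P0 => //; exact: (KL_iota hv Lb).
Qed.

(** Noether normalization: a tower that cannot be prolonged exists because [tower_size] bounds its
    length by [n]. *)
Lemma exists_full_tower P : prime_ideal P -> exists2 La, tower v P La &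
  forall f, P f -> KL La f -> f = 0.
Proof.
move=> [iP P1 _].
suff h m La : tower v P La -> (n - size La <= m)%N ->
    exists2 La, tower v P La & forall f, P f -> KL La f -> f = 0.
  exact: (h _ [::] (tower_nil _ _) (leqnn _)).
elim: m La => [|m IH] La tP hm.
  exists La => // f Pf Lf; apply/eqP/negPn/negP => f0.
  have [t ht] := exists_separating hv (msupp f).
  have tP' : tower v P (t :: La).
    by apply: (@tower_cons _ _ _ _ _ t La f) => // u w; rewrite !mcoeff_neq0; exact: ht.
  have /= := tower_size hv iP P1 tP'; move: hm; lia.
have [|hn] := pselect (forall f, P f -> KL La f -> f = 0); first by exists La.
have [f /not_implyP[Pf /not_implyP[Lf /eqP f0]]] : exists f, ~ (P f -> KL La f -> f = 0).
  by apply: contrapT => /forallNP h; apply: hn => f; apply: contrapT; exact: h.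
have [t ht] := exists_separating hv (msupp f).
apply: (IH (t :: La)); last by move: hm => /=; lia.
by apply: (@tower_cons _ _ _ _ _ t La f) => // u w; rewrite !mcoeff_neq0; exact: ht.
Qed.

(* The points with kernel exactly Q are dense among those containing Q in their
   kernel: perturb z on a polynomial subring and lift by domination; a product of
   peak functions keeps the lifts close to z. *)
Lemma density Q z (F0 : seq A) d : prime_ideal Q -> mnorm z ->
  (forall a, Q a -> z a = 0) -> (forall c : K, z c%:A = abs c) -> 0 < d ->
  exists x, [/\ mnorm x, forall a, x a = 0 <-> Q a, forall c : K, x c%:A = abs c &
    forall f, f \in F0 -> `|x f - z f| < d].
Proof.
move=> pQ hz zQ zK d0; have [iQ Q1 QM] := pQ.
have [La tQ Q0] := exists_full_tower pQ.
have [r [b [V [Lb bV bgen _]]]] := lat_basis hv La.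
pose iota := iter_eval (gen_sym v K b) r.
have fin : finite_over setT (range iota) Q := tower_iota_finite iQ tQ Lb bV bgen.
have inj a : Q (iota a) -> a = 0 by exact: iota_mod_inj Q0 a.
have sB := range_subring iota.
pose y := z \o iota; have hy : mnorm y by exact: mnorm_comp.
have yK (c : K) : y (iter_polyC K r c) = abs c by rewrite /y /= iter_evalC.
have [|D hD] := norm_approximation hy; first by move=> c; rewrite yK; exact: abs0.
pose CC := [set c : A -> R | [/\ mnorm c, forall a, Q a -> c a = 0 & forall a, c (iota a) = y a]].
have CCz : CC z by [].
have peaks s : exists g, [/\ 0 < z g, forall c, CC c -> c g <= z g &
    forall c, CC c -> c g = z g -> c s = z s].
  have [p [pm Bp Qp]] := finite_over_monic sB iQ fin s.
  apply: (peak (p := p)) => // [c [] //|c i [_ _ cy]|c [_ cQ _]]; last exact: cQ.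
  by have [a _ <-] := Bp i; rewrite cy.
(* Domination is only requested at this product; in the limit it forces equality at each factor. *)
have [g hg] := choice peaks; pose G := \prod_(s <- F0) g s.
have lift k : exists x, [/\ mnorm x, forall a, Q a -> x a = 0, forall a, x (iota a) = D k a & z G <= x G].
  have [Dm D0 yD _ _] := hD k.
  apply: (domination G pQ inj fin _ Dm D0 hz zQ) => //.
  exact/poly_cic/iter_poly_cic.
have [x hx] := choice lift.
pose F : set_system (A -> R) := x @ \oo.
have Fm : F [set x' | mnorm x'] by exists 0%N => // k _ /=; case: (hx k).
have [a|U [c [uU FU hc lc]]] := @exists_limit R A F _ Fm.
  have [||M hM] := @mnorm_integral_bounded R A (range iota) Q (range x) sB iQ fin _ _ a.
  - by move=> _ [k _ <-]; case: (hx k).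
  - move=> _ [b0 _ <-]; exists (Num.max (y b0) (D 0%N b0)) => _ [k _ <-].
    have [_ _ -> _] := hx k; have [_ _ _ _ h] := hD k.
    rewrite (le_trans (h b0)) // ge_max !le_max lexx /=; apply/orP; right.
    have [D0m _ _ _ _] := hD 0%N.
    by rewrite ler_piMl ?(mnorm_ge0 D0m) // invf_le1 ?ler1n ?ltr0Sn.
  by exists M; exists 0%N => // k _ /=; apply: hM; exists k.
have Uall (T : set (A -> R)) : (forall k, T (x k)) -> U T.
  by move=> h; apply: FU; exists 0%N => // k _ /=.
have CCc : CC c.
  split=> // [a Qa|a].
    by apply: (limit_closed_eq (W := Q) (w := fun=> 0) uU _ hc lc Qa); apply: Uall => k; case: (hx k).
  apply/le_anti/andP; split; last first.
    apply: (limit_ge _ lc); apply: Uall => k /=.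
    by have [_ _ -> _] := hx k; case: (hD k).
  apply: le_gtP => m ym; apply: (limit_le _ lc); apply: FU.
  have m0 : 0 < m by rewrite (le_lt_trans _ ym) // mnorm_ge0.
  have [D0m _ _ _ _] := hD 0%N.
  (* From this index on the error D 0 a / (k + 1) is at most [m]. *)
  exists (Num.truncn (D 0%N a / m)).+1 => // k /= hk; have [_ _ -> _] := hx k.
  have [_ _ _ _ h] := hD k; rewrite (le_trans (h a)) // ge_max (ltW ym) /=.
  rewrite mulrC ler_pdivrMr ?ltr0Sn // mulrC -ler_pdivrMr //.
  rewrite (le_trans (ltW (truncnS_gt _))) // ler_nat.
  by rewrite (leq_trans hk).
have cg s : s \in F0 -> c s = z s.
  move=> sF; have [_ _ ] := hg s; apply=> //; apply/le_anti.
  have [zg0 hcg _] := hg s; rewrite (hcg c CCc) /= leNgt; apply/negP => lt.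
  have zcG : z G <= c G by apply: (limit_ge _ lc); apply: Uall => k; case: (hx k).
  suff : c G < z G by rewrite ltNge zcG.
  rewrite /G (big_rem s) //= (mnormM hc) (mnormM hz).
  have rest : c (\prod_(t <- rem s F0) g t) <= z (\prod_(t <- rem s F0) g t).
    rewrite (mnorm_prod hc) (mnorm_prod hz); apply: ler_prod => t _.
    by rewrite mnorm_ge0 //=; have [_ ->] := hg t.
  have zrest : 0 < z (\prod_(t <- rem s F0) g t).
    by rewrite (mnorm_prod hz) prodr_gt0 // => t _; case: (hg t).
  apply: (@le_lt_trans _ _ (c (g s) * z (\prod_(t <- rem s F0) g t))).
    by apply: ler_wpM2l => //; exact: mnorm_ge0.
  by rewrite ltr_pM2r.
have Unear : U [set x' | forall f, f \in F0 -> `|x' f - z f| < d].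
  elim: F0 {G lift x hx F Fm FU Uall} cg => [|s F0 IH] cg; first by apply: filterS filterT.
  have h1 := limit_near s (@filter_filter _ _ (@ultra_proper _ _ uU)) lc d0.
  have h2 : U [set x' | forall f, f \in F0 -> `|x' f - z f| < d].
    by apply: IH => f fF; apply: cg; rewrite inE fF orbT.
  apply: filterS2 h1 h2 => x' /= h1 h2 f; rewrite inE => /predU1P[->|/h2 //].
  by rewrite -(cg s) ?mem_head.
have Urange : U (range x) by apply: Uall => k; exists k.
have [_ [[k _ <-] hk]] := filter_ex (filterI Urange Unear).
have [hxk xQ xi _] := hx k; exists (x k); split=> // [a|a]; last first.
  rewrite -(iter_evalC (gen_sym v K b) r) -/iota xi.
  by have [_ _ _ -> _] := hD k; rewrite yK.
split; last exact: xQ.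
(* The kernel of [x k] contains [Q] and meets the polynomial subring in 0, since [D k] is a norm;
   hence it equals [Q]. *)
apply: (prime_incomparable R sB pQ (mnorm_ker_prime hxk) xQ fin).
move=> _ [a0 _ <-] /=; rewrite xi; have [_ D0 _ _ _] := hD k => /D0 ->.
by rewrite rmorph0; case: iQ.
Qed.

Lemma chi_gt0 x u : mnorm x -> 0 < x (chi K u).
Proof.
move=> hx; rewrite lt_def (mnorm_ge0 hx) andbT; apply/eqP => h.
have := mnorm1 hx; rewrite -(chi_mul_opp hv K u) (mnormM hx) h mul0r => /esym/eqP.
by rewrite oner_eq0.
Qed.

Lemma chi_opp x u : mnorm x -> x (chi K (emb_sub v 0 u)) = (x (chi K u))^-1.
Proof.
move=> hx; have u0 := chi_gt0 u hx.
by apply: (mulfI (lt0r_neq0 u0)); rewrite -(mnormM hx) (chi_mul_opp hv) (mnorm1 hx) divff ?gt_eqF.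
Qed.

(** The quotient of the values at characters is itself a character, trivial where [t] vanishes,
    hence a power of [t]. A root of order k + 1 is extracted because [t] need not take the value 1
    on the lattice. *)
Lemma char_ratio x z La t u0 k : mnorm x -> mnorm z ->
  (forall u, lat v (t :: La) u -> x (chi K u) = z (chi K u)) ->
  lat v La u0 -> dot (v u0) t = k.+1%:Z ->
  exists2 th, 0 < th & forall u, lat v La u -> x (chi K u) = z (chi K u) * th ^ dot (v u) t.
Proof.
move=> hx hz xz Lu0 u0t; pose rho u := x (chi K u) / z (chi K u).
have rho_gt0 u : 0 < rho u by rewrite divr_gt0 ?chi_gt0.
have rhoD u w : rho (u + w) = rho u * rho w.
  by rewrite /rho chiD (mnormM hx) (mnormM hz) mulrACA -invfM.
have rho1 u : lat v (t :: La) u -> rho u = 1.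
  by move=> /xz h; rewrite /rho h divff // gt_eqF ?chi_gt0.
have rho0 : rho 0 = 1 by apply: rho1; exact: (lat0 hv).
have rhoMn u m : rho (u *+ m) = rho u ^+ m.
  by elim: m => [|m IH]; rewrite ?mulr0n ?expr0 // mulrS exprS rhoD IH.
have vMn u m : v (u *+ m) = v u *+ m.
  by elim: m => [|m IH]; rewrite ?mulr0n ?(emb0 hv) // !mulrS (embD hv) IH.
have dotMn (y : 'rV[int]_n) m : dot (y *+ m) t = dot y t *+ m.
  by elim: m => [|m IH]; rewrite ?mulr0n ?dot0l // !mulrS dotDl IH.
have sc (y : int) m : y *+ m = y * m%:Z by rewrite -mulr_natr natz.
have LMn u m : lat v La u -> lat v La (u *+ m).
  move=> Lu; elim: m => [|m IH]; first by rewrite mulr0n; exact: (lat0 hv).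
  by rewrite mulrS; exact: (latD hv).
have [th th0 thk] := root_exists k (rho_gt0 u0).
exists th => // u Lu.
suff h : rho u = th ^ dot (v u) t.
  by rewrite -h /rho mulrC divfK // gt_eqF ?chi_gt0.
apply: (@pexpIrn _ k.+1) => //; rewrite ?nnegrE ?ltW ?exprz_gt0 //.
rewrite -rhoMn; case ut: (dot (v u) t) => [m|m].
  have Lw : lat v (t :: La) (emb_sub v (u *+ k.+1) (u0 *+ m)).
    apply/lat_cons; split; last by apply: (lat_sub hv); exact: LMn.
    by rewrite (emb_subE hv) dotBl !vMn !dotMn ut u0t !sc mulrC subrr.
  rewrite -(emb_subK hv (u *+ k.+1) (u0 *+ m)) rhoD rho1 // mul1r rhoMn -thk.
  by rewrite -exprnP -!exprM mulnC.
have Lw : lat v (t :: La) (u *+ k.+1 + u0 *+ m.+1).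
  apply/lat_cons; split; last by apply: (latD hv); exact: LMn.
  by rewrite (embD hv) dotDl !vMn !dotMn ut u0t !sc NegzE mulNr mulrC addNr.
have := rho1 _ Lw; rewrite rhoD => h; rewrite NegzE -invr_expz -exprnP.
have rm : rho (u0 *+ m.+1) = (th ^+ m.+1) ^+ k.+1 by rewrite rhoMn -thk -!exprM mulnC.
have thn0 : (th ^+ m.+1) ^+ k.+1 != 0 by rewrite !expf_neq0 // gt_eqF.
by rewrite exprVn; apply: (mulIf thn0); rewrite -{1}rm h mulVf.
Qed.

(* Descends the tower one form at a time: the peak functions of each relation
   force the remaining freedom th in the values of the characters to be 1. *)
Lemma tower_characters P La z : prime_ideal P -> tower v P La ->
  mnorm z -> (forall a, P a -> z a = 0) -> (forall c : K, z c%:A = abs c) ->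
  forall DD, dominating z DD ->
  (forall x, DD x -> [/\ forall a, P a -> x a = 0, forall c : K, x c%:A = abs c &
    forall u, lat v La u -> x (chi K u) = z (chi K u)]) ->
  forall g, exists x, [/\ DD x, forall u, x (chi K u) = z (chi K u) & z g <= x g].
Proof.
move=> [iP P1 _] tP hz zP zK; elim: tP => [|t La' f tP IH Pf f0 Lf sep] DD domD DDP g.
  have [x DDx xg] := dom_ge domD g; have [_ _ xu] := DDP x DDx.
  by exists x; split=> // u; exact: xu.
have [u0 [k [Lu0 u0k]]] : exists u0 k, lat v La' u0 /\ dot (v u0) t = k.+1%:Z.
  have [u [w [uw uf wf]]] := ideal_two_terms hv iP P1 Pf f0.
  have neq : dot (v u) t != dot (v w) t by apply: contraNneq uw => h; apply/eqP; exact: sep.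
  have [lt|gt|eq] := ltrgtP (dot (v u) t) (dot (v w) t); last by rewrite eq eqxx in neq.
    exists (emb_sub v w u), `|dot (v w) t - dot (v u) t|%N.-1; split.
      by apply: (lat_sub hv); exact: Lf.
    by rewrite (emb_subE hv) dotBl; move: lt; lia.
  exists (emb_sub v u w), `|dot (v u) t - dot (v w) t|%N.-1; split.
    by apply: (lat_sub hv); exact: Lf.
  by rewrite (emb_subE hv) dotBl; move: gt; lia.
pose a (j : msupp f) : A := mcoeff (val j) f *: chi K (val j).
pose l (j : msupp f) := dot (v (val j)) t.
pose al (j : msupp f) := abs (mcoeff (val j) f) * z (chi K (val j)).
have fj (j : msupp f) : mcoeff (val j) f != 0 by rewrite mcoeff_neq0; exact: fsvalP.
have fE : f = \sum_j a j by rewrite [LHS]ma_sum big_seq_fsetE.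
have al_gt0 j : 0 < al j.
  by rewrite mulr_gt0 ?chi_gt0 // lt_def (mnorm_ge0 habs) andbT; apply/eqP => /abs0/eqP; exact/negP.
have inj1 : injective l by move=> i j h; apply: val_inj; apply: sep h.
have inj2 : injective (fun j => - l j) by move=> i j /oppr_inj /inj1.
have [j0] : exists j0 : msupp f, true.
  have [u [_ [_ uf _]]] := ideal_two_terms hv iP P1 Pf f0.
  by rewrite mcoeff_neq0 in uf; exists [` uf]%fset.
move=> _; have al_ge0 j : 0 <= al j by exact: ltW.
have [j1 [H1 [_ h1]]] := graded_peak a inj1 al_ge0 (al_gt0 j0).
have [j2 [H2 [_ h2]]] := graded_peak a inj2 al_ge0 (al_gt0 j0).
(* Dividing by the character of the dominant term makes the bounds independent of th. *)
pose e1 := H1 * chi K (emb_sub v 0 (val j1)); pose e2 := H2 * chi K (emb_sub v 0 (val j2)).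
have hval x : DD x -> exists2 th : R, 0 < th & (forall u, lat v La' u ->
      x (chi K u) = z (chi K u) * th ^ dot (v u) t) /\
    [/\ x e1 <= abs (mcoeff (val j1) f), x e2 <= abs (mcoeff (val j2) f),
      x e1 = abs (mcoeff (val j1) f) -> th <= 1 & x e2 = abs (mcoeff (val j2) f) -> 1 <= th].
  move=> DDx; have [xP xK xu] := DDP x DDx; have hx := dom_mnorm domD DDx.
  have [th th0 thE] := char_ratio hx hz xu Lu0 u0k; exists th => //; split=> //.
  have xj j : x (chi K (val j)) = z (chi K (val j)) * th ^ l j by apply/thE/Lf.
  have xa j : x (a j) = al j * th ^ l j by rewrite /a (mnorm_scale _ _ hx) xK xj mulrA.
  have xs : x (\sum_j a j) = 0 by rewrite -fE xP.
  have thV : 0 < th^-1 by rewrite invr_gt0.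
  have thVE j : th^-1 ^ (- l j) = th ^ l j by rewrite -exprz_inv invrK.
  have [h1a h1b] := h1 x th hx th0 xa xs.
  have [|h2a h2b] := h2 x th^-1 hx thV _ xs; first by move=> j; rewrite thVE xa.
  rewrite thVE in h2a h2b.
  have xj0 j : 0 < x (chi K (val j)) by exact: chi_gt0.
  have alE j : al j * th ^ l j = abs (mcoeff (val j) f) * x (chi K (val j)).
    by rewrite xj /al mulrA.
  have xe H j : x (H * chi K (emb_sub v 0 (val j))) = x H / x (chi K (val j)).
    by rewrite (mnormM hx) chi_opp.
  split.
  - by rewrite xe ler_pdivrMr // -alE.
  - by rewrite xe ler_pdivrMr // -alE.
  - move=> h; apply/h1b; rewrite alE -h xe divfK // gt_eqF //.
  - move=> h; rewrite -invf_le1 //; apply/h2b; rewrite alE -h xe divfK // gt_eqF //.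
have zs : z (\sum_j a j) = 0 by rewrite -fE zP.
have za j : z (a j) = al j * 1 ^ l j by rewrite /a (mnorm_scale _ _ hz) zK exp1rz mulr1.
have za' j : z (a j) = al j * 1 ^ - l j by rewrite za !exp1rz.
have z0 j : z (chi K (val j)) != 0 by rewrite gt_eqF ?chi_gt0.
have ze1 : z e1 = abs (mcoeff (val j1) f).
  have [_ [_ h]] := h1 z 1 hz ltr01 za zs.
  by rewrite /e1 (mnormM hz) chi_opp // h // exp1rz mulr1 /al mulfK.
have ze2 : z e2 = abs (mcoeff (val j2) f).
  have [_ [_ h]] := h2 z 1 hz ltr01 za' zs.
  by rewrite /e2 (mnormM hz) chi_opp // h // exp1rz mulr1 /al mulfK.
have abs_gt0 (j : msupp f) : 0 < abs (mcoeff (val j) f).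
  by rewrite lt_def (mnorm_ge0 habs) andbT; apply/eqP => /abs0/eqP; exact/negP.
pose EE := [set e1; e2].
have dom' : dominating z (DD `&` [set x | forall e, EE e -> x e = z e]).
  apply: (dominating_refine hz domD) => [h|h x].
    by case=> ->; rewrite ?ze1 ?ze2; exact: abs_gt0.
  by case=> -> /hval[th _ [_ [le1 le2 _ _]]]; rewrite ?ze1 ?ze2.
have [x DDx|x [[DDx _] xu zg]] := IH _ dom' _ g; last by exists x.
have [DDx0 xE] := DDx; have [xP xK _] := DDP x DDx0; split=> // u Lu.
have [th th0 [-> // [_ _ t1 t2]]] := hval x DDx0.
have /le_anti -> : th <= 1 <= th.
  by apply/andP; split; [apply: t1; rewrite -ze1|apply: t2; rewrite -ze2]; apply: xE; [left|right].
by rewrite exp1rz mulr1.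
Qed.

(** [domination] controls the values on the polynomial subring only. The characters of a basis of M'
    are recovered by refinement, those of M by [tower_characters], and the Gauss norm on all of
    K[M'] by incomparability, as K[M'] is integral over that subring. *)
Lemma torus_domination P La z g : prime_ideal P -> tower v P La ->
  (forall f, P f -> KL La f -> f = 0) ->
  mnorm z -> (forall a, P a -> z a = 0) -> (forall c : K, z c%:A = abs c) ->
  exists x, [/\ mnorm x, forall a, P a -> x a = 0, forall u, x (chi K u) = z (chi K u),
    forall f, KL La f -> x f = gaussw abs (fun u => z (chi K u)) f & z g <= x g].
Proof.
move=> pP tP P0 hz zP zK; have [iP P1 _] := pP.
have [r [b [V [Lb bV bgen _]]]] := lat_basis hv La.
pose iota := iter_eval (gen_sym v K b) r.
have fin : finite_over setT (range iota) P := tower_iota_finite iP tP Lb bV bgen.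
have inj a : P (iota a) -> a = 0 by exact: iota_mod_inj P0 a.
have iotaL := KL_iota hv Lb : forall a, KL La (iota a).
have wt_gt0 u : 0 < z (chi K u) by exact: chi_gt0.
pose G := gaussw abs (fun u => z (chi K u)) : A -> R.
have hG : mnorm G.
  apply: (gaussw_mnorm hv habs abs0 wt_gt0) => [|u w]; first by rewrite chi0 (mnorm1 hz).
  by rewrite chiD (mnormM hz).
have Gchi u : G (chi K u) = z (chi K u).
  by rewrite -[chi K u in LHS]scale1r /G (gaussw_scale_chi habs) // (mnorm1 habs) mul1r.
have GK (c : K) : G c%:A = abs c.
  by rewrite -(chi0 K S) /G (gaussw_scale_chi habs) // chi0 (mnorm1 hz) mulr1.
pose D := G \o iota; have hD : mnorm D by exact: mnorm_comp.
have D0 a : D a = 0 -> a = 0.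
  by move=> /(gaussw_eq0 habs abs0 wt_gt0) h; apply: inj; rewrite h; case: iP.
have zD a : z (iota a) <= D a by apply: (mnorm_le_gaussw habs wt_gt0) => // u.
pose DD := [set x : A -> R | mnorm x] `&`
  ([set x | forall a, P a -> x a = (fun=> 0) a] `&`
   [set x | forall a, range iota a -> x a = G a]).
have domDD : dominating z DD.
  split=> [x []//|||f].
  - apply: (mnorm_integral_bounded (range_subring iota) iP fin).
      by move=> x [hx [xP _]]; split=> // a /xP.
    by move=> a ra; exists (G a) => x [_ [_ ->]].
  - apply: limit_closedI; first exact: limit_closed_mnorm.
    by apply: limit_closedI; exact: limit_closed_eq.
  - have [|x [hx xP xi xg]] := domination f pP inj fin _ hD D0 hz zP zD.
      exact/poly_cic/iter_poly_cic.
    by exists x => //; split=> //; split=> // _ [a _ <-]; exact: xi.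
(* Of each basis character and its inverse, the one at which [z] is at least 1. There [x] is at most
   [z], because the sum of the two lies in the polynomial subring, where [x] is the Gauss norm. *)
pose ee (i : 'I_r) : A := if 1 <= z (gen_chi K b i) then gen_chi K b i else gen_inv v K b i.
pose EE := [set e' | exists i, e' = ee i].
have zV (x : A -> R) (i : 'I_r) : mnorm x -> x (gen_inv v K b i) = (x (gen_chi K b i))^-1 /\ 0 < x (gen_chi K b i).
  by move=> hx; rewrite gen_invE gen_chiE chi_opp //; split=> //; exact: chi_gt0.
have Ele e' x : EE e' -> DD x -> x e' <= z e'.
  move=> [i ->] [hx [_ xi]].
  have [zi zi0] := zV z i hz; have [xi' xi0] := zV x i hx.
  have symle : x (gen_sym v K b i) <= Num.max (z (gen_chi K b i)) (z (gen_inv v K b i)).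
    rewrite xi; last exact: iter_eval_range.
    by apply: (le_trans (mnormD hG _ _)); rewrite gen_chiE gen_invE !Gchi.
  have pick (p q : A) : x q = (x p)^-1 -> 0 < x p -> z q = (z p)^-1 -> 1 <= z p ->
      x (p + q) <= Num.max (z p) (z q) -> x p <= z p.
    move=> xq xp zq zp; have -> : Num.max (z p) (z q) = z p.
      by apply/max_idPl; rewrite zq (le_trans _ zp) // invf_le1 // (lt_le_trans ltr01).
    move=> le; rewrite leNgt; apply/negP => lt; have x1 := le_lt_trans zp lt.
    by move: le; rewrite (mnorm_addl hx) ?xq ?(lt_trans _ x1) ?invf_lt1 // leNgt lt.
  rewrite /ee; case: ifP => [z1|/negbT]; first exact: (pick _ _ xi').
  rewrite -ltNge => z1; apply: (pick _ (gen_chi K b i)); rewrite ?xi' ?zi ?invrK ?invr_gt0 //.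
    by rewrite invf_ge1 // ltW.
  by rewrite -zi addrC maxC.
have dom1 : dominating z (DD `&` [set x | forall e, EE e -> x e = z e]).
  apply: dominating_refine => // _ [i ->].
  have [zi zi0] := zV z i hz.
  by rewrite /ee; case: ifP => _ //; rewrite zi invr_gt0.
have DDchar x : (DD `&` [set x | forall e, EE e -> x e = z e]) x ->
    forall u, lat v La u -> x (chi K u) = z (chi K u).
  move=> [[hx _] xE]; have xb i : x (chi K (b i)) = z (chi K (b i)).
    have := xE (ee i) (ex_intro _ i erefl); rewrite /ee -!gen_chiE.
    case: ifP => // _; have [-> _] := zV x i hx; have [-> _] := zV z i hz.
    exact: invr_inj.
  apply: (lat_ind hv Lb bV bgen) => [|u i Lu xu]; first by rewrite chi0 (mnorm1 hx) (mnorm1 hz).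
  split; first by rewrite chiD (mnormM hx) (mnormM hz) xu xb.
  have xbn : x (chi K (b i)) != 0 by rewrite gt_eqF ?chi_gt0.
  apply: (mulIf xbn); rewrite {2}xb -(mnormM hx) -(mnormM hz) -!chiD.
  by rewrite (emb_subK hv).
have DDK x : DD x -> forall c : K, x c%:A = abs c.
  by move=> [_ [_ xi]] c; rewrite xi ?GK //; exists (iter_polyC K r c); rewrite ?iter_evalC.
have [x DDx|x [[DDx xE] xu zg]] := tower_characters pP tP hz zP zK dom1 _ g.
  split; last exact: DDchar.
    by have [[_ [xP _]] _] := DDx.
  by apply: DDK; case: DDx.
have [hx [xP xi]] := DDx; exists x; split=> // f Lf.
have [p [pm Bp Pp]] := finite_over_monic (range_subring iota) iP fin f.
have Lp i : KL La p`_i by have [a _ <-] := Bp i.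
have sL := KL_subring hv K La.
apply: (mnorm_incomparable (T := KL La) (p := p)) => //.
- move=> h Lh; apply: (mnorm_le_gaussw habs wt_gt0) => // [|u]; first exact: DDK.
  by rewrite xu.
- by move=> i; apply: xi; exact: Bp.
- suff -> : p.[f] = 0 by exact: (mnorm0 hG).
  apply: P0 => //.
  rewrite horner_coef; apply: (subring_sum sL) => i _; apply: (subringM sL) => //.
  by elim: (i : nat) => [|m IH]; rewrite ?expr0 ?exprS; [case: sL|exact: (subringM sL)].
Qed.

End Lattice.

(** * Charts and orbits of toric varieties *)

(** The factor N + 1 is beaten at the exponents N = 2m, where Bernoulli's inequality makes (a / b)^N
    grow at least quadratically in m. *)
Lemma linear_geometric_le (R : realType) (a b : R) : 0 <= a -> 0 <= b ->
  (forall N, a ^+ N <= N.+1%:R * b ^+ N) -> a <= b.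
Proof.
move=> a0 b0 h; rewrite leNgt; apply/negP => ba.
have [b00|bn0] := eqVneq b 0.
  by have := h 1%N; rewrite b00 !expr1 mulr0 leNgt (le_lt_trans b0 ba).
have bp : 0 < b by rewrite lt_def bn0.
pose q := a / b - 1; have q0 : 0 < q by rewrite subr_gt0 ltr_pdivlMr // mul1r.
have hq m : (1 + m%:R * q) ^+ 2 <= (2 * m).+1%:R.
  have bern : 1 + m%:R * q <= (a / b) ^+ m.
    have -> : a / b = 1 + q by rewrite /q addrC subrK.
    elim: m => [|m IH]; first by rewrite mul0r addr0 expr0.
    rewrite exprS; apply: (@le_trans _ _ ((1 + q) * (1 + m%:R * q))); last first.
      by apply: ler_wpM2l => //; rewrite addr_ge0 // ltW.
    rewrite -natr1; have : 0 <= m%:R * (q * q) by rewrite !mulr_ge0 // ltW.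
    lra.
  apply: (@le_trans _ _ ((a / b) ^+ (2 * m))).
    rewrite [X in _ <= _ ^+ X]mulnC exprM le_expn // addr_ge0 // mulr_ge0 // ltW //.
  by rewrite expr_div_n ler_pdivrMr ?exprn_gt0.
pose m := (Num.truncn (2 / q ^+ 2)).+1.
have hm : 2 < m%:R * q ^+ 2 by rewrite -ltr_pdivrMr ?exprn_gt0 // truncnS_gt.
have := hq m; rewrite -natr1 natrM.
have m0 : 0 < m%:R :> R by rewrite ltr0n.
have : 2 * m%:R < m%:R * (m%:R * q ^+ 2) by rewrite mulrC ltr_pM2l.
have : 0 <= m%:R * q by rewrite mulr_ge0 ?ltW.
move: (m%:R) (m0) => r r0; rewrite !expr2; nra.
Qed.

Section Analytification.
Variables (R : realType) (K : fieldType) (abs : K -> R).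
Hypothesis habs : complete_nonarch_abs abs.

Lemma abs_mnorm : mnorm abs.
Proof.
have abs1 : abs 1 = 1.
  have := absM habs 1 1; rewrite mulr1 => /eqP; rewrite eq_sym -subr_eq0.
  rewrite -[X in _ - X]mulr1 -mulrBr mulf_eq0 => /orP[/eqP/(abs_eq0 habs)/eqP|].
    by rewrite oner_eq0.
  by rewrite subr_eq0 => /eqP.
split=> //; [exact/(abs_eq0 habs)|exact: (abs_ge0 habs)|exact: (absM habs)|exact: (abs_ultra habs)].
Qed.

Lemma abs_eq0_eq0 c : abs c = 0 -> c = 0.
Proof. by move=> /(abs_eq0 habs). Qed.

Variable A : comAlgType K.

(** The definition only asks for the triangle inequality. Integers have absolute value at most 1, so
    the binomial formula bounds the N-th power of |a + b| by N + 1 times that of the larger of |a|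
    and |b|; then N tends to infinity. *)
Lemma seminorm_mnorm (x : berkovich abs A) : mnorm (seminorm x).
Proof.
have [x1 x0 xM xD xK] := seminormP x.
have xX a N : seminorm x (a ^+ N) = seminorm x a ^+ N.
  by elim: N => [|N IH]; rewrite ?expr0 // !exprS xM IH.
have nat1 N : seminorm x (N%:R) <= 1.
  have -> : (N%:R : A) = (N%:R : K)%:A by rewrite scaler_nat.
  rewrite xK; elim: N => [|N IH]; first by rewrite (mnorm0 abs_mnorm).
  rewrite -natr1; apply: (le_trans (abs_ultra habs _ _)).
  by rewrite ge_max IH (mnorm1 abs_mnorm) lexx.
have x00 : seminorm x 0 = 0 by rewrite -(scale0r (1 : A)) xK; exact/(abs_eq0 habs).
split=> // a b; set M := Num.max _ _.
have M0 : 0 <= M by rewrite le_max x0.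
apply: linear_geometric_le => // N; rewrite -xX exprDn.
have le_sum (F : 'I_N.+1 -> A) : (forall i, seminorm x (F i) <= M ^+ N) ->
    seminorm x (\sum_i F i) <= N.+1%:R * M ^+ N.
  move=> hF; rewrite -[N.+1 in leRHS]card_ord -sum1_card natr_sum mulr_suml.
  elim/big_ind2: _ => [|y1 y2 z1 z2 h1 h2|i _]; rewrite ?x00 ?mul1r //.
  by rewrite (le_trans (xD _ _)) // lerD.
apply: le_sum => i; rewrite -mulr_natr !xM.
rewrite -[leRHS]mulr1; apply: ler_pM; rewrite ?mulr_ge0 ?nat1 //.
have iN : (i <= N)%N by rewrite -ltnS.
rewrite !xX -[in leRHS](subnK iN) exprD.
by apply: ler_pM; rewrite ?exprn_ge0 // le_expn // /M le_max lexx ?orbT.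
Qed.

Lemma seminorm_scalar (x : berkovich abs A) c : seminorm x c%:A = abs c.
Proof. by case: (seminormP x). Qed.

Lemma mnorm_mult_seminorm (y : A -> R) : mnorm y -> (forall c : K, y c%:A = abs c) ->
  mult_seminorm abs y.
Proof.
move=> hy yK; split=> //; [exact: mnorm1|exact: mnorm_ge0|exact: mnormM|].
move=> a b; rewrite (le_trans (mnormD hy a b)) // ge_max.
by rewrite lerDl lerDr !(mnorm_ge0 hy).
Qed.

Definition berk (y : A -> R) (hy : mnorm y) (yK : forall c : K, y c%:A = abs c) :
  berkovich abs A := SigSub (mem_set (mnorm_mult_seminorm hy yK)).

Lemma berkE y hy yK : seminorm (@berk y hy yK) = y. Proof. by []. Qed.

Lemma berk_eq (x y : berkovich abs A) : seminorm x =1 seminorm y -> x = y.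
Proof. by move=> h; apply: val_inj; apply/funext. Qed.

End Analytification.

(** * Krull dimension through chains of primes *)

Section Chains.
Variable A : comNzRingType.
Implicit Types I P : set A.

Definition has_chain I k : Prop := exists P : nat -> set A,
  (forall i, (i <= k)%N -> prime_ideal (P i) /\ I `<=` P i) /\
  forall i, (i < k)%N -> P i `<` P i.+1.

Lemma krull_dim_ge (R : realType) I k : has_chain I k -> (k%:R%:E <= krull_dim R I)%E.
Proof.
move=> [P [hP PS]]; apply: ereal_sup_ubound; exists k => //; exists (fun i => P i).
split=> [i|i j]; first by apply: hP; rewrite -ltnS.
have jk : (j <= k)%N by rewrite -ltnS.
move=> ij; have : (i < j)%N by []. move: jk.
elim: (j : nat) => // m IH mk; rewrite ltnS leq_eqVlt => /predU1P[->|im]; first exact: PS.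
have [h1 h2] := IH (ltnW mk) im; have [h3 h4] := PS m mk.
by split=> [|h]; [exact: subset_trans h3|apply: h2; apply: subset_trans h].
Qed.

(* Junk: krull_dim is -oo for the zero ring. *)
Lemma krull_dim_attained (R : realType) I N k0 : has_chain I k0 ->
  (forall k, has_chain I k -> (k <= N)%N) ->
  exists d, [/\ has_chain I d, krull_dim R I = d%:R%:E & forall k, has_chain I k -> (k <= d)%N].
Proof.
move=> h0 hN; pose p k := `[< has_chain I k >].
have ex : exists k, p k by exists k0; exact/asboolP.
have bd k : p k -> (k <= N)%N by move=> /asboolP/hN.
case: (ex_maxnP ex bd) => d /asboolP hd dmax.
have {}dmax k : has_chain I k -> (k <= d)%N by move=> h; apply: dmax; exact/asboolP.
exists d; split=> //; apply/le_anti; rewrite krull_dim_ge // andbT.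
apply: ge_ereal_sup => _ [k [P [hP PS]] <-]; rewrite lee_fin ler_nat; apply: dmax.
exists (fun i => P (inord i)); split=> [i ik|i ik]; first exact: hP.
by apply: PS; rewrite !inordK // ltnS // ltnW.
Qed.

Lemma has_chain_minimal I k : has_chain I k ->
  exists2 P, minimal_prime I P & has_chain P k.
Proof.
move=> [Q [hQ QS]]; have [p0 I0] := hQ 0%N (leq0n k).
have [P minP PQ] := minimal_prime_below p0 I0; exists P => //; exists Q; split=> // i ik.
have [pr _] := hQ i ik; split=> //.
elim: i ik {pr} => // i IH ik; apply: subset_trans (IH (ltnW ik)) _; case: (QS i ik) => //.
Qed.

Lemma has_chain0 I : ideal I -> ~ I 1 -> has_chain I 0.
Proof.
move=> iI I1; have [|//||P [pP IP _]] := @prime_avoiding A I [set 1] iI.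
- by [].
- by move=> a b -> ->; rewrite mulr1.
- by move=> a Ia /= aE; apply: I1; rewrite -aE.
- by exists (fun=> P); split=> // i.
Qed.

End Chains.

Lemma prime_preimage (A B : comNzRingType) (f : A -> B) (P : set B) : f 1 = 1 ->
  {morph f : a b / a + b} -> {morph f : a b / a * b} -> prime_ideal P ->
  prime_ideal (f @^-1` P).
Proof.
move=> f1 fD fM [[P0 PD PM] P1 Pp].
have f0 : f 0 = 0 by apply: (addrI (f 0)); rewrite -fD !addr0.
split=> [||a b]; rewrite /preimage /=; rewrite ?f1 //; last by rewrite fM; exact: Pp.
split=> /= [|a b|a b]; rewrite ?f0 // ?fD ?fM; [exact: PD|exact: PM].
Qed.

Lemma has_chain_preimage (A B : comNzRingType) (f : A -> B) (I : set A) (J : set B) k :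
  f 1 = 1 -> {morph f : a b / a + b} -> {morph f : a b / a * b} ->
  (forall b, exists a, f a = b) -> (forall a, I a -> J (f a)) -> has_chain J k -> has_chain I k.
Proof.
move=> f1 fD fM fs IJ [P [hP PS]]; exists (fun i => f @^-1` P i); split=> i ik.
  have [pP JP] := hP i ik; split; first exact: prime_preimage.
  by move=> a /IJ/JP.
have [h1 h2] := PS i ik; split=> [a /h1 //|h]; apply: h2 => b.
by have [a <-] := fs b; exact: h.
Qed.

Section Embeddings.
Variables (R : realType) (n : nat).
Implicit Types s t : set 'rV[R]_n.

Lemma pairing_mx (u : 'rV[int]_n) k (G : 'M[int]_(k, n)) (i : 'I_k) :
  pairing u (row i (map_mx intr G) : 'rV[R]_n) = ((u *m G^T) 0 i)%:~R.
Proof.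
rewrite /pairing mxE rmorph_sum /=; apply: eq_bigr => j _.
by rewrite !mxE rmorphM.
Qed.

Lemma pairing_comb (u : 'rV[int]_n) k (G : 'M[int]_(k, n)) (c : 'rV[R]_k) :
  pairing u (c *m map_mx intr G) = \sum_i c 0 i * ((u *m G^T) 0 i)%:~R.
Proof.
rewrite /pairing (eq_bigr (fun j => \sum_i c 0 i * ((u 0 j)%:~R * (G i j)%:~R))).
  rewrite exchange_big; apply: eq_bigr => i _; rewrite -mulr_sumr; congr (_ * _).
  by rewrite mxE rmorph_sum /=; apply: eq_bigr => j _; rewrite !mxE rmorphM.
by move=> j _; rewrite mxE mulr_sumr; apply: eq_bigr => i _; rewrite !mxE mulrCA.
Qed.

Lemma gen_cone k (G : 'M[int]_(k, n)) s (i : 'I_k) :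
  s = [set v | exists2 c : 'rV[R]_k, forall i, 0 <= c 0 i & v = c *m map_mx intr G] ->
  s (row i (map_mx intr G)).
Proof.
move=> ->; exists (delta_mx 0 i) => [j|]; last by rewrite -rowE.
by rewrite mxE; case: (_ && _).
Qed.

Lemma dual_coneP k (G : 'M[int]_(k, n)) s u :
  s = [set v | exists2 c : 'rV[R]_k, forall i, 0 <= c 0 i & v = c *m map_mx intr G] ->
  u \in dual_cone s <-> forall i, 0 <= (u *m G^T) 0 i.
Proof.
move=> sE; split=> [/asboolP h i|h].
  by rewrite -(ler0z R) -pairing_mx; apply: h; exact: gen_cone.
apply/asboolP => v; rewrite sE => -[c c0 ->]; rewrite pairing_comb.
by apply: sumr_ge0 => i _; rewrite mulr_ge0 ?c0 // ler0z.
Qed.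

Lemma orth_coneP k (G : 'M[int]_(k, n)) s u :
  s = [set v | exists2 c : 'rV[R]_k, forall i, 0 <= c 0 i & v = c *m map_mx intr G] ->
  u \in orth_cone s <-> u *m G^T = 0.
Proof.
move=> sE; split=> [/asboolP h|h].
  apply/rowP => i; rewrite [RHS]mxE; apply/eqP; rewrite -(intr_eq0 R) -pairing_mx; apply/eqP.
  by apply: h; exact: gen_cone.
apply/asboolP => v; rewrite sE => -[c c0 ->]; rewrite pairing_comb big1 // => i _.
by rewrite h mxE mulr0.
Qed.

Lemma orth_lattice_emb k (G : 'M[int]_(k, n)) s :
  s = [set v | exists2 c : 'rV[R]_k, forall i, 0 <= c 0 i & v = c *m map_mx intr G] ->
  lattice_emb (@orth_val R n s) G^T.
Proof.
move=> sE; split=> [|//|u|x /(orth_coneP _ sE) h]; first exact: orth_val_inj.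
  by apply/(orth_coneP _ sE); exact: valP.
by exists (to_orth s x); rewrite to_orthK.
Qed.

Lemma dual_val_inj s : injective (@dual_val R n s).
Proof. exact: val_inj. Qed.

Lemma pairing_r0 u : pairing u (0 : 'rV[R]_n) = 0.
Proof. by rewrite /pairing big1 // => i _; rewrite mxE mulr0. Qed.

Lemma dual_cone0 u : u \in dual_cone [set (0 : 'rV[R]_n)].
Proof. by apply/asboolP => v ->; rewrite pairing_r0. Qed.

Lemma orth_cone0 u : u \in orth_cone [set (0 : 'rV[R]_n)].
Proof. by apply/asboolP => v ->; rewrite pairing_r0. Qed.

Lemma dual0_lattice_emb :
  lattice_emb (@dual_val R n [set 0]) (0 : 'M[int]_(n, 0)).
Proof.
split=> [|//|u|x _]; [exact: dual_val_inj|by rewrite mulmx0|].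
by exists (to_dual [set 0] x); rewrite to_dualK // dual_cone0.
Qed.

Lemma cone_dim0 : cone_dim [set (0 : 'rV[R]_n)] = 0%N.
Proof.
have [_ /(_ 0%VS) h] := lin_spanP [set (0 : 'rV[R]_n)].
apply/eqP; rewrite dimv_eq0 -subv0; apply: h => w ->; exact: mem0v.
Qed.

(** The generators lie in the linear span of the cone, and their rank is the same over the rationals
    and over the reals. *)
Lemma rank_le_cone_dim k (G : 'M[int]_(k, n)) s :
  s = [set v | exists2 c : 'rV[R]_k, forall i, 0 <= c 0 i & v = c *m map_mx intr G] ->
  (\rank (map_mx intr G^T : 'M[rat]_(n, k)) <= cone_dim s)%N.
Proof.
move=> sE; set GR := map_mx (intr : int -> R) G.
have -> : \rank (map_mx intr G^T : 'M[rat]_(n, k)) = \rank GR.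
  rewrite -(mxrank_tr (map_mx _ _)) -(mxrank_map (ratr : {rmorphism rat -> R})).
  by congr (\rank _); apply/matrixP => i j; rewrite !mxE; exact: ratr_int.
pose X := vbasis (lin_span s).
pose C := \matrix_(i < k, j < cone_dim s) vector.coord X j (row i GR).
pose M : 'M[R]_(cone_dim s, n) := \matrix_(j, l) X`_j 0 l.
suff -> : GR = C *m M by apply: leq_trans (mxrankM_maxl _ _) (rank_leq_col _).
apply/row_matrixP => i; rewrite row_mul.
have [h _] := lin_spanP s.
rewrite [LHS](coord_vbasis (h _ (gen_cone i sE))).
apply/rowP => l; rewrite mxE summxE; apply: eq_bigr => j _; by rewrite !mxE.
Qed.

End Embeddings.

Section ChainBounds.
Variables (n e : nat) (S : nmodType) (v : S -> 'rV[int]_n) (E : 'M[int]_(n, e)).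
Hypothesis hv : lattice_emb v E.
Variables (R : realType) (K : fieldType).
Local Notation A := (monoid_algebra K S).
Implicit Types (I : set A) (La : seq 'rV[int]_n).

(** Each form lowers the rank of the lattice by at most one, and the rank that remains is the length
    of a chain. *)
Lemma has_chain_tower I La : ideal I -> tower v I La ->
  (forall f, I f -> KL v La f -> f = 0) ->
  exists2 r, has_chain I r &
    (n <= r + (\rank (map_mx intr E : 'M[rat]_(n, e)) + size La))%N.
Proof.
move=> iI tI I0; have [r [b [V [Lb bV _ hr]]]] := lat_basis hv La; exists r; last first.
  apply: leq_trans hr _; rewrite leq_add2l /lat_mx map_row_mx -mxrank_tr tr_row_mx.
  rewrite -addsmxE; apply: leq_trans (mxrank_adds_leqif _ _) _.
  by rewrite !mxrank_tr leq_add2l rank_leq_col.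
pose U : 'M[int]_(r, n) := \matrix_i v (b i).
apply: (exists_prime_chain hv R (U := U) (V := V) iI I0 (tower_finite hv iI tI)).
- by apply/row_matrixP => i; rewrite row_mul rowK row0 (embP hv).
- by move=> i t tL; rewrite rowK; exact: Lb.
- by apply/row_matrixP => i; rewrite row_mul rowK bV row1.
Qed.

Lemma has_chain_le I La k : ideal I -> tower v I La -> has_chain I k -> (k + size La <= n)%N.
Proof.
move=> iI tI [P [hP PS]]; have [p0 IP0] := hP 0%N (leq0n k).
apply: (tower_chain hv R (P := P)) => // [i ik|]; first by case: (hP i ik).
exact: tower_sub tI.
Qed.

Lemma has_chain_lt I La k f : tower v I La -> has_chain I k -> I f -> KL v La f -> f != 0 ->
  (k + size La < n)%N.
Proof.
move=> tI [P [hP PS]] If Lf f0; have [p0 IP0] := hP 0%N (leq0n k).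
apply: (tower_chain_lt hv R (P := P) _ _ _ (IP0 f If) Lf f0) => // [i ik|].
  by case: (hP i ik).
exact: tower_sub tI.
Qed.

(** A form that is nonzero on these vectors separates the exponents of [f]. As they live in Z^n, one
    form can be chosen for elements of the rings of several orbits. *)
Definition diffs (f : A) : seq 'rV[int]_n :=
  [seq v u.1 - v u.2 | u : S * S <- [seq (u, w) | u <- msupp f, w <- msupp f] & u.1 != u.2].

Lemma diffs_neq0 f x : x \in diffs f -> x != 0.
Proof.
move=> /mapP[[u w]]; rewrite mem_filter => /andP[/= uw _] ->.
by rewrite subr_eq0 (inj_eq (emb_inj hv)).
Qed.

Lemma diffs_separates f t : (forall x, x \in diffs f -> dot x t != 0) -> separates v t f.
Proof.
move=> ht u w; rewrite !mcoeff_neq0 => uf wf h; apply/eqP/negPn/negP => uw.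
have /ht : v u - v w \in diffs f.
  by apply/mapP; exists (u, w) => //; rewrite mem_filter /= uw; apply/allpairsP; exists (u, w).
by rewrite dotBl h subrr eqxx.
Qed.

End ChainBounds.

Lemma krull_dim_le (R : realType) (A : comNzRingType) (I : set A) (x : \bar R) :
  (forall k, has_chain I k -> (k%:R%:E <= x)%E) -> (krull_dim R I <= x)%E.
Proof.
move=> h; apply: ge_ereal_sup => _ [k [P [hP PS]] <-]; apply: h.
exists (fun i => P (inord i)); split=> [i ik|i ik]; first exact: hP.
by apply: PS; rewrite !inordK // ltnS // ltnW.
Qed.

Lemma krull_dim_eq (R : realType) (A B : comNzRingType) (I : set A) (J : set B) :
  (forall k, has_chain I k <-> has_chain J k) -> krull_dim R I = krull_dim R J.
Proof.
by move=> h; apply/le_anti/andP; split; apply: krull_dim_le => k /h; exact: krull_dim_ge.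
Qed.

Lemma ma_lift_id (K : fieldType) (S : nmodType) (f : monoid_algebra K S) :
  ma_lift (fun u => chi K u : monoid_algebra K S) f = f.
Proof. by rewrite [RHS]ma_sum. Qed.

Lemma eq_ma_lift (K : fieldType) (S : nmodType) (A : comAlgType K) (g g' : S -> A) f :
  g =1 g' -> ma_lift g f = ma_lift g' f.
Proof. by move=> gg'; apply: eq_bigr => u _; rewrite gg'. Qed.

Section ToricMaps.
Variables (R : realType) (K : fieldType) (n : nat).
Implicit Types s t : set 'rV[R]_n.
Local Notation toric_ring := (@toric_ring R K n).
Local Notation orbit_ring := (@orbit_ring R K n).
Local Notation oproj s := (@orbit_proj R K n s).

Lemma orbit_proj1 s : oproj s 1 = 1.
Proof. exact: (ma_lift1 (orbit_chi0 K s)). Qed.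

Lemma orbit_projD s : {morph (oproj s) : f g / f + g}.
Proof. exact: ma_liftD. Qed.

Lemma orbit_projM s : {morph (oproj s) : f g / f * g}.
Proof. exact: (ma_liftM (@orbit_chiD R K n s)). Qed.

Lemma orth_dual s u : u \in orth_cone s -> u \in dual_cone s.
Proof. by move=> /asboolP h; apply/asboolP => w sw; rewrite h. Qed.

(** The inclusion of K[s^\perp] in K[s^\vee], a section of [orbit_proj]: geometrically, the
    retraction of the chart onto its closed orbit. *)
Definition orbit_lift s : orbit_ring s -> toric_ring s :=
  ma_lift (fun w : orth_monoid s => chi K (to_dual s (orth_val w)) : toric_ring s).

Lemma dual_of_orth s (w : orth_monoid s) : dual_val (to_dual s (orth_val w)) = orth_val w.
Proof. by rewrite to_dualK // orth_dual //; exact: valP. Qed.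

Lemma orbit_liftK s g : oproj s (orbit_lift g) = g.
Proof.
transitivity (ma_lift (@orbit_chi R K n s \o (fun w => to_dual s (orth_val w))) g).
  exact: ma_lift_chi_comp.
apply: etrans (ma_lift_id g); apply: eq_ma_lift => w; rewrite [LHS]/=.
rewrite /orbit_chi dual_of_orth (valP w : orth_val w \in orth_cone s); congr (chi K _).
by apply: orth_val_inj; rewrite to_orthK //; exact: valP.
Qed.

Lemma orbit_lift0K f : orbit_lift (oproj [set 0] f) = f.
Proof.
pose p (u : dual_monoid [set 0 : 'rV[R]_n]) : orth_monoid [set 0 : 'rV[R]_n] :=
  to_orth [set 0] (dual_val u).
have -> : oproj [set 0] f = ma_lift (fun u => chi K (p u) : orbit_ring [set 0]) f.
  by apply: eq_ma_lift => u; rewrite /orbit_chi orth_cone0.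
transitivity (ma_lift ((fun w => chi K (to_dual [set 0] (orth_val w)) : toric_ring [set 0]) \o p) f).
  exact: ma_lift_chi_comp.
apply: etrans (ma_lift_id f); apply: eq_ma_lift => u; congr (chi K _).
by apply: dual_val_inj; rewrite /p to_orthK ?orth_cone0 // to_dualK // dual_cone0.
Qed.

Lemma orbit_lift0 s : orbit_lift (chi K 0 : orbit_ring s) = 1.
Proof.
rewrite /orbit_lift ma_lift_chi -(chi0 K (dual_monoid s)); congr (chi K _).
by apply: dual_val_inj; rewrite dual_of_orth.
Qed.

Lemma orbit_liftD s : {morph @orbit_lift s : f g / f + g}.
Proof. exact: ma_liftD. Qed.

Lemma orbit_liftM s : {morph @orbit_lift s : f g / f * g}.
Proof.
apply: ma_liftM => u w; rewrite -chiD; congr (chi K _).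
by apply: dual_val_inj; rewrite dual_valD !dual_of_orth.
Qed.

(** For the zero cone the orbit is the torus, and [orbit_lift] is inverse to [orbit_proj]. *)
Lemma krull_dim_orbit_ideal0 D (X : closed_subscheme K D) :
  krull_dim R (orbit_ideal X [set 0]) = krull_dim R (@ideal_of R K n D X [set 0]).
Proof.
have sub f : @ideal_of R K n D X [set 0] f -> orbit_ideal X [set 0] (oproj [set 0] f).
  by move=> h; apply: sub_ideal_span; exists f.
apply: krull_dim_eq => k; split=> [|[P [hP PS]]].
  apply: (has_chain_preimage (f := (oproj [set 0]))) => //.
  - exact: orbit_proj1.
  - exact: orbit_projD.
  - exact: orbit_projM.
  - by move=> b; exists (orbit_lift b); exact: orbit_liftK.
exists (fun i => @orbit_lift [set 0] @^-1` P i); split=> i ik.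
  have [pP IP] := hP i ik.
  have pP' : prime_ideal (@orbit_lift [set 0] @^-1` P i).
    by apply: prime_preimage => //; [exact: orbit_lift0|exact: orbit_liftD|exact: orbit_liftM].
  split=> //; apply: ideal_span_sub; first by case: pP'.
  by move=> _ [f If <-]; rewrite /preimage /= orbit_lift0K; exact: IP.
have [h1 h2] := PS i ik; split=> [a /h1 //|h]; apply: h2 => b Pb.
by have := h (oproj [set 0] b); rewrite /preimage /= orbit_lift0K; apply.
Qed.

Definition incl_chi s t (u : dual_monoid s) : toric_ring t :=
  chi K (to_dual t (dual_val u)).

Lemma dual_cone_sub s t u : t `<=` s -> u \in dual_cone s -> u \in dual_cone t.
Proof. by move=> ts /asboolP h; apply/asboolP => w /ts; exact: h. Qed.

Lemma dual_val_incl s t (u : dual_monoid s) : t `<=` s ->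
  dual_val (to_dual t (dual_val u)) = dual_val u.
Proof. by move=> ts; rewrite to_dualK // (dual_cone_sub ts) // dual_valP. Qed.

Lemma incl1 s t : incl t (1 : toric_ring s) = 1.
Proof.
apply: (@ma_lift1 _ _ _ (@incl_chi s t)); rewrite -(chi0 K (dual_monoid t)); congr (chi K _).
by apply: dual_val_inj; rewrite dual_val0 to_dualK // rpred0.
Qed.

Lemma inclD s t : {morph @incl R K n s t : f g / f + g}.
Proof. exact: ma_liftD. Qed.

Lemma inclM s t : t `<=` s -> {morph @incl R K n s t : f g / f * g}.
Proof.
move=> ts; apply: ma_liftM => u w; rewrite -chiD; congr (chi K _).
by apply: dual_val_inj; rewrite dual_val_incl // !dual_valD !dual_val_incl.
Qed.

Lemma incl_scalar s t (c : K) : incl t (c%:A : toric_ring s) = c%:A.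
Proof.
apply: (@ma_liftA _ _ _ (@incl_chi s t)); rewrite -(chi0 K (dual_monoid t)); congr (chi K _).
by apply: dual_val_inj; rewrite dual_val0 to_dualK // rpred0.
Qed.

End ToricMaps.

(** * Construction of the sublattice M' *)

Section Slicing.
Variables (R : realType) (K : fieldType) (n : nat).
Variable D : set (set 'rV[R]_n).
Hypothesis hD : pointed_rational_fan D.
Variable X : closed_subscheme K D.
Hypothesis hequi : torus_equidimensional X.
Hypothesis hdim : forall s, D s -> orbit_ideal X s = setT \/
  krull_dim R (orbit_ideal X s) = (scheme_dim X - (cone_dim s)%:R%:E)%E.

Local Notation I0 := (@ideal_of R K n D X [set 0]).
Local Notation v0 := (@dual_val R n [set 0]).

Lemma orbit_ideal_ideal s : ideal (orbit_ideal X s).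
Proof. exact: ideal_span_ideal. Qed.

(** With d = dim X the construction stops at n - d forms. Before that, an ideal meeting K[M'] in 0
    would admit a chain longer than d on the torus, or longer than d - dim(s) on the orbit of s,
    whose lattice has rank at least n - dim(s). After n - d forms, a nonzero element of K[M'] in a
    minimal prime P would bound the lengths of chains above P by d - 1. *)
Lemma exists_slicing : ~ I0 1 -> exists La, [/\ tower v0 I0 La,
  forall s, D s -> ~ orbit_ideal X s 1 -> tower (@orth_val R n s) (orbit_ideal X s) La &
  forall P f, minimal_prime I0 P -> P f -> KL v0 La f -> f = 0].
Proof.
move=> I01; have hv0 := dual0_lattice_emb R n.
have iI0 : ideal I0 by apply: ideal_ofP; exact: fan_zero.
have [d [cd dE dmax]] := krull_dim_attained R (has_chain0 iI0 I01)
  (fun k h => leq_trans (leq_addr _ _) (has_chain_le hv0 R iI0 (tower_nil _ _) h)).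
have dn : (d <= n)%N by have := has_chain_le hv0 R iI0 (tower_nil _ _) cd; rewrite addn0.
(* The dimension hypothesis for the zero cone identifies dim X with the dimension of X on the
   torus. *)
have sdim : scheme_dim X = d%:R%:E.
  have [h|] := hdim (fan_zero hD).
    exfalso; apply: I01; have := krull_dim_orbit_ideal0 X; rewrite h dE => h'.
    suff : krull_dim R (setT : set (orbit_ring K [set (0 : 'rV[R]_n)])) = -oo%E by rewrite h'.
    apply/eqP; rewrite -leeNy_eq; apply: krull_dim_le => k [P [hP _]].
    by have [[_ P1 _] /(_ 1 Logic.I)/P1] := hP 0%N (leq0n k).
  by rewrite krull_dim_orbit_ideal0 dE cone_dim0 sube0 => <-.
have orbit_chain s k : D s -> ~ orbit_ideal X s 1 -> has_chain (orbit_ideal X s) k ->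
    (k + cone_dim s <= d)%N.
  move=> Ds s1 /(krull_dim_ge R); have [h|->] := hdim Ds; first by case: s1; rewrite h.
  by rewrite sdim -EFinB lee_fin lerBrDr -natrD ler_nat.
have [La [sLa t0 ts]] : exists La, [/\ (size La = n - d)%N, tower v0 I0 La &
    forall s, D s -> ~ orbit_ideal X s 1 -> tower (@orth_val R n s) (orbit_ideal X s) La].
  have : (n - d <= n - d)%N by []; elim: {1 3}(n - d)%N => [_|j IH jc].
    by exists [::]; split=> //; [exact: tower_nil|move=> s _ _; exact: tower_nil].
  have [La [sLa t0 ts]] := IH (ltnW jc).
  have [f0 [If0 f00 Lf0]] : exists f, [/\ I0 f, f != 0 & KL v0 La f].
    apply: contrapT => hn; have [|r cr nr] := has_chain_tower hv0 R iI0 t0.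
      by move=> f If Lf; apply/eqP/negPn/negP => fn0; apply: hn; exists f.
    have r0 : \rank (map_mx intr (0 : 'M[int]_(n, 0)) : 'M[rat]_(n, 0)) = 0%N.
      by apply/eqP; rewrite -leqn0 rank_leq_col.
    have := dmax r cr; move: nr jc; rewrite r0 sLa; lia.
  (* Formulated for every [s], with [W] empty when the orbit does not meet X, so that [choice]
     applies. *)
  have h s : exists W : seq 'rV[int]_n, (forall x, x \in W -> x != 0) /\
      (D s -> ~ orbit_ideal X s 1 -> exists f, [/\ orbit_ideal X s f, f != 0,
        KL (@orth_val R n s) La f & forall t, (forall x, x \in W -> dot x t != 0) ->
          separates (@orth_val R n s) t f]).
    have [[Ds s1]|hn] := pselect (D s /\ ~ orbit_ideal X s 1); last first.
      by exists [::]; split=> // Ds s1; case: hn.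
    have [k [G sG]] := fan_rational hD Ds; have hvs := orth_lattice_emb sG.
    have [f [If fn0 Lf]] : exists f, [/\ orbit_ideal X s f, f != 0 & KL (@orth_val R n s) La f].
      apply: contrapT => hn; have [|r cr nr] := has_chain_tower hvs R (orbit_ideal_ideal s) (ts s Ds s1).
        by move=> f If Lf; apply/eqP/negPn/negP => fn0; apply: hn; exists f.
      have := orbit_chain s r Ds s1 cr; have := rank_le_cone_dim sG; move: nr jc; rewrite sLa; lia.
    exists (diffs (@orth_val R n s) f); split=> [x|_ _]; first exact: (diffs_neq0 hvs).
    by exists f; split=> // t; exact: diffs_separates.
  have [W hW] := choice h.
  have finW : finite_set (\bigcup_(s in D) [set` W s]).
    by apply: bigcup_finite => [|s _]; [exact: fan_finite|exact: finite_seq].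
  have /finite_seqP[W' W'E] := finW.
  have [x|t ht] := @exists_nonorthogonal n (W' ++ diffs v0 f0).
    rewrite mem_cat => /orP[xW|]; last exact: (diffs_neq0 hv0).
    have : [set` W'] x by [].
    by rewrite -W'E => -[s _ xs]; have [h0 _] := hW s; exact: h0.
  exists (t :: La); split=> /=; first by rewrite sLa.
    apply: (@tower_cons _ _ _ _ _ t La f0) => //; apply: diffs_separates => x xf.
    by apply: ht; rewrite mem_cat xf orbT.
  move=> s Ds s1; have [_ /(_ Ds s1)[f [If fn0 Lf sep]]] := hW s.
  apply: (@tower_cons _ _ _ _ _ t La f) => //; first exact: ts.
  apply: sep => x xW; apply: ht; rewrite mem_cat; apply/orP; left.
  suff : [set` W'] x by [].
  by rewrite -W'E; exists s.
exists La; split=> // P f minP Pf Lf; apply/eqP/negPn/negP => fn0.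
have [pP IP _] := minP.
have [Q minQ cQ] := has_chain_minimal cd.
have tP : tower v0 P La by exact: tower_sub t0.
have iP : ideal P by case: pP.
have P1 : ~ P 1 by case: pP.
have [k [ck kE _]] := krull_dim_attained R (has_chain0 iP P1)
  (fun k h => leq_trans (leq_addr _ _) (has_chain_le hv0 R iP (tower_nil _ _) h)).
have dk : (d <= k)%N.
  have := krull_dim_ge R cQ; rewrite -(hequi minP minQ) kE lee_fin ler_nat; exact.
have := has_chain_lt hv0 R tP ck Pf Lf fn0; move: dk dn; rewrite sLa; lia.
Qed.

End Slicing.

(** * Approximation by points of the torus *)

Section Fractions.
Variables (R : realType) (C F : comNzRingType) (j : C -> F) (x : C -> R).
Hypotheses (j1 : j 1 = 1) (jD : {morph j : a b / a + b}) (jM : {morph j : a b / a * b}).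
Hypothesis hx : mnorm x.

(** [f] has a denominator at which [x] does not vanish, as in the localization of [C] at the kernel
    of [x]. *)
Definition fraction (f : F) : Prop := exists t c, x t != 0 /\ j t * f = j c.

Lemma fractionD f g : fraction f -> fraction g -> fraction (f + g).
Proof.
move=> [t [c [t0 tf]]] [t' [c' [t'0 tg]]]; exists (t * t'), (t' * c + t * c').
by rewrite (mnormM hx) mulf_neq0 // jM jD !jM -tf -tg; split=> //; ring.
Qed.

Lemma fractionM f g : fraction f -> fraction g -> fraction (f * g).
Proof.
move=> [t [c [t0 tf]]] [t' [c' [t'0 tg]]]; exists (t * t'), (c * c').
by rewrite (mnormM hx) mulf_neq0 // !jM -tf -tg; split=> //; ring.
Qed.

Lemma fraction_image c : fraction (j c).
Proof. by exists 1, c; rewrite (mnorm1 hx) oner_eq0 j1 mul1r. Qed.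

(** The value of a fraction c / t is x c / x t; it is well defined because the kernel of [j] lies in
    that of [x]. *)
Lemma mnorm_extension : (forall c, j c = 0 -> x c = 0) -> (forall f, fraction f) ->
  exists2 y : F -> R, mnorm y & forall c, y (j c) = x c.
Proof.
move=> j0 fr.
have jB a b : j (a - b) = j a - j b by apply/eqP; rewrite eq_sym subr_eq -jD subrK.
have h f : exists r, forall t c, x t != 0 -> j t * f = j c -> r = x c / x t.
  have [t [c [t0 tf]]] := fr f; exists (x c / x t) => t' c' t'0 tf'.
  have E0 : x (t' * c) = x (t * c').
    by apply: (mnorm_sub0 hx); apply: j0; rewrite jB !jM -tf -tf'; ring.
  by apply/eqP; rewrite eqr_div // -!(mnormM hx) mulrC E0 mulrC.
have [y hy] := choice h.
have yE f : exists t c, [/\ x t != 0, j t * f = j c & y f = x c / x t].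
  by have [t [c [t0 tf]]] := fr f; exists t, c; split=> //; exact: hy.
have yj c : y (j c) = x c.
  by rewrite (hy _ 1 c) ?(mnorm1 hx) ?oner_eq0 ?divr1 // j1 mul1r.
exists y => //; split=> [||f|f g|f g].
- by rewrite -(subrr (j 1)) -jB subrr yj (mnorm0 hx).
- by rewrite -j1 yj (mnorm1 hx).
- by have [t [c [_ _ ->]]] := yE f; rewrite divr_ge0 ?mnorm_ge0.
- have [t [c [t0 tf ->]]] := yE f; have [t' [c' [t'0 tg ->]]] := yE g.
  have tt : j (t * t') * (f * g) = j (c * c') by rewrite !jM -tf -tg; ring.
  have tt0 : x (t * t') != 0 by rewrite (mnormM hx) mulf_neq0.
  by rewrite (hy _ _ _ tt0 tt) !(mnormM hx) invfM mulrACA.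
- have [t [c [t0 tf ->]]] := yE f; have [t' [c' [t'0 tg ->]]] := yE g.
  have tt : j (t * t') * (f + g) = j (t' * c + t * c') by rewrite jM jD !jM -tf -tg; ring.
  have tt0 : x (t * t') != 0 by rewrite (mnormM hx) mulf_neq0.
  have pt : 0 < x t by rewrite lt_def t0 mnorm_ge0.
  have pt' : 0 < x t' by rewrite lt_def t'0 mnorm_ge0.
  rewrite (hy _ _ _ tt0 tt) ler_pdivrMr (mnormM hx) ?mulr_gt0 //.
  rewrite (le_trans (mnormD hx _ _)) // !(mnormM hx) maxr_pMl ?mulr_ge0 ?mnorm_ge0 //.
  rewrite [x c / x t * _]mulrA divfK // [x t * x t']mulrC [x c' / x t' * _]mulrA divfK //.
  by rewrite [x c * _]mulrC [x c' * _]mulrC lexx.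
Qed.

End Fractions.

Section LatticeFractions.
Variables (n e : nat) (S : nmodType) (v : S -> 'rV[int]_n) (E : 'M[int]_(n, e)).
Hypothesis hv : lattice_emb v E.
Variables (R : realType) (K : fieldType) (C : comNzRingType).
Local Notation A := (monoid_algebra K S).
Variables (j : C -> A) (x : C -> R).
Hypotheses (j1 : j 1 = 1) (jD : {morph j : a b / a + b}) (jM : {morph j : a b / a * b}).
Hypotheses (hx : mnorm x) (jK : forall c : K, exists a, j a = c%:A).
Variables (r : nat) (b : 'I_r -> S) (V : 'M[int]_(n, r)).
Hypothesis bV : forall i, v (b i) *m V = delta_mx 0 i.
Hypothesis bgen : forall u, v u = \sum_i v (b i) *~ (v u *m V) 0 i.

Lemma fraction_lattice :
  (forall i, fraction j x (chi K (b i)) /\ fraction j x (chi K (emb_sub v 0 (b i)))) ->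
  forall f, fraction j x f.
Proof.
move=> fb f; rewrite (ma_sum f).
have frK c : fraction j x (c%:A : A) by have [a <-] := jK c; exact: fraction_image.
apply: (big_ind (fraction j x)) => [|g h|u _]; first by rewrite -(scale0r 1); exact: frK.
  exact: fractionD.
rewrite -mulr_algl; apply: fractionM => //.
have Lb i : lat v [::] (b i) by [].
apply: (lat_ind (Q := fun u => fraction j x (chi K u)) hv Lb bV (fun u _ => bgen u)) => //.
- by rewrite chi0 -j1; exact: fraction_image.
move=> w i _ fw; have [f1 f2] := fb i; split; first by rewrite chiD; exact: fractionM.
have -> : emb_sub v w (b i) = w + emb_sub v 0 (b i).
  by apply: (emb_inj hv); rewrite (embD hv) !(emb_subE hv) (emb0 hv) sub0r.
by rewrite chiD; exact: fractionM.
Qed.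

End LatticeFractions.

Section PolynomialDensity.
Variables (R : realType) (K : fieldType) (abs : K -> R).
Hypothesis abs0 : forall c, abs c = 0 -> c = 0.
Variables (A : comAlgType K) (z : A -> R) (P : set A) (p : nat -> A) (m : nat).
Hypotheses (hz : mnorm z) (zK : forall c : K, z c%:A = abs c).
Hypotheses (pP : prime_ideal P) (zP : forall a, P a -> z a = 0).
Hypothesis zp : forall i, (i < m)%N -> z (p i) != 0.
Local Notation psi := (iter_eval p m).

(* As the p i are not in the kernel of z, both z and P extend to Laurent
   polynomials, where density applies. *)
Lemma polynomial_density (F0 : seq (iter_poly K m)) d : 0 < d ->
  exists x : iter_poly K m -> R, [/\ mnorm x, forall a, x a = 0 <-> P (psi a),
    forall c, x (iter_polyC K m c) = abs c & forall a, a \in F0 -> `|x a - z (psi a)| < d].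
Proof.
move=> d0; pose v := fun u : 'rV[int]_m => u.
have hv : lattice_emb v (0 : 'M[int]_(m, 0)) := id_lattice_emb m.
pose b (i : 'I_m) : 'rV[int]_m := delta_mx 0 i.
have bV i : v (b i) *m 1%:M = delta_mx 0 i by rewrite mulmx1.
have bgen u : v u = \sum_i v (b i) *~ (v u *m 1%:M) 0 i.
  apply/rowP => k; rewrite mulmx1 summxE (bigD1 k) //= big1 => [|i ik].
    by rewrite -scaler_int !mxE !eqxx mulr1 intz addr0.
  by rewrite -scaler_int !mxE eqxx eq_sym (negPf ik) mulr0.
pose j : {rmorphism iter_poly K m -> monoid_algebra K 'rV[int]_m} := iter_eval (gen_chi K b) m.
have jK (c : K) : j (iter_polyC K m c) = c%:A by rewrite /j iter_evalC.
have j_inj a : j a = 0 -> a = 0.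
  pose deg (k : nat) (u : 'rV[int]_m) : int := if insub k is Some l then u 0 (l : 'I_m) else 0.
  have degE (k : 'I_m) u : deg k u = u 0 k by rewrite /deg valK.
  have degD k u w : deg k (u + w) = deg k u + deg k w.
    by rewrite /deg; case: insub => [l|]; rewrite ?addr0 // mxE.
  move=> ja.
  have inj := @iter_eval_inj _ _ _ _ _ hv R K (gen_chi K b) m deg degD.
  apply: (inj _ _ m (leqnn m) a ja) => [k i km ik|k km].
    have im : (i < m)%N by exact: ltn_trans km.
    rewrite -[i]/(val (Ordinal im)) gen_chiE; apply: supported_chi => /=.
    rewrite -[k]/(val (Ordinal km)) degE mxE eqxx; case: eqP => // /(congr1 val) /= h.
    by rewrite h ltnn in ik.
  rewrite -[k]/(val (Ordinal km)) gen_chiE -[chi K _]scale1r gaussw_scale_chi.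
  - by rewrite (mnorm1 (trivial_abs_mnorm R K)) mul1r degE mxE !eqxx expr1z.
  - exact: trivial_abs_mnorm.
  - by move=> u; rewrite exprz_gt0.
have jb (i : 'I_m) : j (iter_var K m i) = chi K (b i).
  by rewrite /j iter_eval_var // gen_chiE.
clearbody j.
have fr (y : A -> R) : mnorm y -> (forall a, z a != 0 -> y a != 0) ->
    forall f, fraction j (y \o psi) f.
  move=> hy zy; have hypsi : mnorm (y \o psi) by exact: mnorm_comp.
  apply: (fraction_lattice hv (rmorph1 j) (rmorphD j) (rmorphM j) hypsi _ bV bgen).
    by move=> c; exists (iter_polyC K m c).
  move=> i.
  split; first by rewrite -jb; apply: fraction_image; [exact: rmorph1|].
  exists (iter_var K m i), 1; split; last by rewrite jb (chi_mul_opp hv) (rmorph1 j).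
  by rewrite /= iter_eval_var //; apply: zy; exact: zp.
have extend (y : A -> R) : mnorm y -> (forall a, z a != 0 -> y a != 0) ->
    exists2 y' : monoid_algebra K 'rV[int]_m -> R, mnorm y' & forall a, y' (j a) = y (psi a).
  move=> hy zy; have hypsi : mnorm (y \o psi) by exact: mnorm_comp.
  apply: (mnorm_extension (rmorph1 j) (rmorphD j) (rmorphM j) hypsi); last exact: fr.
  by move=> a /j_inj ->; exact: (mnorm0 hypsi).
have [z' hz' z'j] := extend z hz (fun a h => h).
have [q' hq' q'j] : exists2 q' : monoid_algebra K 'rV[int]_m -> R, mnorm q' & forall a, q' (j a) = if `[< P (psi a) >] then 0 else 1.
  apply: (extend (fun a => if `[< P a >] then 0 else 1)); first exact: prime_mnorm.
  by move=> a za; rewrite asboolF ?oner_eq0 // => /zP; exact/eqP.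
have q'z a : q' a = 0 -> z' a = 0.
  have [t [c [t0 tc]]] := fr z hz (fun a h => h) a.
  move=> qa; have : q' (j c) = 0 by rewrite -tc (mnormM hq') qa mulr0.
  rewrite q'j; case: asboolP => [/zP zc _|_ /eqP]; last by rewrite oner_eq0.
  have : z' (j c) = 0 by rewrite z'j.
  rewrite -tc (mnormM hz') => /eqP; rewrite mulf_eq0 z'j => /orP[/eqP h|/eqP //].
  by rewrite /= h eqxx in t0.
have z'K (c : K) : z' c%:A = abs c by rewrite -jK z'j iter_evalC zK.
have [x [hx xQ xK xF]] := density hv abs0 (map j F0) (mnorm_ker_prime hq') hz' q'z z'K d0.
exists (x \o j); split=> [|a|c|a aF] /=.
- exact: mnorm_comp.
- rewrite xQ /= q'j; case: asboolP => h; split=> // /eqP; by rewrite oner_eq0.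
- by rewrite jK xK.
- by rewrite -z'j; apply: xF; exact: map_f.
Qed.

End PolynomialDensity.

Section FanCones.
Variables (R : realType) (n : nat) (D : set (set 'rV[R]_n)).
Hypothesis hD : pointed_rational_fan D.
Variable s : set 'rV[R]_n.
Hypothesis Ds : D s.

Lemma zero_in_cone : s 0.
Proof.
have [k [G ->]] := fan_rational hD Ds.
by exists 0; rewrite ?mul0mx // => i; rewrite mxE.
Qed.

Lemma zero_face : face [set 0] s.
Proof.
have [h _] := fan_meet hD Ds (fan_zero hD).
suff <- : s `&` [set 0] = [set 0] by [].
by apply/seteqP; split=> [x []|x ->] //; split=> //; exact: zero_in_cone.
Qed.

Lemma zero_sub : [set 0] `<=` s.
Proof. by move=> _ ->; exact: zero_in_cone. Qed.

(** A generator of [s] at which [m0] vanishes lies in [t], where [u] is nonnegative. At the others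
    [m0] is at least 1, so N only has to reach the absolute values of [u] at the generators. *)
Lemma dual_absorb (t : set 'rV[R]_n) (m0 : dual_monoid s) (u : 'rV[int]_n) :
  t = s `&` [set x | pairing (dual_val m0) x = 0] -> u \in dual_cone t ->
  exists N0, forall N, (N0 <= N)%N -> u + dual_val m0 *+ N \in dual_cone s.
Proof.
move=> tE /asboolP ut; have [k [G sE]] := fan_rational hD Ds.
exists (\sum_i `|((u *m G^T) 0 i)%R|)%N => N hN; apply/(dual_coneP _ sE) => i.
have /(dual_coneP _ sE)/(_ i) mi := dual_valP m0.
rewrite mulmxDl -scaler_nat -scalemxAl !mxE.
have -> : \sum_j u 0 j * G^T j i = (u *m G^T) 0 i by rewrite mxE.
have -> : \sum_j dual_val m0 0 j * G^T j i = (dual_val m0 *m G^T) 0 i by rewrite mxE.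
have [m00|m0n] := eqVneq ((dual_val m0 *m G^T) 0 i) 0.
  rewrite m00 mulr0 addr0 -(ler0z R) -pairing_mx; apply: ut; rewrite tE.
  by split; [exact: gen_cone|rewrite /= pairing_mx m00].
have le : (`|((u *m G^T) 0 i)%R| <= N)%N.
  by apply: leq_trans hN; rewrite (bigD1 i) //= leq_addr.
move: le mi m0n; set a := (u *m _) _ _; set c := (_ *m _) _ _.
move=> le c0 cn; rewrite natz; nia.
Qed.

End FanCones.

Lemma mcoeff_lift_chi (K : fieldType) (S S' : nmodType) (p : S -> S') (f : monoid_algebra K S) u :
  injective p ->
  mcoeff (p u) (ma_lift (fun w => chi K (p w) : monoid_algebra K S') f) = mcoeff u f.
Proof.
move=> p_inj; rewrite {2}(ma_sum f) /ma_lift !mcoeff_sumE; apply: eq_bigr => w _.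
by rewrite !mcoeffZ !mcoeff_chi (inj_eq p_inj).
Qed.

Lemma supported_lift_chi (K : fieldType) (S S' : nmodType) (p : S -> S')
    (f : monoid_algebra K S) (L : set S') : supported (L \o p) f ->
  supported L (ma_lift (fun w => chi K (p w) : monoid_algebra K S') f).
Proof.
move=> Lf w; rewrite /ma_lift mcoeff_sumE => h; apply: contrapT => Lw.
move/eqP: h; apply; rewrite big_seq big1 // => u uf.
rewrite mcoeffZ mcoeff_chi; case: eqP => [puw|_]; last by rewrite mulr0.
by exfalso; apply: Lw; rewrite -puw; apply: Lf; rewrite mcoeff_neq0.
Qed.

Section Inclusion.
Variables (R : realType) (K : fieldType) (n : nat) (s t : set 'rV[R]_n).
Hypothesis ts : t `<=` s.

Lemma to_dual_val_inj : injective (fun w : dual_monoid s => to_dual t (dual_val w)).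
Proof.
move=> w w' /(congr1 (@dual_val R n t)); rewrite !dual_val_incl //; exact: dual_val_inj.
Qed.

Lemma mcoeff_incl (f : toric_ring K s) u :
  mcoeff (to_dual t (dual_val u)) (incl t f) = mcoeff u f.
Proof. exact: (mcoeff_lift_chi f u to_dual_val_inj). Qed.

Lemma incl_inj (f : toric_ring K s) : incl t f = 0 -> f = 0.
Proof. by move=> h; apply/malgP => u; rewrite -mcoeff_incl h !mcoeff0. Qed.

Lemma incl_scale_chi (c : K) u :
  incl t (c *: chi K u : toric_ring K s) = c *: chi K (to_dual t (dual_val u)).
Proof. by rewrite ma_scaleU mulr1; exact: ma_liftU. Qed.

End Inclusion.

Lemma incl_chi_mul (R : realType) (K : fieldType) n (s t : set 'rV[R]_n) (u a : dual_monoid s)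
    (w : dual_monoid t) : t `<=` s -> dual_val a = dual_val u + dual_val w ->
  incl t (chi K u : toric_ring K s) * chi K w = incl t (chi K a : toric_ring K s).
Proof.
move=> ts E.
have iE x : incl t (chi K x : toric_ring K s) = chi K (to_dual t (dual_val x)) by exact: ma_lift_chi.
apply: etrans (congr1 (fun g => g * chi K w) (iE u)) _; apply: etrans _ (esym (iE a)).
suff e1 : to_dual t (dual_val u) + w = to_dual t (dual_val a) by rewrite -e1 chiD.
by apply: dual_val_inj; rewrite dual_valD !dual_val_incl.
Qed.

Lemma mnorm_1D (R : realType) (A : comNzRingType) (x : A -> R) a :
  mnorm x -> x a = 0 -> x (1 + a) = 1.
Proof. by move=> hx h; rewrite (mnorm_addl hx) (mnorm1 hx) // h ltr01. Qed.

Section TorusDensity.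
Variables (R : realType) (K : fieldType) (abs : K -> R).
Hypotheses (habs : mnorm abs) (abs0 : forall c, abs c = 0 -> c = 0).
Variables (n : nat) (D : set (set 'rV[R]_n)).
Hypothesis hD : pointed_rational_fan D.
Variable X : closed_subscheme K D.
Hypothesis hdense : torus_dense X.
Variable s : set 'rV[R]_n.
Hypothesis Ds : D s.
Local Notation C := (toric_ring K s).
Local Notation C0 := (toric_ring K [set (0 : 'rV[R]_n)]).
Local Notation Is := (@ideal_of R K n D X s).
Local Notation I0 := (@ideal_of R K n D X [set 0]).
Local Notation inc := (@incl R K n s [set 0]).

Lemma chiMn (S : nmodType) (u : S) N : chi K (u *+ N) = chi K u ^+ N.
Proof. by elim: N => [|N IH]; rewrite ?mulr0n ?chi0 // mulrS chiD IH exprS. Qed.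

Lemma dual_valMn (t : set 'rV[R]_n) (u : dual_monoid t) N : dual_val (u *+ N) = dual_val u *+ N.
Proof. by elim: N => [|N IH] //; rewrite !mulrS dual_valD IH. Qed.

(** By density no f with x0 f nonzero can fall into the ideal of X on the torus, where the character
    of [m0] is invertible. So the products of such f with powers of this character avoid the ideal
    of the chart. *)
Lemma exists_torus_prime (x0 : C -> R) (m0 : dual_monoid s) : mnorm x0 ->
  (forall f, Is f -> x0 f = 0) ->
  exists P, [/\ prime_ideal P, Is `<=` P, forall f, P f -> x0 f = 0 & ~ P (chi K m0)].
Proof.
move=> hx xI; have iI : ideal Is by exact: ideal_ofP.
have s0 := zero_sub hD Ds.
pose SS := [set h : C | exists f N, x0 f != 0 /\ h = f * chi K m0 ^+ N].
have [||h Ih [f [N [f0 hE]]]|P [pP IP PS]] := prime_avoiding (S := SS) iI.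
- by exists 1, 0%N; rewrite (mnorm1 hx) oner_eq0 expr0 mulr1.
- move=> _ _ [f [N [f0 ->]]] [f' [N' [f'0 ->]]]; exists (f * f'), (N + N')%N.
  split; first by rewrite (mnormM hx) mulf_neq0.
  by rewrite exprD; exact: mulrACA.
- have If : I0 (inc f).
    have Ih' : I0 (inc h).
      rewrite (ideal_of_face X Ds (fan_zero hD) (zero_face hD Ds)).
      by apply: sub_ideal_span; exists h.
    pose u : dual_monoid [set (0 : 'rV[R]_n)] := to_dual [set 0] (dual_val (m0 *+ N)).
    have hv0 := dual0_lattice_emb R n.
    have [_ _ IM] := ideal_ofP X (fan_zero hD).
    have := IM (chi K (emb_sub (@dual_val R n [set 0]) 0 u)) _ Ih'.
    rewrite hE (inclM s0) -chiMn {2}/incl ma_lift_chi -/u mulrC -mulrA.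
    by rewrite (chi_mul_opp hv0) mulr1.
  have [||Q [[_ Q1 _] IQ]] := hdense Ds (mnorm_ker_prime hx) (f := f).
  + by move=> g /xI.
  + exact/eqP.
  + by case; exact: IQ.
exists P; split=> // [f Pf|Pm].
  apply: contrapT => /eqP f0; apply: (PS f Pf); exists f, 0%N; by rewrite expr0 mulr1.
by apply: (PS _ Pm); exists 1, 1%N; rewrite (mnorm1 hx) oner_eq0 mul1r expr1.
Qed.

(** The chart ring is not the algebra of a lattice, so density is applied to a polynomial ring
    mapping to it. The point found has kernel the preimage of [P]; as [P] does not contain the
    character of [m0], all characters of M become fractions and the point extends to the torus. *)
Lemma torus_density (x0 : C -> R) (G : seq C) d : mnorm x0 -> (forall f, Is f -> x0 f = 0) ->
  (forall c : K, x0 c%:A = abs c) -> 0 < d ->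
  exists y : C0 -> R, [/\ mnorm y, forall f, I0 f -> y f = 0, forall c : K, y c%:A = abs c &
    forall g, g \in G -> `|y (inc g) - x0 g| < d].
Proof.
move=> hx xI xK d0; have s0 := zero_sub hD Ds.
have [m0 m0E] : exists m0 : dual_monoid s, [set 0] = s `&` [set x | pairing (dual_val m0) x = 0].
  have [m m_s ->] := zero_face hD Ds.
  by exists (to_dual s m); rewrite to_dualK.
have [P [pP IP Px Pm]] := exists_torus_prime m0 hx xI.
have [P0 _ _] : ideal P by case: pP.
have hv0 := dual0_lattice_emb R n.
have [r [b [V [_ bV bgen _]]]] := lat_basis hv0 [::].
have abso (w : dual_monoid [set (0 : 'rV[R]_n)]) : exists u : dual_monoid s,
    exists N, dual_val u = dual_val w + dual_val m0 *+ N.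
  have [N hN] := dual_absorb hD Ds m0E (dual_cone0 R (dual_val w)).
  by exists (to_dual s (dual_val w + dual_val m0 *+ N)), N; rewrite to_dualK ?hN.
have [A hA] := choice abso.
pose bV' i := emb_sub (@dual_val R n [set 0]) 0 (b i).
(* Exponents whose characters must come from the polynomial ring: the denominator [m0], the supports
   of the elements of [G], and numerators for a basis of M and its opposite. *)
pose a : seq (dual_monoid s) := m0 :: flatten [seq enum_fset (msupp g) | g <- G] ++
  [seq A (b i) | i <- enum 'I_r] ++ [seq A (bV' i) | i <- enum 'I_r].
(* Adding 1 to a character that vanishes at [x0] gives it a nonzero value, as [polynomial_density]
   requires. *)
pose tau (u : dual_monoid s) : C := if x0 (chi K u) == 0 then 1 + chi K u else chi K u.
have tau0 u : x0 (tau u) != 0.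
  rewrite /tau; case: ifPn => // /eqP h.
  by rewrite (mnorm_1D hx h); exact: oner_neq0.
pose p i := tau (nth 0 a i); pose m := size a.
pose psi : {rmorphism iter_poly K m -> C} := iter_eval p m.
have sR := range_subring psi.
have psiK c : psi (iter_polyC K m c) = c%:A by exact: iter_evalC.
have Ra u : u \in a -> range psi (chi K u).
  move=> ua; have : range psi (tau u).
    by rewrite -[u](nth_index 0 ua); apply: iter_eval_range; rewrite index_mem.
  rewrite /tau; case: ifP => // _ h; rewrite -[chi K u](addKr 1) addrC.
  by case: (sR) => R1 RB _; apply: RB.
have RG g : g \in G -> range psi g.
  move=> gG; rewrite (ma_sum g) big_seq; apply: (subring_sum sR) => u ug.
  rewrite -mulr_algl; apply: (subringM sR); first by exists (iter_polyC K m (mcoeff u g)).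
  apply: Ra; rewrite inE mem_cat; apply/orP; right; apply/orP; left.
  by apply/flattenP; exists (enum_fset (msupp g)) => //; apply/mapP; exists g.
have [pre preE] : exists pre : C -> iter_poly K m, forall g, range psi g -> psi (pre g) = g.
  exists (fun g => xget 0 [set c | psi c = g]) => g [c _ cg].
  by apply: (@xgetPex _ 0 [set c | psi c = g]); exists c.
have [x [hx' xP xK' xF]] := polynomial_density abs0 hx xK pP Px
  (fun i (_ : (i < m)%N) => tau0 (nth 0 a i)) (map pre G) d0.
rewrite -/p -/psi in xP xF.
clearbody psi.
pose j c := inc (psi c).
have j1 : j 1 = 1 by rewrite /j (rmorph1 psi) incl1.
have jD : {morph j : c c' / c + c'} by move=> c c'; rewrite /j (rmorphD psi) inclD.
have jM : {morph j : c c' / c * c'} by move=> c c'; rewrite /j (rmorphM psi) (inclM s0).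
have jK (c : K) : j (iter_polyC K m c) = c%:A by rewrite /j psiK incl_scalar.
have jE c : j c = inc (psi c) by [].
clearbody j.
have jpre g : range psi g -> j (pre g) = inc g by move=> rg; rewrite jE preE.
have fr w : A w \in a -> fraction j x (chi K w).
  have [N AN] := hA w => Aa.
  have mN : range psi (chi K (m0 *+ N)).
    rewrite chiMn; have [c _ <-] := Ra m0 (mem_head _ _).
    by exists (c ^+ N) => //; rewrite rmorphXn.
  exists (pre (chi K (m0 *+ N))), (pre (chi K (A w))); split.
    apply/eqP => /xP; rewrite (preE _ mN) chiMn => Pc; exact: (Pm (prime_idealX pP Pc)).
  have h : inc (chi K (m0 *+ N)) * chi K w = inc (chi K (A w)).
    by apply: (incl_chi_mul K s0); rewrite dual_valMn addrC.
  exact: (etrans (congr1 (fun g => g * chi K w) (jpre _ mN)) (etrans h (esym (jpre _ (Ra _ Aa))))).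
have frC0 : forall f, fraction j x f.
  apply: (fraction_lattice hv0 j1 jD jM hx' _ bV) => [c|u|i].
  - by exists (iter_polyC K m c).
  - by apply: bgen.
  - split; apply: fr; rewrite !(inE, mem_cat); apply/orP; right; apply/orP; right; apply/orP.
      by left; apply/mapP; exists i; rewrite ?mem_enum.
    by right; apply/mapP; exists i; rewrite ?mem_enum.
have [y hy yj] : exists2 y : C0 -> R, mnorm y & forall c, y (j c) = x c.
  apply: (mnorm_extension j1 jD jM hx' _ frC0) => c.
  by rewrite jE => /(incl_inj s0) pc; apply/xP; rewrite pc.
exists y; split=> // [||g gG]; last first.
- have rg := RG g gG; rewrite -(jpre g rg) yj.
  have := xF (pre g) (map_f pre gG); rewrite preE //; exact.
- by move=> c; rewrite -jK yj xK'.
move=> f; rewrite (ideal_of_face X Ds (fan_zero hD) (zero_face hD Ds)).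
have [iK _ _] := mnorm_ker_prime hy.
move=> /(ideal_span_sub iK) h; apply: h => _ [g Ig <-] /=.
have [t [c [t0 tc]]] := frC0 (inc g).
have cE : psi t * g = psi c.
  apply/eqP; rewrite -subr_eq0; apply/eqP; apply: (incl_inj s0).
  have incB h h' : inc (h - h') = inc h - inc h'.
    by apply/eqP; rewrite eq_sym subr_eq -inclD subrK.
  by rewrite incB (inclM s0) -!jE tc subrr.
have xc : x c = 0.
  by apply/xP; rewrite -cE; have [[_ _ PM] _ _] := pP; apply: PM; exact: IP.
have := congr1 y tc; rewrite (mnormM hy) !yj xc => /eqP.
by rewrite mulf_eq0 (negPf t0) => /eqP.
Qed.

End TorusDensity.

Lemma limit_le2 (R : realType) (A : comNzRingType) (U : set_system (A -> R)) c a b :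
  ProperFilter U -> limit U c -> U [set x | x a <= x b] -> c a <= c b.
Proof.
move=> FU hc h; rewrite -subr_ge0; apply: (cvgr_to_ge (cvgB (hc b) (hc a))).
by apply: filterS h => x /=; rewrite subr_ge0.
Qed.

Lemma ma_liftZ (K : fieldType) (S : nmodType) (A : comAlgType K) (g : S -> A) (c : K)
    (f : monoid_algebra K S) : ma_lift g (c *: f) = c *: ma_lift g f.
Proof.
rewrite [in LHS](ma_sum f) scaler_sumr ma_lift_sum [in RHS]/ma_lift scaler_sumr.
by apply: eq_bigr => u _; rewrite !ma_scaleU ma_liftU mulr1 scalerA.
Qed.


Lemma mnorm_morph (R : realType) (A B : comNzRingType) (f : A -> B) (x : B -> R) :
  f 1 = 1 -> {morph f : a b / a + b} -> {morph f : a b / a * b} -> mnorm x -> mnorm (x \o f).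
Proof.
move=> f1 fD fM hx; have f0 : f 0 = 0 by apply: (addrI (f 0)); rewrite -fD !addr0.
split=> /= [||a|a b|a b]; rewrite ?f0 ?f1 ?fM ?fD.
- exact: mnorm0.
- exact: mnorm1.
- exact: mnorm_ge0.
- exact: mnormM.
- exact: mnormD.
Qed.

(** * Domination on the orbits *)

Section OrbitDomination.
Variables (R : realType) (K : fieldType) (abs : K -> R).
Hypotheses (habs : mnorm abs) (abs0 : forall c, abs c = 0 -> c = 0).
Variables (n : nat) (D : set (set 'rV[R]_n)).
Hypothesis hD : pointed_rational_fan D.
Variable X : closed_subscheme K D.
Hypothesis hdense : torus_dense X.
Variable La : seq 'rV[int]_n.
Local Notation C0 := (toric_ring K [set (0 : 'rV[R]_n)]).
Local Notation I0 := (@ideal_of R K n D X [set 0]).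
Local Notation v0 := (@dual_val R n [set 0]).
Hypothesis tI0 : tower v0 I0 La.
Hypothesis minI0 : forall P f, minimal_prime I0 P -> P f -> KL v0 La f -> f = 0.

(** The opposite inequality is ultrametricity. Only values of [x] occur, so the condition passes to
    pointwise limits even when the values at characters vary. *)
Definition gauss_on (S : nmodType) (v : S -> 'rV[int]_n) (x : monoid_algebra K S -> R) : Prop :=
  forall f u, KL v La f -> x (mcoeff u f *: chi K u) <= x f.

(** A minimal prime below the kernel of [y] meets K[M'] in 0, so [torus_domination] applies to
    it. *)
Lemma torus_points (y : C0 -> R) g : mnorm y -> (forall f, I0 f -> y f = 0) ->
  (forall c : K, y c%:A = abs c) ->
  exists x : C0 -> R, [/\ mnorm x, forall f, I0 f -> x f = 0,
    forall c : K, x c%:A = abs c, gauss_on v0 x &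
    y g <= x g /\ forall u, x (chi K u) = y (chi K u)].
Proof.
move=> hy yI yK; have hv0 := dual0_lattice_emb R n.
have [P minP Py] := minimal_prime_below (mnorm_ker_prime hy) yI.
have [pP IP _] := minP; have tP := tower_sub IP tI0.
have [x [hx xP xy xG yg]] := torus_domination hv0 habs abs0 g pP tP
  (fun f => minI0 minP) hy Py yK.
have wt_gt0 w : 0 < y (chi K w) by exact: (chi_gt0 hv0).
exists x; split=> // [f /IP/xP //|c|f u Lf].
  rewrite -(chi0 K (dual_monoid [set (0 : 'rV[R]_n)])) xG.
    by rewrite (gaussw_scale_chi habs wt_gt0) chi0 (mnorm1 hy) mulr1.
  apply: supported_scale; apply: supported_chi; exact: (lat0 hv0).
have Lu : KL v0 La (mcoeff u f *: chi K u).
  move=> w; rewrite mcoeffZ mcoeff_chi; have [<-|_] := eqVneq u w; last by rewrite mulr0 eqxx.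
  by rewrite mulr1; exact: Lf.
rewrite (xG _ Lf) (xG _ Lu) (gaussw_scale_chi habs wt_gt0).
exact: (gaussw_le habs wt_gt0).
Qed.

Variable s : set 'rV[R]_n.
Hypothesis Ds : D s.
Local Notation C := (toric_ring K s).
Local Notation Is := (@ideal_of R K n D X s).
Local Notation inc := (@incl R K n s [set 0]).
Local Notation vs := (@dual_val R n s).

Lemma torus_points_near (x0 : C -> R) (G : seq C) h d : mnorm x0 ->
  (forall f, Is f -> x0 f = 0) -> (forall c : K, x0 c%:A = abs c) -> 0 < d ->
  exists x : C -> R, [/\ mnorm x, forall f, Is f -> x f = 0, forall c : K, x c%:A = abs c,
    gauss_on vs x & [/\ x0 h - d <= x h &
    forall u, chi K u \in G -> `|x (chi K u) - x0 (chi K u)| < d]].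
Proof.
move=> hx0 x0I x0K d0; have s0 := zero_sub hD Ds; have hv0 := dual0_lattice_emb R n.
have [y [hy yI yK yG]] := torus_density abs0 hD hdense Ds (h :: G) hx0 x0I x0K d0.
have [x [hx xI xK xG [yg xy]]] := torus_points (inc h) hy yI yK.
exists (x \o inc); split=> [|f If|c|f u Lf|].
- apply: mnorm_morph => //; [exact: incl1|exact: inclD|exact: inclM].
- apply: xI; rewrite (ideal_of_face X Ds (fan_zero hD) (zero_face hD Ds)).
  by apply: sub_ideal_span; exists f.
- by rewrite /= incl_scalar xK.
- rewrite /= incl_scale_chi -(mcoeff_incl s0); apply: xG.
  by apply: supported_lift_chi => w wf /=; rewrite /lat /= dual_val_incl //; exact: Lf.
- have hh := yG h (mem_head _ _).
  split=> [|u uG] /=.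
    apply: le_trans yg; rewrite lerBlDr -lerBlDl ltW //.
    by apply: le_lt_trans (ler_norm _) _; rewrite distrC.
  have -> : x (inc (chi K u)) = y (inc (chi K u)).
    have e1 : inc (chi K u) = chi K (to_dual [set 0] (vs u)) by exact: ma_lift_chi.
    by rewrite e1 xy.
  by apply: yG; rewrite inE uG orbT.
Qed.

(** Such a [c] is a point of the closed orbit: [f] and the lift of its restriction differ by
    characters that [c] kills. *)
Lemma orbit_lift_proj (c : C -> R) f : mnorm c ->
  (forall u, dual_val u \notin orth_cone s -> c (chi K u) = 0) ->
  c (orbit_lift (@orbit_proj R K n s f)) = c f.
Proof.
move=> hc c0; have [iI _ _] := mnorm_ker_prime hc.
apply: (mnorm_sub0 hc); suff : [set a | c a = 0] (orbit_lift (@orbit_proj R K n s f) - f) by [].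
have -> : orbit_lift (@orbit_proj R K n s f) =
    \sum_(u <- msupp f) mcoeff u f *: orbit_lift (orbit_chi K u).
  rewrite /orbit_proj /ma_lift /orbit_lift ma_lift_sum.
  by apply: eq_bigr => u _; rewrite ma_liftZ.
rewrite [X in _ - X]ma_sum -sumrB; apply: ideal_sum => // u _.
rewrite -scalerBr -mulr_algl; case: (iI) => _ _ IM; apply: IM.
rewrite /orbit_chi; case: ifPn => [us|us] /=.
  rewrite /orbit_lift ma_lift_chi to_orthK //.
  have -> : to_dual s (dual_val u) = u by apply: dual_val_inj; rewrite to_dualK // dual_valP.
  by rewrite subrr (mnorm0 hc).
by rewrite /orbit_lift ma_lift0 sub0r (mnormN hc) c0.
Qed.

Local Notation OR := (orbit_ring K s).
Local Notation oproj := (@orbit_proj R K n s).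
Local Notation vo := (@orth_val R n s).

(** The torus points near the pullback [x0] of [z] are controlled at finitely many characters and at
    [h]. A limit along an ultrafilter has the values of [x0] at all characters; hence it kills those
    outside the orthogonal of the cone and descends to the orbit. *)
Lemma orbit_domination (z : OR -> R) g : mnorm z -> (forall f, orbit_ideal X s f -> z f = 0) ->
  (forall c : K, z c%:A = abs c) ->
  exists x : OR -> R, [/\ mnorm x, forall f, orbit_ideal X s f -> x f = 0,
    forall c : K, x c%:A = abs c, gauss_on vo x &
    z g <= x g /\ forall u, x (chi K u) = z (chi K u)].
Proof.
move=> hz zI zK; pose x0 := z \o oproj.
have hx0 : mnorm x0.
  by apply: mnorm_morph => //; [exact: orbit_proj1|exact: orbit_projD|exact: orbit_projM].
have x0I f : Is f -> x0 f = 0 by move=> If; apply: zI; apply: sub_ideal_span; exists f.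
have x0K (c : K) : x0 c%:A = abs c.
  by rewrite /x0 /= /orbit_proj ma_liftA // orbit_chi0.
have x0out u : dual_val u \notin orth_cone s -> x0 (chi K u) = 0.
  by move=> us; rewrite /x0 /= /orbit_proj ma_lift_chi /orbit_chi (negPf us) (mnorm0 hz).
pose h := orbit_lift g.
pose W (i : (seq C * nat)%type) : set (C -> R) := [set x | [/\ mnorm x,
  forall f, Is f -> x f = 0, forall c : K, x c%:A = abs c, gauss_on vs x &
  x0 h - i.2.+1%:R^-1 <= x h /\
  forall u, chi K u \in i.1 -> `|x (chi K u) - x0 (chi K u)| < i.2.+1%:R^-1]].
pose F := filter_from setT W.
have FF : ProperFilter F.
  apply: filter_from_proper => [|[G k] _].
    apply: filter_fromT_filter => [|[G k] [G' k']]; first by exists ([::], 0%N).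
    exists (G ++ G', maxn k k') => x [hx xI xK xG [xh xu]].
    have le1 : (maxn k k').+1%:R^-1 <= k.+1%:R^-1 :> R.
      by rewrite lef_pV2 ?posrE ?ltr0Sn // ler_nat ltnS leq_maxl.
    have le2 : (maxn k k').+1%:R^-1 <= k'.+1%:R^-1 :> R.
      by rewrite lef_pV2 ?posrE ?ltr0Sn // ler_nat ltnS leq_maxr.
    split; split=> //; split.
    - by apply: le_trans xh; rewrite lerB.
    - by move=> u uG; apply: lt_le_trans le1; apply: xu; rewrite mem_cat uG.
    - by apply: le_trans xh; rewrite lerB.
    - by move=> u uG; apply: lt_le_trans le2; apply: xu; rewrite mem_cat uG orbT.
  have k0 : 0 < k.+1%:R^-1 :> R by rewrite invr_gt0 ltr0Sn.
  by have [x hx] := torus_points_near G h hx0 x0I x0K k0; exists x.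
have FW i : F (W i) by exists i.
have W0 : F (W ([::], 0%N)) by exact: FW.
have [|a|U [c [uU FU hc lc]]] := @exists_limit R C F FF.
- by apply: filterS W0 => x [].
(* The 1 added to x0 (chi u) is the tolerance 1 / (k + 1) for k = 0. *)
- exists (\big[Num.max/0]_(u <- msupp a) (abs (mcoeff u a) * (x0 (chi K u) + 1))).
  apply: filterS (FW ([seq chi K u | u <- msupp a], 0%N)) => x [hx _ xK _ [_ xu]] /=.
  rewrite [leLHS](congr1 x (ma_sum a)) big_seq; apply: (mnorm_sum_le hx) => [|u ua].
    by apply: (big_ind (fun y => 0 <= y)) => // [y y' y0 y'0|u _]; rewrite ?le_max ?y0 //
      mulr_ge0 ?(mnorm_ge0 habs) // addr_ge0 ?(mnorm_ge0 hx0).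
  rewrite -mulr_algl (mnormM hx) xK.
  apply: (@le_trans _ _ (abs (mcoeff u a) * (x0 (chi K u) + 1))); last first.
    exact: (@le_bigmax_seq _ _ _ _ _ u xpredT).
  apply: ler_wpM2l; first exact: (mnorm_ge0 habs).
  have := xu u (map_f _ ua); rewrite invr1 => /ltW/(le_trans (ler_norm _)).
  by rewrite lerBlDl.
have pU : ProperFilter U by exact: ultra_proper.
have cI f : Is f -> c f = 0.
  apply: (limit_closed_eq (W := Is) (w := fun=> 0) uU _ hc lc).
  by apply: FU; apply: filterS W0 => x [].
have cK (k : K) : c k%:A = abs k.
  apply/le_anti/andP; split.
    by apply: (limit_le _ lc); apply: FU; apply: filterS W0 => x [_ _ /= -> _ _].
  by apply: (limit_ge _ lc); apply: FU; apply: filterS W0 => x [_ _ /= -> _ _].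
have cG : gauss_on vs c.
  move=> f u Lf; apply: (limit_le2 pU lc); apply: FU.
  by apply: filterS W0 => x [_ _ _ xG _]; exact: xG.
have small (e : R) : 0 < e -> exists k : nat, k.+1%:R^-1 < e.
  by move=> e0; have [k] := ltr_add_invr e0; rewrite add0r; exists k.
have cu u : c (chi K u) = x0 (chi K u).
  have hk k : U [set x | `|x (chi K u) - x0 (chi K u)| < k.+1%:R^-1].
    apply: FU; apply: filterS (FW ([:: chi K u], k)) => x [_ _ _ _ [_ xu]].
    by apply: xu; rewrite mem_head.
  apply/le_anti/andP; split.
    apply/ler_addgt0Pr => e e0; have [k ke] := small e e0.
    apply: (limit_le _ lc); apply: filterS (hk k) => x /= hxu.
    rewrite -lerBlDl; apply: le_trans (ler_norm _) (ltW (lt_trans hxu ke)).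
  apply/ler_addgt0Pr => e e0; have [k ke] := small e e0; rewrite -lerBlDr.
  apply: (limit_ge _ lc); apply: filterS (hk k) => x /= hxu.
  rewrite lerBlDr -lerBlDl; apply: le_trans (ler_norm _) _.
  by rewrite distrC ltW // (lt_trans hxu).
have ch : x0 h <= c h.
  apply/ler_addgt0Pr => e e0; have [k ke] := small e e0; rewrite -lerBlDr.
  apply: (limit_ge _ lc); apply: FU; apply: filterS (FW ([::], k)) => x [_ _ _ _ [xh _]] /=.
  by apply: le_trans xh; rewrite lerB // ltW.
have cout u : dual_val u \notin orth_cone s -> c (chi K u) = 0 by move=> us; rewrite cu x0out.
have liftu (u : orth_monoid s) : orbit_lift (chi K u : OR) = chi K (to_dual s (vo u)).
  exact: ma_lift_chi.
have [iK _ _] : prime_ideal [set f : OR | c (orbit_lift f) = 0].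
  apply: (prime_preimage (f := @orbit_lift R K n s)) (mnorm_ker_prime hc).
  - exact: orbit_lift0.
  - exact: orbit_liftD.
  - exact: orbit_liftM.
exists (c \o @orbit_lift R K n s); split=> [|f|k|f u Lf|].
- by apply: mnorm_morph => //; [exact: orbit_lift0|exact: orbit_liftD|exact: orbit_liftM].
- move=> /(ideal_span_sub iK) hf; apply: hf => _ [a Ia <-] /=.
  by rewrite orbit_lift_proj // cI.
- by rewrite /= -(chi0 K) /orbit_lift ma_liftZ -/(orbit_lift _) orbit_lift0 cK.
- rewrite /= /orbit_lift ma_liftZ ma_lift_chi.
  have to_inj : injective (fun w : orth_monoid s => to_dual s (vo w)).
    by move=> w w' /(congr1 (@dual_val R n s)); rewrite !dual_of_orth; exact: orth_val_inj.
  rewrite -(mcoeff_lift_chi f u to_inj); apply: cG.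
  by apply: supported_lift_chi => w wf /=; rewrite /lat /= dual_of_orth; exact: Lf.
- split; first by apply: le_trans ch; rewrite /x0 /= orbit_liftK.
  move=> u; rewrite /= liftu cu /x0 /= /orbit_proj ma_lift_chi /orbit_chi dual_of_orth.
  rewrite (valP u : vo u \in orth_cone s); congr (z (chi K _)).
  by apply: orth_val_inj; rewrite to_orthK //; exact: valP.
Qed.

End OrbitDomination.

(** * Shilov boundaries *)

Lemma initial_cvg (S : choiceType) (T : topologicalType) (f : S -> T) (F : set_system S) s :
  Filter F -> f @ F --> f s -> F --> (s : initial_topology f).
Proof.
move=> FF Ff A [_ [[W oW <-] Ws WA]]; apply: filterS WA _.
by apply: Ff; rewrite nbhsE; exists W.
Qed.

Section BerkovichTopology.
Variables (R : realType) (K : fieldType) (abs : K -> R) (A : comAlgType K).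

Lemma seminorm_continuous (f : A) : continuous (fun x : berkovich abs A => seminorm x f).
Proof.
move=> x; have h := @initial_continuous _ {ptws A -> R} (set_val : mult_seminorm abs (A := A) -> _) x.
exact: (continuous_comp (g := fun y : {ptws A -> R} => y f) h (@proj_continuous A (fun=> R) f _)).
Qed.

Lemma berkovich_cvg (F : set_system (berkovich abs A)) x : Filter F ->
  (forall f, (fun y => seminorm y f) @ F --> seminorm x f) -> F --> x.
Proof.
move=> FF h; apply: initial_cvg.
apply/cvg_sup => f; apply: (@initial_cvg (A -> R) R (fun y : A -> R => y f)); exact: h.
Qed.

Variable B : set (berkovich abs A).

Lemma sub_seminorm_continuous (f : A) : continuous (fun x : B => seminorm (sval x) f).
Proof.
move=> x; have h := @initial_continuous _ _ (set_val : B -> berkovich abs A) x.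
apply: (@continuous_comp B (berkovich abs A) R set_val (fun y => seminorm y f) x h).
exact: seminorm_continuous.
Qed.

Lemma sub_berkovich_cvg (F : set_system B) (x : B) : Filter F ->
  (forall f, (fun y : B => seminorm (sval y) f) @ F --> seminorm (sval x) f) -> F --> x.
Proof. by move=> FF h; apply: initial_cvg; apply: berkovich_cvg => f; exact: h. Qed.

(** Translates closedness for the subspace topology into stability under pointwise ultrafilter
    limits, the form that [dominating] uses. *)
Lemma closed_limit (C : set B) (c : B) (U : set_system (A -> R)) : closed C ->
  UltraFilter U -> U ((fun x : B => seminorm (sval x)) @` C) -> limit U (seminorm (sval c)) -> C c.
Proof.
move=> clC uU UC lc; pose i (x : B) := seminorm (sval x).
pose V : set_system B := filter_from U (fun P => i @^-1` P).
have FV : ProperFilter V.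
  apply: filter_from_proper => [|P UP].
    apply: filter_from_filter => [|P Q UP UQ]; first by exists setT; exact: filterT.
    by exists (P `&` Q) => //; exact: filterI.
  by have [_ [[x _ <-] Pix]] := filter_ex (filterI UC UP); exists x.
apply: (@closed_cvg B B V FV id C clC _ c).
  by exists (i @` C) => // x [y Cy yx]; have -> : x = y by apply: val_inj; apply: val_inj.
apply: sub_berkovich_cvg => f P /(lc f) UP.
by exists ((fun x : A -> R => x f) @^-1` P).
Qed.

End BerkovichTopology.

Lemma mnorm_dist (R : realType) (A : comNzRingType) (y : A -> R) a b : mnorm y ->
  `|y a - y b| <= y (a - b).
Proof.
move=> hy; have h c d : y c <= y (c - d) + y d.
  rewrite -[c in leLHS](subrK d); apply: le_trans (mnormD hy _ _) _.
  by rewrite ge_max lerDl lerDr !(mnorm_ge0 hy).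
rewrite ler_norml lerNl opprB lerBlDr lerBlDr h andbT.
by rewrite -[y (a - b)](mnormN hy) opprB.
Qed.

(** * Laurent series on a fibre of the tropicalization *)

Section LaurentSeries.
Variables (R : realType) (K : fieldType) (S : nmodType) (abs : K -> R) (wt : S -> R).
Hypothesis habs : mnorm abs.
Local Notation A := (monoid_algebra K S).
Variable a : S -> K.
Hypothesis afin : forall e, 0 < e -> finite_set [set u | e <= abs (a u) * wt u].

Definition laurent_sum (J : {fset S}) : A := \sum_(u <- J) a u *: chi K u.

Lemma mcoeff_laurent_sum J u : mcoeff u (laurent_sum J) = if u \in J then a u else 0.
Proof.
rewrite /laurent_sum mcoeff_sumE; have [uJ|uJ] := boolP (u \in J).
  rewrite (bigD1_seq u) ?fset_uniq //= mcoeffZ mcoeff_chi eqxx mulr1 big1 ?addr0 // => w /negPf wu.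
  by rewrite mcoeffZ mcoeff_chi wu mulr0.
rewrite big_seq big1 // => w wJ; rewrite mcoeffZ mcoeff_chi; case: eqP => [wu|_]; rewrite ?mulr0 //.
by rewrite -wu wJ in uJ.
Qed.

Lemma exists_laurent_sum e : 0 < e -> exists J : {fset S}, forall u, e <= abs (a u) * wt u -> u \in J.
Proof.
move=> e0; have /finite_fsetP[J JE] := afin e0; exists J => u ue.
by have : [set` J] u by rewrite -JE.
Qed.

Variable y : A -> R.
Hypotheses (hy : mnorm y) (yK : forall c : K, y c%:A = abs c).
Hypothesis ywt : forall u, y (chi K u) = wt u.

Lemma laurent_sum_sub e (J0 J : {fset S}) : 0 < e ->
  (forall u, e <= abs (a u) * wt u -> u \in J0) -> (J0 `<=` J)%fset ->
  y (laurent_sum J - laurent_sum J0) < e.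
Proof.
move=> e0 hJ0 /fsubsetP sub; rewrite [X in y X]ma_sum.
apply: (mnorm_sum_lt hy) => // u; rewrite -mulr_algl (mnormM hy) yK ywt -mcoeff_neq0.
rewrite mcoeffB !mcoeff_laurent_sum; have [uJ0|uJ0] := boolP (u \in J0).
  by rewrite sub // subrr eqxx.
case: ifP => _; rewrite subr0; last by rewrite eqxx.
by move=> _ _; rewrite ltNge; apply: contra uJ0; exact: hJ0.
Qed.

Definition laurent_norm : R := lim ((fun J : {fset S} => y (laurent_sum J)) @ totally).

Lemma laurent_norm_cvg : (fun J : {fset S} => y (laurent_sum J)) @ totally --> laurent_norm.
Proof.
have FT := @totally_filter S.
have tot (J0 : {fset S}) (P : set {fset S}) : (forall J, (J0 `<=` J)%fset -> P J) -> totally P.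
  by move=> h; exists J0.
suff [l hl] : exists l : R, (fun J : {fset S} => y (laurent_sum J)) @ totally --> l.
  by rewrite /laurent_norm (cvg_lim (@Rhausdorff R) hl).
(* If some partial sum is at least as large as the bound on its tail, later ones keep its value;
   otherwise the values tend to 0. *)
have [[e [J0 [e0 hJ0 ey]]]|hn] := pselect (exists e (J0 : {fset S}),
  [/\ 0 < e, forall u, e <= abs (a u) * wt u -> u \in J0 & e <= y (laurent_sum J0)]).
  exists (y (laurent_sum J0)); apply: cvg_near_cst; apply: (tot J0) => J sub.
  rewrite -[laurent_sum J](subrK (laurent_sum J0)) addrC; apply: (mnorm_addl hy).
  exact: lt_le_trans (laurent_sum_sub e0 hJ0 sub) ey.
exists 0; apply/cvgrPdist_lt => e e0; have [J0 hJ0] := exists_laurent_sum e0.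
apply: (tot J0) => J /fsubsetP sub; rewrite sub0r normrN ger0_norm ?mnorm_ge0 // ltNge.
by apply/negP => ey; apply: hn; exists e, J; split=> // u /hJ0/sub.
Qed.

(** [J0] depends on [a] and [wt] only, so the approximation is uniform over a fibre. *)
Lemma laurent_norm_near e (J0 : {fset S}) : 0 < e ->
  (forall u, e <= abs (a u) * wt u -> u \in J0) ->
  `|laurent_norm - y (laurent_sum J0)| <= e.
Proof.
move=> e0 hJ0.
have FT := @totally_filter S.
have h := cvgB laurent_norm_cvg (cvg_cst (y (laurent_sum J0))).
apply: (cvgr_to_le (cvg_norm (h _ _))); exists J0 => // J sub /=.
have lt := laurent_sum_sub e0 hJ0 sub.
exact: le_trans (mnorm_dist (laurent_sum J) (laurent_sum J0) hy) (ltW lt).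
Qed.

End LaurentSeries.

Lemma laurent_norm_poly (R : realType) (K : fieldType) (S : nmodType) (abs : K -> R) (wt : S -> R)
    (y : monoid_algebra K S -> R) (g : monoid_algebra K S) : mnorm abs -> mnorm y ->
  (forall c : K, y c%:A = abs c) -> (forall u, y (chi K u) = wt u) ->
  (forall e, 0 < e -> finite_set [set u | e <= abs (mcoeff u g) * wt u]) /\
  laurent_norm (mcoeff^~ g) y = y g.
Proof.
move=> habs hy yK ywt.
have supp e u : 0 < e -> e <= abs (mcoeff u g) * wt u -> u \in msupp g.
  move=> e0; apply: contraTT => /mcoeff_outdom ->; rewrite (mnorm0 habs) mul0r -ltNge; exact.
have fin e : 0 < e -> finite_set [set u | e <= abs (mcoeff u g) * wt u].
  move=> e0; apply: (@sub_finite_set _ _ [set` msupp g]); last exact: finite_fset.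
  by move=> u /= /(supp e u e0).
split=> //.
have gE : laurent_sum (mcoeff^~ g) (msupp g) = g by rewrite [RHS]ma_sum.
apply/eqP; rewrite -subr_eq0 -normr_le0; apply/ler_addgt0Pr => e e0; rewrite add0r -[X in y X]gE.
exact: (laurent_norm_near fin hy yK ywt e0 (fun u => supp e u e0)).
Qed.

Section Shilov.
Variables (R : realType) (K : fieldType) (abs : K -> R).
Hypothesis kabs : complete_nonarch_abs abs.
Let habs : mnorm abs := abs_mnorm kabs.
Let abs0 := abs_eq0_eq0 kabs.
Variables (n : nat) (D : set (set 'rV[R]_n)).
Hypothesis hD : pointed_rational_fan D.
Variable X : closed_subscheme K D.
Hypothesis hdense : torus_dense X.
Variable La : seq 'rV[int]_n.
Local Notation I0 := (@ideal_of R K n D X [set 0]).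
Local Notation v0 := (@dual_val R n [set 0]).
Hypothesis tI0 : tower v0 I0 La.
Hypothesis minI0 : forall P f, minimal_prime I0 P -> P f -> KL v0 La f -> f = 0.
Variables (s : D) (w : 'rV[R]_n).
Local Notation OR := (orbit_ring K (sval s)).
Local Notation vo := (@orth_val R n (sval s)).
Local Notation I := (orbit_ideal X (sval s)).
Hypothesis tI : ~ I 1 -> tower vo I La.
Local Notation Aff := (@affinoid R K abs n D X s w).
Let wt (u : orth_monoid (sval s)) : R := expR (- pairing (vo u) w).
Hypothesis affinoidP : forall z : berkovich abs OR, Aff z <->
  (forall f, I f -> seminorm z f = 0) /\ forall u, seminorm z (chi K u) = wt u.

Let Ds : D (sval s). Proof. exact: set_mem (svalP s). Qed.
Let wt_gt0 u : 0 < wt u. Proof. exact: expR_gt0. Qed.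

Let hvo : exists e (E : 'M[int]_(n, e)), lattice_emb vo E.
Proof.
by have [k [G sE]] := fan_rational hD Ds; exists k, G^T; exact: (orth_lattice_emb sE).
Qed.

Let AF : set (OR -> R) := [set c | [/\ mnorm c, forall f, I f -> c f = 0,
  forall k : K, c k%:A = abs k & forall u, c (chi K u) = wt u]].

Let AF_affinoid (x : Aff) : AF (seminorm (sval x)).
Proof.
have /affinoidP[xI xw] : Aff (sval x) by exact: set_mem (svalP x).
by split=> //; [exact: seminorm_mnorm|exact: seminorm_scalar].
Qed.

Let AF_mk c : AF c -> exists x : Aff, seminorm (sval x) = c.
Proof.
move=> [hc cI cK cw]; have aff : Aff (berk hc cK) by apply/affinoidP; rewrite berkE.
by exists (SigSub (mem_set aff)).
Qed.

Let AF_bound c f : AF c -> c f <= gaussw abs wt f.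
Proof.
move=> [hc _ cK cw]; have [e [E hv]] := hvo.
by apply: (mnorm_le_gaussw habs wt_gt0) => // u; rewrite cw.
Qed.

Let AF_limit U c : UltraFilter U -> U AF -> mnorm c -> limit U c -> AF c.
Proof.
move=> uU UAF hc lc; have pU : ProperFilter U by exact: ultra_proper.
have const a m : (forall x, AF x -> x a = m) -> c a = m.
  move=> h; apply/le_anti/andP; split.
    by apply: (limit_le _ lc); apply: filterS UAF => x /h /= ->.
  by apply: (limit_ge _ lc); apply: filterS UAF => x /h /= ->.
by split=> // [f If|k|u]; apply: const => x [_ xI xK xw] //; exact: xI.
Qed.

Let B0 : set (Aff) := [set x | gauss_on La vo (seminorm (sval x))].

Let B0_closed : closed B0.
Proof.
have -> : B0 = \bigcap_(i in [set i : (OR * orth_monoid (sval s))%type | KL vo La i.1])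
    [set x : Aff | seminorm (sval x) (mcoeff i.2 i.1 *: chi K i.2) <= seminorm (sval x) i.1].
  apply/seteqP; split=> [x xG [f u] /= Lf|x xG f u Lf]; first exact: xG.
  exact: (xG (f, u)).
apply: closed_bigI => -[f u] _ /=.
have cf g := @sub_seminorm_continuous R K abs OR Aff g.
have -> : [set x : Aff | seminorm (sval x) (mcoeff u f *: chi K u) <= seminorm (sval x) f]
   = (fun x : Aff => seminorm (sval x) f - seminorm (sval x) (mcoeff u f *: chi K u)) @^-1` [set r | 0 <= r].
  by apply/seteqP; split=> x /=; rewrite subr_ge0.
apply: preimage_closed; last exact: closed_ge.
by move=> x _; apply: continuousB; exact: cf.
Qed.

(** Domination at a partial sum yields, for each y and k, a Gauss point whose value at the series is
    at least that of y minus 1 / (k + 1). These conditions form a filter because the values of two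
    points y are comparable, and a limit point attains the maximum. *)
Let B0_boundary (x0 : Aff) : boundary B0.
Proof.
split=> [|a ain]; first exact: B0_closed.
have afin e : 0 < e -> finite_set [set u | e <= abs (a u) * wt u] by exact: ain.
pose l c : R := laurent_norm a c.
have near c e (J0 : {fset orth_monoid (sval s)}) : AF c -> 0 < e ->
    (forall u, e <= abs (a u) * wt u -> u \in J0) -> `|l c - c (laurent_sum a J0)| <= e.
  by move=> [hc _ cK cw]; exact: (laurent_norm_near afin hc cK cw).
pose W (i : (Aff * nat)%type) : set (OR -> R) := [set c | [/\ AF c, gauss_on La vo c &
  l (seminorm (sval i.1)) - i.2.+1%:R^-1 <= l c]].
pose F := filter_from setT W.
have FF : ProperFilter F.
  apply: filter_from_proper => [|[y k] _].
    apply: filter_fromT_filter => [|[y k] [y' k']]; first by exists (x0, 0%N).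
    pose y2 := if l (seminorm (sval y)) <= l (seminorm (sval y')) then y' else y.
    have y2y : l (seminorm (sval y)) <= l (seminorm (sval y2)) by rewrite /y2; case: ifP.
    have y2y' : l (seminorm (sval y')) <= l (seminorm (sval y2)).
      by rewrite /y2; case: ifPn => //; rewrite -ltNge => /ltW.
    exists (y2, maxn k k') => c [cA cG cl].
    have le1 : (maxn k k').+1%:R^-1 <= k.+1%:R^-1 :> R.
      by rewrite lef_pV2 ?posrE ?ltr0Sn // ler_nat ltnS leq_maxl.
    have le2 : (maxn k k').+1%:R^-1 <= k'.+1%:R^-1 :> R.
      by rewrite lef_pV2 ?posrE ?ltr0Sn // ler_nat ltnS leq_maxr.
    by split; split=> //; apply: le_trans cl; rewrite lerB.
  pose e : R := k.+1%:R^-1 / 2.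
  have e0 : 0 < e by rewrite divr_gt0 ?invr_gt0 ?ltr0Sn.
  have [J0 hJ0] := exists_laurent_sum afin e0.
  have [hy yI yK yw] := AF_affinoid y.
  have [c [hc cI cK cG [cy cu]]] := orbit_domination habs abs0 hD hdense tI0 minI0 Ds
    (laurent_sum a J0) hy yI yK.
  have cA : AF c by split=> // u; rewrite cu.
  exists c; split=> //=.
  have := near _ _ _ cA e0 hJ0; have := near _ _ _ (AF_affinoid y) e0 hJ0.
  rewrite !ler_norml => /andP[_ h1] /andP[h2 _].
  by rewrite (splitr k.+1%:R^-1) -/e; lra.
have FW i : F (W i) by exists i.
have W0 : F (W (x0, 0%N)) by exact: FW.
have [|f|U [c [uU FU hc lc]]] := @exists_limit R OR F FF.
- by apply: filterS W0 => c [[]].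
- by exists (gaussw abs wt f); apply: filterS W0 => c [cA _ _]; exact: AF_bound.
have pU : ProperFilter U by exact: ultra_proper.
have cA : AF c by apply: (AF_limit uU _ hc lc); apply: FU; apply: filterS W0 => x [].
have [x xE] := AF_mk cA; exists x => [f u Lf|y].
  rewrite xE; apply: (limit_le2 pU lc); apply: FU; apply: filterS W0 => x' [_ xG _].
  exact: xG.
suff : l (seminorm (sval y)) <= l (seminorm (sval x)) by [].
rewrite xE; apply/ler_addgt0Pr => e e0.
have e3 : 0 < e / 3 by rewrite divr_gt0.
have [J0 hJ0] := exists_laurent_sum afin e3.
have [k] := ltr_add_invr e3; rewrite add0r => hk.
have h1 : l (seminorm (sval y)) - e / 3 - e / 3 <= c (laurent_sum a J0).
  apply: (limit_ge _ lc); apply: FU; apply: filterS (FW (y, k)) => x' [x'A _ /= xl].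
  have := near _ _ _ x'A e3 hJ0; rewrite ler_norml => /andP[_]; rewrite lerBlDr => h2.
  rewrite lerBlDl; apply: le_trans h2; apply: le_trans xl.
  by rewrite lerB // ltW.
have := near _ _ _ cA e3 hJ0; rewrite ler_norml => /andP[h2 _].
have -> : e = e / 3 + e / 3 + e / 3 by field.
by move: h1 h2; lra.
Qed.

(** A boundary [C] dominates [z]. It is cut down first to equality with [z] on K[M'], where the
    Gauss norm is maximal, then to equality at every function that peaks at [z]; [peak] for the
    integral equation of each f leaves only [z]. *)
Let B0_minimal (C : set Aff) : boundary C -> B0 `<=` C.
Proof.
move=> [clC Cmax] x xG; have [e [E hv]] := hvo.
pose z := seminorm (sval x); have [hz zI zK zw] := AF_affinoid x.
have I1 : ~ I 1.
  by move=> I1; have := mnorm1 hz; rewrite (zI 1 I1) => /esym/eqP; rewrite oner_eq0.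
pose DD := (fun y : Aff => seminorm (sval y)) @` C.
have DDA c : DD c -> AF c by move=> [y _ <-]; exact: AF_affinoid.
have dom0 : dominating z DD.
  split=> [c /DDA[] //|f|U c uU UD hc lc|g].
  - by exists (gaussw abs wt f) => c /DDA; exact: AF_bound.
  - have cA : AF c by apply: (AF_limit uU _ hc lc); apply: filterS UD => y /DDA.
    have [y yE] := AF_mk cA; exists y => //.
    by apply: (closed_limit clC uU UD); rewrite yE.
  - have [fin lz] := laurent_norm_poly g habs hz zK zw.
    have [y Cy ymax] := Cmax (mcoeff^~ g) fin.
    exists (seminorm (sval y)); first by exists y.
    have [hy _ yK yw] := AF_affinoid y; have [_ ly] := laurent_norm_poly g habs hy yK yw.
    by rewrite -ly /z -lz; exact: ymax.
have gle c f : AF c -> KL vo La f -> c f <= z f.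
  move=> cA Lf; apply: le_trans (AF_bound f cA) _; apply: gaussw_leP => [|u uf].
    exact: (mnorm_ge0 hz).
  by have := xG f u Lf; rewrite -mulr_algl (mnormM hz) zK zw.
pose E1 := [set f : OR | KL vo La f /\ f != 0].
have dom1 : dominating z (DD `&` [set c | forall f, E1 f -> c f = z f]).
  apply: (dominating_refine hz dom0) => [f [Lf f0]|f c [Lf _] /DDA cA]; last exact: gle.
  have [u uf] : exists u, mcoeff u f != 0.
    apply: contrapT => /forallNP h; move/eqP: f0; apply; apply/malgP => u; rewrite mcoeff0.
    by apply/eqP/negPn/negP => /h.
  have := xG f u Lf; apply: lt_le_trans; rewrite -mulr_algl (mnormM hz) zK zw mulr_gt0 //.
  by rewrite lt_def (mnorm_ge0 habs) andbT; apply/eqP => /abs0/eqP; exact/negP.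
pose CC := [set c | AF c /\ forall f, KL vo La f -> c f = z f].
pose E2 := [set g | 0 < z g /\ forall c, CC c -> c g <= z g].
have DDCC c : (DD `&` [set c | forall f, E1 f -> c f = z f]) c -> CC c.
  move=> [/DDA cA cE]; split=> // f Lf; have [->|f0] := eqVneq f 0; last exact: cE.
  by have [hc _ _ _] := cA; rewrite (mnorm0 hc) /z (mnorm0 hz).
have dom2 : dominating z ((DD `&` [set c | forall f, E1 f -> c f = z f]) `&`
    [set c | forall f, E2 f -> c f = z f]).
  apply: (dominating_refine hz dom1) => [f []//|f c [_ h] /DDCC]; exact: h.
have [c [cD cE] _] := dom_ge dom2 1.
have [_ cK] := DDCC c cD; have [[y Cy yE] _] := cD.
suff cz : c = z.
  suff -> : x = y by [].
  by apply: val_inj; apply: berk_eq => f; rewrite -/z -cz -yE.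
apply/funext => f; have iI : ideal I by exact: ideal_span_ideal.
have [p [pm Lp Ip]] := finite_over_monic (KL_subring hv K La) iI (tower_finite hv iI (tI I1)) f.
have [|||||g [g0 gz geq]] := @peak _ _ CC z p f.
- by move=> c' [[]].
- by split=> //; exact: AF_affinoid.
- exact: pm.
- by move=> c' i [_ h]; exact: h.
- by move=> c' [[_ h _ _] _]; exact: h.
by apply: geq; [split=> //; exact: DDA (proj1 cD)|exact: cE].
Qed.

Lemma affinoid_shilov_boundary (x0 : Aff) :
  shilov_boundary [set x : Aff | gauss_on La vo (seminorm (sval x))].
Proof. by split; [exact: B0_boundary|move=> C; exact: B0_minimal]. Qed.

End Shilov.

(** * Gluing *)

Section Faces.
Variables (R : realType) (n : nat).
Implicit Types s t : set 'rV[R]_n.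

Lemma face_sub t s : face t s -> t `<=` s.
Proof. by move=> [m _ ->] x []. Qed.

Lemma face_functional t s : face t s ->
  exists m : dual_monoid s, t = s `&` [set x | pairing (dual_val m) x = 0].
Proof. by move=> [m ms ->]; exists (to_dual s m); rewrite to_dualK. Qed.

Lemma functional_orth t s (m : dual_monoid s) :
  t = s `&` [set x | pairing (dual_val m) x = 0] -> dual_val m \in orth_cone t.
Proof. by move=> ->; apply/asboolP => v []. Qed.

Lemma orth_coneN t u : u \in orth_cone t -> - u \in orth_cone t.
Proof.
move=> /asboolP h; apply/asboolP => v tv.
have := h v tv; rewrite /pairing => hv; rewrite (eq_bigr (fun i => - ((u 0 i)%:~R * v 0 i))).
  by rewrite sumrN hv oppr0.
by move=> i _; rewrite mxE rmorphN mulNr.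
Qed.

End Faces.

Section TropicalGluing.
Variables (R : realType) (n : nat) (D : set (set 'rV[R]_n)).
Hypothesis hD : pointed_rational_fan D.

(* An invariant of the gluing that determines h. *)
Definition finite_diffs (s : set 'rV[R]_n) (h : ext_hom R (dual_monoid s)) (u : 'rV[int]_n) (c : R) : Prop :=
  exists (a b : dual_monoid s) (ca cb : R), [/\ dual_val a = u + dual_val b,
    ext_val h a = ca%:E, ext_val h b = cb%:E & c = ca - cb].

Lemma ext_val0 (S : nmodType) (h : ext_hom R S) : ext_val h 0 = 0%E.
Proof. by have /set_mem[] := valP h. Qed.

Lemma ext_valD (S : nmodType) (h : ext_hom R S) u v :
  ext_val h (u + v) = (ext_val h u + ext_val h v)%E.
Proof. by have /set_mem[_ hD' _] := valP h; exact: hD'. Qed.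

Lemma ext_valNy (S : nmodType) (h : ext_hom R S) u : ext_val h u <> -oo%E.
Proof. by have /set_mem[_ _ hNy] := valP h; exact: hNy. Qed.

Lemma ext_valMn (S : nmodType) (h : ext_hom R S) u c N : ext_val h u = c%:E ->
  ext_val h (u *+ N) = (c *+ N)%:E.
Proof.
move=> hu; elim: N => [|N IH]; first by rewrite !mulr0n ext_val0.
by rewrite !mulrS ext_valD IH hu.
Qed.

(** A multiple of the functional [m] that cuts out the face moves both exponents into the dual cone
    of the larger cone. On the face [m] is invertible, so its value is finite and cancels in the
    difference. *)
Lemma Nglue_finite_diffs (x y : {s : D & ext_hom R (dual_monoid (sval s))}) u c :
  Nglue x y -> finite_diffs (projT2 x) u c <-> finite_diffs (projT2 y) u c.
Proof.
case: x y => [t h] [s k] [/= fts hk]; have ts := face_sub fts.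
have Ds : D (sval s) := set_mem (svalP s).
have [m mE] := face_functional fts.
pose m' : dual_monoid (sval t) := to_dual (sval t) (dual_val m).
have m'E : dual_val m' = dual_val m by exact: dual_val_incl.
split=> [[a [b [ca [cb [abE ha hb ->]]]]]|[a [b [ca [cb [abE ka kb ->]]]]]]; last first.
  exists (to_dual (sval t) (dual_val a)), (to_dual (sval t) (dual_val b)), ca, cb.
  by rewrite !dual_val_incl // -!hk.
have [cm hm] : exists cm, ext_val h m' = cm%:E.
  pose mN : dual_monoid (sval t) := to_dual (sval t) (- dual_val m).
  have mNE : dual_val mN = - dual_val m.
    by rewrite to_dualK //; apply: orth_dual; apply: orth_coneN; exact: functional_orth mE.
  have : ext_val h (m' + mN) = 0%E.
    rewrite -(ext_val0 h); congr (ext_val h _); apply: dual_val_inj.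
    by rewrite dual_valD m'E mNE subrr.
  rewrite ext_valD; case: (ext_val h m') (@ext_valNy _ h m') => [r _ _|_|//].
    by exists r.
  by case: (ext_val h mN) (@ext_valNy _ h mN).
have [Na hNa] := dual_absorb hD Ds mE (dual_valP a).
have [Nb hNb] := dual_absorb hD Ds mE (dual_valP b).
pose N := maxn Na Nb.
have ext (d : dual_monoid (sval t)) cd : ext_val h d = cd%:E ->
    dual_val d + dual_val m *+ N \in dual_cone (sval s) ->
    ext_val k (to_dual (sval s) (dual_val d + dual_val m *+ N)) = (cd + cm *+ N)%:E.
  move=> hd dN; rewrite hk to_dualK // EFinD -hd -(ext_valMn N hm) -ext_valD.
  congr (ext_val h _); apply: dual_val_inj.
  rewrite dual_valD dual_valMn m'E to_dualK //; exact: dual_cone_sub dN.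
have aN := hNa N (leq_maxl _ _); have bN := hNb N (leq_maxr _ _).
exists (to_dual (sval s) (dual_val a + dual_val m *+ N)).
exists (to_dual (sval s) (dual_val b + dual_val m *+ N)), (ca + cm *+ N), (cb + cm *+ N).
by rewrite (ext a ca) // (ext b cb) // !to_dualK // abE addrA; split=> //; rewrite opprD addrACA subrr addr0.
Qed.

Lemma finite_diffs_val (s : set 'rV[R]_n) (h k : ext_hom R (dual_monoid s)) u c :
  (forall w d, finite_diffs h w d -> finite_diffs k w d) ->
  ext_val h u = c%:E -> ext_val k u = c%:E.
Proof.
move=> hk hu; have [|a [b [ca [cb [abE ka kb ->]]]]] := hk (dual_val u) c.
  by exists u, 0, c, 0; rewrite dual_val0 addr0 hu ext_val0 subr0.
have abE' : a = u + b by exact: dual_val_inj.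
move: ka; rewrite abE' ext_valD kb.
case: (ext_val k u) (@ext_valNy _ k u) => [r _ /=|//|//].
by move=> [<-]; rewrite addrK.
Qed.

(** Gluing preserves [finite_diffs]; with b = 0 it recovers the finite values of [h], and thereby
    the places where [h] is infinite. *)
Lemma Nchart_inj (s : D) : injective (@Nchart R n D s).
Proof.
move=> h k; rewrite /Nchart.
move=> /(glue_piP (@Nglue R n D) (existT _ s h) (existT _ s k)) hk.
have {hk} hk u c : finite_diffs h u c <-> finite_diffs k u c.
  suff: forall x y, clos_refl_sym_trans _ (@Nglue R n D) x y ->
      forall u c, finite_diffs (projT2 x) u c <-> finite_diffs (projT2 y) u c.
    by move=> H; exact: (H _ _ hk).
  move=> x y; elim=> [x' y' xy u' c'|x' u' c'|x' y' _ IH u' c'|x' y' z' _ IH1 _ IH2 u' c'].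
  - exact: Nglue_finite_diffs.
  - by [].
  - exact: iff_sym.
  - exact: iff_trans (IH1 _ _) (IH2 _ _).
apply: val_inj; apply/funext => u; suff : ext_val h u = ext_val k u by [].
case hu: (ext_val h u) => [c||]; last by case: (@ext_valNy _ h u).
  by rewrite (finite_diffs_val (k := k) _ hu) // => w d /hk.
case ku: (ext_val k u) => [c|//|]; last by case: (@ext_valNy _ k u).
by have := finite_diffs_val (k := h) (fun w d => proj2 (hk w d)) ku; rewrite hu.
Qed.

End TropicalGluing.

Section ChartGluing.
Variables (R : realType) (K : fieldType) (abs : K -> R).
Hypothesis kabs : complete_nonarch_abs abs.
Variables (n : nat) (D : set (set 'rV[R]_n)).
Hypothesis hD : pointed_rational_fan D.
Local Notation toric_ring := (@toric_ring R K n).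
Local Notation orbit_ring := (@orbit_ring R K n).
Local Notation chart := {s : D & berkovich abs (toric_ring (sval s))}.

(** A predicate preserved by one gluing step depends only on the point of the glued space. *)
Lemma Ychart_invariant (Q : forall s : set 'rV[R]_n, berkovich abs (toric_ring s) -> Prop) :
  (forall x y : chart, Yglue x y -> Q _ (projT2 x) <-> Q _ (projT2 y)) ->
  forall (s t : D) (x : berkovich abs (toric_ring (sval s))) (y : berkovich abs (toric_ring (sval t))),
  Ychart x = Ychart y -> Q _ x <-> Q _ y.
Proof.
move=> hQ s t x y; rewrite /Ychart.
move=> /(glue_piP (@Yglue R K abs n D) (existT _ s x) (existT _ t y)) xy.
suff: forall x y, clos_refl_sym_trans _ (@Yglue R K abs n D) x y -> Q _ (projT2 x) <-> Q _ (projT2 y).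
  by move=> H; exact: (H _ _ xy).
move=> x' y'; elim=> [x1 y1|x1|x1 y1 _|x1 y1 z1 _ IH1 _ IH2].
- exact: hQ.
- by [].
- exact: iff_sym.
- exact: iff_trans IH1 IH2.
Qed.

Section Subscheme.
Variable X : closed_subscheme K D.

Lemma ideal_kernel_invariant (s t : D) (x : berkovich abs (toric_ring (sval s)))
    (y : berkovich abs (toric_ring (sval t))) : Ychart x = Ychart y ->
  (forall f, @ideal_of R K n D X (sval s) f -> seminorm x f = 0) <->
  (forall f, @ideal_of R K n D X (sval t) f -> seminorm y f = 0).
Proof.
apply: (@Ychart_invariant (fun s x => forall f, @ideal_of R K n D X s f -> seminorm x f = 0)).
move=> {s t x y} [t x] [s y] [/= fts yx].
have Ds : D (sval s) := set_mem (svalP s); have Dt : D (sval t) := set_mem (svalP t).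
split=> [xI f If|yI f].
  by rewrite yx; apply: xI; rewrite (ideal_of_face X Ds Dt fts); apply: sub_ideal_span; exists f.
rewrite (ideal_of_face X Ds Dt fts); have [iK _ _] := mnorm_ker_prime (seminorm_mnorm kabs x).
by move=> /(ideal_span_sub iK) h; apply: h => _ [g Ig <-] /=; rewrite -yx; exact: yI.
Qed.

Lemma XanP (s : D) (x : berkovich abs (toric_ring (sval s))) : Xan X (Ychart x) <->
  forall f, @ideal_of R K n D X (sval s) f -> seminorm x f = 0.
Proof.
split=> [[t [y [xy yI]]]|xI]; first exact/(ideal_kernel_invariant xy).
by exists s, x.
Qed.

Lemma orbit_ideal_kernel (s : D) (z : berkovich abs (orbit_ring (sval s))) :
  (forall f, @ideal_of R K n D X (sval s) f -> seminorm (orbit_pullback z) f = 0) <->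
  forall f, orbit_ideal X (sval s) f -> seminorm z f = 0.
Proof.
split=> [zI f|zI f If]; last by rewrite orbit_pullbackE; apply: zI; apply: sub_ideal_span; exists f.
have [iK _ _] := mnorm_ker_prime (seminorm_mnorm kabs z).
move=> /(ideal_span_sub iK) h; apply: h => _ [g Ig <-] /=.
by rewrite -orbit_pullbackE; exact: zI.
Qed.

(** By [Nchart_inj] the equation in the glued space becomes one between homomorphisms on the chart
    of [s], both infinite at the exponents outside the orthogonal. *)
Lemma affinoidP (s : D) (w : 'rV[R]_n) (z : berkovich abs (orbit_ring (sval s))) :
  affinoid X w z <-> (forall f, orbit_ideal X (sval s) f -> seminorm z f = 0) /\
    forall u, seminorm z (chi K u) = expR (- pairing (orth_val u) w).
Proof.
have hz := seminorm_mnorm kabs z.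
have chi_pos u : 0 < seminorm z (chi K u).
  have [k [G sE]] := fan_rational hD (set_mem (svalP s)).
  exact: (chi_gt0 (orth_lattice_emb sE)).
suff h : trop (orbit_emb z) = Nstratum s w <->
    forall u, seminorm z (chi K u) = expR (- pairing (orth_val u) w).
  by rewrite -h -orbit_ideal_kernel -XanP.
rewrite trop_Ychart; split=> [/(Nchart_inj hD)E u|zw].
  pose u' := to_dual (sval s) (orth_val u).
  have u'o : dual_val u' \in orth_cone (sval s) by rewrite dual_of_orth; exact: valP.
  have := congr1 (fun h => ext_val h u') E.
  rewrite /ext_val /= /stratum_fun u'o /orbit_proj ma_lift_chi /orbit_chi u'o dual_of_orth.
  have -> : to_orth (sval s) (orth_val u) = u.
    by apply: orth_val_inj; rewrite to_orthK //; exact: valP.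
  by rewrite leNgt chi_pos /= => -[<-]; rewrite opprK lnK //; exact: chi_pos.
congr Nchart; apply: val_inj; apply/funext => u; rewrite /= /stratum_fun.
have E : ma_lift (@orbit_chi R K n (sval s)) (chi K u) = orbit_chi K u by exact: ma_lift_chi.
rewrite E /orbit_chi; case: (boolP (dual_val u \in orth_cone (sval s))) => uo /=.
  by rewrite zw leNgt expR_gt0 /= expRK opprK to_orthK.
by have -> : seminorm z 0 = 0 := mnorm0 hz; rewrite lexx.
Qed.

End Subscheme.

End ChartGluing.

Lemma mnorm_chiD (R : realType) (K : fieldType) (S : nmodType) (x : monoid_algebra K S -> R) u w :
  mnorm x -> x (chi K (u + w)) = x (chi K u) * x (chi K w).
Proof. by move=> hx; rewrite chiD (mnormM hx). Qed.

(** [w] is read off from the logarithms at a basis, through the dual coordinates [V]. *)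
Lemma character_exp (R : realType) n e (S : nmodType) (v : S -> 'rV[int]_n) (E : 'M[int]_(n, e))
    (f : S -> R) : lattice_emb v E -> f 0 = 1 -> (forall u w, f (u + w) = f u * f w) ->
  (forall u, 0 < f u) -> exists w : 'rV[R]_n, forall u, f u = expR (- pairing (v u) w).
Proof.
move=> hv f0 fD fpos; have [r [b [V [Lb bV bgen _]]]] := lat_basis hv [::].
pose la i := - ln (f (b i)).
pose w : 'rV[R]_n := \row_j \sum_i (V j i)%:~R * la i.
have wE x : pairing x w = \sum_i ((x *m V) 0 i)%:~R * la i.
  rewrite /pairing (eq_bigr (fun j => \sum_i (x 0 j)%:~R * ((V j i)%:~R * la i))).
    rewrite exchange_big; apply: eq_bigr => i _.
    rewrite mxE rmorph_sum /= mulr_suml; apply: eq_bigr => j _.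
    by rewrite rmorphM mulrA.
  by move=> j _; rewrite mxE mulr_sumr.
have fb i : f (b i) = expR (- pairing (v (b i)) w).
  rewrite wE bV (bigD1 i) //= big1 => [|i' /negPf ii']; last by rewrite mxE ii' andbF mul0r.
  have -> : (delta_mx 0 i : 'rV[int]_r) 0 i = 1 by rewrite mxE !eqxx.
  by rewrite mulr1z mul1r addr0 opprK lnK // posrE.
exists w => u.
apply: (lat_ind (Q := fun u => f u = expR (- pairing (v u) w)) hv Lb bV bgen) => //.
  by rewrite f0 (emb0 hv) pairing0 oppr0 expR0.
move=> u' i _ IH; split; first by rewrite fD IH fb (embD hv) pairingD opprD expRD.
have fbn : f (b i) != 0 by rewrite gt_eqF.
apply: (mulIf fbn); rewrite -fD (emb_subK hv) IH fb -expRD -opprD -pairingD.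
by rewrite (emb_subE hv) subrK.
Qed.

Section OrbitDecomposition.
Variables (R : realType) (K : fieldType) (abs : K -> R).
Hypothesis kabs : complete_nonarch_abs abs.
Variables (n : nat) (D : set (set 'rV[R]_n)).
Hypothesis hD : pointed_rational_fan D.
Local Notation toric_ring := (@toric_ring R K n).
Local Notation orbit_ring := (@orbit_ring R K n).

(* Among the characters that do not vanish at x, m is positive on as many
   generators of s as possible. *)
Lemma support_face (s : set 'rV[R]_n) (x : toric_ring s -> R) : D s -> mnorm x ->
  exists t (m : dual_monoid s), [/\ t = s `&` [set v | pairing (dual_val m) v = 0],
    x (chi K m) != 0 & forall u : dual_monoid s, x (chi K u) != 0 -> dual_val u \in orth_cone t].
Proof.
move=> Ds hx; have [k [G sE]] := fan_rational hD Ds.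
pose supp (u : dual_monoid s) : {set 'I_k} := [set i | (dual_val u *m G^T) 0 i != 0]%SET.
pose P j := `[< exists u, x (chi K u) != 0 /\ #|supp u| = j >].
have exP : exists j, P j.
  by exists #|supp 0|; apply/asboolP; exists 0; rewrite chi0 (mnorm1 hx) oner_eq0.
have bd j : P j -> (j <= k)%N by move=> /asboolP[u [_ <-]]; rewrite -[k in (_ <= k)%N]card_ord max_card.
case: (ex_maxnP exP bd) => j /asboolP[m [mx mj]] jmax.
exists (s `&` [set v | pairing (dual_val m) v = 0]), m; split=> // u ux.
have pos (w : dual_monoid s) i : 0 <= (dual_val w *m G^T) 0 i.
  by have /(dual_coneP _ sE) := dual_valP w; apply.
have suppD : supp (u + m) = (supp u :|: supp m)%SET.
  apply/setP => i; rewrite !inE dual_valD mulmxDl mxE.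
  by have := pos u i; have := pos m i; set a := _ 0 i; set b := _ 0 i; lia.
have sub : supp u \subset supp m.
  have le : (#|supp (u + m)%R| <= #|supp m|)%N.
    rewrite mj; apply: jmax; apply/asboolP; exists (u + m).
    split; last by [].
    have -> : x (chi K (u + m)) = x (chi K u) * x (chi K m) := mnorm_chiD u m hx.
    exact: mulf_neq0 ux mx.
  apply/finset.setUidPr/eqP; rewrite eq_sym eqEcard finset.subsetUr /= -suppD; exact: le.
apply/asboolP => v [sv mv]; have [c c0 vE] : exists2 c : 'rV[R]_k,
  forall i, 0 <= c 0 i & v = c *m map_mx intr G by have := sv; rewrite {1}sE.
rewrite vE pairing_comb big1 // => i _.
have : pairing (dual_val m) v = 0 by exact: mv.
rewrite vE pairing_comb => /eqP; rewrite psumr_eq0; last first.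
  by move=> i' _; rewrite mulr_ge0 ?c0 // ler0z.
move=> /allP/(_ i (mem_index_enum _)) /=; rewrite mulf_eq0 => /orP[/eqP ->|].
  by rewrite mul0r.
rewrite intr_eq0 => mi; have [ui|] := boolP (i \in supp u).
  by have := fintype.subsetP sub i ui; rewrite inE mi.
by rewrite inE negbK => /eqP ->; rewrite mulr0.
Qed.

Lemma extend_to_face (s t : set 'rV[R]_n) (x : toric_ring s -> R) (m : dual_monoid s) : D s ->
  t = s `&` [set v | pairing (dual_val m) v = 0] -> mnorm x -> x (chi K m) != 0 ->
  exists2 y : toric_ring t -> R, mnorm y & forall f, y (incl t f) = x f.
Proof.
move=> Ds tE hx mx; have ts : t `<=` s by rewrite tE => v [].
have i1 := @incl1 R K n s t; have iD := @inclD R K n s t; have iM := @inclM R K n s t ts.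
apply: (mnorm_extension i1 iD iM hx) => [c /(incl_inj ts) ->|f]; first exact: mnorm0.
rewrite (ma_sum f); apply: (big_ind (fraction (@incl R K n s t) x)) => [|g h|u _].
- have -> : 0 = incl t (0 : toric_ring s) by rewrite /incl ma_lift0.
  exact: fraction_image.
- exact: fractionD.
rewrite -mulr_algl; apply: fractionM => //.
  by rewrite -(incl_scalar s t); exact: fraction_image.
have [N hN] := dual_absorb hD Ds tE (dual_valP u).
pose a := to_dual s (dual_val u + dual_val m *+ N).
have aE : dual_val a = dual_val u + dual_val m *+ N by rewrite to_dualK // hN.
exists (chi K (m *+ N)), (chi K a); split.
  by rewrite chiMn (mnormX hx) expf_neq0.
by apply: (incl_chi_mul K ts); rewrite aE dual_valMn addrC.
Qed.

(** The orbit is that of the face [t] from [support_face]: [x] extends to the chart of [t] because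
    it does not vanish at the character of [m], and there it kills all characters outside the
    orthogonal of [t]. *)
Lemma exists_orbit_point (s : D) (x : berkovich abs (toric_ring (sval s))) :
  exists (t : D) (z : berkovich abs (orbit_ring (sval t))), Ychart x = orbit_emb z.
Proof.
have Ds : D (sval s) := set_mem (svalP s).
have hx := seminorm_mnorm kabs x.
have [t0 [m [tE mx out]]] := support_face Ds hx.
have fts : face t0 (sval s) by exists (dual_val m); [exact: dual_valP|].
have Dt : D t0 := fan_face hD Ds fts.
have ts := face_sub fts.
have [y hy yx] := extend_to_face Ds tE hx mx.
have yK (c : K) : y c%:A = abs c by rewrite -(incl_scalar (sval s) t0) yx seminorm_scalar.
have yout u : dual_val u \notin orth_cone t0 -> y (chi K u) = 0.
  move=> uo; have [N hN] := dual_absorb hD Ds tE (dual_valP u).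
  pose a := to_dual (sval s) (dual_val u + dual_val m *+ N).
  have aE : dual_val a = dual_val u + dual_val m *+ N by rewrite to_dualK // hN.
  have xa : seminorm x (chi K a) = 0.
    apply/eqP/negPn/negP => /out ao; move/negP: uo; apply.
    have mo := functional_orth tE; have mNo : dual_val m *+ N \in orth_cone t0 by rewrite rpredMn.
    by rewrite -[dual_val u](addrK (dual_val m *+ N)) -aE rpredD // orth_coneN.
  have aE' : dual_val a = dual_val (m *+ N) + dual_val u by rewrite aE dual_valMn addrC.
  have /eqP : y (incl t0 (chi K (m *+ N))) * y (chi K u) = 0.
    exact: etrans (esym (mnormM hy _ _)) (etrans (congr1 y (incl_chi_mul K ts aE')) (etrans (yx _) xa)).
  rewrite mulf_eq0 => /orP[/eqP h|/eqP //].
  have : seminorm x (chi K (m *+ N)) = 0 := etrans (esym (yx _)) h.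
  by rewrite chiMn (mnormX hx) => /eqP; rewrite expf_eq0 (negPf mx) andbF.
pose t : D := SigSub (mem_set Dt).
pose zf := y \o @orbit_lift R K n t0.
have hz : mnorm zf.
  by apply: mnorm_morph => //; [exact: orbit_lift0|exact: orbit_liftD|exact: orbit_liftM].
have zK (c : K) : zf c%:A = abs c.
  by rewrite /zf /= -(chi0 K) /orbit_lift ma_liftZ -/(orbit_lift _) orbit_lift0 yK.
exists t, (berk hz zK : berkovich abs (orbit_ring (sval t))).
apply/esym/glue_pi_step; split=> //= f.
by rewrite /zf /= orbit_lift_proj // yx.
Qed.

Lemma exists_trop_vector (t : set 'rV[R]_n) (z : berkovich abs (orbit_ring t)) : D t ->
  exists w, forall u, seminorm z (chi K u) = expR (- pairing (orth_val u) w).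
Proof.
move=> Dt; have [k [G tE]] := fan_rational hD Dt; have hv := orth_lattice_emb tE.
have hz := seminorm_mnorm kabs z.
apply: (character_exp hv (f := fun u => seminorm z (chi K u))) => [|u u'|u].
- exact: mnorm1 hz.
- exact: mnorm_chiD.
- exact: (chi_gt0 hv).
Qed.

End OrbitDecomposition.

(** * The coset criterion on the charts *)

Section CosetGauss.
Variables (R : realType) (K : fieldType) (abs : K -> R).
Hypothesis kabs : complete_nonarch_abs abs.
Variables (n : nat) (D : set (set 'rV[R]_n)).
Hypothesis hD : pointed_rational_fan D.
Variable La : seq 'rV[int]_n.
Local Notation toric_ring := (@toric_ring R K n).
Local Notation orbit_ring := (@orbit_ring R K n).

Definition coset (S : nmodType) (v : S -> 'rV[int]_n) (f : monoid_algebra K S) : Prop :=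
  forall a b, mcoeff a f != 0 -> mcoeff b f != 0 -> forall t, t \in La -> dot (v a - v b) t = 0.

(* Unlike gauss_on, this makes sense on the charts: it is invariant under the
   multiplication by monomials needed to pass to faces. *)
Definition coset_gauss (s : set 'rV[R]_n) (x : toric_ring s -> R) : Prop :=
  forall f u, coset (@dual_val R n s) f -> x (mcoeff u f *: chi K u) <= x f.

(** A multiple of [m], whose character is invertible on the face, shifts finitely many exponents
    into the dual cone of [s] and keeps them in one coset. *)
Lemma coset_gauss_incl (s t : set 'rV[R]_n) (x : toric_ring t -> R) (y : toric_ring s -> R) :
  D s -> face t s -> mnorm x -> (forall f, y f = x (incl t f)) ->
  coset_gauss x <-> coset_gauss y.
Proof.
move=> Ds fts hx yx; have ts := face_sub fts.
split=> [xG f u cf|yG f u cf].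
  rewrite !yx incl_scale_chi -(mcoeff_incl ts); apply: xG.
  have supp w : mcoeff w (incl t f) != 0 -> exists2 u', mcoeff u' f != 0 & dual_val w = dual_val u'.
    apply: (supported_lift_chi (L := fun w => exists2 u', mcoeff u' f != 0 & dual_val w = dual_val u')).
    by move=> u' u'f; exists u' => //; rewrite dual_val_incl.
  move=> a b /supp[a' a'f ->] /supp[b' b'f ->]; exact: cf.
have [m mE] := face_functional fts.
have absorb (r : seq (dual_monoid t)) : exists N, forall u, u \in r -> dual_val u + dual_val m *+ N \in dual_cone s.
  elim: r => [|u' r [N hN]]; first by exists 0%N.
  have [N' hN'] := dual_absorb hD Ds mE (dual_valP u').
  have mulm k w : w \in dual_cone s -> w + dual_val m *+ k \in dual_cone s.
    by move=> ws; rewrite rpredD // rpredMn // dual_valP.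
  exists (N + N')%N => w; rewrite inE => /predU1P[->|/hN wN]; first by apply: hN'; rewrite leq_addl.
  by rewrite mulrnDr addrA; exact: mulm.
(* [u] is listed separately because it need not belong to the support of [f]. *)
have [N hN] := absorb (u :: enum_fset (msupp f)).
pose sh (w : dual_monoid t) : dual_monoid s := to_dual s (dual_val w + dual_val m *+ N).
have shE w : w \in u :: enum_fset (msupp f) -> dual_val (sh w) = dual_val (m *+ N) + dual_val w.
  by move=> wf; rewrite to_dualK ?hN // dual_valMn addrC.
pose c : toric_ring t := incl t (chi K (m *+ N) : toric_ring s).
have shc w : w \in u :: enum_fset (msupp f) -> c * chi K w = incl t (chi K (sh w) : toric_ring s).
  by move=> wf; exact: (incl_chi_mul K ts (shE w wf)).
pose g : toric_ring s := \sum_(w <- msupp f) mcoeff w f *: chi K (sh w).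
have ig : incl t g = c * f.
  rewrite [in RHS](ma_sum f) mulr_sumr /incl ma_lift_sum big_seq [RHS]big_seq.
  apply: eq_bigr => w wf; rewrite ma_liftZ -/(incl t _) -shc ?inE ?wf ?orbT //.
  by rewrite scalerAr.
have sh_inj w w' : w \in u :: enum_fset (msupp f) -> w' \in u :: enum_fset (msupp f) -> sh w = sh w' -> w = w'.
  move=> wf w'f /(congr1 (@dual_val R n s)); rewrite !shE // => /addrI; exact: dual_val_inj.
have mc : mcoeff (sh u) g = mcoeff u f.
  rewrite /g mcoeff_sumE [in RHS](ma_sum f) mcoeff_sumE big_seq [RHS]big_seq; apply: eq_bigr => w wf.
  rewrite !mcoeffZ !mcoeff_chi; congr (_ * _%:R); congr nat_of_bool.
  apply/eqP/eqP => [|->//]; apply: sh_inj; by rewrite inE ?eqxx ?wf ?orbT.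
have cg : coset (@dual_val R n s) g.
  have supp w : mcoeff w g != 0 -> exists2 u', mcoeff u' f != 0 & w = sh u'.
    move=> wg; apply: contrapT => hn; move/eqP: wg; apply.
    rewrite /g mcoeff_sumE big_seq big1 // => w' w'f; rewrite mcoeffZ mcoeff_chi.
    case: eqP => [ww'|_]; last by rewrite mulr0.
    by exfalso; apply: hn; exists w' => //; rewrite mcoeff_neq0.
  move=> a b /supp[a' a'f ->] /supp[b' b'f ->] t' t'L.
  have memf w : mcoeff w f != 0 -> w \in u :: enum_fset (msupp f).
    by move=> wf; rewrite inE; apply/orP; right; have := wf; rewrite mcoeff_neq0.
  rewrite (shE a' (memf _ a'f)) (shE b' (memf _ b'f)) opprD addrACA subrr add0r; exact: cf.
have xc : 0 < x c.
  have mo := functional_orth mE.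
  pose mV : dual_monoid t := to_dual t (- dual_val m *+ N).
  have mVE : dual_val mV = - dual_val m *+ N.
    by rewrite to_dualK //; apply: orth_dual; rewrite rpredMn // orth_coneN.
  have : c * chi K mV = 1.
    have e1 : dual_val (0 : dual_monoid s) = dual_val (m *+ N) + dual_val mV.
      by rewrite dual_val0 mVE dual_valMn mulNrn subrr.
    by rewrite /c (incl_chi_mul K ts e1) chi0 incl1.
  move=> h; rewrite lt_def (mnorm_ge0 hx) andbT; apply/eqP => c0.
  by have := mnorm1 hx; rewrite -h (mnormM hx) c0 mul0r => /eqP; rewrite eq_sym oner_eq0.
have := yG g (sh u) cg; rewrite mc !yx ig (mnormM hx) incl_scale_chi.
have -> : chi K (to_dual t (dual_val (sh u))) = c * chi K u.
  by rewrite shc ?inE ?eqxx //; apply/esym; exact: ma_lift_chi.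
by rewrite scalerAr (mnormM hx) ler_pM2l.
Qed.

(** On the orbit characters are units: dividing by that of [u] moves the coset of [u] onto M'.
    Characters outside the orthogonal vanish on the orbit and satisfy the inequality trivially. *)
Lemma coset_gauss_pullback (t : set 'rV[R]_n) (z : orbit_ring t -> R) : D t -> mnorm z ->
  coset_gauss (z \o @orbit_proj R K n t) <-> gauss_on La (@orth_val R n t) z.
Proof.
move=> Dt hz; have [k [G tE]] := fan_rational hD Dt; have hv := orth_lattice_emb tE.
split=> [xG f u Lf|zG f u cf].
  pose p (w : orth_monoid t) := to_dual t (orth_val w).
  have p_inj : injective p.
    by move=> w w' /(congr1 (@dual_val R n t)); rewrite !dual_of_orth; exact: orth_val_inj.
  have cf : coset (@dual_val R n t) (orbit_lift f).
    have supp w : mcoeff w (orbit_lift f) != 0 -> lat (@dual_val R n t) La w.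
      apply: (supported_lift_chi (L := lat (@dual_val R n t) La)) => w' w'f /=.
      by rewrite /lat /= dual_of_orth; exact: Lf.
    by move=> a b /supp ha /supp hb t' t'L; rewrite dotBl ha ?hb // subrr.
  have := xG _ (p u) cf; rewrite (mcoeff_lift_chi f u p_inj) /= orbit_liftK.
  suff -> : orbit_proj (mcoeff u f *: chi K (p u)) = mcoeff u f *: chi K u by [].
  have -> : mcoeff u f *: chi K (p u) = orbit_lift (mcoeff u f *: chi K u).
    by rewrite /orbit_lift ma_liftZ ma_lift_chi.
  exact: orbit_liftK.
have opc w : orbit_proj (mcoeff w f *: chi K w) = mcoeff w f *: orbit_chi K w.
  by rewrite /orbit_proj ma_liftZ ma_lift_chi.
rewrite /= opc; have z_ge0 := mnorm_ge0 hz.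
have [fu|fu] := eqVneq (mcoeff u f) 0.
  by rewrite fu scale0r (mnorm0 hz).
rewrite /orbit_chi; case: ifPn => uo; last by rewrite scaler0 (mnorm0 hz).
pose u' := to_orth t (dual_val u); have u'E : orth_val u' = dual_val u by rewrite to_orthK.
pose uV := emb_sub (@orth_val R n t) 0 u'.
have supp w : mcoeff w (orbit_proj f) != 0 ->
    exists2 u0, mcoeff u0 f != 0 & orth_val w = dual_val u0.
  rewrite /orbit_proj /ma_lift mcoeff_sumE => wf; apply: contrapT => hn; move/eqP: wf; apply.
  rewrite big_seq big1 // => u0 u0f; rewrite mcoeffZ /orbit_chi; case: ifPn => u0o; last by rewrite mcoeff0 mulr0.
  rewrite mcoeff_chi; case: eqP => [e|_]; last by rewrite mulr0.
  by exfalso; apply: hn; exists u0; rewrite ?mcoeff_neq0 // -e to_orthK.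
have Lg : KL (@orth_val R n t) La (orbit_proj f * chi K uV).
  move=> w /mcoeffM_neq0[w1 [w2 [/supp[u0 u0f w1E] ]]].
  rewrite mcoeff_chi; have [<- _ ->|_] := eqVneq uV w2; last by rewrite eqxx.
  move=> t' t'L; rewrite (embD hv) (emb_subE hv) (emb0 hv) sub0r w1E u'E.
  exact: cf.
have shift_inj : injective (fun w : orth_monoid t => w + uV).
  by move=> w w'; rewrite ![_ + uV]addrC; exact: (emb_addI hv).
have shiftE : orbit_proj f * chi K uV = ma_lift (fun w => chi K (w + uV) : orbit_ring t) (orbit_proj f).
  rewrite [in LHS](ma_sum (orbit_proj f)) mulr_suml; apply: eq_bigr => w _.
  by rewrite -scalerAl chiD.
have mc : mcoeff (u' + uV) (orbit_proj f * chi K uV) = mcoeff u f.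
  rewrite shiftE (mcoeff_lift_chi _ u' shift_inj) [in RHS](ma_sum f).
  rewrite /orbit_proj /ma_lift !mcoeff_sumE; apply: eq_bigr => w _.
  rewrite !mcoeffZ /orbit_chi; case: ifPn => wo; rewrite mcoeff_chi ?mcoeff0; last first.
    have -> : (w == u) = false by apply: contraNF wo => /eqP ->.
    by [].
  rewrite mcoeff_chi; congr (_ * _%:R); congr nat_of_bool; apply/eqP/eqP => [|->//].
  move=> E; apply: dual_val_inj; have := congr1 (@orth_val R n t) E.
  by rewrite u'E (to_orthK wo).
have u0 : u' + uV = 0.
  by apply: (emb_inj hv); rewrite (embD hv) (emb_subE hv) (emb0 hv) sub0r subrr.
have := zG _ (u' + uV) Lg; rewrite mc u0 chi0 (mnormM hz) (chi_opp hv u' hz).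
have zu' : 0 < z (chi K u') := chi_gt0 hv u' hz.
have cE (c : K) : z (c *: chi K u') = z c%:A * z (chi K u').
  exact: mnorm_scale.
have le (a b c d : R) : 0 < c -> d = a * c -> a <= b / c -> d <= b.
  by move=> c0 ->; rewrite -ler_pdivlMr.
exact: le zu' (cE _).
Qed.

Lemma coset_gauss_closed (s : set 'rV[R]_n) :
  closed [set x : berkovich abs (toric_ring s) | coset_gauss (seminorm x)].
Proof.
have -> : [set x : berkovich abs (toric_ring s) | coset_gauss (seminorm x)] =
    \bigcap_(i in [set i : (toric_ring s * dual_monoid s)%type | coset (@dual_val R n s) i.1])
    [set x | seminorm x (mcoeff i.2 i.1 *: chi K i.2) <= seminorm x i.1].
  apply/seteqP; split=> [x xG [f u] /= cf|x xG f u cf]; first exact: xG.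
  exact: (xG (f, u)).
apply: closed_bigI => -[f u] _ /=.
have -> : [set x : berkovich abs (toric_ring s) | seminorm x (mcoeff u f *: chi K u) <= seminorm x f] =
    (fun x : berkovich abs (toric_ring s) => seminorm x f - seminorm x (mcoeff u f *: chi K u)) @^-1` [set r | 0 <= r].
  by apply/seteqP; split=> x /=; rewrite subr_ge0.
apply: preimage_closed; last exact: closed_ge.
by move=> x _; apply: continuousB; exact: seminorm_continuous.
Qed.

Lemma coset_gauss_invariant (s t : D) (x : berkovich abs (toric_ring (sval s)))
    (y : berkovich abs (toric_ring (sval t))) : Ychart x = Ychart y ->
  coset_gauss (seminorm x) <-> coset_gauss (seminorm y).
Proof.
apply: (@Ychart_invariant R K abs n D (fun s x => coset_gauss (seminorm x))).
move=> {s t x y} [t x] [s y] [/= fts yx].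
exact: (coset_gauss_incl (set_mem (svalP s)) fts (seminorm_mnorm kabs x)).
Qed.

Definition coset_gauss_locus : set (Yan abs D) :=
  [set p | exists (s : D) (x : berkovich abs (toric_ring (sval s))),
     p = Ychart x /\ coset_gauss (seminorm x)].

(** The quotient topology is tested on the charts, and by invariance the preimage of the locus in a
    chart is the closed set of seminorms satisfying [coset_gauss]. *)
Lemma coset_gauss_locus_closed : closed coset_gauss_locus.
Proof.
rewrite -openC; apply/sigT_openP => s.
rewrite [X in open X](_ : _ =
    ~` [set x : berkovich abs (toric_ring (sval s)) | coset_gauss (seminorm x)]).
  by rewrite openC; exact: coset_gauss_closed.
apply/seteqP; split=> x h xG; apply: h; first by exists s, x.
by case: xG => t [y [xy yG]]; apply/(coset_gauss_invariant xy).
Qed.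

End CosetGauss.

Theorem corollary7p7 (R : realType) (K : fieldType) (abs : K -> R)
  (habs : complete_nonarch_abs abs) (n : nat) (D : set (set 'rV[R]_n))
  (hD : pointed_rational_fan D) (X : closed_subscheme K D)
  (hequi : torus_equidimensional X) (hdense : torus_dense X)
  (hdim : forall s, D s ->
     orbit_ideal X s = setT \/
     krull_dim R (orbit_ideal X s) = (scheme_dim X - (cone_dim s)%:R%:E)%E) :
  closed (tropical_skeleton abs X).
Proof.
(* If X does not meet the torus, density makes X empty. *)
have [I01|I01] := pselect (@ideal_of R K n D X [set 0] 1).
  have -> : tropical_skeleton abs X = set0.
    apply/seteqP; split=> // p _; have [s [x [_ xI]]] := set_mem (svalP p).
    have hx := seminorm_mnorm habs x.
    have [||Q [[_ Q1 _] IQ _]] := hdense (sval s) (set_mem (svalP s)) _ 1 (mnorm_ker_prime hx).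
    - exact: xI.
    - by rewrite /= (mnorm1 hx) => /eqP; rewrite oner_eq0.
    - exact: (Q1 (IQ 1 I01)).
  exact: closed0.
have [La [tI0 tI minI0]] := exists_slicing hD hequi hdim I01.
have shilov (s : D) w := affinoid_shilov_boundary habs hD hdense tI0 minI0 (s := s) (w := w)
  (tI (sval s) (set_mem (svalP s))) (affinoidP habs hD X w).
have -> : tropical_skeleton abs X = sval @^-1` (@coset_gauss_locus R K abs n D La).
  apply/seteqP; split=> p.
    move=> [s [w [x [B [px [bB Bmin] Bx]]]]].
    exists s, (orbit_pullback (sval x)); split; first exact: px.
    have [bB0 _] := shilov s w x.
    (* A Shilov boundary is contained in every boundary, in particular in the set of Gauss
       points. *)
    have /= xG := Bmin _ bB0 x Bx.
    have [_ h] := coset_gauss_pullback hD La (set_mem (svalP s)) (seminorm_mnorm habs (sval x)).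
    exact: h xG.
  move=> [s [x [px xG]]].
  (* A point of the locus is moved to its own orbit, where it belongs to the affinoid over its
     tropicalization. *)
  have [t [z xz]] := exists_orbit_point habs hD x.
  have [w zw] := exists_trop_vector habs hD z (set_mem (svalP t)).
  have Xx : Xan X (Ychart x) by rewrite -px; exact: set_mem (svalP p).
  have az : affinoid X w z.
    apply/(affinoidP habs hD); split=> //; apply/(orbit_ideal_kernel habs)/(XanP habs).
    by have := Xx; rewrite xz.
  exists t, w, (SigSub (mem_set az)).
  exists [set y : affinoid X w | gauss_on La (@orth_val R n (sval t)) (seminorm (sval y))].
  split; first by rewrite px xz.
    exact: shilov (SigSub (mem_set az)).
  have [h _] := coset_gauss_pullback hD La (set_mem (svalP t)) (seminorm_mnorm habs z).
  by apply: h; exact/(coset_gauss_invariant habs hD La xz).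
apply: preimage_closed; last exact: coset_gauss_locus_closed.
by move=> p _; exact: initial_continuous.
Qed.
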